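(* Let $\Psi=\{\psi^1,\psi^2,\dots,\psi^{q-1}\}\subseteq L^2(K)$ be a set of basic wavelets of $L^2(K)$. Then $\Psi$ is an MRA-wavelet if and only if $D_\Psi(\xi)=1$ for almost every $\xi\in K$, where $$D_\Psi(\xi)=\sum_{l=1}^{q-1}\sum_{j=1}^{\infty}\sum_{k\in\mathbb{N}_0}|\hat{\psi}^l(\mathfrak{p}^{-j}(\xi+u(k)))|^2$$ is the dimension function of $\Psi$.
   Context: $K$ is a local field of characteristic $p>0$, i.e. a nondiscrete, totally disconnected, locally compact topological field of characteristic $p$. Let $dx$ be a Haar measure on $K^+$; the absolute value is defined by $d(\alpha x)=|\alpha|\,dx$ for $\alpha\neq 0$, and $|0|=0$. Put $\mathfrak{D}=\{x\in K:|x|\leq 1\}$, $\mathfrak{P}=\{x\in K:|x|<1\}$, $\mathfrak{D}^*=\mathfrak{D}\setminus\mathfrak{P}$; $dx$ is normalized so that $\mathfrak{D}$ has measure $1$. Fix a prime element $\mathfrak{p}$, i.e. an element of maximal absolute value in $\mathfrak{P}$. The residue field $\mathfrak{D}/\mathfrak{P}$ is isomorphic to $GF(q)$, $q=p^c$ with $c\in\mathbb{N}$, and $|\mathfrak{p}|=q^{-1}$. $\mathbb{N}_0=\mathbb{N}\cup\{0\}$. Fix $\{1=\epsilon_0,\epsilon_1,\dots,\epsilon_{c-1}\}\subset\mathfrak{D}^*$ whose span over $GF(p)$ is a subfield of $K$ isomorphic to $GF(q)$. For $0\leq n<q$ write $n=a_0+a_1p+\dots+a_{c-1}p^{c-1}$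 with $0\leq a_k<p$ and set $u(n)=(a_0+a_1\epsilon_1+\dots+a_{c-1}\epsilon_{c-1})\mathfrak{p}^{-1}$. For general $n\in\mathbb{N}_0$ write $n=b_0+b_1q+\dots+b_rq^r$ with $0\leq b_k<q$ and set $u(n)=u(b_0)+u(b_1)\mathfrak{p}^{-1}+\dots+u(b_r)\mathfrak{p}^{-r}$. The set $\{u(n):n\in\mathbb{N}_0\}$ is a subgroup of $K^+$ and a complete list of distinct coset representatives of $\mathfrak{D}$ in $K^+$. $\chi$ is the continuous unitary character of $K^+$ determined by $\chi(\epsilon_\mu\mathfrak{p}^{-j})=\exp(2\pi i/p)$ if $\mu=0$ and $j=1$, and $\chi(\epsilon_\mu\mathfrak{p}^{-j})=1$ if $\mu\in\{1,\dots,c-1\}$ or $j\neq 1$. It is trivial on $\mathfrak{D}$ and nontrivial on $\mathfrak{P}^{-1}=\mathfrak{p}^{-1}\mathfrak{D}$. The Fourier transform is $\hat f(\xi)=\int_K f(x)\overline{\chi(\xi x)}\,dx$ for $f\in L^1(K)\cap L^2(K)$, extended to a unitary operator on $L^2(K)$. For $\psi^l\in L^2(K)$ let $\psi^l_{j,k}(x)=q^{j/2}\psi^l(\mathfrak{p}^{-j}x-u(k))$, $j\in\mathbb{Z}$, $k\in\mathbb{N}_0$. A finite family $\Psi=\{\psi^1,\dots,\psi^L\}$ is a set of basic wavelets (a ''wavelet'') of $L^2(K)$ if $\{\psi^l_{j,k}:1\leq l\leq L,\ j\in\mathbb{Z},\ k\in\mathbb{N}_0\}$ is an orthonormal basis of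 $L^2(K)$. A multiresolution analysis (MRA) of $L^2(K)$ is a sequence $\{V_j:j\in\mathbb{Z}\}$ of closed subspaces of $L^2(K)$ such that: (a) $V_j\subset V_{j+1}$ for all $j$; (b) $\bigcup_{j}V_j$ is dense in $L^2(K)$; (c) $\bigcap_j V_j=\{0\}$; (d) $f\in V_j$ if and only if $f(\mathfrak{p}^{-1}\cdot)\in V_{j+1}$, for all $j$; (e) there is $\varphi\in V_0$ such that $\{\varphi(\cdot-u(k)):k\in\mathbb{N}_0\}$ is an orthonormal basis of $V_0$. Given a set of basic wavelets $\Psi=\{\psi^1,\dots,\psi^L\}$, put $W_j=\overline{\mathrm{span}}\{\psi^l_{j,k}:1\leq l\leq L,\ k\in\mathbb{N}_0\}$ and $V_j=\bigoplus_{m<j}W_m$ (closed orthogonal sum), $j\in\mathbb{Z}$; these spaces always satisfy (a)-(d). $\Psi$ is called an MRA-wavelet (is associated with an MRA) if there is $\varphi\in L^2(K)$ such that $\{\varphi(\cdot-u(k)):k\in\mathbb{N}_0\}$ is an orthonormal basis of $V_0$, i.e. if $\{V_j\}$ is an MRA. *)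

(* Defs.v *)
From HB Require Import structures.
From mathcomp Require Import all_boot all_order all_algebra.
From mathcomp Require Import all_classical all_reals all_analysis.
From mathcomp.real_closed Require Export complex.

Set Implicit Arguments.
Unset Strict Implicit.
Unset Printing Implicit Defensive.

Import Order.TTheory GRing.Theory Num.Theory.
Import numFieldNormedType.Exports.

Local Open Scope classical_set_scope.
Local Open Scope ring_scope.
Local Open Scope complex_scope.

HB.mixin Record isTopologicalField K & TopologicalZmodule K & GRing.Field K := {
  mulf_continuous : continuous (fun xy : K * K => xy.1 * xy.2) ;
  invf_continuous : forall x : K, x != 0 -> {for x, continuous (@GRing.inv K)}
}.

#[short(type="topologicalFieldType")]
HB.structure Definition TopologicalField :=
  {K of TopologicalZmodule K & GRing.Field K & isTopologicalField K}.

Definition is_local_field (K : topologicalFieldType) : Prop :=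
  [/\ ~ (forall A : set K, open A),
      totally_disconnected [set: K] &
      locally_compact [set: K]].

(* Alias of [K] with base point 0: [g_sigma_algebraType] is a measurable type
   only over a pointed type. *)
Definition pointed_of (K : topologicalFieldType) : Type := K.
HB.instance Definition _ (K : topologicalFieldType) :=
  Topological.on (pointed_of K).
HB.instance Definition _ (K : topologicalFieldType) :=
  isPointed.Build (pointed_of K) (0 : K).

Notation borel K := (g_sigma_algebraType (@open (pointed_of K))).

Section Setting.
Context {R : realType} {K : topologicalFieldType}.
Variable mu : {measure set (borel K) -> \bar R}.

(* No regularity condition: [K] is second countable, so that every Borel
   measure which is finite on compact sets is regular. *)
Definition is_haar : Prop :=
  [/\ forall (x : K) (A : set (borel K)), measurable A ->
        mu [set x + y | y in A] = mu A,
      forall A : set K, compact A -> (mu A < +oo)%E &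
      forall A : set K, open A -> A !=set0 -> (0 < mu A)%E].

(* d(a x) = |a| dx *)
Definition is_absolute_value (absv : K -> R) : Prop :=
  absv 0 = 0 /\
  forall (a : K) (A : set (borel K)), a != 0 -> measurable A ->
    mu [set a * x | x in A] = ((absv a)%:E * mu A)%E.

Definition int_ring (absv : K -> R) : set K := [set x | absv x <= 1].
Definition max_ideal (absv : K -> R) : set K := [set x | absv x < 1].
Definition int_units (absv : K -> R) : set K :=
  int_ring absv `\` max_ideal absv.

Definition is_prime_element (absv : K -> R) (varpi : K) : Prop :=
  max_ideal absv varpi /\
  forall x, max_ideal absv x -> absv x <= absv varpi.

(* The quotient of [int_ring] by [max_ideal] is isomorphic to GF(q), phrased as
   a surjective ring morphism [r] from [int_ring] onto a field with q elements,
   with kernel [max_ideal]; the values of [r] outside [int_ring] are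
   irrelevant. *)
Definition residue_field_GF (absv : K -> R) (q : nat) : Prop :=
  exists (F : finFieldType) (r : K -> F),
  [/\ #|F| = q,
      [/\ r 1 = 1,
          {in int_ring absv &, {morph r : x y / x + y}} &
          {in int_ring absv &, {morph r : x y / x * y}}],
      forall z : F, exists2 x, int_ring absv x & r x = z &
      forall x, int_ring absv x -> (r x = 0 <-> max_ideal absv x)].

(* Span over the prime subfield, whose elements are the [n%:R]. *)
Definition prime_span (c : nat) (eps : 'I_c -> K) : set K :=
  [set x | exists a : 'I_c -> nat, x = \sum_(i < c) (a i)%:R * eps i].

Definition is_residue_basis (absv : K -> R) (p c : nat) (eps : 'I_c -> K) :
    Prop :=
  [/\ forall i : 'I_c, val i = 0%N -> eps i = 1,
      forall i : 'I_c, int_units absv (eps i) &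
      exists (F : finFieldType) (iota : {rmorphism F -> K}),
        #|F| = (p ^ c)%N /\ range iota = prime_span eps].

Definition digit (b k n : nat) : nat := (n %/ b ^ k) %% b.

Definition trans0 (varpi : K) (p c : nat) (eps : 'I_c -> K) (n : nat) : K :=
  (\sum_(k < c) (digit p k n)%:R * eps k) * varpi^-1.

(* u(n). The digits of rank k > n of n vanish, hence the bound on k. *)
Definition trans (varpi : K) (p c : nat) (eps : 'I_c -> K) (n : nat) : K :=
  \sum_(k < n.+1) trans0 varpi p eps (digit (p ^ c) k n) * varpi ^- k.

Definition is_basic_character (varpi : K) (p c : nat) (eps : 'I_c -> K)
    (chi : K -> R[i]) : Prop :=
  [/\ continuous (chi : K -> R[i]^o),
      forall x y, chi (x + y) = chi x * chi y,
      forall x, `|chi x| = 1 &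
      forall (i : 'I_c) (j : int), chi (eps i * varpi ^ (- j)) =
        if (val i == 0%N) && (j == 1)
        then cos (2 * pi / p%:R) +i* sin (2 * pi / p%:R) else 1].

Definition cmeasurable (f : K -> R[i]) : Prop :=
  measurable_fun [set: borel K] (fun x : borel K => complex.Re (f x)) /\
  measurable_fun [set: borel K] (fun x : borel K => complex.Im (f x)).

Definition cintegral (f : K -> R[i]) : R[i] :=
  Rintegral mu [set: borel K] (fun x => complex.Re (f x)) +i*
  Rintegral mu [set: borel K] (fun x => complex.Im (f x)).

Definition cLnorm (s : \bar R) (f : K -> R[i]) : \bar R :=
  Lnorm mu s (fun x : borel K => (ComplexField.Normc.normc (f x))%:E).

(* Elements of L^1(K) and L^2(K) are handled through their Borel
   representatives. *)
Definition L1 : set (K -> R[i]) :=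
  [set f | cmeasurable f /\ (cLnorm 1%:E f < +oo)%E].
Definition L2 : set (K -> R[i]) :=
  [set f | cmeasurable f /\ (cLnorm 2%:E f < +oo)%E].

Definition L2dist (f g : K -> R[i]) : \bar R :=
  cLnorm 2%:E (fun x => f x - g x).

Definition inner (f g : K -> R[i]) : R[i] :=
  cintegral (fun x => f x * (g x)^*).

Definition L2closure (E : set (K -> R[i])) : set (K -> R[i]) :=
  [set f | L2 f /\
    forall e : R, 0 < e -> exists2 g, E g & (L2dist f g < e%:E)%E].

Definition lin_span (E : set (K -> R[i])) : set (K -> R[i]) :=
  [set f | exists (n : nat) (a : 'I_n -> R[i]) (g : 'I_n -> K -> R[i]),
    (forall i, E (g i)) /\ f = (fun x => \sum_(i < n) a i * g i x)].

Definition closed_span (E : set (K -> R[i])) : set (K -> R[i]) :=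
  L2closure (lin_span E).

Definition is_closed_subspace (V : set (K -> R[i])) : Prop :=
  [/\ V `<=` L2, lin_span V `<=` V & L2closure V `<=` V].

Definition is_orthonormal_basis (V : set (K -> R[i])) (I : eqType)
    (e : I -> K -> R[i]) : Prop :=
  [/\ forall i, V (e i),
      forall i i', inner (e i) (e i') = (i == i')%:R &
      closed_span (range e) = V].

Section Fourier.
Variable chi : K -> R[i].

Definition fourier_int (f : K -> R[i]) (xi : K) : R[i] :=
  cintegral (fun x => f x * (chi (xi * x))^*).

(* [g] represents the image of [f] under the continuous extension to L^2 of
   [fourier_int], defined on the intersection of L^1 and L^2. *)
Definition is_fourier (f g : K -> R[i]) : Prop :=
  L2 g /\
  exists f_ : nat -> K -> R[i],
    [/\ forall n, L1 (f_ n) /\ L2 (f_ n),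
        (fun n => L2dist (f_ n) f) @ \oo --> 0%E &
        (fun n => L2dist (fourier_int (f_ n)) g) @ \oo --> 0%E].

(* A chosen representative of the Fourier transform. *)
Definition fourier (f : K -> R[i]) : K -> R[i] := xget (fun=> 0) (is_fourier f).

End Fourier.

Section Wavelets.
Variables (varpi : K) (q : nat) (u : nat -> K).

Definition wave (f : K -> R[i]) (j : int) (k : nat) : K -> R[i] :=
  fun x => ((q%:R : R) `^ (j%:~R / 2))%:C * f (varpi ^ (- j) * x - u k).

Definition is_wavelet (L : nat) (psi : 'I_L -> K -> R[i]) : Prop :=
  (forall l, L2 (psi l)) /\
  is_orthonormal_basis L2
    (fun ljk : 'I_L * int * nat => wave (psi ljk.1.1) ljk.1.2 ljk.2).

Definition is_MRA (V : int -> set (K -> R[i])) : Prop :=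
  (forall j, is_closed_subspace (V j)) /\
  [/\ forall j, V j `<=` V (j + 1),
      L2closure (\bigcup_j V j) = L2,
      \bigcap_j V j = [set f | L2 f /\ {ae mu, forall x, f x = 0}],
      forall j f, V j f <-> V (j + 1) (fun x => f (varpi^-1 * x)) &
      exists2 phi, V 0 phi &
        is_orthonormal_basis (V 0) (fun k x => phi (x - u k))].

Definition wave_space (L : nat) (psi : 'I_L -> K -> R[i]) (j : int) :
    set (K -> R[i]) :=
  closed_span [set f | exists l k, f = wave (psi l) j k].

(* The orthogonal sum of the W_m, m < j: for a wavelet the W_m are pairwise
   orthogonal, so that this sum is the closed span of their union. *)
Definition scale_space (L : nat) (psi : 'I_L -> K -> R[i]) (j : int) :
    set (K -> R[i]) :=
  closed_span (\bigcup_(m in [set m : int | m < j]) wave_space psi m).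

Definition is_MRA_wavelet (L : nat) (psi : 'I_L -> K -> R[i]) : Prop :=
  is_MRA (scale_space psi).

Definition dimension_function (chi : K -> R[i]) (L : nat)
    (psi : 'I_L -> K -> R[i]) (xi : K) : \bar R :=
  (\sum_(l < L) \sum_(1 <= j <oo) \sum_(0 <= k <oo)
    (ComplexField.Normc.normc
      (fourier chi (psi l) (varpi ^- j * (xi + u k))) ^+ 2)%:E)%E.

End Wavelets.
End Setting.

(* Main.v *)
Require Import Defs.
From HB Require Import structures.
From mathcomp Require Import all_boot all_order all_algebra all_field.
From mathcomp Require Import all_classical all_reals all_analysis measurable_realfun.
From mathcomp Require Import ring lra.

(** Why the theorem holds.

    For a wavelet the spaces V_j satisfy all the axioms of a multiresolution analysis
    but the existence of a scaling function: V_j consists of the f orthogonal to the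
    scales m >= j, dilations shift the scales, and the wavelet expansion gives density
    and trivial intersection ([scale_spaceP], [is_MRA_waveletP]). The question is
    whether V_0 has an orthonormal basis of translates phi(. - u(k)).

    On the Fourier side a translation by u(k) is the multiplication by a character
    with frequency in the lattice Lam = {u(k)}. The transform of V_0 has as an
    orthonormal basis the transforms [neg_waveF] of the wavelets of negative scale.
    The sum of the squared coefficients of f in this basis, [energy0 f], is the
    squared norm of the projection of f onto that space. Let S ([spectral]) be the sum
    over l and j >= 1 of the squared moduli of hat psi^l(varpi^-j xi), so that D_Psi
    is the sum of the translates of S by Lam ([dimension_functionE]).

    The heart of the proof is [energy0_small]: if E lies in a disk avoiding 0, then
    the energy of the indicator of E is the integral of S over E. For a set inside a
    disk of radius |varpi^J|, the coefficients at scale -J of its indicator are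
    Fourier coefficients on that disk, and Parseval's identity gives exactly the term
    of S of scale -J. The transform of V_0 is invariant under the characters of Lam
    ([energy0_modl]), and an average over the first q^n of them shows that the energy
    of the indicator of E is the sum of the energies of the parts of E in the cosets
    of Lam + varpi^n D ([energy_per_split]). These parts lie in disks of radius
    |varpi^n|, so that the scales up to n become exact. For J > n, cutting further
    into q^(J-n) disks and applying the Cauchy-Schwarz inequality overestimates by a
    factor of at most q^(J-n). The resulting error tends to 0 when n grows, since the
    sum over J of q^J times the integral over E of the squared modulus of hat
    psi^l(varpi^-J .) is a sum of integrals of the squared modulus of hat psi^l over
    dilates of E, which are pairwise disjoint.

    Let phi be a scaling function with transform g. Its translates span V_0 as well,
    so that the energy of the indicator of E is also the integral over E of |g|^2, by
    Parseval's identity on the disks of radius 1 ([energy_modulates]). Thus S = |g|^2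
    almost everywhere, and orthonormality of the translates means that the
    periodization of |g|^2 is 1: this is D_Psi = 1 ([MRA_dimension]).

    Conversely let D_Psi = 1. Almost everywhere some term of S has a nonzero and
    finite periodization; on periodic pieces, divide the first such term, hat
    psi^l(varpi^-j .), by the square root of the periodization of its squared modulus.
    The resulting g has modulates that are orthonormal, because the periodization of
    |g|^2 is 1, and that belong to the transform of V_0, because multiplication by a
    periodic function preserves orthogonality to the nonnegative scales
    ([normalized_generator], [periodic_orth]). Hence the integral of |g|^2 over a
    small set is at most that of S; as |g|^2 and S have the same periodization, both
    integrals agree. So the modulates of g and [neg_waveF] give the same energy to the
    indicators of small sets, and therefore to all functions, because the difference
    of the energies is a nonnegative quadratic form and these indicators span a dense
    subspace ([parseval_all_eq], [cspan_small]). The modulates of g thus span the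
    transform of V_0, and the function with transform g is a scaling function
    ([dimension_MRA]).

    Everything else is the analysis on which this rests: the ultrametric structure of
    K derived from the Haar measure, the duality between Lam and the integer ring, the
    completeness of L2, and the Fourier transform of L2, obtained by extending an
    isometry from the indicators of disks multiplied by characters. *)

Set Implicit Arguments.
Unset Strict Implicit.
Unset Printing Implicit Defensive.
Import Order.TTheory GRing.Theory Num.Theory.
Import numFieldNormedType.Exports.
Local Open Scope classical_set_scope.
Local Open Scope ring_scope.
Local Open Scope complex_scope.

(** * Squared moduli *)

Section ComplexSquare.
Context {R : realType}.
Implicit Types z w : R[i].

Definition abs2 z : R := complex.Re z ^+ 2 + complex.Im z ^+ 2.

Lemma abs2_ge0 z : 0 <= abs2 z.
Proof. by rewrite addr_ge0 // sqr_ge0. Qed.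

Lemma abs2_EFin_ge0 z : (0 <= (abs2 z)%:E)%E.
Proof. by rewrite lee_fin abs2_ge0. Qed.

Lemma abs2M z w : abs2 (z * w) = abs2 z * abs2 w.
Proof. by case: z w => [a b] [c d]; rewrite /abs2 /=; ring. Qed.

Lemma abs2J z : abs2 z^* = abs2 z.
Proof. by case: z => [a b]; rewrite /abs2 /= sqrrN. Qed.

Lemma abs2N z : abs2 (- z) = abs2 z.
Proof. by case: z => [a b]; rewrite /abs2 /= !sqrrN. Qed.

Lemma abs2_0 : abs2 0 = 0.
Proof. by rewrite /abs2 /= expr0n addr0. Qed.

Lemma abs2_1 : abs2 1 = 1.
Proof. by rewrite /abs2 /= expr0n expr1n addr0. Qed.

Lemma abs2_real (x : R) : abs2 x%:C = x ^+ 2.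
Proof. by rewrite /abs2 /= expr0n addr0. Qed.

Lemma abs2_eq0 z : abs2 z = 0 -> z = 0.
Proof.
case: z => a b; rewrite /abs2 /= => /eqP; rewrite paddr_eq0 ?sqr_ge0 // !sqrf_eq0.
by move=> /andP[/eqP -> /eqP ->].
Qed.

Lemma mulJ_abs2 z : z * z^* = (abs2 z)%:C.
Proof.
case: z => a b; rewrite /abs2; apply/eqP; rewrite eq_complex /=.
by apply/andP; split; apply/eqP; ring.
Qed.

Lemma abs2_normc z : ComplexField.Normc.normc z ^+ 2 = abs2 z.
Proof. by case: z => a b; rewrite /= sqr_sqrtr // addr_ge0 // sqr_ge0. Qed.

Lemma abs2_parallelogram z w : abs2 (z + w) + abs2 (z - w) = 2 * (abs2 z + abs2 w).
Proof. by case: z w => [a b] [c d]; rewrite /abs2 /=; ring. Qed.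

Lemma abs2D_le z w : abs2 (z + w) <= 2 * (abs2 z + abs2 w).
Proof. by rewrite -abs2_parallelogram lerDl abs2_ge0. Qed.

End ComplexSquare.

(** * Sums of nonnegative families *)

Lemma esum_le_seq {R : realType} {I : choiceType} (f : I -> \bar R) (x : \bar R) :
  (forall s, uniq s -> (\sum_(i <- s) f i <= x)%E) -> (\esum_(i in [set: I]) f i <= x)%E.
Proof.
move=> Hs; apply: ge_ereal_sup => _ [A [fA _] <-].
by rewrite fsbig_finite //=; apply: Hs; exact: finmap.fset_uniq.
Qed.

Lemma esum_ge_seq {R : realType} {I : choiceType} (f : I -> \bar R) s : uniq s ->
  (\sum_(i <- s) f i <= \esum_(i in [set: I]) f i)%E.
Proof.
move=> us; apply: ereal_sup_ubound; exists [set` s].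
  by split => //; exact: finite_seq.
by rewrite -fsbig_seq.
Qed.

Lemma esumZl {R : realType} {I : choiceType} (a : R) (f : I -> \bar R) : 0 <= a ->
  (forall i, 0 <= f i)%E -> (\esum_(i in [set: I]) (a%:E * f i) = a%:E * \esum_(i in [set: I]) f i)%E.
Proof.
have ub (b : R) (g : I -> \bar R) : 0 <= b -> (forall i, 0 <= g i)%E ->
    (\esum_(i in [set: I]) (b%:E * g i) <= b%:E * \esum_(i in [set: I]) g i)%E.
  move=> b0 g0; apply: ge_ereal_sup => _ [A [fA _] <-].
  rewrite fsbig_finite //= -ge0_sume_distrr //; apply: lee_wpmul2l => //.
  apply: ereal_sup_ubound; exists A => //; by rewrite fsbig_finite.
move=> a0 f0; apply/eqP; rewrite eq_le ub //=.
have [->|an0] := eqVneq a 0.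
  by rewrite mul0e; apply: esum_ge0 => i _; rewrite mul0e.
have ap : 0 < a by rewrite lt_neqAle eq_sym an0.
rewrite -lee_pdivlMl //; apply: le_trans (ub _ _ _ _).
- by apply: le_esum => i _; rewrite muleA -EFinM mulVf // mul1e.
- by rewrite invr_ge0.
- by move=> i; rewrite mule_ge0.
Qed.

Lemma esum_swap_le {R : realType} {I J : choiceType} (f : I -> J -> \bar R) : (forall i j, 0 <= f i j)%E ->
  (\esum_(i in [set: I]) \esum_(j in [set: J]) f i j <= \esum_(j in [set: J]) \esum_(i in [set: I]) f i j)%E.
Proof.
move=> f0; apply: esum_le_seq => s us; rewrite -esum_sum //.
by apply: le_esum => j _; exact: esum_ge_seq.
Qed.

Lemma esum_swap {R : realType} {I J : choiceType} (f : I -> J -> \bar R) : (forall i j, 0 <= f i j)%E ->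
  (\esum_(i in [set: I]) \esum_(j in [set: J]) f i j = \esum_(j in [set: J]) \esum_(i in [set: I]) f i j)%E.
Proof. by move=> f0; apply/eqP; rewrite eq_le !esum_swap_le. Qed.

Lemma esum_pair {R : realType} {I J : choiceType} (f : I * J -> \bar R) : (forall i, 0 <= f i)%E ->
  (\esum_(i in [set: I * J]) f i = \esum_(i in [set: I]) \esum_(j in [set: J]) f (i, j))%E.
Proof.
move=> f0; rewrite (@esum_esum _ _ _ setT (fun=> setT) (fun i j => f (i, j))) //.
rewrite (_ : _ `*`` _ = setT); last by apply/seteqP; split => // -[i j].
by apply: eq_esum => -[i j].
Qed.

Lemma esum_fintype {R : realType} {I : finType} (f : I -> \bar R) : (forall l, 0 <= f l)%E ->
  (\esum_(l in [set: I]) f l = \sum_l f l)%E.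
Proof.
move=> f0; apply/eqP; rewrite eq_le; apply/andP; split; last exact: (esum_ge_seq f (index_enum_uniq _)).
apply: esum_le_seq => s us; rewrite (big_uniq _ us) /= [leRHS](bigID (mem s)) /= leeDl //.
by apply: sume_ge0 => l _; exact: f0.
Qed.

(** Enumerating the index type turns an unordered sum into a series, the form required
    by monotone convergence. *)
Lemma esum_pickle {R : realType} {I : countType} (f : I -> \bar R) : (forall i, (0 <= f i)%E) ->
  (\esum_(i in [set: I]) f i = \sum_(0 <= n <oo) oapp f 0 (@pickle_inv I n))%E.
Proof.
move=> f0; pose g n := oapp f 0%E (@pickle_inv I n).
have g0 n : (0 <= g n)%E by rewrite /g; case: pickle_inv.
rewrite (nneseries_esumT g0) (esum_mkcond _ g).
transitivity (\esum_(n in range (@pickle I)) g n)%E.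
  rewrite esum_image; last by move=> i j _ _; exact: (pcan_inj pickleK).
  by apply: eq_esum => i _; rewrite /g pickleK_inv.
rewrite esum_mkcond -(esum_mkcond setT g); apply: eq_esum => n _.
case: ifPn => // /negP nr; rewrite /g; case E : (pickle_inv n) => [i|//].
exfalso; apply: nr; rewrite inE; exists i => //.
by have := @pickle_invK I n; rewrite /= E.
Qed.

Lemma integral_esum {d : measure_display} {T : measurableType d} {R : realType}
    (mu : {measure set T -> \bar R}) (D : set T) {I : countType} (f : I -> T -> \bar R) :
  measurable D -> (forall i, measurable_fun D (f i)) -> (forall i x, (0 <= f i x)%E) ->
  (\int[mu]_(x in D) (\esum_(i in [set: I]) f i x) = \esum_(i in [set: I]) (\int[mu]_(x in D) f i x))%E.
Proof.
move=> mD mf f0; rewrite esum_pickle; last by move=> i; apply: integral_ge0 => x _; exact: f0.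
under eq_integral => x _ do rewrite esum_pickle //.
rewrite integral_nneseries //.
- by apply: eq_eseriesr => n _; case: pickle_inv => //=; rewrite integral0.
- by move=> n; case: pickle_inv => //= *; exact: measurable_cst.
- by move=> n x _; case: pickle_inv => [i|] //=.
Qed.

Lemma measurable_esum {d : measure_display} {T : measurableType d} {R : realType}
    (D : set T) {I : countType} (f : I -> T -> \bar R) :
  measurable D -> (forall i, measurable_fun D (f i)) -> (forall i x, (0 <= f i x)%E) ->
  measurable_fun D (fun x => \esum_(i in [set: I]) f i x)%E.
Proof.
move=> mD mf f0; rewrite (_ : (fun x => _) = fun x => (\sum_(0 <= n <oo) oapp (f ^~ x) 0 (@pickle_inv I n))%E).
  apply: ge0_emeasurable_sum => //.
  - by move=> n x _ _; case: pickle_inv => [i|] //=.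
  - by move=> n _; case: pickle_inv => //= *; exact: measurable_cst.
by apply/funext => x; rewrite esum_pickle.
Qed.

(** * Pre-Hilbert spaces of functions *)

Section PreHilbert.
Context {R : realType} {V : zmodType} (sc : R[i] -> V -> V) (S : V -> Prop)
  (ip : V -> V -> R[i]).

(** [S] carves the vectors of finite norm out of the ambient module. Functions
    themselves, not their classes modulo null sets, are the vectors, so [ip f f = 0]
    does not force [f = 0]. *)
Record pre_hilbert : Prop := PreHilbert {
  ph0 : S 0 ;
  phD : forall f g, S f -> S g -> S (f + g) ;
  phN : forall f, S f -> S (- f) ;
  phZ : forall a f, S f -> S (sc a f) ;
  ph_scD : forall a f g, sc a (f + g) = sc a f + sc a g ;
  ph_scA : forall a b f, sc a (sc b f) = sc (a * b) f ;
  ph_ipD : forall f g h, S f -> S g -> S h -> ip (f + g) h = ip f h + ip g h ;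
  ph_ipZ : forall a f g, S f -> S g -> ip (sc a f) g = a * ip f g ;
  ph_ipC : forall f g, S f -> S g -> ip g f = (ip f g)^* ;
  ph_ip_ge0 : forall f, S f -> 0 <= complex.Re (ip f f)
}.

Hypothesis H : pre_hilbert.

Definition nsq f : R := complex.Re (ip f f).

Let S0 := ph0 H.
Let SD := phD H.
Let SN := phN H.
Let SZ := phZ H.

Lemma phB f g : S f -> S g -> S (f - g).
Proof. by move=> Sf Sg; apply: SD => //; exact: SN. Qed.
Let SB := phB.

Lemma ph_sum (I : Type) (r : seq I) (P : pred I) (F : I -> V) :
  (forall i, P i -> S (F i)) -> S (\sum_(i <- r | P i) F i).
Proof. by move=> SF; elim/big_ind: _. Qed.

Lemma ip0l g : S g -> ip 0 g = 0.
Proof.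
by move=> Sg; apply: (addrI (ip 0 g)); rewrite -(ph_ipD H) // !addr0.
Qed.

Lemma ipNl f g : S f -> S g -> ip (- f) g = - ip f g.
Proof.
move=> Sf Sg; apply: (addrI (ip f g)); rewrite -(ph_ipD H) ?subrr ?ip0l //.
exact: SN.
Qed.

Lemma ipBl f g h : S f -> S g -> S h -> ip (f - g) h = ip f h - ip g h.
Proof. by move=> Sf Sg Sh; rewrite (ph_ipD H) ?ipNl //; exact: SN. Qed.

Lemma ip_suml (I : Type) (r : seq I) (F : I -> V) g : S g -> (forall i, S (F i)) ->
  ip (\sum_(i <- r) F i) g = \sum_(i <- r) ip (F i) g.
Proof.
move=> Sg SF; elim: r => [|i r IH]; first by rewrite !big_nil ip0l.
by rewrite !big_cons (ph_ipD H) ?IH //; apply: ph_sum.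
Qed.

Lemma ip0r g : S g -> ip g 0 = 0.
Proof. by move=> Sg; rewrite (ph_ipC H) // ip0l // rmorph0. Qed.

Lemma ipDr f g h : S f -> S g -> S h -> ip f (g + h) = ip f g + ip f h.
Proof.
move=> Sf Sg Sh; rewrite (ph_ipC H) //; last exact: SD.
by rewrite (ph_ipD H) // rmorphD /= -!(ph_ipC H).
Qed.

Lemma ipZr a f g : S f -> S g -> ip f (sc a g) = a^* * ip f g.
Proof.
move=> Sf Sg; rewrite (ph_ipC H) //; last exact: SZ.
by rewrite (ph_ipZ H) // rmorphM /= -!(ph_ipC H).
Qed.

Lemma ip_self f : S f -> ip f f = (nsq f)%:C.
Proof.
move=> Sf; have := ph_ipC H Sf Sf; rewrite /nsq; case: (ip f f) => a b [] /eqP.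
by rewrite -subr_eq0 opprK -mulr2n mulrn_eq0 /= => /eqP ->.
Qed.

Lemma nsq_ge0 f : S f -> 0 <= nsq f. Proof. exact: (ph_ip_ge0 H). Qed.

Lemma nsq0 : nsq 0 = 0. Proof. by rewrite /nsq ip0l. Qed.

Lemma nsqD f g : S f -> S g -> nsq (f + g) = nsq f + nsq g + 2 * complex.Re (ip f g).
Proof.
move=> Sf Sg; rewrite /nsq (ph_ipD H) ?ipDr //; last exact: SD.
rewrite (ph_ipC H Sf Sg); case: (ip f f) (ip f g) (ip g g) => [a b] [c d] [e i] /=.
by ring.
Qed.

Lemma nsqN f : S f -> nsq (- f) = nsq f.
Proof.
move=> Sf; rewrite /nsq ipNl //; last exact: SN.
by rewrite (ph_ipC H (SN Sf) Sf) ipNl //; case: (ip f f) => a b /=; rewrite opprK.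
Qed.

Lemma nsqB f g : S f -> S g -> nsq (f - g) = nsq f + nsq g - 2 * complex.Re (ip f g).
Proof.
move=> Sf Sg; rewrite nsqD //; last exact: SN.
rewrite nsqN // -[in X in _ = _ - X](opprK g) -mulrN; congr (_ + _ * _).
rewrite -[ip f (- g)](conjcK) -(ph_ipC H) //; last exact: SN.
rewrite opprK ipNl // (ph_ipC H Sf Sg); by case: (ip f g).
Qed.

Lemma nsqC f g : S f -> S g -> nsq (f - g) = nsq (g - f).
Proof. by move=> Sf Sg; rewrite -nsqN ?opprB //; exact: SB. Qed.

Lemma nsqZ a f : S f -> nsq (sc a f) = abs2 a * nsq f.
Proof.
move=> Sf; rewrite /nsq (ph_ipZ H) ?ipZr //; last exact: SZ.
by rewrite ip_self //; case: a => a b; rewrite /abs2 /=; ring.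
Qed.

Lemma nsq_parallelogram f g : S f -> S g -> nsq (f + g) + nsq (f - g) = 2 * (nsq f + nsq g).
Proof. by move=> Sf Sg; rewrite nsqD // nsqB //; ring. Qed.

Lemma nsqD_le f g : S f -> S g -> nsq (f + g) <= 2 * (nsq f + nsq g).
Proof.
by move=> Sf Sg; rewrite -nsq_parallelogram // lerDl nsq_ge0 //; exact: SB.
Qed.

Lemma cauchy_schwarz f g : S f -> S g -> abs2 (ip f g) <= nsq f * nsq g.
Proof.
move=> Sf Sg; have key t : 0 <= nsq f - 2 * t * abs2 (ip f g) + t ^+ 2 * abs2 (ip f g) * nsq g.
  pose a := t%:C * ip f g.
  have := nsq_ge0 (SB Sf (SZ a Sg)).
  rewrite nsqB ?nsqZ ?ipZr //; last exact: SZ.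
  have -> : a^* * ip f g = (t * abs2 (ip f g))%:C.
    by rewrite /a; case: (ip f g) => x y; rewrite /abs2; apply/eqP; rewrite eq_complex /=; apply/andP; split; apply/eqP; ring.
  by rewrite /a abs2M abs2_real /=; lra.
have f0 := nsq_ge0 Sf; have g0 := nsq_ge0 Sg.
have c0 := abs2_ge0 (ip f g); set c := abs2 _ in key c0 *.
have [g00|gn0] := eqVneq (nsq g) 0.
  rewrite g00 mulr0 leNgt; apply/negP => cpos.
  have := key ((nsq f + 1) / (2 * c)); rewrite g00 mulr0 addr0.
  have -> : 2 * ((nsq f + 1) / (2 * c)) * c = nsq f + 1 by field; rewrite gt_eqF.
  lra.
have gp : 0 < nsq g by rewrite lt_neqAle eq_sym gn0.
have := key (nsq g)^-1.
have -> : nsq f - 2 * (nsq g)^-1 * c + (nsq g)^-1 ^+ 2 * c * nsq g =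
   (nsq f * nsq g - c) / nsq g by field.
by rewrite pmulr_lge0 ?invr_gt0 // subr_ge0.
Qed.

(** A weighted triangle inequality without square roots: for small [d], adding a much
    smaller [g] hardly changes the squared norm of [f]. *)
Lemma nsqD_young f g d : S f -> S g -> 0 < d ->
  nsq (f + g) <= (1 + d) * nsq f + (1 + d^-1) * nsq g.
Proof.
move=> Sf Sg d0; rewrite nsqD //.
have Sdf : S (sc d%:C f) by exact: SZ.
have := nsq_ge0 (SB Sdf Sg); rewrite nsqB // nsqZ // abs2_real (ph_ipZ H) //.
have -> : complex.Re (d%:C * ip f g) = d * complex.Re (ip f g).
  by case: (ip f g) => a b /=; rewrite mul0r subr0.
set c := complex.Re _ => Hd.
have : 0 <= (d ^+ 2 * nsq f + nsq g - 2 * (d * c)) / d by rewrite divr_ge0 // ltW.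
have -> : (d ^+ 2 * nsq f + nsq g - 2 * (d * c)) / d = d * nsq f + d^-1 * nsq g - 2 * c.
  by field; rewrite gt_eqF.
by lra.
Qed.

(** The closed linear span; distances are squared throughout. *)
Definition cspan (E : set V) (f : V) := forall e : R, 0 < e ->
  exists (n : nat) (a : 'I_n -> R[i]) (g : 'I_n -> V),
    (forall i, E (g i)) /\ nsq (f - \sum_(i < n) sc (a i) (g i)) < e.

Lemma cspanD (E : set V) f g : (forall h, E h -> S h) -> S f -> S g ->
  cspan E f -> cspan E g -> cspan E (f + g).
Proof.
move=> ES Sf Sg Af Ag d d0; have d4 : 0 < d / 4 by rewrite divr_gt0.
have [n [a [h [hE fh]]]] := Af _ d4; have [m [b [k [kE gk]]]] := Ag _ d4.
exists (n + m)%N, (fun i => match fintype.split i with inl j => a j | inr j => b j end),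
  (fun i => match fintype.split i with inl j => h j | inr j => k j end); split.
  by move=> i; case: (fintype.split i).
rewrite big_split_ord /=.
have -> : \sum_(i < n) sc match fintype.split (lshift m i) with inl j => a j | inr j => b j end
    match fintype.split (lshift m i) with inl j => h j | inr j => k j end = \sum_(i < n) sc (a i) (h i).
  by apply: eq_bigr => i _; rewrite (unsplitK (inl _ i)).
have -> : \sum_(i < m) sc match fintype.split (rshift n i) with inl j => a j | inr j => b j end
    match fintype.split (rshift n i) with inl j => h j | inr j => k j end = \sum_(i < m) sc (b i) (k i).
  by apply: eq_bigr => i _; rewrite (unsplitK (inr _ i)).
have Sh : S (\sum_(i < n) sc (a i) (h i)) by apply: ph_sum => i _; apply: SZ; exact: ES.
have Sk : S (\sum_(i < m) sc (b i) (k i)) by apply: ph_sum => i _; apply: SZ; exact: ES.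
rewrite opprD addrACA; apply: le_lt_trans (nsqD_le (SB Sf Sh) (SB Sg Sk)) _.
by lra.
Qed.

Lemma sc_sum a n (F : 'I_n -> V) : sc a (\sum_(i < n) F i) = \sum_(i < n) sc a (F i).
Proof.
have sc0 : sc a 0 = 0 by apply: (addrI (sc a 0)); rewrite -(ph_scD H) !addr0.
by elim/big_rec2: _ => [|i x y _ <-]; rewrite ?sc0 // (ph_scD H).
Qed.

Lemma cspanZ (E : set V) a f : (forall h, E h -> S h) -> S f ->
  cspan E f -> cspan E (sc a f).
Proof.
move=> ES Sf Af d d0; have a1 : 0 < abs2 a + 1 by rewrite ltr_wpDl // abs2_ge0.
have [|n [b [h [hE fh]]]] := Af (d / (abs2 a + 1)); first by rewrite divr_gt0.
exists n, (fun i => a * b i), h; split => //.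
have Sh : S (\sum_(i < n) sc (b i) (h i)) by apply: ph_sum => i _; apply: SZ; exact: ES.
have scN g : sc a (- g) = - sc a g.
  have sc0 : sc a 0 = 0 by apply: (addrI (sc a 0)); rewrite -(ph_scD H) !addr0.
  by apply: (addrI (sc a g)); rewrite -(ph_scD H) !subrr.
have -> : \sum_(i < n) sc (a * b i) (h i) = sc a (\sum_(i < n) sc (b i) (h i)).
  by rewrite sc_sum; apply: eq_bigr => i _; rewrite (ph_scA H).
rewrite -scN -(ph_scD H) nsqZ //; last exact: SB.
have n0 := nsq_ge0 (SB Sf Sh).
apply: le_lt_trans (_ : (abs2 a + 1) * nsq (f - \sum_(i < n) sc (b i) (h i)) < _).
  by rewrite ler_wpM2r // lerDl.
by rewrite mulrC -ltr_pdivlMr.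
Qed.

Lemma cspan_mem (E : set V) f : sc 1 f = f -> S f -> E f -> cspan E f.
Proof.
move=> f1 Sf Ef d d0; exists 1%N, (fun=> 1), (fun=> f); split => //.
by rewrite big_ord1 f1 subrr nsq0.
Qed.

Lemma cspan0 (E : set V) : cspan E 0.
Proof.
move=> d d0; exists 0%N, (fun=> 0), (fun=> 0); split; first by case.
by rewrite big_ord0 subr0 nsq0.
Qed.

Lemma cspan_closed (E : set V) f : (forall h, E h -> S h) -> S f ->
  (forall d, 0 < d -> exists g, [/\ S g, cspan E g & nsq (f - g) < d]) -> cspan E f.
Proof.
move=> ES Sf Af d d0; have d4 : 0 < d / 4 by rewrite divr_gt0.
have [g [Sg Ag fg]] := Af _ d4; have [n [a [h [hE gh]]]] := Ag _ d4.
exists n, a, h; split => //.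
have Sh : S (\sum_(i < n) sc (a i) (h i)) by apply: ph_sum => i _; apply: SZ; exact: ES.
have -> : f - \sum_(i < n) sc (a i) (h i) = (f - g) + (g - \sum_(i < n) sc (a i) (h i)).
  by rewrite addrA subrK.
by apply: le_lt_trans (nsqD_le (SB Sf Sg) (SB Sg Sh)) _; lra.
Qed.

Lemma cspan_comb (E : set V) n (a : 'I_n -> R[i]) (g : 'I_n -> V) :
  (forall h, E h -> S h) -> (forall i, S (g i)) -> (forall i, cspan E (g i)) ->
  cspan E (\sum_(i < n) sc (a i) (g i)).
Proof.
move=> ES Sg Eg; elim: (index_enum _) => [|i r IH]; first by rewrite big_nil; exact: cspan0.
rewrite big_cons; apply: cspanD => //; first exact: SZ.
  by apply: ph_sum => j _; exact: SZ.
exact: cspanZ.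
Qed.

Lemma cspan_trans (E E' : set V) f : (forall h, E h -> S h) -> (forall h, E' h -> S h) ->
  S f -> (forall g, E g -> cspan E' g) -> cspan E f -> cspan E' f.
Proof.
move=> ES E'S Sf EE' Af; apply: cspan_closed => // d d0.
have [n [a [h [hE fh]]]] := Af d d0.
exists (\sum_(i < n) sc (a i) (h i)); split => //.
  by apply: ph_sum => i _; apply: SZ; exact: ES.
by apply: cspan_comb => // i; [exact: ES|exact: EE'].
Qed.

Section Orthonormal.
Context {I : choiceType} (e : I -> V).
Definition orthonormal := (forall i, S (e i)) /\ (forall i j, ip (e i) (e j) = (i == j)%:R).
Hypothesis oe : orthonormal.
Let Se i : S (e i). Proof. by case: oe. Qed.
Let eE i j : ip (e i) (e j) = (i == j)%:R. Proof. by case: oe. Qed.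

Definition proj (s : seq I) (f : V) := \sum_(i <- s) sc (ip f (e i)) (e i).
(** When [e] is orthonormal, [energy f] is the squared norm of the projection of [f]
    onto the closed span of [e]. Projections are compared through their energies. *)
Definition energy (f : V) : \bar R := \esum_(i in [set: I]) (abs2 (ip f (e i)))%:E.

Lemma comb_S (s : seq I) (b : I -> R[i]) : S (\sum_(i <- s) sc (b i) (e i)).
Proof. by apply: ph_sum => i _; exact: SZ. Qed.

Lemma proj_S s f : S (proj s f). Proof. exact: comb_S. Qed.

Lemma ip_comb (s : seq I) (b : I -> R[i]) i : uniq s ->
  ip (\sum_(j <- s) sc (b j) (e j)) (e i) = if i \in s then b i else 0.
Proof.
move=> us; rewrite ip_suml // => [|j]; last exact: SZ.
rewrite (eq_bigr (fun j => if i == j then b j else 0)) => [|j _]; last first.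
  by rewrite (ph_ipZ H) // eE eq_sym; case: eqP => _; rewrite ?mulr1 ?mulr0.
rewrite -big_mkcond; case: ifPn => ins; last first.
  by rewrite big_seq_cond big1 // => j /andP[js /eqP ij]; rewrite -ij (negPf ins) in js.
rewrite (eq_bigl (pred1 i)) => [|j]; last by rewrite eq_sym.
by rewrite -big_filter filter_pred1_uniq // big_seq1.
Qed.

Lemma nsq_sub_comb (s : seq I) (b : I -> R[i]) f : S f -> uniq s ->
  nsq (f - \sum_(i <- s) sc (b i) (e i)) =
  nsq f - \sum_(i <- s) abs2 (ip f (e i)) + \sum_(i <- s) abs2 (ip f (e i) - b i).
Proof.
move=> Sf; elim: s => [|i s IH] /=; first by rewrite !big_nil !subr0 addr0.
move=> /andP[ins us]; rewrite !big_cons opprD addrA addrAC nsqB; [|exact/SB/comb_S|exact: SZ].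
rewrite IH // ipZr //; last exact/SB/comb_S.
rewrite ipBl ?ip_comb ?(negPf ins) ?subr0 ?nsqZ //; last exact: comb_S.
rewrite /nsq eE eqxx mulr1.
by case: (ip f (e i)) (b i) => [x y] [z w]; rewrite /abs2 /=; ring.
Qed.

Lemma nsq_sub_proj (s : seq I) f : S f -> uniq s ->
  nsq (f - proj s f) = nsq f - \sum_(i <- s) abs2 (ip f (e i)).
Proof.
move=> Sf us; rewrite nsq_sub_comb // [X in _ + X]big1 ?addr0 // => i _.
by rewrite subrr abs2_0.
Qed.

Lemma bessel_fin s f : S f -> uniq s -> \sum_(i <- s) abs2 (ip f (e i)) <= nsq f.
Proof.
by move=> Sf us; rewrite -subr_ge0 -nsq_sub_proj // nsq_ge0 //; apply/SB/proj_S.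
Qed.

Lemma energy_le f (x : R) :
  (forall s, uniq s -> \sum_(i <- s) abs2 (ip f (e i)) <= x) -> (energy f <= x%:E)%E.
Proof. by move=> Hs; apply: esum_le_seq => s us; rewrite sumEFin lee_fin Hs. Qed.

Lemma energy_ge f s : uniq s -> ((\sum_(i <- s) abs2 (ip f (e i)))%:E <= energy f)%E.
Proof. by move=> us; rewrite -sumEFin; exact: esum_ge_seq. Qed.

Lemma bessel f : S f -> (energy f <= (nsq f)%:E)%E.
Proof. by move=> Sf; apply: energy_le => s us; exact: bessel_fin. Qed.

Lemma energy_ge0 f : (0 <= energy f)%E.
Proof. by apply: esum_ge0 => i _; rewrite lee_fin abs2_ge0. Qed.

Lemma energy_fin f : S f -> energy f \is a fin_num.
Proof.
move=> Sf; rewrite ge0_fin_numE ?energy_ge0 //.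
by apply: le_lt_trans (bessel Sf) _; rewrite ltry.
Qed.

Lemma energy_approx f (d : R) : S f -> 0 < d ->
  exists2 s, uniq s & (energy f - d%:E < (\sum_(i <- s) abs2 (ip f (e i)))%:E)%E.
Proof.
move=> Sf d0; have [_ [A [fA _] <-] HA] := ub_ereal_sup_adherent d0 (energy_fin Sf).
exists (finmap.enum_fset (fset_set A)); first exact: finmap.fset_uniq.
by apply: lt_le_trans HA _; rewrite fsbig_finite //= sumEFin.
Qed.

(** Among the combinations of the [e i] with [i] in [s], the projection [proj s f] is
    the closest to [f]; hence a combination close to [f] makes the defect in Bessel's
    inequality small. *)
Lemma cspan_parseval f : S f -> cspan (range e) f -> energy f = (nsq f)%:E.
Proof.
move=> Sf Af; apply/eqP; rewrite eq_le bessel //=; apply/lee_addgt0Pr => d d0.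
have [n [a [g [gE fg]]]] := Af d d0.
have [k kE] : exists k : 'I_n -> I, forall i, g i = e (k i).
  have /choice[k kE] : forall i : 'I_n, exists j, g i = e j.
      by move=> i; have [j _ <-] := gE i; exists j.
    by exists k.
pose s := undup [seq k i | i <- enum 'I_n].
have us : uniq s by exact: undup_uniq.
have ks i : k i \in s by rewrite mem_undup map_f // mem_enum.
have Sg : S (\sum_(i < n) sc (a i) (g i)) by apply: ph_sum => i _; rewrite kE; exact: SZ.
have Sfp : S (f - proj s f) by apply/SB/proj_S.
have orth : ip (f - proj s f) (proj s f - \sum_(i < n) sc (a i) (g i)) = 0.
  have oi i : i \in s -> ip (f - proj s f) (e i) = 0.
    by move=> ins; rewrite ipBl ?ip_comb ?ins ?subrr //; exact: proj_S.
  have oi' i : i \in s -> ip (e i) (f - proj s f) = 0.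
    by move=> ins; rewrite (ph_ipC H Sfp) // oi // rmorph0.
  rewrite (ph_ipC H) //; last by apply: SB => //; exact: proj_S.
  rewrite ipBl //; last exact: proj_S.
  rewrite !ip_suml // => [|i|i]; rewrite ?kE; try exact: SZ.
  rewrite big_seq big1 => [|i ins]; last by rewrite (ph_ipZ H) // oi' // mulr0.
  by rewrite big1 ?subrr ?rmorph0 // => i _; rewrite kE (ph_ipZ H) // oi' ?mulr0.
have E : f - \sum_(i < n) sc (a i) (g i) =
   (f - proj s f) + (proj s f - \sum_(i < n) sc (a i) (g i)) by rewrite addrA subrK.
have : nsq (f - proj s f) < d.
  apply: le_lt_trans fg; rewrite E [X in _ <= X]nsqD //; last by apply: SB => //; exact: proj_S.
  by rewrite orth mulr0 addr0 lerDl nsq_ge0 //; apply: SB => //; exact: proj_S.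
rewrite nsq_sub_proj // ltrBlDr => /ltW; rewrite -lee_fin EFinD => /le_trans; apply.
by rewrite addeC leeD2r // energy_ge.
Qed.

Lemma parseval_proj f : S f -> energy f = (nsq f)%:E ->
  forall d : R, 0 < d -> exists2 s, uniq s & nsq (f - proj s f) < d.
Proof.
move=> Sf Ef d d0; have [s us] := energy_approx Sf d0.
rewrite Ef -EFinB lte_fin => Hs; exists s => //.
by rewrite nsq_sub_proj // ltrBlDr addrC -ltrBlDr.
Qed.

Lemma cspan_seq (E : set V) f (s : seq I) (b : I -> R[i]) d :
  (forall i, i \in s -> E (e i)) -> nsq (f - \sum_(i <- s) sc (b i) (e i)) < d ->
  exists (n : nat) (a : 'I_n -> R[i]) (g : 'I_n -> V),
    (forall i, E (g i)) /\ nsq (f - \sum_(i < n) sc (a i) (g i)) < d.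
Proof.
move=> sE; case: s sE => [|i0 s0] sE.
  by rewrite big_nil => Hd; exists 0%N, (fun=> 0), (fun=> 0); split => [[]//|]; rewrite big_ord0.
set s := i0 :: s0 in sE * => Hd.
exists (size s), (fun i => b (nth i0 s i)), (fun i => e (nth i0 s i)); split.
  by move=> i; apply: sE; exact: mem_nth.
by rewrite (big_nth i0) big_mkord in Hd.
Qed.

Lemma parseval_cspan f (E : set V) : S f -> energy f = (nsq f)%:E ->
  (forall i, ip f (e i) != 0 -> E (e i)) -> cspan E f.
Proof.
move=> Sf Ef fE d d0; have [s us] := parseval_proj Sf Ef d0.
rewrite nsq_sub_proj // => Hd.
pose s' := [seq i <- s | ip f (e i) != 0].
apply: (@cspan_seq E f s' (fun i => ip f (e i))).
  by move=> i; rewrite mem_filter => /andP[/fE].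
rewrite -/(proj s' f) nsq_sub_proj ?filter_uniq //.
suff -> : \sum_(i <- s') abs2 (ip f (e i)) = \sum_(i <- s) abs2 (ip f (e i)) by [].
rewrite big_filter [RHS](bigID (fun i => ip f (e i) != 0)) /= [X in _ = _ + X]big1 ?addr0 //.
by move=> i /negPn /eqP ->; rewrite abs2_0.
Qed.

Lemma fine_energyE f : S f -> (fine (energy f))%:E = energy f.
Proof. by move=> Sf; rewrite fineK // energy_fin. Qed.

Lemma energyZ a f : S f -> energy (sc a f) = ((abs2 a)%:E * energy f)%E.
Proof.
move=> Sf; rewrite /energy -esumZl ?abs2_ge0 //; last first.
  by move=> i; rewrite lee_fin abs2_ge0.
by apply: eq_esum => i _; rewrite (ph_ipZ H) // abs2M EFinM.
Qed.

Lemma energy_parallelogram f g : S f -> S g ->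
  (energy (f + g) + energy (f - g) = 2%:E * (energy f + energy g))%E.
Proof.
move=> Sf Sg; rewrite /energy -!esumD; try by move=> i _; rewrite lee_fin abs2_ge0.
rewrite -esumZl //; last first.
  by move=> i; rewrite adde_ge0 // lee_fin abs2_ge0.
apply: eq_esum => i _; rewrite -!EFinD -EFinM; congr EFin.
by rewrite (ph_ipD H) // ipBl // abs2_parallelogram.
Qed.

Lemma fine_energy_parallelogram f g : S f -> S g ->
  fine (energy (f + g)) + fine (energy (f - g)) = 2 * (fine (energy f) + fine (energy g)).
Proof.
move=> Sf Sg; apply: EFin_inj.
rewrite EFinM !EFinD (fine_energyE (SD Sf Sg)) (fine_energyE (SB Sf Sg)).
by rewrite (fine_energyE Sf) (fine_energyE Sg) energy_parallelogram.
Qed.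

(** The left-hand side is the squared distance from [f] to the closed span of [e]. *)
Lemma nsq_sub_comb_ge f (s : seq I) (b : I -> R[i]) : S f -> uniq s ->
  nsq f - fine (energy f) <= nsq (f - \sum_(i <- s) sc (b i) (e i)).
Proof.
move=> Sf us; rewrite nsq_sub_comb // -addrA lerD2l.
have := energy_ge f us; rewrite -(fine_energyE Sf) lee_fin => Hs.
rewrite -lerBlDl opprK; apply: (@le_trans _ _ 0); first by rewrite addrC subr_le0.
by apply: sumr_ge0 => i _; exact: abs2_ge0.
Qed.

End Orthonormal.

Lemma cspan_orth (E : set V) f g : (forall h, E h -> S h) -> S f -> S g ->
  cspan E f -> (forall h, E h -> ip h g = 0) -> ip f g = 0.
Proof.
move=> ES Sf Sg Af Eg; apply: abs2_eq0; apply/eqP; rewrite eq_le abs2_ge0 andbT.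
have g0 := nsq_ge0 Sg.
apply/ler_addgt0Pr => d d0; rewrite add0r.
have [|n [a [h [hE fh]]]] := Af (d / (nsq g + 1)); first by rewrite divr_gt0 // ltr_wpDl.
have Sh : S (\sum_(i < n) sc (a i) (h i)) by apply: ph_sum => i _; apply: SZ; exact: ES.
have -> : ip f g = ip (f - \sum_(i < n) sc (a i) (h i)) g.
  rewrite ipBl // ip_suml // => [|i]; last by apply: SZ; exact: ES.
  by rewrite big1 ?subr0 // => i _; rewrite (ph_ipZ H) ?Eg ?mulr0 //; exact: ES.
apply: le_trans (cauchy_schwarz (SB Sf Sh) Sg) _.
apply: (@le_trans _ _ (d / (nsq g + 1) * nsq g)); first by rewrite ler_wpM2r // ltW.
by rewrite mulrAC ler_pdivrMr ?ltr_wpDl // ler_pM2l // lerDl.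
Qed.

Section TwoFamilies.
Context {I J : choiceType} (e : I -> V) (e' : J -> V).
Hypotheses (oe : orthonormal e) (oe' : orthonormal e').

(** The vectors of the closed span of [e], in the form in which they are used: equality
    in Bessel's inequality. *)
Definition parseval_set {I : choiceType} (e : I -> V) (f : V) := S f /\ energy e f = (nsq f)%:E.

Lemma parseval_setP f : S f -> parseval_set e f <-> nsq f - fine (energy e f) <= 0.
Proof.
move=> Sf; rewrite /parseval_set; split => [[_ ->]|Hf]; first by rewrite subrr.
split => //; apply/eqP; rewrite eq_le bessel //= -(fine_energyE oe Sf) lee_fin.
by rewrite -subr_le0.
Qed.

(** Both sides obey the parallelogram law, and [f - g] obeys Bessel's inequality. *)
Lemma parseval_setD f g : parseval_set e f -> parseval_set e g -> parseval_set e (f + g).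
Proof.
move=> [Sf Ef] [Sg Eg]; apply/parseval_setP; first exact: SD.
have := energy_parallelogram oe Sf Sg; rewrite Ef Eg.
rewrite -(fine_energyE oe (SD Sf Sg)) -(fine_energyE oe (SB Sf Sg)) -!EFinD -EFinM => -[].
rewrite -nsq_parallelogram // => E.
have : fine (energy e (f - g)) <= nsq (f - g).
  by rewrite -lee_fin fine_energyE // ?bessel //; exact: SB.
by lra.
Qed.

Lemma parseval_setZ a f : parseval_set e f -> parseval_set e (sc a f).
Proof.
move=> [Sf Ef]; split; first exact: SZ.
by rewrite energyZ // Ef nsqZ // EFinM.
Qed.

Lemma parseval_set_sum (K : Type) (s : seq K) (F : K -> V) :
  (forall i, parseval_set e (F i)) -> parseval_set e (\sum_(i <- s) F i).
Proof.
move=> HF; elim/big_ind: _ => //; last by move=> f g; exact: parseval_setD.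
split => //; rewrite nsq0 /energy esum1 // => i _.
by rewrite ip0l ?abs2_0 //; case: oe.
Qed.

Hypothesis sub : forall j, parseval_set e (e' j).

(** Projecting onto a larger closed subspace increases norms. The projection of [f] onto
    finitely many [e' j] lies in the span of [e], so it is at least as far from [f] as
    that span. *)
Lemma energy_mono f : S f -> (energy e' f <= energy e f)%E.
Proof.
move=> Sf; rewrite -(fine_energyE oe Sf); apply: energy_le => // t ut.
pose g := proj e' t f; have Sg : S g by exact: proj_S.
have [_ Eg] : parseval_set e g.
  by apply: parseval_set_sum => j; exact: parseval_setZ.
have dist : nsq (f - g) = nsq f - \sum_(j <- t) abs2 (ip f (e' j)) by rewrite nsq_sub_proj.
suff : nsq f - fine (energy e f) <= nsq (f - g) by rewrite dist lerD2l lerN2.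
have fg0 := nsq_ge0 (SB Sf Sg).
have E0 : 0 <= fine (energy e f) by rewrite fine_ge0 // energy_ge0.
(* [g] is replaced by a finite projection of it, at a cost controlled by [nsqD_young]. *)
have key (d : R) : 0 < d -> nsq f - fine (energy e f) <= (1 + d) * nsq (f - g) + d.
  move=> d0; have d1 : 0 < d / (1 + d^-1) by rewrite divr_gt0 // addr_gt0 // invr_gt0.
  have [s us gs] := parseval_proj oe Sg Eg d1.
  apply: (le_trans (nsq_sub_comb_ge oe (fun i => ip g (e i)) Sf us)).
  rewrite -/(proj e s g); have Sp : S (proj e s g) by exact: proj_S.
  set h := proj e s g in gs Sp *.
  have -> : f - h = (f - g) + (g - h) by rewrite addrA subrK.
  apply: le_trans (nsqD_young (SB Sf Sg) (SB Sg Sp) d0) _.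
  rewrite lerD2l -ler_pdivlMl; last by rewrite addr_gt0 // invr_gt0.
  by rewrite mulrC ltW.
apply/ler_addgt0Pr => d d0.
have c0 : 0 < nsq (f - g) + 1 by rewrite ltr_wpDl.
apply: le_trans (key (d / (nsq (f - g) + 1)) _) _; first by rewrite divr_gt0.
rewrite mulrDl mul1r -addrA lerD2l.
rewrite -[X in _ + X <= _]mulr1 -mulrDr divfK ?gt_eqF //.
Qed.

(** The difference of the two energies is a nonnegative quadratic form bounded by the
    squared norm, so the vectors where it vanishes form a closed subspace. *)
Lemma parseval_all_eq (Z : set V) f : (forall g, Z g -> S g) ->
  (forall g, Z g -> energy e' g = energy e g) -> S f ->
  cspan Z f -> energy e' f = energy e f.
Proof.
move=> ZS ZE Sf Af.
pose Q g := fine (energy e g) - fine (energy e' g).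
have Q0 g : S g -> 0 <= Q g.
  by move=> Sg; rewrite subr_ge0 -lee_fin !fine_energyE // energy_mono.
have Qle g : S g -> Q g <= nsq g.
  move=> Sg; apply: (@le_trans _ _ (fine (energy e g))).
    by rewrite lerBlDr lerDl fine_ge0 // energy_ge0.
  by rewrite -lee_fin fine_energyE // bessel.
have Qp g h : S g -> S h -> Q (g + h) <= 2 * (Q g + Q h).
  move=> Sg Sh; have := Q0 _ (SB Sg Sh); rewrite /Q.
  have := fine_energy_parallelogram oe Sg Sh.
  have := fine_energy_parallelogram oe' Sg Sh.
  by lra.
have Qc a g : S g -> Q (sc a g) = abs2 a * Q g.
  by move=> Sg; rewrite /Q !energyZ // -(fine_energyE oe Sg) -(fine_energyE oe' Sg) -!EFinM /= mulrBr.
have Qz n (a : 'I_n -> R[i]) (g : 'I_n -> V) : (forall i, Z (g i)) -> Q (\sum_(i < n) sc (a i) (g i)) = 0.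
  move=> gZ.
  have SF (r : seq 'I_n) : S (\sum_(i <- r) sc (a i) (g i)).
    by apply: ph_sum => i _; apply: SZ; exact: ZS.
  elim: (index_enum _) => [|i r IH].
    rewrite big_nil /Q /energy !esum1 ?subrr // => j _; rewrite ip0l ?abs2_0 //; [by case: oe'|by case: oe].
  have Sgi : S (sc (a i) (g i)) by apply: SZ; exact: ZS.
  apply/eqP; rewrite eq_le Q0 ?andbT; last exact: SF.
  rewrite big_cons; apply: le_trans (Qp _ _ Sgi (SF r)) _.
  by rewrite IH addr0 Qc; [rewrite /Q ZE // subrr !mulr0|exact: ZS].
suff Qf : Q f <= 0.
  have : Q f = 0 by apply/eqP; rewrite eq_le Qf Q0.
  by rewrite -(fine_energyE oe Sf) -(fine_energyE oe' Sf) => /eqP; rewrite subr_eq0 => /eqP ->.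
apply/ler_addgt0Pr => d d0; rewrite add0r.
have [|n [a [g [gZ fg]]]] := Af (d / 2); first by rewrite divr_gt0.
have Sg : S (\sum_(i < n) sc (a i) (g i)) by apply: ph_sum => i _; apply: SZ; exact: ZS.
rewrite -(subrK (\sum_(i < n) sc (a i) (g i)) f).
apply: le_trans (Qp _ _ (SB Sf Sg) Sg) _; rewrite Qz // addr0.
have := Qle _ (SB Sf Sg); lra.
Qed.

End TwoFamilies.

End PreHilbert.

(** * Unitary extension of an isometric correspondence *)

Section UnitaryExtension.
Context {R : realType} {V : zmodType} (sc : R[i] -> V -> V) (S : V -> Prop)
  (ip : V -> V -> R[i]).
Hypothesis H : pre_hilbert sc S ip.
Hypotheses (sc1 : forall f, sc 1 f = f) (scN : forall f, sc (- 1) f = - f).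
Local Notation nsq := (nsq ip).

Section Extension.
Context {I : Type}.

Definition lc (e : I -> V) (s : seq (R[i] * I)) : V := \sum_(x <- s) sc x.1 (e x.2).

(** The graph of the isometry sending [e i] to [e' i], extended by linearity and
    continuity. It is a relation because vectors are functions: an image is determined
    only up to a null set. *)
Definition uext (e e' : I -> V) (f g : V) : Prop := [/\ S f, S g & forall d : R, 0 < d ->
  exists s, nsq (f - lc e s) < d /\ nsq (g - lc e' s) < d].

Lemma uextC e e' f g : uext e e' f g -> uext e' e g f.
Proof. by move=> [Sf Sg fg]; split => // d /fg[s [? ?]]; exists s. Qed.

Lemma lc_S e s : (forall i, S (e i)) -> S (lc e s).
Proof. by move=> Se; apply: (ph_sum H) => x _; exact: (phZ H). Qed.

Lemma lc_cat e s t : lc e (s ++ t) = lc e s + lc e t.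
Proof. by rewrite /lc big_cat. Qed.

Lemma lcZ a e s : lc e [seq (a * x.1, x.2) | x <- s] = sc a (lc e s).
Proof.
elim: s => [|x s IH]; rewrite /lc ?big_nil ?big_cons /=.
  by apply: (addrI (sc a 0)); rewrite addr0 -(ph_scD H) addr0.
by rewrite (ph_scD H) -IH (ph_scA H) /lc.
Qed.

Context (e e' : I -> V).
Hypotheses (Se : forall i, S (e i)) (Se' : forall i, S (e' i)).
Hypothesis (ee' : forall i j, ip (e' i) (e' j) = ip (e i) (e j)).

Lemma ip_lc s t : ip (lc e' s) (lc e' t) = ip (lc e s) (lc e t).
Proof.
have L (g : I -> V) : (forall i, S (g i)) ->
    ip (lc g s) (lc g t) = \sum_(x <- s) \sum_(y <- t) x.1 * (y.1^* * ip (g x.2) (g y.2)).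
  move=> Sg; rewrite /lc (ip_suml H) ?(lc_S _ Sg) //; last by move=> x; exact: (phZ H).
  apply: eq_bigr => x _; rewrite (ph_ipZ H) //; last exact: lc_S.
  rewrite -mulr_sumr; congr (_ * _).
  elim: t => [|y t IH]; rewrite ?big_nil ?(ip0r H) // !big_cons.
  by rewrite (ipDr H) ?(ipZr H) ?IH //; [exact: (phZ H)|exact: (lc_S t Sg)].
  exact: (lc_S t Sg).
by rewrite !L //; apply: eq_bigr => x _; apply: eq_bigr => y _; rewrite ee'.
Qed.

Lemma nsq_lc s : nsq (lc e' s) = nsq (lc e s).
Proof. by rewrite /nsq ip_lc. Qed.

Lemma uext_lc s : uext e e' (lc e s) (lc e' s).
Proof.
split; [exact: lc_S|exact: lc_S|] => d d0; exists s.
by rewrite !subrr (nsq0 H).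
Qed.

Lemma uextD f g f' g' : uext e e' f g -> uext e e' f' g' -> uext e e' (f + f') (g + g').
Proof.
move=> [Sf Sg fg] [Sf' Sg' fg']; split; [exact: (phD H)|exact: (phD H)|] => d d0.
have d4 : 0 < d / 4 by rewrite divr_gt0.
have [s [s1 s2]] := fg _ d4; have [t [t1 t2]] := fg' _ d4.
have K (u v w z : V) : S u -> S v -> S w -> S z -> nsq (u - w) < d / 4 -> nsq (v - z) < d / 4 ->
    nsq (u + v - (w + z)) < d.
  move=> Su Sv Sw Sz h1 h2; rewrite opprD addrACA.
  apply: le_lt_trans (nsqD_le H _ _) _; try exact: (phB H).
  by move: h1 h2; lra.
by exists (s ++ t); rewrite !lc_cat; split; apply: K => //; exact: lc_S.
Qed.

Lemma uextZ a f g : uext e e' f g -> uext e e' (sc a f) (sc a g).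
Proof.
move=> [Sf Sg fg]; split; [exact: (phZ H)|exact: (phZ H)|] => d d0.
have a0 := abs2_ge0 a.
have [s [s1 s2]] := fg (d / (abs2 a + 1)) ltac:(by rewrite divr_gt0 // ltr_wpDl).
exists [seq (a * x.1, x.2) | x <- s]; rewrite !lcZ.
have K u w : S u -> S w -> nsq (u - w) < d / (abs2 a + 1) -> nsq (sc a u - sc a w) < d.
  move=> Su Sw; have Suw := phB H Su Sw; have -> : sc a u - sc a w = sc a (u - w).
    by apply/eqP; rewrite subr_eq -(ph_scD H) subrK.
  rewrite (nsqZ H) // ltr_pdivlMr ?ltr_wpDl //.
  by apply: le_lt_trans; rewrite mulrC ler_wpM2l ?(nsq_ge0 H) // lerDl.
by split; apply: K => //; exact: lc_S.
Qed.

Lemma uextB f g f' g' : uext e e' f g -> uext e e' f' g' -> uext e e' (f - f') (g - g').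
Proof. by move=> fg fg'; rewrite -!scN; apply: uextD => //; exact: uextZ. Qed.

(** Both norms are limits of the norms of combinations with the same coefficients, and
    these agree by [nsq_lc]. *)
Lemma uext_nsq f g : uext e e' f g -> nsq g = nsq f.
Proof.
have K (u v : V) : S u -> S v -> (forall d : R, 0 < d -> exists h h',
    [/\ S h, S h', nsq h = nsq h', nsq (u - h) < d & nsq (v - h') < d]) -> nsq u <= nsq v.
  move=> Su Sv uv; have g0 := nsq_ge0 H Sv.
  suff K d : 0 < d -> d <= 1 -> nsq u <= nsq v + d * (3 * nsq v + 4).
    apply/ler_addgt0Pr => r r0.
    have c0 : 0 < 3 * nsq v + 4 by lra.
    have := K (Num.min 1 (r / (3 * nsq v + 4))).
    rewrite lt_min ltr01 divr_gt0 // ge_min lexx => /(_ isT isT) E.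
    by apply: (le_trans E); rewrite lerD2l -ler_pdivlMr // ge_min lexx orbT.
  move=> d0 d1; have i0 : 0 < 1 + d^-1 by rewrite addr_gt0 // invr_gt0.
  have [h [h' [Sh Sh' hh' s1 s2]]] := uv (d / (1 + d^-1)) ltac:(by rewrite divr_gt0).
  have A := nsqD_young H Sh (phB H Su Sh) d0.
  have B := nsqD_young H Sv (phB H Sh' Sv) d0.
  rewrite addrC subrK in A; rewrite addrC subrK -hh' in B.
  rewrite (nsqC H) // in s2.
  rewrite ltr_pdivlMr // in s1; rewrite ltr_pdivlMr // in s2.
  rewrite [X in _ <= _ + X]mulrC in A; rewrite [X in _ <= _ + X]mulrC in B.
  have C : (1 + d) * nsq h <= (1 + d) * ((1 + d) * nsq v + d).
    by rewrite ler_wpM2l //; lra.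
  have D : d * d <= d by rewrite ler_piMr // ltW.
  have E : d * d * nsq v <= d * nsq v by rewrite ler_wpM2r.
  rewrite !mulrDl !mul1r in C; rewrite mulrDl mul1r in A.
  have -> : d * (3 * nsq v + 4) = 3 * (d * nsq v) + 4 * d by ring.
  have {}C : nsq h + d * nsq h <= nsq v + d * nsq v + d + (d * nsq v + d * d * nsq v + d * d).
    by apply: (le_trans C); rewrite mulrDr mulrDr mulrA.
  by lra.
move=> [Sf Sg fg]; apply/eqP; rewrite eq_le; apply/andP; split; apply: K => // d /fg[s [s1 s2]].
  by exists (lc e' s), (lc e s); split => //; [exact: lc_S|exact: lc_S|exact: nsq_lc].
by exists (lc e s), (lc e' s); split => //; [exact: lc_S|exact: lc_S|rewrite nsq_lc].
Qed.

Local Notation U := (uext e e').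

(** Polarization: the norm of a sum gives the real part of the product, and multiplying
    one factor by the imaginary unit gives the other part. *)
Lemma uext_ip f g f' g' : U f g -> U f' g' -> ip g g' = ip f f'.
Proof.
have K f1 g1 f2 g2 : U f1 g1 -> U f2 g2 -> complex.Re (ip g1 g2) = complex.Re (ip f1 f2).
  move=> h1 h2; have h3 := uext_nsq (uextD h1 h2).
  move: (h1) (h2) => [a1 b1 _] [a2 b2 _].
  rewrite !(nsqD H) // (uext_nsq h1) (uext_nsq h2) in h3.
  by move: h3; lra.
move=> fg fg'; apply/eqP; rewrite eq_complex (K _ _ _ _ fg fg') eqxx /=.
have := K _ _ _ _ fg (uextZ 'i%C fg').
move: fg fg' => [a1 b1 _] [a2 b2 _].
rewrite !(ipZr H) //; case: (ip g g') => x y; case: (ip f f') => x' y' /= E.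
by apply/eqP; move: E; rewrite /=; lra.
Qed.

Lemma uext_closed f g : S f -> S g ->
  (forall d : R, 0 < d -> exists f1 g1, [/\ U f1 g1, nsq (f - f1) < d & nsq (g - g1) < d]) ->
  U f g.
Proof.
move=> Sf Sg fg; split => // d d0; have d4 : 0 < d / 4 by rewrite divr_gt0.
have [f1 [g1 [[Sf1 Sg1 h] k1 k2]]] := fg _ d4; have [s [s1 s2]] := h _ d4.
have K u v w : S u -> S v -> S w -> nsq (u - v) < d / 4 -> nsq (v - w) < d / 4 -> nsq (u - w) < d.
  move=> Su Sv Sw h1 h2; rewrite -(subrK v u) -addrA.
  apply: le_lt_trans (nsqD_le H _ _) _; try exact: (phB H).
  by move: h1 h2; lra.
by exists s; split; [apply: K k1 s1|apply: K k2 s2] => //; exact: lc_S.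
Qed.

(** Bounded operators that correspond to each other on the generators do so everywhere.
    Affine changes of variable are carried through the Fourier transform in this way. *)
Lemma uext_map (A A' : V -> V) (C : R) :
  (forall f, S f -> S (A f)) -> (forall f, S f -> S (A' f)) ->
  (forall f g, A (f + g) = A f + A g) -> (forall f g, A' (f + g) = A' f + A' g) ->
  (forall a f, A (sc a f) = sc a (A f)) -> (forall a f, A' (sc a f) = sc a (A' f)) ->
  (forall f, S f -> nsq (A f) <= C * nsq f) -> (forall f, S f -> nsq (A' f) <= C * nsq f) ->
  (forall i, U (A (e i)) (A' (e' i))) -> forall f g, U f g -> U (A f) (A' g).
Proof.
move=> SA SA' AD A'D AZ A'Z AC A'C Ui f g [Sf Sg fg].
have N (B : V -> V) u v : (forall f g, B (f + g) = B f + B g) -> B (u - v) = B u - B v.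
  by move=> BD; apply/eqP; rewrite eq_sym subr_eq -BD subrK.
apply: uext_closed; [exact: SA|exact: SA'|] => d d0.
have c0 : 0 < `|C| + 1 by rewrite ltr_wpDl.
have [s [s1 s2]] := fg (d / (`|C| + 1)) ltac:(by rewrite divr_gt0).
exists (A (lc e s)), (A' (lc e' s)).
have K (B : V -> V) u v : (forall f g, B (f + g) = B f + B g) ->
    (forall f, S f -> nsq (B f) <= C * nsq f) -> S u -> S v ->
    nsq (u - v) < d / (`|C| + 1) -> nsq (B u - B v) < d.
  move=> BD BC Su Sv; rewrite -N // ltr_pdivlMr //; apply: le_lt_trans.
  have Suv := phB H Su Sv; apply: le_trans (BC _ Suv) _; rewrite mulrC ler_wpM2l ?(nsq_ge0 H) //.
  by apply: le_trans (ler_norm _) _; rewrite lerDl.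
split; [|by apply: K => //; exact: lc_S|by apply: K => //; exact: lc_S].
elim: s {s1 s2} => [|x s IH].
  rewrite /lc !big_nil.
  have Z (B : V -> V) : (forall f g, B (f + g) = B f + B g) -> B 0 = 0.
    by move=> BD; apply: (addrI (B 0)); rewrite -BD !addr0.
  rewrite !Z //; have := uext_lc [::]; by rewrite /lc !big_nil.
rewrite /lc !big_cons AD A'D AZ A'Z; apply: uextD => //; exact: uextZ.
Qed.

Lemma cspan_lc f : cspan sc ip (range e) f -> forall d, 0 < d -> exists s, nsq (f - lc e s) < d.
Proof.
move=> ef d /ef[n [a [g [gE E]]]].
have /choice[idx idxE] : forall i, exists x, e x = g i.
  by move=> i; have [x _ <-] := gE i; exists x.
exists [seq (a i, idx i) | i <- enum 'I_n]; rewrite /lc big_map big_enum /=.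
by under eq_bigr do rewrite idxE.
Qed.

(** Completeness along sequences with a fixed geometric rate, which approximations can
    always be chosen to satisfy. *)
Hypothesis complete : forall f_ : nat -> V, (forall n, S (f_ n)) ->
  (forall n m, (n <= m)%N -> nsq (f_ m - f_ n) <= 8^-1 ^+ n) ->
  exists f, S f /\ forall n, nsq (f - f_ n) <= 8^-1 ^+ n.

Lemma uext_exists f : S f -> cspan sc ip (range e) f -> exists g, U f g.
Proof.
move=> Sf /cspan_lc ef.
have d0 n : 0 < 8^-1 ^+ n / 4 :> R by rewrite divr_gt0 // exprn_gt0.
have [s sE] := choice (fun n => ef _ (d0 n)).
have Sl t : S (lc e t) by exact: lc_S.
have Sl' t : S (lc e' t) by exact: lc_S.
have [g [Sg gE]] : exists g, S g /\ forall n, nsq (g - lc e' (s n)) <= 8^-1 ^+ n.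
  apply: complete => // n m nm.
  rewrite (uext_nsq (uextB (uext_lc (s m)) (uext_lc (s n)))).
  rewrite -(subrK f (lc e (s m))) -addrA; apply: le_trans (nsqD_le H _ _) _; try exact: (phB H).
  rewrite (nsqC H (Sl _) Sf); have := sE n; have := sE m.
  have : 8^-1 ^+ m <= 8^-1 ^+ n :> R by rewrite ler_wiXn2l // ?invr_ge0 // invf_le1 // ler1n.
  by lra.
exists g; apply: uext_closed => // d dd.
have [n nd] : exists n, 8^-1 ^+ n < d.
  have /cvgr_dist_lt/(_ _ dd)[N _ /(_ N (leqnn N))] := @cvg_expr R 8^-1 ltac:(by rewrite gtr0_norm ?invr_gt0 // invf_lt1 // ltr1n).
  by rewrite /= sub0r normrN ger0_norm ?exprn_ge0 ?invr_ge0 // => K; exists N.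
exists (lc e (s n)), (lc e' (s n)); split; first exact: uext_lc.
  by apply: lt_trans nd; have := sE n; have := d0 n; lra.
exact: le_lt_trans (gE n) nd.
Qed.

End Extension.
End UnitaryExtension.

(** * The complex L2 space of a measure *)

Definition cscale {T : Type} {R : realType} (a : R[i]) (f : T -> R[i]) : T -> R[i] :=
  fun x => a * f x.

Notation cindic A := (fun x => (\1_A x)%:C).

Section ComplexL2.
Context {d : measure_display} {T : measurableType d} {R : realType}.
Variable mu : {measure set T -> \bar R}.
Implicit Types f g h : T -> R[i].
Notation Re := complex.Re.
Notation Im := complex.Im.

Definition cmeas f : Prop := measurable_fun [set: T] (fun x => Re (f x)) /\
  measurable_fun [set: T] (fun x => Im (f x)).
Definition cintegrable f : Prop := mu.-integrable [set: T] (EFin \o (fun x => Re (f x))) /\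
  mu.-integrable [set: T] (EFin \o (fun x => Im (f x))).
Definition cInt f : R[i] := Rintegral mu [set: T] (fun x => Re (f x)) +i*
  Rintegral mu [set: T] (fun x => Im (f x)).
Definition sqnorm f : \bar R := (\int[mu]_x (abs2 (f x))%:E)%E.
Definition sqint f : Prop := cmeas f /\ (sqnorm f < +oo)%E.
Definition inn f g : R[i] := cInt (fun x => f x * (g x)^*).

Lemma cmeas_cst (a : R[i]) : cmeas (fun=> a).
Proof. by split; exact: measurable_cst. Qed.

Lemma cmeasD f g : cmeas f -> cmeas g -> cmeas (fun x => f x + g x).
Proof.
move=> [fr fi] [gr gi]; split.
  rewrite (_ : (fun x => _) = (fun x => Re (f x)) \+ (fun x => Re (g x))); first exact: measurable_funD.
  by apply/funext => x /=; case: (f x) (g x) => [a b] [a' b'].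
rewrite (_ : (fun x => _) = (fun x => Im (f x)) \+ (fun x => Im (g x))); first exact: measurable_funD.
by apply/funext => x /=; case: (f x) (g x) => [a b] [a' b'].
Qed.

Lemma cmeasM f g : cmeas f -> cmeas g -> cmeas (fun x => f x * g x).
Proof.
move=> [fr fi] [gr gi]; split.
  rewrite (_ : (fun x => _) = (fun x => Re (f x) * Re (g x) - Im (f x) * Im (g x))).
    by apply: measurable_funB; exact: measurable_funM.
  by apply/funext => x /=; case: (f x) (g x) => [a b] [a' b'].
rewrite (_ : (fun x => _) = (fun x => Re (f x) * Im (g x) + Im (f x) * Re (g x))).
  by apply: measurable_funD; exact: measurable_funM.
by apply/funext => x /=; case: (f x) (g x) => [a b] [a' b'].
Qed.

Lemma cmeasN f : cmeas f -> cmeas (fun x => - f x).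
Proof.
move=> mf; rewrite (_ : (fun x => _) = (fun x => (-1) * f x)).
  by apply: cmeasM => //; exact: cmeas_cst.
by apply/funext => x; rewrite mulN1r.
Qed.

Lemma cmeasJ f : cmeas f -> cmeas (fun x => (f x)^*).
Proof.
move=> [fr fi]; split.
  rewrite (_ : (fun x => _) = (fun x => Re (f x))) //.
  by apply/funext => x /=; case: (f x).
rewrite (_ : (fun x => _) = \- (fun x => Im (f x))); first exact: measurable_funN.
by apply/funext => x /=; case: (f x).
Qed.

Lemma cmeas_real (r : T -> R) : measurable_fun [set: T] r -> cmeas (fun x => (r x)%:C).
Proof. by move=> mr; split => //; exact: measurable_cst. Qed.

Lemma cmeas_indic (A : set T) : measurable A -> cmeas (cindic A).
Proof. by move=> mA; apply: cmeas_real; exact: measurable_indic. Qed.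

Lemma measurable_abs2 f : cmeas f -> measurable_fun [set: T] (fun x => abs2 (f x)).
Proof. by move=> [fr fi]; apply: measurable_funD; exact: measurable_funX. Qed.

Lemma emeasurable_abs2 f : cmeas f -> measurable_fun [set: T] (fun x => (abs2 (f x))%:E).
Proof. by move=> mf; apply/measurable_EFinP; exact: measurable_abs2. Qed.

Lemma sqnorm_ge0 f : (0 <= sqnorm f)%E.
Proof. by apply: integral_ge0 => x _; rewrite lee_fin abs2_ge0. Qed.

Lemma cmeas_scale a f : cmeas f -> cmeas (cscale a f).
Proof. by move=> mf; apply: cmeasM => //; exact: cmeas_cst. Qed.

Lemma cIntD f g : cintegrable f -> cintegrable g -> cInt (fun x => f x + g x) = cInt f + cInt g.
Proof.
move=> [fr fi] [gr gi]; apply/eqP; rewrite eq_complex /=; apply/andP; split; apply/eqP.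
  rewrite -RintegralD //; congr (Rintegral _ _ _); apply/funext => x.
  by case: (f x) (g x) => [a b] [a' b'].
rewrite -RintegralD //; congr (Rintegral _ _ _); apply/funext => x.
by case: (f x) (g x) => [a b] [a' b'].
Qed.

Let RIcomb (u v : T -> R) (a b : R) : mu.-integrable [set: T] (EFin \o u) -> mu.-integrable [set: T] (EFin \o v) ->
  Rintegral mu [set: T] (fun x => a * u x + b * v x) = a * Rintegral mu [set: T] u + b * Rintegral mu [set: T] v.
Proof.
move=> iu iv; rewrite RintegralD // ?RintegralZl //.
- by rewrite (_ : _ \o _ = (fun x => a%:E * (EFin \o u) x)%E) //; exact: integrableZl.
- by rewrite (_ : _ \o _ = (fun x => b%:E * (EFin \o v) x)%E) //; exact: integrableZl.
Qed.

Lemma cIntZ a f : cintegrable f -> cInt (cscale a f) = a * cInt f.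
Proof.
move=> [fr fi]; case: a => a b; apply/eqP; rewrite eq_complex /=; apply/andP; split; apply/eqP.
  rewrite -mulNr -RIcomb //; congr (Rintegral _ _ _); apply/funext => x.
  by rewrite /cscale; case: (f x) => u v /=; rewrite mulNr.
rewrite addrC -RIcomb //; congr (Rintegral _ _ _); apply/funext => x.
by rewrite /cscale; case: (f x) => u v /=; rewrite addrC.
Qed.

Lemma cIntJ f : cintegrable f -> cInt (fun x => (f x)^*) = (cInt f)^*.
Proof.
move=> [fr fi]; apply/eqP; rewrite eq_complex /=; apply/andP; split; apply/eqP.
  by congr (Rintegral _ _ _); apply/funext => x; case: (f x).
rewrite -[RHS]mulN1r -[RHS]add0r -[X in X + _](mul0r (Rintegral mu [set: T] (fun x => Re (f x)))) -RIcomb //.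
by congr (Rintegral _ _ _); apply/funext => x; case: (f x) => u v /=; rewrite mul0r add0r mulN1r.
Qed.

Lemma cInt_eq f g : (forall x, f x = g x) -> cInt f = cInt g.
Proof. by move=> /funext ->. Qed.

Lemma integrable_dominated (u v : T -> R) : measurable_fun [set: T] u ->
  measurable_fun [set: T] v -> (forall x, `|u x| <= v x) -> (\int[mu]_x (v x)%:E < +oo)%E ->
  mu.-integrable [set: T] (EFin \o u).
Proof.
move=> mu' mv uv iv; apply: (@le_integrable _ _ _ mu _ _ _ (EFin \o v)) => //.
- exact/measurable_EFinP.
- by move=> x _; rewrite /= !lee_fin (le_trans (uv x)) // ler_norm.
apply/integrableP; split; first exact/measurable_EFinP.
apply: le_lt_trans iv; apply: ge0_le_integral => //.
- by apply/measurable_EFinP; apply: measurableT_comp.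
- exact/measurable_EFinP.
- by move=> x _; rewrite lee_fin ger0_norm // (le_trans _ (uv x)).
Qed.

Lemma sqnorm_cst_mul (r : R) f : 0 <= r -> cmeas f -> (\int[mu]_x (r * abs2 (f x))%:E = r%:E * sqnorm f)%E.
Proof.
move=> r0 mf; rewrite /sqnorm -ge0_integralZl //.
- exact: emeasurable_abs2.
- by move=> x _; rewrite lee_fin abs2_ge0.
Qed.

Lemma sqint0 : sqint (fun=> 0).
Proof.
split; first exact: cmeas_cst.
by rewrite /sqnorm; under eq_integral do rewrite abs2_0; rewrite integral0 ltry.
Qed.

Lemma sqnormD_le f g : cmeas f -> cmeas g -> (sqnorm (fun x => f x + g x)%R <= 2%:E * (sqnorm f + sqnorm g))%E.
Proof.
move=> mf mg; rewrite /sqnorm -ge0_integralD //.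
- rewrite -ge0_integralZl //.
  + apply: ge0_le_integral => //.
    * by move=> x _; rewrite lee_fin abs2_ge0.
    * by apply: emeasurable_abs2; exact: cmeasD.
    * apply: measurable_funeM; apply: emeasurable_funD; exact: emeasurable_abs2.
    * by move=> x _; rewrite -EFinD -EFinM lee_fin abs2D_le.
  + by apply: emeasurable_funD; exact: emeasurable_abs2.
  + by move=> x _; rewrite -EFinD lee_fin addr_ge0 // abs2_ge0.
- by move=> x _; rewrite lee_fin abs2_ge0.
- exact: emeasurable_abs2.
- by move=> x _; rewrite lee_fin abs2_ge0.
- exact: emeasurable_abs2.
Qed.

Lemma sqintD f g : sqint f -> sqint g -> sqint (fun x => f x + g x).
Proof.
move=> [mf fi] [mg gi]; split; first exact: cmeasD.
apply: le_lt_trans (sqnormD_le mf mg) _.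
have ff : sqnorm f \is a fin_num by rewrite ge0_fin_numE // sqnorm_ge0.
have gf : sqnorm g \is a fin_num by rewrite ge0_fin_numE // sqnorm_ge0.
by rewrite -(fineK ff) -(fineK gf) -EFinD -EFinM ltry.
Qed.

Lemma sqnorm_scale a f : cmeas f -> sqnorm (cscale a f) = ((abs2 a)%:E * sqnorm f)%E.
Proof.
move=> mf; rewrite -sqnorm_cst_mul ?abs2_ge0 //.
by apply: eq_integral => x _; rewrite abs2M.
Qed.

Lemma sqintZ a f : sqint f -> sqint (cscale a f).
Proof.
move=> [mf fi]; split; first exact: cmeas_scale.
have ff : sqnorm f \is a fin_num by rewrite ge0_fin_numE // sqnorm_ge0.
by rewrite sqnorm_scale // -(fineK ff) -EFinM ltry.
Qed.

Lemma sqintN f : sqint f -> sqint (fun x => - f x).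
Proof.
by move=> /(@sqintZ (-1)); congr sqint; apply/funext => x; rewrite /cscale mulN1r.
Qed.

Lemma sqintB f g : sqint f -> sqint g -> sqint (fun x => f x - g x).
Proof. by move=> fi gi; apply: sqintD => //; exact: sqintN. Qed.

Lemma sqint_abs2_integrable f : sqint f -> mu.-integrable [set: T] (EFin \o (fun x => abs2 (f x))).
Proof.
move=> [mf fi]; apply: (@integrable_dominated _ (fun x => abs2 (f x))) => //.
- exact: measurable_abs2.
- exact: measurable_abs2.
- by move=> x; rewrite ger0_norm // abs2_ge0.
Qed.

Lemma sqint_mul f g : sqint f -> sqint g -> cintegrable (fun x => f x * (g x)^*).
Proof.
move=> [mf fi] [mg gi].
have m : cmeas (fun x => f x * (g x)^*) by apply: cmeasM => //; exact: cmeasJ.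
pose v x := abs2 (f x) + abs2 (g x).
have mv : measurable_fun [set: T] v by apply: measurable_funD; exact: measurable_abs2.
have vi : (\int[mu]_x (v x)%:E < +oo)%E.
  rewrite /v; under eq_integral do rewrite EFinD.
  rewrite ge0_integralD //; first exact: lte_add_pinfty.
  - by move=> x _; rewrite lee_fin abs2_ge0.
  - exact: emeasurable_abs2.
  - by move=> x _; rewrite lee_fin abs2_ge0.
  - exact: emeasurable_abs2.
split; apply: (integrable_dominated (proj1 m) mv) vi || apply: (integrable_dominated (proj2 m) mv) vi.
  move=> x; rewrite /v /abs2; case: (f x) (g x) => [a b] [a' b'] /=.
  have := sqr_ge0 (a + a'); have := sqr_ge0 (a - a'); have := sqr_ge0 (b + b'); have := sqr_ge0 (b - b').
  by move=> *; rewrite ler_norml; apply/andP; split; nra.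
move=> x; rewrite /v /abs2; case: (f x) (g x) => [a b] [a' b'] /=.
have := sqr_ge0 (a + b'); have := sqr_ge0 (a - b'); have := sqr_ge0 (b + a'); have := sqr_ge0 (b - a').
by move=> *; rewrite ler_norml; apply/andP; split; nra.
Qed.

Lemma inn_self f : sqint f -> (Re (inn f f))%:E = sqnorm f.
Proof.
move=> fi; rewrite /inn /cInt /= /Rintegral fineK.
  apply: eq_integral => x _; congr EFin; rewrite /abs2.
  by case: (f x) => a b /=; ring.
by apply: integrable_fin_num => //; have [] := sqint_mul fi fi.
Qed.

Lemma innC f g : sqint f -> sqint g -> inn g f = (inn f g)^*.
Proof.
move=> fi gi; rewrite /inn -cIntJ; last exact: sqint_mul.
by apply: cInt_eq => x; rewrite rmorphM /= conjcK mulrC.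
Qed.

Lemma pre_hilbert_sqint : pre_hilbert cscale sqint inn.
Proof.
split.
- exact: sqint0.
- exact: sqintD.
- exact: sqintN.
- exact: sqintZ.
- by move=> a f g; apply/funext => x; rewrite /cscale mulrDr.
- by move=> a b f; apply/funext => x; rewrite /cscale mulrA.
- move=> f g h fi gi hi; rewrite /inn -cIntD; try exact: sqint_mul.
  by apply: cInt_eq => x; rewrite mulrDl.
- move=> a f g fi gi; rewrite /inn -cIntZ; last exact: sqint_mul.
  by apply: cInt_eq => x; rewrite /cscale mulrA.
- by move=> f g; exact: innC.
- by move=> f fi; rewrite -lee_fin inn_self // sqnorm_ge0.
Qed.

Lemma Lnorm2E f : (Lnorm mu 2%:E (fun x => (ComplexField.Normc.normc (f x))%:E) `^ 2 = sqnorm f)%E.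
Proof.
rewrite poweR_Lnorm //; apply: eq_integral => x _.
by rewrite /= powR_mulrn ?normr_ge0 // ger0_norm ?abs2_normc //; case: (f x) => a b /=; rewrite sqrtr_ge0.
Qed.

Lemma Lnorm2_lty f : (Lnorm mu 2%:E (fun x => (ComplexField.Normc.normc (f x))%:E) < +oo <-> sqnorm f < +oo)%E.
Proof.
rewrite -Lnorm2E; split; first exact: poweR_lty.
by apply: lty_poweRy; rewrite pnatr_eq0.
Qed.

Lemma Lnorm2_lt f (e : R) : 0 < e ->
  (Lnorm mu 2%:E (fun x => (ComplexField.Normc.normc (f x))%:E) < e%:E <-> sqnorm f < (e ^+ 2)%:E)%E.
Proof.
move=> e0; rewrite -Lnorm2E; have := @Lnorm_ge0 _ T R mu 2%:E (fun x => (ComplexField.Normc.normc (f x))%:E).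
case: (Lnorm _ _ _) => [r| |] //=; last by move=> _; rewrite pnatr_eq0 /=.
rewrite lee_fin !lte_fin => r0; rewrite powR_mulrn // ltr_pXn2r // ?nnegrE ?ltW //.
Qed.

Lemma Lnorm1E f : (Lnorm mu 1%:E (fun x => (ComplexField.Normc.normc (f x))%:E) =
  \int[mu]_x (Num.sqrt (abs2 (f x)))%:E)%E.
Proof.
rewrite Lnorm1; apply: eq_integral => x _.
by rewrite /= ger0_norm; case: (f x) => a b /=; rewrite ?sqrtr_ge0.
Qed.

Lemma measurable_normc f : cmeas f -> measurable_fun [set: T] (fun x => Num.sqrt (abs2 (f x))).
Proof.
move=> mf; rewrite (_ : (fun x => _) = (fun x => (abs2 (f x)) `^ (2^-1))).
  exact: (measurableT_comp (@measurable_powR R 2^-1) (measurable_abs2 mf)).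
by apply/funext => x; rewrite powR12_sqrt // abs2_ge0.
Qed.

Lemma abs_Re_le (z : R[i]) : `|Re z| <= Num.sqrt (abs2 z).
Proof. by rewrite -sqrtr_sqr ler_sqrt ?abs2_ge0 // lerDl sqr_ge0. Qed.

Lemma abs_Im_le (z : R[i]) : `|Im z| <= Num.sqrt (abs2 z).
Proof. by rewrite -sqrtr_sqr ler_sqrt ?abs2_ge0 // lerDr sqr_ge0. Qed.

Lemma cintegrable_L1 f : cmeas f -> (\int[mu]_x (Num.sqrt (abs2 (f x)))%:E < +oo)%E -> cintegrable f.
Proof.
move=> mf fi; split.
  by apply: (integrable_dominated (proj1 mf) (measurable_normc mf)) fi => x; exact: abs_Re_le.
by apply: (integrable_dominated (proj2 mf) (measurable_normc mf)) fi => x; exact: abs_Im_le.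
Qed.

Lemma fatou_bound (u : nat -> T -> \bar R) (v : T -> \bar R) (b : \bar R) :
  (forall n, measurable_fun [set: T] (u n)) -> (forall n x, (0 <= u n x)%E) ->
  (forall x, u ^~ x @ \oo --> v x) -> (forall n, (\int[mu]_x u n x <= b)%E) ->
  (\int[mu]_x v x <= b)%E.
Proof.
move=> mu' u0 uv ub.
have := @fatou _ _ _ mu _ measurableT u mu' (fun n x _ => u0 n x).
have -> : (\int[mu]_x limn_einf (u^~ x) = \int[mu]_x v x)%E.
  by apply: eq_integral => x _; rewrite (cvg_limn_einf_sup (uv x)).1.
move=> /le_trans; apply; rewrite limn_einf_lim; apply: lime_le.
  exact: ereal_nondecreasing_is_cvgn (nondecreasing_einfs _).
apply: nearW => n; apply: le_trans (ub n).
by rewrite /einfs; apply: ereal_inf_lbound; exists n => /=.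
Qed.

Lemma cvg_geometric_increments (a : nat -> R) (C : R) :
  (forall n, `|a n.+1 - a n| <= C * 2^-1 ^+ n) -> cvgn a.
Proof.
move=> H; have C0 : 0 <= C.
  by have := le_trans (normr_ge0 _) (H 0%N); rewrite expr0 mulr1.
pose b n := a n - 2 * C * 2^-1 ^+ n.
have gcv : (fun n => 2 * C * 2^-1 ^+ n : R) @ \oo --> (0 : R).
  have := @cvg_geometric R (2 * C) 2^-1; rewrite ger0_norm ?invr_ge0 //; apply.
  by rewrite invf_lt1 // ltr1n.
have bstep n : b n <= b n.+1.
  have := H n; rewrite ler_norml => /andP[h _].
  by rewrite /b exprS; move: h; set z := _ ^+ n; lra.
have abnd n : a n <= a 0%N + 2 * C - 2 * C * 2^-1 ^+ n.
  elim: n => [|n IH]; first by rewrite expr0; lra.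
  have := H n; rewrite ler_norml => /andP[_ h].
  by rewrite exprS; move: h IH; set z := _ ^+ n; lra.
have cb : cvgn b.
  apply: nondecreasing_is_cvgn; first by apply/nondecreasing_seqP.
  exists (a 0%N + 2 * C) => _ [n _ <-]; have := abnd n; rewrite /b.
  have : 0 <= 2 * C * 2^-1 ^+ n by rewrite mulr_ge0 ?mulr_ge0 ?exprn_ge0 ?invr_ge0.
  by lra.
have -> : a = b \+ (fun n => 2 * C * 2^-1 ^+ n) by apply/funext => n; rewrite /b /= subrK.
by apply: is_cvgD => //; apply/cvg_ex; exists 0.
Qed.

Lemma nneseries_geometric_bound (a : nat -> \bar R) : (forall n, (0 <= a n)%E) ->
  (forall n, (a n <= (2^-1 ^+ n)%:E)%E) -> (\sum_(0 <= n <oo) a n <= 2%:E)%E.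
Proof.
move=> a0 ab; apply: lime_le; first exact: is_cvg_nneseries.
apply: nearW => n; apply: (@le_trans _ _ (\sum_(0 <= i < n) (2^-1 ^+ i)%:E)%E).
  exact: lee_sum.
rewrite sumEFin lee_fin.
have := @geometric_le_lim R n 1 2^-1; rewrite ler01 invr_gt0 ltr0n ger0_norm ?invr_ge0 //.
move=> /(_ isT isT); have -> : (2^-1 < 1 :> R) by rewrite invf_lt1 // ltr1n.
move=> /(_ isT); rewrite /series /geometric /=; under eq_bigr do rewrite mul1r.
by move=> /le_trans; apply; rewrite (_ : 1 / (1 - 2^-1) = 2) //; field.
Qed.

Lemma sqnorm_ae (f g : T -> R[i]) : cmeas f -> cmeas g -> {ae mu, forall x, f x = g x} -> sqnorm f = sqnorm g.
Proof.
move=> mf mg fg; apply: ge0_ae_eq_integral => //.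
- exact: emeasurable_abs2.
- exact: emeasurable_abs2.
- by move=> x _; rewrite lee_fin abs2_ge0.
- by move=> x _; rewrite lee_fin abs2_ge0.
- by apply: filterS fg => x + _; move=> ->.
Qed.

(** The squared increments weighted by [4 ^+ n] have a finite total integral, so almost
    everywhere the increments decrease geometrically and the sequence converges. Fatou's
    lemma then bounds the distance to the limit. *)
Lemma riesz_fischer (f_ : nat -> T -> R[i]) : (forall n, sqint (f_ n)) ->
  (forall n m, (n <= m)%N -> (sqnorm (fun x => f_ m x - f_ n x)%R <= (8^-1 ^+ n)%:E)%E) ->
  exists f, sqint f /\ forall n, (sqnorm (fun x => f x - f_ n x)%R <= (8^-1 ^+ n)%:E)%E.
Proof.
move=> fi fc.
have mf n : cmeas (f_ n) by case: (fi n).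
have mB n m : cmeas (fun x => f_ m x - f_ n x) by apply: cmeasD => //; exact: cmeasN.
pose D n x := (4 ^+ n * abs2 (f_ n.+1 x - f_ n x))%:E.
pose F x := (\sum_(0 <= n <oo) D n x)%E.
have D0 n x : (0 <= D n x)%E by rewrite lee_fin mulr_ge0 ?exprn_ge0 ?abs2_ge0.
have mD n : measurable_fun [set: T] (D n).
  apply/measurable_EFinP; apply: measurable_funM; [exact: measurable_cst|exact: measurable_abs2].
have mF : measurable_fun [set: T] F.
  by apply: (ge0_emeasurable_sum (P := xpredT)) => // k x _ _; exact: D0.
have F0 x : (0 <= F x)%E by apply: nneseries_ge0.
have iF : (\int[mu]_x F x < +oo)%E.
  rewrite /F integral_nneseries //; apply: (@le_lt_trans _ _ 2%:E); last exact: ltry.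
  apply: nneseries_geometric_bound => n; first by apply: integral_ge0 => x _; exact: D0.
  rewrite sqnorm_cst_mul ?exprn_ge0 //.
  apply: (@le_trans _ _ ((4 ^+ n)%:E * (8^-1 ^+ n)%:E)%E).
    by apply: lee_wpmul2l; [rewrite lee_fin exprn_ge0|exact: fc].
  by rewrite -EFinM lee_fin -exprMn; have -> : 4 * 8^-1 = 2^-1 :> R by lra.
pose A := [set x | F x \is a fin_num].
have mA : measurable A.
  by rewrite -[A]setTI; exact: emeasurable_fin_num.
have aeA : {ae mu, forall x, A x}.
  have : mu.-integrable [set: T] F.
    apply/integrableP; split => //.
    by under eq_integral do rewrite gee0_abs //.
  by move=> /(integrable_ae measurableT); apply: filterS => x; exact.
have cvx x : A x -> cvgn (fun n => Re (f_ n x)) /\ cvgn (fun n => Im (f_ n x)).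
  move=> Ax; pose M := fine (F x).
  have bnd n : Num.sqrt (abs2 (f_ n.+1 x - f_ n x)) <= Num.sqrt M * 2^-1 ^+ n.
    have DM : (D n x <= F x)%E.
      apply: (@le_trans _ _ (\sum_(0 <= k < n.+1) D k x)%E).
        rewrite big_nat_recr //= -[leLHS]add0e; apply: leeD => //.
        by apply: sume_ge0 => k _; exact: D0.
      by apply: nneseries_lim_ge => k _ _; exact: D0.
    have M0 : 0 <= M by rewrite fine_ge0.
    have hM : 4 ^+ n * abs2 (f_ n.+1 x - f_ n x) <= M by rewrite -lee_fin fineK.
    rewrite -[2^-1 ^+ n]ger0_norm ?exprn_ge0 ?invr_ge0 // -sqrtr_sqr -sqrtrM //.
    rewrite ler_sqrt ?mulr_ge0 ?sqr_ge0 // -exprM mulnC exprM.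
    have -> : 2^-1 ^+ 2 = 4^-1 :> R by lra.
    by rewrite exprVn -ler_pdivrMr ?invr_gt0 ?exprn_gt0 // invrK mulrC.
  split; apply: cvg_geometric_increments => n; apply: le_trans (bnd n).
    have := abs_Re_le (f_ n.+1 x - f_ n x).
    by case: (f_ n.+1 x) (f_ n x) => [a b] [a' b'].
  have := abs_Im_le (f_ n.+1 x - f_ n x).
  by case: (f_ n.+1 x) (f_ n x) => [a b] [a' b'].
pose fr x := \1_A x * limn (fun n => Re (f_ n x)).
pose fim x := \1_A x * limn (fun n => Im (f_ n x)).
have cfr x : (fun n => \1_A x * Re (f_ n x)) @ \oo --> fr x.
  rewrite /fr indicE; case: (boolP (x \in A)) => [/set_mem /cvx [c1 _]|_].
    by apply: cvgMl_tmp => //; exact: cvg_cst.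
  by under eq_fun do rewrite mul0r; rewrite mul0r; exact: cvg_cst.
have cfi x : (fun n => \1_A x * Im (f_ n x)) @ \oo --> fim x.
  rewrite /fim indicE; case: (boolP (x \in A)) => [/set_mem /cvx [_ c1]|_].
    by apply: cvgMl_tmp => //; exact: cvg_cst.
  by under eq_fun do rewrite mul0r; rewrite mul0r; exact: cvg_cst.
have m1 : measurable_fun [set: T] (\1_A : T -> R) by exact: measurable_indic.
pose f x := fr x +i* fim x.
have mff : cmeas f.
  split; apply: measurable_fun_cvg.
  - by move=> n; apply: measurable_funM m1 (proj1 (mf n)).
  - by move=> x _; exact: cfr.
  - by move=> n; apply: measurable_funM m1 (proj2 (mf n)).
  - by move=> x _; exact: cfi.
have bound n : (sqnorm (fun x => f x - f_ n x)%R <= (8^-1 ^+ n)%:E)%E.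
  have -> : sqnorm (fun x => f x - f_ n x) = sqnorm (fun x => f x - (\1_A x)%:C * f_ n x).
    apply: sqnorm_ae; first by apply: cmeasD => //; exact: cmeasN.
      by apply: cmeasD => //; apply: cmeasN; apply: cmeasM => //; exact: cmeas_indic.
    by apply: filterS aeA => x Ax; rewrite indicE mem_set // mul1r.
  apply: (@fatou_bound (fun m x => (abs2 ((\1_A x)%:C * (f_ (n + m)%N x - f_ n x)))%:E)).
  - by move=> m; apply: emeasurable_abs2; apply: cmeasM => //; exact: cmeas_indic.
  - by move=> m x; rewrite lee_fin abs2_ge0.
  - move=> x; apply/fine_cvgP; split; first by apply: nearW.
    have -> : abs2 (f x - (\1_A x)%:C * f_ n x) =
       (fr x - \1_A x * Re (f_ n x)) ^+ 2 + (fim x - \1_A x * Im (f_ n x)) ^+ 2.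
      by rewrite /f /abs2; case: (f_ n x) => a b /=; rewrite !mul0r subr0 addr0.
    have -> : fine \o (fun m => (abs2 ((\1_A x)%:C * (f_ (n + m)%N x - f_ n x)))%:E) =
       (fun m => (\1_A x * Re (f_ (m + n)%N x) - \1_A x * Re (f_ n x)) ^+ 2 +
                 (\1_A x * Im (f_ (m + n)%N x) - \1_A x * Im (f_ n x)) ^+ 2).
      apply/funext => m; rewrite /= addnC /abs2; case: (f_ n x) => a b.
      by case: (f_ (m + n)%N x) => a' b' /=; rewrite !mul0r subr0 addr0 !mulrBr.
    have c1 : (fun m => \1_A x * Re (f_ (m + n)%N x)) @ \oo --> fr x.
      by have := cfr x; rewrite -(cvg_shiftn n).
    have c2 : (fun m => \1_A x * Im (f_ (m + n)%N x)) @ \oo --> fim x.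
      by have := cfi x; rewrite -(cvg_shiftn n).
    rewrite !expr2; under eq_fun do rewrite !expr2.
    by apply: cvgD; apply: cvgM; apply: cvgB => //; exact: cvg_cst.
  - move=> m; apply: le_trans (fc n (n + m)%N (leq_addr _ _)).
    apply: ge0_le_integral => //.
    + by move=> x _; rewrite lee_fin abs2_ge0.
    + by apply: emeasurable_abs2; apply: cmeasM => //; exact: cmeas_indic.
    + exact: emeasurable_abs2.
    + move=> x _; rewrite lee_fin abs2M ler_piMl ?abs2_ge0 // abs2_real indicE.
      by case: (x \in A); rewrite ?expr1n ?expr0n.
exists f; split => //; split => //.
have := sqnormD_le (f := fun x => f x - f_ 0%N x) (g := f_ 0%N) _ (mf 0%N).
have -> : (fun x => f x - f_ 0%N x + f_ 0%N x) = f by apply/funext => x; rewrite subrK.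
move=> H; apply: le_lt_trans (H _) _; first by apply: cmeasD => //; exact: cmeasN.
apply: (@le_lt_trans _ _ (2%:E * ((8^-1 ^+ 0)%:E + sqnorm (f_ 0%N)))%E).
  by apply: lee_wpmul2l => //; apply: leeD2r; exact: bound.
have ff : sqnorm (f_ 0%N) \is a fin_num by rewrite ge0_fin_numE ?sqnorm_ge0 //; case: (fi 0%N).
by rewrite -(fineK ff) -EFinD -EFinM ltry.
Qed.

Definition indicators : set (T -> R[i]) :=
  [set g | exists A, [/\ measurable A, (mu A < +oo)%E & g = fun x => (\1_A x)%:C]].

Lemma sqnorm_indic (A : set T) : measurable A -> sqnorm (cindic A) = mu A.
Proof.
move=> mA; rewrite /sqnorm -{2}(setIT A) -(integral_indic mu measurableT mA).
apply: eq_integral => x _; rewrite abs2_real indicE; case: (x \in A); by rewrite ?expr1n ?expr0n.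
Qed.

Lemma sqint_indic (A : set T) : measurable A -> (mu A < +oo)%E -> sqint (cindic A).
Proof. by move=> mA Af; split; [exact: cmeas_indic|rewrite sqnorm_indic]. Qed.

Lemma indicators_sqint h : indicators h -> sqint h.
Proof. by move=> [A [mA Af ->]]; exact: sqint_indic. Qed.

Lemma nsq_fine f : sqint f -> (nsq inn f)%:E = sqnorm f.
Proof. exact: inn_self. Qed.

Import HBNNSimple.
(** Approximation from below by simple functions, with dominated convergence of the
    squared differences. *)
Lemma cspan_real_ge0 (r : T -> R) : measurable_fun [set: T] r -> (forall x, 0 <= r x) ->
  sqint (fun x => (r x)%:C) -> cspan cscale inn indicators (fun x => (r x)%:C).
Proof.
move=> mr r0 ri.
have mr' : measurable_fun [set: T] (EFin \o r) by exact/measurable_EFinP.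
pose h n := nnsfun_approx measurableT mr' n.
have hr n x : h n x <= r x.
  rewrite -lee_fin /h nnsfun_approxE; apply: (@le_approx _ _ _ _ (EFin \o r)) => //.
  by move=> y _; rewrite lee_fin.
have h0 n x : 0 <= h n x by exact: fun_ge0.
have hc x : (h n x) @[n --> \oo] --> r x.
  have := @cvg_nnsfun_approx _ _ _ _ measurableT _ mr' (fun y _ => r0 y) x I.
  by move=> /fine_cvgP [].
have mh n : measurable_fun [set: T] (h n) by exact: measurable_funPT.
have ii : mu.-integrable [set: T] (EFin \o (fun x => abs2 (r x)%:C)) by exact: sqint_abs2_integrable.
have [||||_ dc _] := @dominated_convergence _ _ _ mu _ measurableT
   (fun n x => ((r x - h n x) ^+ 2)%:E) (fun=> 0%E) (EFin \o (fun x => abs2 (r x)%:C)) _ _ _ ii _.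
- move=> n; apply/measurable_EFinP; apply: measurable_funX; exact: measurable_funB.
- exact: measurable_cst.
- apply/aeW => x _; apply/fine_cvgP; split; first by apply: nearW.
  rewrite /= -[0]/(fine 0%E); rewrite (_ : fine 0%E = (r x - r x) * (r x - r x)); last by rewrite subrr mulr0.
  rewrite (_ : fine \o _ = fun n => (r x - h n x) * (r x - h n x)); last by apply/funext => n /=; rewrite expr2.
  by apply: cvgM; apply: cvgB => //; exact: cvg_cst.
- apply/aeW => x n _; rewrite /= abs2_real lee_fin ger0_norm ?sqr_ge0 //.
  by rewrite lerXn2r ?nnegrE // ?subr_ge0 // lerBlDr lerDl.
move=> e e0.
have hsq n : sqint (fun x => (h n x)%:C).
  split; first exact: cmeas_real.
  case: ri => _; apply: le_lt_trans; apply: ge0_le_integral => //.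
  - by move=> x _; rewrite lee_fin abs2_ge0.
  - by apply: emeasurable_abs2; exact: cmeas_real.
  - by apply: emeasurable_abs2; exact: cmeas_real.
  - by move=> x _; rewrite !abs2_real lee_fin lerXn2r ?nnegrE.
have [n nE] : exists n, nsq inn ((fun x => (r x)%:C) - (fun x => (h n x)%:C)) < e.
  have /fine_cvgP [_ /cvgrPdist_lt /(_ e e0) [n _ /(_ n (leqnn n))]] := dc.
  rewrite /= sub0r normrN => He; exists n.
  rewrite -lte_fin nsq_fine; last exact: sqintB.
  move: He; rewrite ger0_norm ?fine_ge0 ?integral_ge0 // => He.
  have E : sqnorm (fun x => (r x)%:C - (h n x)%:C) = (\int[mu]_x `|((r x - h n x) ^+ 2)%:E - 0|)%E.
    apply: eq_integral => x _; rewrite -rmorphB abs2_real sube0 /= ger0_norm ?sqr_ge0 //.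
  rewrite [sqnorm _]E -(fineK (x := (\int[mu]_x `|((r x - h n x) ^+ 2)%:E - 0|)%E)) ?lte_fin //.
  rewrite -E; have := sqintB ri (hsq n) => -[_]; rewrite ge0_fin_numE ?sqnorm_ge0 //.
pose s := finmap.enum_fset (fset_set (range (h n))).
(* The level set of the value 0, possibly of infinite measure, gives way to the empty set. *)
exists (size s), (fun i => (nth 0 s i)%:C),
  (fun i => if nth 0 s i == 0 then (cindic set0) else fun x => (\1_(h n @^-1` [set nth 0 s i]) x)%:C); split.
  move=> i; case: ifPn => [_|yi]; first by exists set0; rewrite measure0.
  have my : measurable (h n @^-1` [set s`_i]) by rewrite -[_ @^-1` _]setTI; exact: mh.
  exists (h n @^-1` [set s`_i]); split => //.
  have y2 : 0 < s`_i ^+ 2 by rewrite lt_neqAle eq_sym sqrf_eq0 yi sqr_ge0.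
  have : ((s`_i ^+ 2)%:E * mu (h n @^-1` [set s`_i]) < +oo)%E.
    case: (hsq n) => _; apply: le_lt_trans.
    rewrite -(sqnorm_indic my) -sqnorm_cst_mul ?sqr_ge0 //; last exact: cmeas_indic.
    apply: ge0_le_integral => //.
    - by move=> x _; rewrite lee_fin mulr_ge0 ?sqr_ge0 ?abs2_ge0.
    - apply/measurable_EFinP; apply: measurable_funM; [exact: measurable_cst|].
      by apply: measurable_abs2; exact: cmeas_indic.
    - by apply: emeasurable_abs2; exact: cmeas_real.
    - move=> x _; rewrite !abs2_real lee_fin indicE; case: (boolP (x \in _)) => [/set_mem /= ->|_].
        by rewrite expr1n mulr1.
      by rewrite expr0n mulr0 sqr_ge0.
  rewrite !ltey; apply: contra => /eqP ->; by rewrite gt0_muley // lte_fin.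
apply: le_lt_trans nE; rewrite le_eqVlt; apply/orP; left; apply/eqP; congr nsq; congr (_ - _).
apply/funext => x; rewrite fct_sumE (fimfunEord (h n) x) rmorph_sum /=; apply: eq_bigr => i _.
rewrite /cscale; case: eqP => [->|_]; first by rewrite !mul0r.
by rewrite rmorphM.
Qed.

Lemma cspan_indicators f : sqint f -> cspan cscale inn indicators f.
Proof.
have H := pre_hilbert_sqint; move=> fi; have [[mr mi] ff] := fi.
have sr (g : T -> R) : measurable_fun [set: T] g -> (forall x, g x ^+ 2 <= abs2 (f x)) -> sqint (fun x => (g x)%:C).
  move=> mg gf; split; first exact: cmeas_real.
  apply: le_lt_trans ff; apply: ge0_le_integral => //.
  - by move=> x _; rewrite lee_fin abs2_ge0.
  - by apply: emeasurable_abs2; exact: cmeas_real.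
  - by apply: emeasurable_abs2; case: fi.
  - by move=> x _; rewrite abs2_real lee_fin.
pose rp x := Num.max (Re (f x)) 0; pose rn x := Num.max (- Re (f x)) 0.
pose ip x := Num.max (Im (f x)) 0; pose im x := Num.max (- Im (f x)) 0.
have mx (g : T -> R) : measurable_fun [set: T] g -> measurable_fun [set: T] (fun x => Num.max (g x) 0).
  by move=> mg; apply: measurable_maxr => //; exact: measurable_cst.
have mrp := mx _ mr; have mip := mx _ mi.
have mrn := mx _ (measurable_funN mr); have min := mx _ (measurable_funN mi).
have maxsq (a : R) : Num.max a 0 ^+ 2 <= a ^+ 2.
  by case: (leP a 0) => //; rewrite expr0n sqr_ge0.
have maxsqN (a : R) : Num.max (- a) 0 ^+ 2 <= a ^+ 2 by rewrite -[leRHS]sqrrN.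
have max0 (a : R) : 0 <= Num.max a 0 by rewrite le_max lexx orbT.
have maxB (a : R) : Num.max a 0 - Num.max (- a) 0 = a.
  by case: (leP a 0); case: (leP (- a) 0); lra.
have rp0 x : 0 <= rp x by exact: max0.
have rn0 x : 0 <= rn x by exact: max0.
have ip0 x : 0 <= ip x by exact: max0.
have im0 x : 0 <= im x by exact: max0.
have Srp : sqint (fun x => (rp x)%:C) by apply: sr => // x; rewrite (le_trans (maxsq _)) // lerDl sqr_ge0.
have Srn : sqint (fun x => (rn x)%:C) by apply: sr => // x; rewrite (le_trans (maxsqN _)) // lerDl sqr_ge0.
have Sip : sqint (fun x => (ip x)%:C) by apply: sr => // x; rewrite (le_trans (maxsq _)) // lerDr sqr_ge0.
have Sin : sqint (fun x => (im x)%:C) by apply: sr => // x; rewrite (le_trans (maxsqN _)) // lerDr sqr_ge0.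
have -> : f = (fun x => (rp x)%:C) + cscale (-1) (fun x => (rn x)%:C) +
   (cscale 'i (fun x => (ip x)%:C) + cscale (- 'i) (fun x => (im x)%:C)).
  apply/funext => x; change (f x = (rp x)%:C + (-1) * (rn x)%:C + ('i * (ip x)%:C + (- 'i) * (im x)%:C)).
  rewrite /rp /rn /ip /im; case: (f x) => a b /=; have := maxB a; have := maxB b.
  move: (Num.max a 0) (Num.max (- a) 0) (Num.max b 0) (Num.max (- b) 0) => u v u' v' E1 E2.
  by apply/eqP; rewrite eq_complex /=; apply/andP; split; apply/eqP; lra.
have pz (a : R[i]) (g : T -> R) : measurable_fun [set: T] g -> (forall x, 0 <= g x) ->
    sqint (fun x => (g x)%:C) -> cspan cscale inn indicators (cscale a (fun x => (g x)%:C)).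
  by move=> mg g0 gs; exact: (cspanZ H a indicators_sqint gs (cspan_real_ge0 mg g0 gs)).
have Sa a (g : T -> R) : sqint (fun x => (g x)%:C) -> sqint (cscale a (fun x => (g x)%:C)) by exact: sqintZ.
have S2 := sqintD (Sa 'i _ Sip) (Sa (- 'i) _ Sin).
have S1 := sqintD Srp (Sa (-1) _ Srn).
apply: (cspanD H indicators_sqint S1 S2).
  apply: (cspanD H indicators_sqint Srp (Sa (-1) _ Srn)); last exact: pz.
  exact: cspan_real_ge0.
by apply: (cspanD H indicators_sqint (Sa 'i _ Sip) (Sa (- 'i) _ Sin)); exact: pz.
Qed.

Lemma sqnorm_eq0 f : cmeas f -> sqnorm f = 0%E -> {ae mu, forall x, f x = 0}.
Proof.
move=> mf f0.
have : (\int[mu]_x `|(abs2 (f x))%:E| = 0)%E.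
  by rewrite -f0; apply: eq_integral => x _; rewrite gee0_abs // lee_fin abs2_ge0.
move=> /(ae_eq_integral_abs mu measurableT (emeasurable_abs2 mf)).
by apply: filterS => x /(_ I) /= [] /abs2_eq0.
Qed.

(** The measure of the complement of [A n] in the union tends to 0. *)
Lemma cspan_indic_cvg (E : set (T -> R[i])) (A : nat -> set T) : (forall h, E h -> sqint h) ->
  (forall n, measurable (A n)) -> nondecreasing_seq A -> (mu (\bigcup_n A n) < +oo)%E ->
  (forall n, cspan cscale inn E (cindic (A n))) ->
  cspan cscale inn E (cindic (\bigcup_n A n)).
Proof.
move=> ES mA ndA fA cA; have mB : measurable (\bigcup_n A n) by exact: bigcup_measurable.
have fAn n : (mu (A n) < +oo)%E.
  by apply: le_lt_trans fA; apply: le_measure; rewrite ?inE //; exact: bigcup_sup.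
apply: (cspan_closed pre_hilbert_sqint ES (sqint_indic mB fA)) => e e0.
have fB : mu (\bigcup_n A n) \is a fin_num by rewrite ge0_fin_numE.
have : (mu \o A) @ \oo --> (fine (mu (\bigcup_n A n)))%:E.
  by rewrite fineK //; exact: nondecreasing_cvg_mu.
move=> /fine_cvgP[_ /cvgr_dist_lt/(_ _ e0)[N _ /(_ N (leqnn N)) /= HN]].
exists (cindic (A N)); split => //; first exact: sqint_indic.
rewrite -lte_fin nsq_fine; last by apply: sqintB; exact: sqint_indic.
rewrite (_ : _ - _ = fun x => (\1_(\bigcup_n A n `\` A N) x)%:C); last first.
  apply/funext => x; transitivity ((\1_(\bigcup_n A n) x)%:C - (\1_(A N) x)%:C : R[i]); first by [].
  rewrite -rmorphB /= !indicE in_setD.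
  have [xA|xA] := boolP (x \in A N); last by rewrite andbT subr0.
  by rewrite andbF (mem_set (_ : (\bigcup_n A n) x)) ?subrr //; exists N => //; rewrite -inE.
rewrite sqnorm_indic; last exact: measurableD.
rewrite measureD //.
rewrite setIidr; last exact: bigcup_sup.
suff : ((fine (mu (\bigcup_n A n)) - fine (mu (A N)))%:E < e%:E)%E.
  by rewrite EFinB !fineK // ge0_fin_numE.
by rewrite lte_fin; apply: le_lt_trans (ler_norm _) HN.
Qed.

End ComplexL2.

(** * Topological fields *)

Section TopField.
Context {K : topologicalFieldType}.

Lemma addl_continuous (a : K) : continuous (fun x : K => a + x).
Proof.
move=> x; apply: (@continuous_comp K (K * K)%type K (fun x => (a, x)) (fun x => x.1 + x.2)).
  by apply: cvg_pair; [exact: cvg_cst|exact: cvg_id].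
exact: add_continuous.
Qed.

Lemma mull_continuous (a : K) : continuous (fun x : K => a * x).
Proof.
move=> x; apply: (@continuous_comp K (K * K)%type K (fun x => (a, x)) (fun x => x.1 * x.2)).
  by apply: cvg_pair; [exact: cvg_cst|exact: cvg_id].
exact: mulf_continuous.
Qed.

Lemma nbhs_translate (a : K) (U : set K) : nbhs a U -> nbhs 0 [set x | U (a + x)].
Proof.
by move=> aU; apply: (@addl_continuous a 0); rewrite addr0.
Qed.

Lemma open_translate (a : K) (U : set K) : open U -> open [set x | U (a + x)].
Proof. by move=> oU; apply: open_comp => // x _; exact: addl_continuous. Qed.

Lemma open_dilate (a : K) (U : set K) : open U -> open [set x | U (a * x)].
Proof. by move=> oU; apply: open_comp => // x _; exact: mull_continuous. Qed.

Lemma translate_preimage (a : K) (A : set K) :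
  [set a + x | x in A] = [set x | A (- a + x)].
Proof.
apply/seteqP; split=> [x [y Ay <-]|x /= Ax]; first by rewrite /= addKr.
by exists (- a + x) => //; rewrite addNKr.
Qed.

Lemma dilate_preimage (a : K) (A : set K) : a != 0 ->
  [set a * x | x in A] = [set x | A (a^-1 * x)].
Proof.
move=> a0; apply/seteqP; split=> [x [y Ay <-]|x /= Ax]; first by rewrite /= mulKf.
by exists (a^-1 * x) => //; rewrite mulVKf.
Qed.

Hypothesis K_td : totally_disconnected [set: K].

Lemma closed_point (x : K) : closed [set x].
Proof.
by rewrite -(K_td (x := x)) //; apply: component_closed; exact: closedT.
Qed.

Lemma topfield_hausdorff : hausdorff_space K.
Proof.
rewrite open_hausdorff => x y xy.
have : nbhs (x - y) (~` [set (0 : K)]).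
  apply: open_nbhs_nbhs; split; last by move=> /= /eqP; rewrite subr_eq0 (negPf xy).
  by apply: closed_openC; exact: closed_point.
move=> /(@sub_continuous K (x, y)) [[A B] /= [Ax By] AB].
move: Ax By; rewrite !nbhsE => -[A' [oA' A'x] AA'] [B' [oB' B'y] BB'].
exists (A', B'); first by rewrite !inE.
split => //; apply/eqP/seteqP; split => // z [/= Az Bz].
have := AB (z, z) (conj (AA' _ Az) (BB' _ Bz)).
by rewrite /= subrr; exact.
Qed.

(** The tube lemma for the multiplication: by compactness, a single neighbourhood of [a]
    serves for all the points of [C]. *)
Lemma compact_mul_tube (a : K) (C U : set K) : compact C -> open U ->
  (forall c, C c -> U (a * c)) -> \forall b \near a, forall c, C c -> U (b * c).
Proof.
move=> /compact_near_coveringP cC oU aCU.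
apply: (cC _ (nbhs a) (fun b c => U (b * c))) => c Cc.
have : nbhs (a * c) U by apply: open_nbhs_nbhs; split => //; exact: aCU.
move=> /(@mulf_continuous K (a, c)) [[A B] /= [Aa Bc] AB].
by exists (B, A) => //= -[x b] [/= Bx Ab]; exact: (AB (b, x)).
Qed.

Lemma mul_box (a c : K) (U : set K) : nbhs (a * c) U ->
  exists A B, [/\ nbhs a A, open B, B c & forall x y, A x -> B y -> U (x * y)].
Proof.
move=> /(@mulf_continuous K (a, c)) [[A B] /= [Aa Bc] AB].
move: Bc; rewrite nbhsE => -[B' [oB' B'c] BB'].
by exists A, B'; split => // x y Ax By; exact: (AB (x, y) (conj Ax (BB' _ By))).
Qed.

End TopField.

Lemma open_measurable_borel (K : topologicalFieldType) (A : set K) :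
  open A -> measurable (A : set (borel K)).
Proof. by move=> oA; apply: sub_sigma_algebra. Qed.

(** * The absolute value of a local field *)

Section LocalField.
Context {R : realType} {K : topologicalFieldType}.
Variables (mu : {measure set (borel K) -> \bar R}) (absv : K -> R).
Hypothesis (K_local : is_local_field K).
Hypothesis (mu_haar : is_haar mu) (absvP : is_absolute_value mu absv).

Let K_td : totally_disconnected [set: K].
Proof. by case: K_local. Qed.

Lemma compact_nbhs0 : exists V : set K, [/\ compact V, closed V & nbhs 0 V].
Proof.
have [_ _ /(_ 0 I)] := K_local; case => V; rewrite /within /= => nV [cV clV].
by exists V; split => //; apply: filterS nV => x; exact.
Qed.

Lemma haar_translate (x : K) (A : set (borel K)) : measurable A ->
  mu [set x + y | y in A] = mu A.
Proof. by case: mu_haar => + _ _; exact. Qed.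

Lemma haar_compact (V : set K) : compact V -> (mu V < +oo)%E.
Proof. by case: mu_haar => _ + _; exact. Qed.

Lemma haar_open (V : set K) : open V -> V !=set0 -> (0 < mu V)%E.
Proof. by case: mu_haar => _ _; exact. Qed.

Lemma haar_nbhs0 : exists V : set K,
  [/\ compact V, closed V, nbhs 0 V, measurable (V : set (borel K)) &
     exists2 m, 0 < m & mu V = m%:E].
Proof.
have [V [cV clV nV]] := compact_nbhs0; exists V.
have mV : measurable (V : set (borel K)).
  by rewrite -[V]setCK; apply: measurableC; apply: open_measurable_borel; exact: closed_openC.
split => //; have Vfin := haar_compact cV.
have V0 : (0 < mu V)%E.
  move: nV; rewrite nbhsE => -[U [oU U0] UV].
  apply: (lt_le_trans (haar_open oU _)); first by exists 0.
  by apply: le_measure => //; rewrite inE //; exact: open_measurable_borel.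
exists (fine (mu V)); first by rewrite fine_gt0 // V0.
by rewrite fineK // ge0_fin_numE.
Qed.

Lemma absv0 : absv 0 = 0. Proof. by case: absvP. Qed.

Lemma haar_dilate (a : K) (A : set (borel K)) : a != 0 -> measurable A ->
  mu [set a * x | x in A] = ((absv a)%:E * mu A)%E.
Proof. by case: absvP => _; exact. Qed.

Lemma absvM (a b : K) : absv (a * b) = absv a * absv b.
Proof.
have [->|a0] := eqVneq a 0; first by rewrite mul0r absv0 mul0r.
have [->|b0] := eqVneq b 0; first by rewrite mulr0 absv0 mulr0.
have [V [cV clV nV mV [m m0 mVE]]] := haar_nbhs0.
have mbV : measurable ([set b * x | x in V] : set (borel K)).
  rewrite dilate_preimage // -[X in measurable X]setCK; apply: measurableC.
  apply: open_measurable_borel; apply: (@open_dilate _ b^-1 (~` V)).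
  exact: closed_openC.
have := haar_dilate (mulf_neq0 a0 b0) mV.
have -> : [set a * b * x | x in V] = [set a * x | x in [set b * x | x in V]].
  apply/seteqP; split => [x [y Vy <-]|x [y [z Vz <-] <-]].
    by exists (b * y); [exists y|rewrite mulrA].
  by exists z => //; rewrite mulrA.
rewrite haar_dilate // haar_dilate // mVE -!EFinM => -[]; rewrite mulrA => /mulIf.
by move=> ->//; rewrite gt_eqF.
Qed.

Lemma absv1 : absv 1 = 1.
Proof.
have [V [cV clV nV mV [m m0 mVE]]] := haar_nbhs0.
have := haar_dilate (oner_neq0 K) mV.
have -> : [set 1 * x | x in V] = V.
  by rewrite dilate_preimage ?oner_neq0 // invr1; apply/seteqP; split=> x /=; rewrite mul1r.
rewrite mVE -EFinM => -[] /esym; rewrite -[RHS]mul1r => /mulIf; apply.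
by rewrite gt_eqF.
Qed.

Lemma absv_ge0 (a : K) : 0 <= absv a.
Proof.
have [->|a0] := eqVneq a 0; first by rewrite absv0.
have [V [cV clV nV mV [m m0 mVE]]] := haar_nbhs0.
have : (0 <= (absv a)%:E * mu V)%E by rewrite -haar_dilate //.
by rewrite mVE -EFinM lee_fin pmulr_lge0.
Qed.

Lemma absv_gt0 (a : K) : a != 0 -> 0 < absv a.
Proof.
move=> a0; rewrite lt_neqAle absv_ge0 andbT eq_sym; apply/eqP => a00.
by have := absv1; rewrite -(mulfV a0) absvM a00 mul0r => /eqP; rewrite eq_sym oner_eq0.
Qed.

Lemma absvV (a : K) : absv a^-1 = (absv a)^-1.
Proof.
have [->|a0] := eqVneq a 0; first by rewrite invr0 absv0 invr0.
apply: (@mulfI _ (absv a)); first by rewrite gt_eqF ?absv_gt0.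
by rewrite -absvM !mulfV ?absv1 // gt_eqF ?absv_gt0.
Qed.

Lemma absvX (a : K) n : absv (a ^+ n) = absv a ^+ n.
Proof. by elim: n => [|n IH]; rewrite ?expr0 ?absv1 // !exprS absvM IH. Qed.

Lemma nbhs0_nontrivial (U : set K) : nbhs 0 U -> exists2 x, U x & x != 0.
Proof.
move=> nU; apply: contrapT => H.
have [+ _ _] := K_local; apply => A.
have o0 : nbhs 0 [set (0 : K)].
  apply: filterS nU => x Ux; apply: contrapT => /eqP x0.
  by apply: H; exists x.
rewrite openE => x Ax; rewrite /interior.
have := @addl_continuous _ (- x) x [set (0 : K)]; rewrite addNr => /(_ o0).
move=> /= nx; change (nbhs x [set y | [set 0] (- x + y)]) in nx.
apply: filterS nx => y /= /eqP; rewrite addrC subr_eq0 => /eqP ->; exact: Ax.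
Qed.

(** If [W] is a small neighbourhood of 0 and [x != 0] is a point of [U], then [x + W] is
    disjoint from [W] and still inside [U]. *)
Lemma halve_open (U : set K) : open U -> U 0 ->
  exists W, [/\ open W, W 0, W `<=` U & (mu W + mu W <= mu U)%E].
Proof.
move=> oU U0.
have [|x Ux x0] := @nbhs0_nontrivial U; first by apply: open_nbhs_nbhs.
have := topfield_hausdorff K_td; rewrite open_hausdorff => /(_ 0 x).
rewrite eq_sym x0 => /(_ isT) [[A B]]; rewrite !inE /= => -[A0 Bx] [oA oB /eqP AB].
pose W := U `&` A `&` ([set y | B (x + y)] `&` [set y | U (x + y)]).
have oW : open W.
  by apply: openI; apply: openI => //; apply: open_translate.
have mW := open_measurable_borel oW.
exists W; split => //; first by split; split => //=; rewrite addr0.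
  by move=> y [[]].
have mxW : measurable ([set x + y | y in W] : set (borel K)).
  by rewrite translate_preimage; apply: open_measurable_borel; apply: open_translate.
rewrite -{2}(haar_translate x mW) -measureU //; last first.
  apply/seteqP; split => // y [[[_ Ay] _] [z [_ [Bz _]] xz]].
  have /eqP AB0 := AB; have : (A `&` B) y by split => //; rewrite -xz.
  by rewrite AB0.
apply: le_measure; rewrite ?inE; [exact: measurableU|exact: open_measurable_borel|].
by move=> y [[[]]//|[z [_ [_ Uz]] <-]].
Qed.

Lemma small_open (e : R) : 0 < e -> exists U : set K, [/\ open U, U 0 & (mu U < e%:E)%E].
Proof.
move=> e0; have [V [cV clV nV mV [m m0 mVE]]] := haar_nbhs0.
move: nV; rewrite nbhsE => -[U0 [oU0 U00] U0V].
have step n : exists U : set K, [/\ open U, U 0 & (mu U * (2 ^+ n)%:E <= m%:E)%E].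
  elim: n => [|n [U [oU U0' UE]]].
    exists U0; split => //; rewrite expr0 mule1 -mVE.
    by apply: le_measure => //; rewrite inE //; exact: open_measurable_borel.
  have [W [oW W0 WU Wh]] := halve_open oU U0'.
  exists W; split => //; apply: le_trans UE.
  rewrite exprS mulrDl mul1r EFinD.
  rewrite ge0_muleDr ?lee_fin ?exprn_ge0 // -ge0_muleDl //.
  apply: lee_wpmul2r => //.
have [n nE] : exists n, m / e < 2 ^+ n.
  exists (Num.truncn (m / e)).+1; apply: lt_le_trans (truncnS_gt _) _.
  by rewrite -natrX ler_nat ltnW // ltn_expl.
have [U [oU U0' UE]] := step n; exists U; split => //.
rewrite ltNge; apply/negP => eU.
have : (e%:E * (2 ^+ n)%:E <= m%:E)%E.
  by apply: le_trans UE; apply: lee_wpmul2r => //; rewrite lee_fin exprn_ge0.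
rewrite -EFinM lee_fin leNgt; move: nE; rewrite ltr_pdivrMr // mulrC.
by move=> ->.
Qed.

(** An element close to 0 maps a fixed compact neighbourhood into an open set of small
    measure, and its absolute value is the ratio of the measures. *)
Lemma absv_small (e : R) : 0 < e -> \forall b \near (0 : K), absv b < e.
Proof.
move=> e0; have [V [cV clV nV mV [m m0 mVE]]] := haar_nbhs0.
have [U [oU U0 UE]] := small_open (mulr_gt0 e0 m0).
have := @compact_mul_tube K 0 V U cV oU => tube.
have {}tube : \forall b \near (0 : K), forall c, V c -> U (b * c).
  by apply: tube => c _; rewrite mul0r.
apply: filterS tube => b WE.
have [->|b0] := eqVneq b 0; first by rewrite absv0.
rewrite -(ltr_pM2r m0) -lte_fin EFinM -mVE -haar_dilate //.
apply: le_lt_trans UE; apply: le_measure; rewrite ?inE.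
- rewrite dilate_preimage // -[X in measurable X]setCK; apply: measurableC.
  apply: open_measurable_borel; apply: (@open_dilate _ b^-1 (~` V)).
  exact: closed_openC.
- exact: open_measurable_borel.
- by move=> _ [c Vc <-]; apply: WE.
Qed.

Lemma absv_bound1 : exists2 M : R, 0 < M & \forall z \near (1 : K), absv z <= M.
Proof.
have [V [cV clV nV mV [m m0 mVE]]] := haar_nbhs0.
have := @mul_box K 1 0 V; rewrite mul1r => /(_ nV) [A [B [A1 oB B0 AB]]].
have mB := open_measurable_borel oB.
have Bpos : (0 < mu B)%E by apply: haar_open => //; exists 0.
have BV : B `<=` V by move=> x Bx; rewrite -[x]mul1r; apply: AB => //; exact: nbhs_singleton.
have [b bE] : exists b, mu B = b%:E.
  exists (fine (mu B)); rewrite fineK // ge0_fin_numE //.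
  apply: (@le_lt_trans _ _ (mu V)); last by rewrite mVE ltry.
  by apply: le_measure; rewrite ?inE.
move: Bpos; rewrite bE lte_fin => b0.
exists (m / b); first by rewrite divr_gt0.
apply: filterS A1 => z Az; have [->|z0] := eqVneq z 0.
  by rewrite absv0 ltW // divr_gt0.
rewrite ler_pdivlMr // -lee_fin EFinM -bE -haar_dilate // -mVE.
apply: le_measure; rewrite ?inE //.
  rewrite dilate_preimage //; apply: open_measurable_borel.
  exact: open_dilate.
by move=> _ [y By <-]; apply: AB.
Qed.

Lemma absv_bound_near (y : K) : exists2 M : R, 0 < M & \forall z \near y, absv z <= M.
Proof.
have [->|y0] := eqVneq y 0.
  by exists 1 => //; apply: filterS (absv_small ltr01) => z /ltW.
have [M M0 HM] := absv_bound1; exists (M * absv y).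
  by rewrite mulr_gt0 // absv_gt0.
have := @mull_continuous _ y^-1 y [set z | absv z <= M]; rewrite mulVf // => /(_ HM) nx.
change (nbhs y [set z | absv (y^-1 * z) <= M]) in nx.
apply: filterS nx => z /= zM; rewrite -[z](mulVKf y0) mulrC absvM.
by rewrite ler_wpM2r // absv_ge0.
Qed.

Lemma absv_bound_compact (C : set K) : compact C -> exists M : R, forall x, C x -> absv x <= M.
Proof.
move=> /compact_near_coveringP cC.
have [] := cC R (pinfty_nbhs R) (fun M x => absv x <= M).
  move=> x Cx; have [M M0 HM] := absv_bound_near x.
  exists ([set z | absv z <= M], [set N | M < N]); first by split => //=; exists M; split => //; exact: num_real.
  by move=> [z N] [/= zM MN]; apply: le_trans zM (ltW MN).
by move=> M [_ HM]; exists (M + 1) => x Cx; apply: HM => //; rewrite ltrDl.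
Qed.

Lemma absv_lbound_compact (C : set K) : compact C -> ~ C 0 ->
  exists2 m : R, 0 < m & forall x, C x -> m <= absv x.
Proof.
move=> /compact_near_coveringP cC C0.
have [] := cC R (pinfty_nbhs R) (fun M x => absv x^-1 <= M).
  move=> x Cx; have x0 : x != 0 by apply/eqP => x0; apply: C0; rewrite -x0.
  have [M M0 HM] := absv_bound_near x^-1.
  exists ([set z | absv z^-1 <= M], [set N | M < N]).
    split => /=; last by exists M; split => //; exact: num_real.
    exact: (@invf_continuous K x x0 _ HM).
  by move=> [z N] [/= zM MN]; apply: le_trans zM (ltW MN).
move=> M [_ HM]; pose M' := Num.max M 0 + 1.
have M'0 : 0 < M' by rewrite ltr_wpDl // le_max lexx orbT.
exists M'^-1; first by rewrite invr_gt0.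
move=> x Cx; have x0 : x != 0 by apply/eqP => x0; apply: C0; rewrite -x0.
have : absv x^-1 <= M'.
  by apply: HM => //; rewrite /M' (le_lt_trans (y := Num.max M 0)) ?ltrDl// le_max lexx.
by rewrite absvV invf_ple // ?posrE // ?absv_gt0.
Qed.

(** Choose [r] mapping [V] into its own interior. Its powers stay in [V], and their
    absolute values tend to 0; since absolute values are bounded below on compact sets
    avoiding 0, the powers tend to 0. *)
Lemma contracting_element (V : set K) : compact V -> closed V -> nbhs 0 V ->
  exists r : K, [/\ r != 0, absv r < 1, (forall x, V x -> V (r * x)) &
    forall U, nbhs 0 U -> exists n, U (r ^+ n)].
Proof.
move=> cV clV nV.
pose W := [set b : K | forall c, V c -> V° (b * c)].
have W0 : nbhs 0 W.
  apply: compact_mul_tube => //; first exact: open_interior.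
  by move=> c _; rewrite mul0r; exact: nV.
have [|r [[Wr Vr] r1] r0] := @nbhs0_nontrivial (W `&` V `&` [set x | absv x < 1]).
  by apply: filterI; [exact: filterI|exact: absv_small].
have rV x : V x -> V (r * x) by move=> Vx; apply: interior_subset; apply: Wr.
exists r; split => // U; rewrite nbhsE => -[U' [oU' U'0] U'U].
have rVn n : V (r ^+ n.+1) by elim: n => [|n IH]; rewrite ?expr1 // exprS; exact: rV.
have cVU : compact (V `\` U').
  by apply: (subclosed_compact _ cV) => //; apply: closedI => //; exact: open_closedC.
have [|m m0 HM] := absv_lbound_compact cVU; first by case.
have [n nm] : exists n, absv r ^+ n.+1 < m.
  have := @cvg_expr R (absv r); rewrite ger0_norm ?absv_ge0 // => /(_ r1).
  move=> /cvgrPdist_lt /(_ _ m0) [n _ Hn]; exists n.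
  have := Hn n.+1 (leqnSn n); rewrite /= sub0r normrN ger0_norm //.
  by rewrite exprn_ge0 ?absv_ge0.
exists n.+1; apply: contrapT => nU.
have := HM (r ^+ n.+1); rewrite absvX leNgt nm => H.
by have : false by apply: H; split => // /U'U.
Qed.

(** Some power of [r] brings [a] into [V]. Just before that, the point is in a compact
    set avoiding 0, where the absolute value is bounded below; when [absv a <= 1] this
    bounds the number of steps. *)
Lemma unit_ball_in_compact : exists2 C : set K, compact C & forall x, absv x <= 1 -> C x.
Proof.
have [V [cV clV nV]] := compact_nbhs0.
have [r [r0 r1 rV rU]] := contracting_element cV clV nV.
have rVn n x : V x -> V (r ^+ n * x).
  by elim: n => [|n IH] Vx; rewrite ?expr0 ?mul1r // exprS -mulrA; apply: rV; exact: IH.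
pose X := V `&` [set x | ~ V° (r^-1 * x)].
have cX : compact X.
  apply: (subclosed_compact _ cV); last by move=> x [].
  apply: closedI => //; apply: open_closedC; apply: open_dilate; exact: open_interior.
have [|m m0 HM] := absv_lbound_compact cX.
  by case=> _ /=; rewrite mulr0; apply; exact: nV.
have [N Nm] : exists N, forall n, (N <= n)%N -> absv r ^+ n < m.
  have := @cvg_expr R (absv r); rewrite ger0_norm ?absv_ge0 // => /(_ r1).
  move=> /cvgrPdist_lt /(_ _ m0) [N _ Hn]; exists N => n /Hn.
  by rewrite /= sub0r normrN ger0_norm // exprn_ge0 ?absv_ge0.
exists [set r^-1 ^+ N * x | x in V].
  by apply: continuous_compact => //; apply: continuous_subspaceT => x; exact: mull_continuous.
move=> a a1.
suff [n nN Vn] : exists2 n, (n <= N)%N & V (r ^+ n * a).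
  exists (r ^+ N * a); last by rewrite mulrA -exprMn mulVf // expr1n mul1r.
  by rewrite -(subnK nN) exprD -mulrA; exact: rVn.
have [n0 Vn0] : exists n, V (r ^+ n * a).
  have := @mull_continuous _ a 0 V; rewrite mulr0 => /(_ nV) nx.
  change (nbhs (0 : K) [set x | V (a * x)]) in nx.
  by have [n Hn] := rU _ nx; exists n; rewrite mulrC.
have exV : exists n, `[< V (r ^+ n * a) >] by exists n0; apply/asboolP.
case: (ex_minnP exV) => n /asboolP Vn nmin; exists n => //.
case: n Vn nmin => // n Vn nmin; rewrite ltnNge; apply/negP => Nn.
have /HM : X (r ^+ n.+1 * a).
  split => //= H; have : (n.+1 <= n)%N.
    apply: nmin; apply/asboolP; move: H; rewrite exprS -mulrA mulKf //.
    exact: interior_subset.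
  by rewrite ltnn.
rewrite absvM absvX leNgt => /negP; apply.
apply: (@le_lt_trans _ _ (absv r ^+ n.+1)).
  by rewrite ler_piMr // exprn_ge0 ?absv_ge0.
by apply: Nm; rewrite (leq_trans Nn) // leqnSn.
Qed.

Variable p : nat.
Hypothesis K_char : p \in [pchar K].

(** On the unit ball [absv (1 + x)] is bounded by a constant [A], hence [absv (x + y)]
    by [A] times the maximum. In characteristic [p] this inequality may be raised to the
    powers [p ^ k] of the Frobenius map without changing [A], which therefore
    disappears. *)
Lemma absv_ultra (x y : K) : absv (x + y) <= Num.max (absv x) (absv y).
Proof.
have [C cC CE] := unit_ball_in_compact.
have [A HA] : exists A, forall x, absv x <= 1 -> absv (1 + x) <= A.
  have cC1 : compact [set 1 + x | x in C].
    by apply: continuous_compact => //; apply: continuous_subspaceT => z; exact: addl_continuous.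
  have [A HA] := absv_bound_compact cC1.
  by exists A => z z1; apply: HA; exists z => //; exact: CE.
have A1 : 1 <= A by rewrite -{1}absv1 -(addr0 1); apply: HA; rewrite absv0.
have quasi a b : absv b <= absv a -> absv (a + b) <= A * absv a.
  have [->|a0] := eqVneq a 0.
    by rewrite absv0 add0r mulr0.
  move=> ba; have -> : a + b = (1 + b / a) * a by rewrite mulrDl mul1r divfK.
  rewrite absvM ler_wpM2r ?absv_ge0 //; apply: HA.
  by rewrite absvM absvV ler_pdivrMr ?absv_gt0 // mul1r.
have p1 := prime_gt1 (pcharf_prime K_char).
have frob k (a b : K) : (a + b) ^+ (p ^ k) = a ^+ (p ^ k) + b ^+ (p ^ k).
  rewrite exprDn_pchar // pnatX; apply/orP; left.
  by rewrite pnatE ?(pcharf_prime K_char) // (pcharf_eq K_char) inE.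
wlog xy : x y / absv y <= absv x.
  by move=> H; case/orP: (le_total (absv y) (absv x)) => /H //; rewrite addrC maxC.
rewrite max_l //; have [x0|x0] := eqVneq x 0.
  by rewrite x0 add0r -x0.
have ax := absv_gt0 x0.
rewrite leNgt; apply/negP; rewrite -{1}[absv x]mul1r -ltr_pdivlMr // => t1.
set t := absv (x + y) / absv x in t1.
have tA k : t ^+ (p ^ k) <= A.
  rewrite expr_div_n ler_pdivrMr ?exprn_gt0 // -!absvX frob; apply: quasi.
  by rewrite !absvX lerXn2r // nnegrE absv_ge0.
have [k kA] : exists k, A < 1 + (t - 1) *+ k.
  exists (Num.truncn (A / (t - 1))).+1.
  rewrite -ltrBlDl -mulr_natl -ltr_pdivrMr ?subr_gt0 //.
  apply: le_lt_trans (truncnS_gt _).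
  by rewrite ler_pdivrMr ?subr_gt0 // divfK ?lerBlDr ?ler_wpDr // gt_eqF // subr_gt0.
have := tA k; rewrite leNgt => /negP; apply; apply: (lt_le_trans kA).
have bern n : 1 + (t - 1) *+ n <= t ^+ n.
  elim: n => [|n IH]; first by rewrite mulr0n addr0 expr0.
  have t0 : 0 <= t by rewrite ltW // (lt_trans ltr01).
  apply: (@le_trans _ _ (t * (1 + (t - 1) *+ n))); last by rewrite exprS ler_wpM2l.
  have : 0 <= (t - 1) * ((t - 1) *+ n) by rewrite mulr_ge0 ?mulrn_wge0 // subr_ge0 ltW.
  by rewrite mulrSr; set u := _ *+ n => H; nra.
apply: le_trans (bern k) _; apply: ler_weXn2l; first exact: ltW.
by rewrite ltnW // ltn_expl.
Qed.

Lemma absvN (x : K) : absv (- x) = absv x.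
Proof.
suff : absv (-1 : K) = 1 by move=> H; rewrite -mulN1r absvM H mul1r.
have : absv (-1 : K) ^+ 2 = 1 ^+ 2 by rewrite -absvX sqrrN !expr1n absv1.
by move=> /eqP; rewrite eqrXn2 ?absv_ge0 // => /eqP.
Qed.

Lemma absv_ultra_lt (x y : K) e : absv x < e -> absv y < e -> absv (x + y) < e.
Proof. by move=> xe ye; apply: le_lt_trans (absv_ultra _ _) _; rewrite gt_max xe. Qed.

Lemma absv_ultra_le (x y : K) e : absv x <= e -> absv y <= e -> absv (x + y) <= e.
Proof. by move=> xe ye; apply: le_trans (absv_ultra _ _) _; rewrite ge_max xe. Qed.

Lemma absv_near (x y : K) : absv y < absv x -> absv (x + y) = absv x.
Proof.
move=> yx; apply/eqP; rewrite eq_le (absv_ultra_le (lexx _) (ltW yx)) /= leNgt.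
apply/negP => H.
have := @absv_ultra_lt (x + y) (- y) (absv x) H; rewrite absvN => /(_ yx).
by rewrite addrK ltxx.
Qed.

Lemma nbhs_absv_ball (x : K) e : 0 < e -> nbhs x [set y | absv (y - x) < e].
Proof.
move=> e0; have := @addl_continuous _ (- x) x [set z | absv z < e].
rewrite addNr => /(_ (absv_small e0)) nx.
change (nbhs x [set y | absv (- x + y) < e]) in nx.
by apply: filterS nx => y /=; rewrite addrC.
Qed.

Lemma open_cball_absv (a : K) e : 0 < e -> open [set y | absv (y - a) <= e].
Proof.
move=> e0; rewrite openE => x /= xa; apply: filterS (nbhs_absv_ball x e0) => y /= yx.
by rewrite -(subrK x y) -addrA; apply: absv_ultra_le => //; exact: ltW.
Qed.

Lemma int_ring_compact : compact (int_ring absv).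
Proof.
have [C cC CE] := unit_ball_in_compact.
apply: (subclosed_compact _ cC) => //.
rewrite -[int_ring _]setCK; apply: open_closedC; rewrite openE => x /= /negP.
rewrite -ltNge => x1; apply: filterS (nbhs_absv_ball x (lt_trans ltr01 x1)) => y /= yx.
rewrite /int_ring /=; apply/negP; rewrite -ltNge.
by rewrite -(subrK x y) addrC absv_near.
Qed.

Lemma nbhs0_absv (U : set K) : nbhs 0 U -> exists2 e : R, 0 < e & forall x, absv x < e -> U x.
Proof.
rewrite nbhsE => -[U' [oU' U'0] U'U].
have cVU : compact (int_ring absv `\` U').
  apply: (subclosed_compact _ int_ring_compact) => //.
  apply: closedI; last exact: open_closedC.
  by apply: compact_closed; [exact: topfield_hausdorff|exact: int_ring_compact].
have [|m m0 HM] := absv_lbound_compact cVU; first by case.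
exists (Num.min m 1); first by rewrite lt_min m0 ltr01.
move=> x; rewrite lt_min => /andP[xm x1]; apply: U'U; apply: contrapT => nU.
have := HM x; rewrite leNgt xm => H.
by have : false by apply: H; split => //; exact: ltW.
Qed.

Lemma nbhs_absv (a : K) (U : set K) : nbhs a U ->
  exists2 e : R, 0 < e & forall x, absv (x - a) < e -> U x.
Proof.
move=> /nbhs_translate /nbhs0_absv [e e0 H]; exists e => // x /H /=.
by rewrite addrC subrK.
Qed.

Variables (c : nat) (varpi : K) (eps : 'I_c -> K).
Hypothesis mu_norm : mu (int_ring absv) = 1%E.
Hypothesis varpiP : is_prime_element absv varpi.
Hypothesis residueP : residue_field_GF absv (p ^ c).

Lemma varpi_neq0 : varpi != 0.
Proof.
apply/eqP => v0; have [x x1 x0] := nbhs0_nontrivial (absv_small ltr01).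
have := (varpiP.2 x x1); rewrite v0 absv0 leNgt; by rewrite absv_gt0.
Qed.

Lemma absv_varpi_lt1 : absv varpi < 1. Proof. by case: varpiP. Qed.

Lemma absv_varpiX_le1 n : absv (varpi ^+ n) <= 1.
Proof. by rewrite absvX exprn_ile1 ?absv_ge0 // ltW // absv_varpi_lt1. Qed.

Lemma absv_lt1 (x : K) : absv x < 1 -> absv x <= absv varpi.
Proof. by case: varpiP => _; exact. Qed.

(** The closed disk of radius [absv t]: the absolute values of elements are the only
    radii that occur. *)
Definition disk (a t : K) : set K := [set x | absv (x - a) <= absv t].

Lemma open_disk a t : t != 0 -> open (disk a t).
Proof. by move=> t0; apply: open_cball_absv; exact: absv_gt0. Qed.

Lemma measurable_disk a t : t != 0 -> measurable (disk a t : set (borel K)).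
Proof. by move=> t0; apply: open_measurable_borel; exact: open_disk. Qed.

Lemma disk_image a t : t != 0 -> disk a t = [set a + x | x in [set t * y | y in int_ring absv]].
Proof.
move=> t0; apply/seteqP; split=> [x /= xa|x [y [z zD <-] <-]].
  exists (x - a); last by rewrite addrC subrK.
  exists (t^-1 * (x - a)); last by rewrite mulVKf.
  by rewrite /int_ring /= absvM absvV mulrC ler_pdivrMr ?absv_gt0 // mul1r.
by rewrite /disk /= addrC addKr absvM ler_piMr // absv_ge0.
Qed.

Lemma haar_disk a t : t != 0 -> mu (disk a t) = (absv t)%:E.
Proof.
move=> t0; have mD : measurable (int_ring absv : set (borel K)).
  have -> : int_ring absv = disk 0 1.
    by apply/seteqP; split=> x; rewrite /disk /int_ring /= subr0 absv1.
  by apply: measurable_disk; exact: oner_neq0.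
have mtD : measurable ([set t * x | x in int_ring absv] : set (borel K)).
  suff -> : [set t * x | x in int_ring absv] = disk 0 t by exact: measurable_disk.
  rewrite disk_image //; apply/seteqP; split=> [_ [y Dy <-]|_ [_ [y Dy <-] <-]].
    by exists (t * y); rewrite ?add0r //; exists y.
  by rewrite add0r; exists y.
by rewrite disk_image // haar_translate // haar_dilate // mu_norm mule1.
Qed.

Lemma max_idealE : max_ideal absv = disk 0 varpi.
Proof.
apply/seteqP; split=> x; rewrite /max_ideal /disk /= subr0; first exact: absv_lt1.
by move=> H; apply: le_lt_trans absv_varpi_lt1.
Qed.

Lemma residue_eq (F : finFieldType) (r : K -> F) :
  {in int_ring absv &, {morph r : x y / x + y}} ->
  (forall x, int_ring absv x -> (r x = 0 <-> max_ideal absv x)) ->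
  forall x y, int_ring absv x -> int_ring absv y -> (r x = r y <-> max_ideal absv (x - y)).
Proof.
move=> rD rker x y Dx Dy.
have Dxy : int_ring absv (x - y) by apply: absv_ultra_le => //; rewrite absvN.
rewrite -rker //; have : r (x - y + y) = r (x - y) + r y by rewrite rD // inE.
rewrite subrK => ->; split => [|->]; last by rewrite add0r.
by move=> E; apply: (addIr (r y)); rewrite E add0r.
Qed.

(** The unit ball, of measure 1, is the disjoint union of [p ^ c] cosets of the maximal
    ideal, each of measure [absv varpi]. *)
Lemma absv_varpi : absv varpi = (p ^ c)%:R^-1.
Proof.
have [F [r [Fq [r1 rD rM] rsurj rker]]] := residueP.
pose A (z : F) : set (borel K) := [set x | int_ring absv x /\ r x = z].
have rB x y := @residue_eq F r rD rker x y.
have AE z : exists x, A z = disk x varpi.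
  have [x Dx rx] := rsurj z; exists x; apply/seteqP; split => [y [Dy ry]|y].
    have /rB -/(_ Dy Dx) : r y = r x by rewrite ry.
    by rewrite max_idealE /disk /= subr0.
  rewrite /disk /= => yx; have Py : max_ideal absv (y - x) by rewrite max_idealE /disk /= subr0.
  have Dy : int_ring absv y.
    by rewrite -(subrK x y); apply: absv_ultra_le => //; exact: ltW.
  by split => //; rewrite -rx; apply/rB.
have mA z : measurable (A z).
  by have [x ->] := AE z; apply: measurable_disk; exact: varpi_neq0.
have DA : int_ring absv = \bigcup_(z in [set: F]) A z.
  by apply/seteqP; split=> [x Dx|x [z _ []//]]; exists (r x).
have := mu_norm; rewrite DA measure_fin_bigcup //; last 2 first.
- exact: finite_finset.
- by move=> z z' _ _ [x [[_ <-] [_ <-]]].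
have muA z : mu (A z) = (absv varpi)%:E.
  by have [x ->] := AE z; rewrite haar_disk // varpi_neq0.
rewrite (fsbigE (enum F)) ?enum_uniq //; last by move=> z _; rewrite mem_enum.
rewrite (eq_bigr (fun=> (absv varpi)%:E)) => [|z _]; last exact: muA.
rewrite (eq_bigl xpredT) => [|z]; last by rewrite in_setT.
rewrite sumEFin big_const_seq count_predT -cardT Fq iter_addr addr0 => -[].
have q0 : (p ^ c)%:R != 0 :> R by rewrite pnatr_eq0 -lt0n expn_gt0 prime_gt0 ?(pcharf_prime K_char).
by move=> H; apply: (mulIf q0); rewrite mulVf // mulr_natr.
Qed.

(** * Digits, the translation lattice and the basic character *)

Section Digits.
Hypothesis epsP : is_residue_basis absv p eps.
Let q := (p ^ c)%N.
Let S := prime_span eps.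

Lemma char_prime : prime p. Proof. exact: pcharf_prime K_char. Qed.

Lemma natr_modp (n : nat) : (n %% p)%:R = n%:R :> K.
Proof.
by rewrite {2}(divn_eq n p) natrD natrM (pcharf0 K_char) mulr0 add0r.
Qed.

Lemma digit_existence (a : nat -> nat) k : 
  exists2 n, (n < p ^ k)%N & forall i, (i < k)%N -> digit p i n = (a i %% p)%N.
Proof.
have p0 := prime_gt0 char_prime.
elim: k a => [|k IH] a; first by exists 0%N.
have [n nk Hn] := IH (fun i => a i.+1); exists (n * p + a 0%N %% p)%N.
  have := ltn_pmod (a 0%N) p0; rewrite expnSr.
  move: (a 0%N %% p)%N => d dp; apply: (@leq_trans (n.+1 * p)); last by rewrite leq_mul2r nk orbT.
  by rewrite mulSn addnC ltn_add2r.
have np : ((n * p + a 0%N %% p) %/ p)%N = n.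
  by rewrite divnMDl // divn_small ?addn0 // ltn_pmod.
case=> [_|i ik]; first by rewrite /digit expn0 divn1 modnMDl modn_mod.
by rewrite /digit expnS divnMA np -/(digit p i n) Hn.
Qed.

Definition res_digit (n : nat) : K := \sum_(k < c) (digit p k n)%:R * eps k.

Lemma prime_span_digit (x : K) : S x -> exists2 n, (n < q)%N & res_digit n = x.
Proof.
move=> [a ->]; have [n nq Hn] := @digit_existence (fun k => if insub k is Some i then a i else 0%N) c.
exists n => //; apply: eq_bigr => i _; rewrite Hn // natr_modp; congr (_%:R * _).
by rewrite valK.
Qed.

Lemma span_res_digit n : S (res_digit n).
Proof. by exists (fun k : 'I_c => digit p k n). Qed.

Lemma res_digit_inj n m : (n < q)%N -> (m < q)%N -> res_digit n = res_digit m -> n = m.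
Proof.
have [_ _ [F [iota [Fq ran]]]] := epsP.
have ex (i : 'I_q) : exists z : F, iota z == res_digit i.
  have : S (res_digit i) by exact: span_res_digit.
  by rewrite /S -ran => -[z _ zE]; exists z; apply/eqP.
pose f (i : 'I_q) := xchoose (ex i).
have fE i : iota (f i) = res_digit i by apply/eqP; exact: (xchooseP (ex i)).
have surj z : exists i, f i = z.
  have : S (iota z) by rewrite /S -ran; exists z.
  move=> /prime_span_digit [k kq kE]; exists (Ordinal kq).
  by apply: (fmorph_inj iota); rewrite fE.
have [g gE] := choice surj.
have ginj : injective g by exact: can_inj gE.
have bij : bijective g by apply: inj_card_bij => //; rewrite card_ord Fq.
have finj : injective f.
  by apply: (bij_inj (f := f)); apply: (bij_can_bij bij).
move=> nq mq nm; have : f (Ordinal nq) = f (Ordinal mq).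
  by apply: (fmorph_inj iota); rewrite !fE.
by move=> /finj [].
Qed.

Lemma prime_span_ring : [/\ S 0, S 1, (forall x y, S x -> S y -> S (x + y)),
  (forall x, S x -> S (- x)) & forall x y, S x -> S y -> S (x * y)].
Proof.
have [_ _ [F [iota [Fq ran]]]] := epsP; rewrite /S -ran; split.
- by exists 0 => //; rewrite rmorph0.
- by exists 1 => //; rewrite rmorph1.
- by move=> _ _ [x _ <-] [y _ <-]; exists (x + y) => //; rewrite rmorphD.
- by move=> _ [x _ <-]; exists (- x) => //; rewrite rmorphN.
- by move=> _ _ [x _ <-] [y _ <-]; exists (x * y) => //; rewrite rmorphM.
Qed.

(** A nonzero element of a finite field is a root of unity. *)
Lemma absv_span (x : K) : S x -> x != 0 -> absv x = 1.
Proof.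
have [_ _ [F [iota [Fq ran]]]] := epsP; rewrite /S -ran => -[z _ <-] z0.
have z1 : z != 0 by apply: contraNneq z0 => ->; rewrite rmorph0.
have F1 := card_finNzRing_gt1 F.
have : absv (iota z) ^+ #|F|.-1 = 1.
  apply: (mulfI (x := absv (iota z))); first by rewrite gt_eqF ?absv_gt0.
  by rewrite -exprS (prednK (ltnW F1)) -absvX -rmorphXn expf_card mulr1.
have F0 : (0 < #|F|.-1)%N by rewrite -ltnS prednK // ltnW.
by move=> /eqP; rewrite pexpr_eq1 ?absv_ge0 // => /eqP.
Qed.

Lemma absv_span_le (x : K) : S x -> absv x <= 1.
Proof.
by have [->|x0] := eqVneq x 0; [rewrite absv0|move=> /absv_span ->].
Qed.

(** The finite field spanned by the [eps i] embeds into the residue field, and exhausts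
    it by cardinality. *)
Lemma span_residue (x : K) : absv x <= 1 -> exists2 s, S s & absv (x - s) < 1.
Proof.
move=> Dx; have [F [r [Fq [r1 rD rM] rsurj rker]]] := residueP.
have [_ _ [F' [iota [Fq' ran]]]] := epsP.
have [_ _ SD SN _] := prime_span_ring.
have Si z : S (iota z) by rewrite /S -ran; exists z.
have DS s : S s -> int_ring absv s by exact: absv_span_le.
have rB a b := @residue_eq F r rD rker a b.
have inj : injective (r \o iota).
  move=> z z' /= /rB - /(_ (DS _ (Si _)) (DS _ (Si _))).
  rewrite -rmorphB /max_ideal /= => H; apply/eqP; rewrite -subr_eq0; apply/negPn/negP => zz'.
  have := absv_span (Si (z - z')); rewrite fmorph_eq0 zz' => /(_ isT) E.
  by rewrite E ltxx in H.
have [g gK Kg] : bijective (r \o iota) by apply: inj_card_bij => //; rewrite Fq Fq'.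
exists (iota (g (r x))) => //.
by apply/rB => //; [exact: DS|rewrite -[LHS]Kg].
Qed.

Definition uu := trans varpi p eps.

Lemma res_digit0 : res_digit 0 = 0.
Proof. by rewrite /res_digit big1 // => i _; rewrite /digit div0n mod0n mul0r. Qed.

Lemma q_gt1 : (0 < c)%N -> (1 < q)%N.
Proof. by move=> c0; rewrite -(exp1n c) ltn_exp2r // prime_gt1 // char_prime. Qed.

Hypothesis c_gt0 : (0 < c)%N.

Lemma uuE n N : (n < N)%N ->
  uu n = \sum_(k < N) res_digit (digit q k n) * varpi ^- k.+1.
Proof.
have E k : trans0 varpi p eps (digit (p ^ c) k n) * varpi ^- k = 
           res_digit (digit q k n) * varpi ^- k.+1.
  by rewrite /trans0 -/(res_digit _) -mulrA exprS invfM.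
move=> nN; rewrite /uu /trans (eq_bigr (fun k : 'I_n.+1 => res_digit (digit q k n) * varpi ^- k.+1)) => [|i _]; last exact: E.
rewrite -(subnKC nN) big_split_ord /= [X in _ + X]big1 ?addr0 //.
move=> i _; rewrite /digit divn_small ?mod0n ?res_digit0 ?mul0r //.
apply: (leq_trans (ltn_expl n (q_gt1 c_gt0))); rewrite leq_pexp2l ?(ltnW (q_gt1 _)) //.
by rewrite (leq_trans (leqnSn n)) // leq_addr.
Qed.

Lemma uu0 : uu 0 = 0.
Proof. by rewrite (@uuE 0 1) // big_ord1 /digit div0n mod0n res_digit0 mul0r. Qed.

(** The lowest digit of [n] carries the term in [varpi^-1]; this recursion drives the
    inductions on digits. *)
Lemma uu_rec n : uu n = varpi^-1 * (res_digit (n %% q) + uu (n %/ q)).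
Proof.
rewrite (@uuE n n.+2) // (@uuE (n %/ q) n.+1) ?ltnS ?leq_div // big_ord_recl mulrDr.
rewrite /digit expn0 divn1 mulrC; congr (_ + _); rewrite mulr_sumr; apply: eq_bigr => i _.
by rewrite lift0 expnS divnMA [varpi ^+ i.+2]exprS invfM mulrCA.
Qed.

Lemma uu_cons b m : (b < q)%N -> uu (q * m + b) = varpi^-1 * (res_digit b + uu m).
Proof.
move=> bq; rewrite uu_rec mulnC modnMDl modn_small // divnMDl ?(leq_trans _ bq) //.
by rewrite divn_small // addn0.
Qed.

Definition Lam : set K := range uu.

Lemma Lam_ind (P : K -> Prop) : P 0 ->
  (forall s y, S s -> Lam y -> P y -> P (varpi^-1 * (s + y))) -> forall x, Lam x -> P x.
Proof.
move=> P0 PS _ [n _ <-]; elim/ltn_ind: n => n IH.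
have [->|n0] := posnP n; first by rewrite uu0.
rewrite uu_rec; apply: PS; [exact: span_res_digit|by exists (n %/ q)%N|].
by apply: IH; rewrite ltn_Pdiv // q_gt1.
Qed.

Lemma Lam0 : Lam 0. Proof. by exists 0%N; rewrite // uu0. Qed.

Lemma Lam_cons s y : S s -> Lam y -> Lam (varpi^-1 * (s + y)).
Proof.
by move=> /prime_span_digit [b bq <-] [m _ <-]; exists (q * m + b)%N => //; rewrite uu_cons.
Qed.

Lemma LamD x y : Lam x -> Lam y -> Lam (x + y).
Proof.
have [S0 S1 SD SN SM] := prime_span_ring.
move=> Lx; elim/Lam_ind: x / Lx y => [y|s x Ss Lx IH y]; first by rewrite add0r.
move=> Ly; elim/Lam_ind: y / Ly => [|t y St Ly _]; first by rewrite addr0; exact: Lam_cons.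
by rewrite -mulrDr addrACA; apply: Lam_cons; [exact: SD|exact: IH].
Qed.

Lemma LamN x : Lam x -> Lam (- x).
Proof.
have [S0 S1 SD SN SM] := prime_span_ring.
move=> Lx; elim/Lam_ind: x / Lx => [|s x Ss Lx IH]; first by rewrite oppr0; exact: Lam0.
by rewrite -mulrN opprD; apply: Lam_cons => //; exact: SN.
Qed.

Lemma Lam_varpi x : Lam x -> Lam (varpi^-1 * x).
Proof.
have [S0 S1 SD SN SM] := prime_span_ring.
by move=> Lx; rewrite -[x]add0r; exact: Lam_cons.
Qed.

Lemma absv_varpiV_gt1 : 1 < absv varpi^-1.
Proof. by rewrite absvV invf_gt1 ?absv_varpi_lt1 // absv_gt0 // varpi_neq0. Qed.

Lemma Lam_int x : Lam x -> x != 0 -> 1 < absv x.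
Proof.
move=> Lx; elim/Lam_ind: x / Lx => [|s x Ss Lx IH]; first by rewrite eqxx.
rewrite mulf_eq0 negb_or => /andP[_].
have [->|x0] := eqVneq x 0.
  by rewrite addr0 => s0; rewrite absvM (absv_span Ss s0) mulr1 absv_varpiV_gt1.
move=> _; rewrite absvM addrC absv_near.
  by rewrite mulr_egt1 ?ltW //; [exact: absv_varpiV_gt1|exact: IH].
by apply: le_lt_trans (IH x0); exact: absv_span_le.
Qed.

Lemma uu_inj : injective uu.
Proof.
move=> n m; have [N] := ubnP (n + m); elim: N n m => // N IH n m nmN E.
have [|nm0] := posnP (n + m)%N; first by case: n m {nmN E} => [|n] [|m].
have LB : Lam (uu (n %/ q) - uu (m %/ q)).
  by apply: LamD; [exists (n %/ q)%N|apply: LamN; exists (m %/ q)%N].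
have [S0 S1 SD SN SM] := prime_span_ring.
have E1 : res_digit (n %% q) + uu (n %/ q) = res_digit (m %% q) + uu (m %/ q).
  apply: (mulfI (x := varpi^-1)); first by rewrite invr_eq0 varpi_neq0.
  by rewrite -!uu_rec.
have E2 : uu (n %/ q) - uu (m %/ q) = res_digit (m %% q) - res_digit (n %% q).
  have -> : uu (n %/ q) = res_digit (m %% q) + uu (m %/ q) - res_digit (n %% q).
    by rewrite -E1; ring.
  by ring.
have E3 : uu (n %/ q) - uu (m %/ q) = 0.
  apply/eqP/negPn/negP => /(Lam_int LB); rewrite E2 ltNge => /negP; apply.
  by apply: absv_span_le; apply: SD; [|apply: SN]; exact: span_res_digit.
have q0 : (0 < q)%N by rewrite ltnW // q_gt1.
rewrite (divn_eq n q) (divn_eq m q); congr (_ * _ + _)%N.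
  apply: IH; last by apply/eqP; rewrite -subr_eq0 E3.
  rewrite -ltnS; apply: leq_trans nmN; rewrite ltnS.
  have [n0|n0] := posnP n; have [m0|m0] := posnP m.
  - by rewrite n0 m0 in nm0.
  - by rewrite n0 div0n !add0n ltn_Pdiv // q_gt1.
  - by rewrite m0 div0n !addn0 ltn_Pdiv // q_gt1.
  - by rewrite -addSn leq_add // ?ltn_Pdiv ?q_gt1 // leq_div.
apply: res_digit_inj; rewrite ?ltn_mod //.
by apply/eqP; rewrite eq_sym -subr_eq0 -E2 E3.
Qed.

Lemma Lam_cover N x : absv x <= absv (varpi ^- N) ->
  exists2 n, (n < q ^ N)%N & absv (x - uu n) <= 1.
Proof.
elim: N x => [|N IH] x xN.
  by exists 0%N => //; rewrite uu0 subr0; rewrite expr0 invr1 absv1 in xN.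
have [|m mN Hm] := IH (varpi * x).
  move: xN; rewrite absvM exprS invfM absvM [absv varpi^-1]absvV.
  by rewrite ler_pdivlMl ?absv_gt0 ?varpi_neq0.
have [s Ss sE] := span_residue Hm.
have [b bq bs] := prime_span_digit Ss.
exists (q * m + b)%N.
  rewrite expnS; apply: (@leq_trans (q * m.+1)); first by rewrite mulnS addnC ltn_add2r.
  by rewrite leq_mul2l mN orbT.
rewrite uu_cons // bs -[x](mulKf varpi_neq0) -mulrBr absvM absvV mulrC.
rewrite ler_pdivrMr ?absv_gt0 ?varpi_neq0 // mul1r; apply: absv_lt1.
by rewrite opprD addrA addrAC.
Qed.

Lemma absv_uu n N : (n < q ^ N)%N -> absv (uu n) <= absv (varpi ^- N).
Proof.
elim: N n => [|N IH] n.
  by rewrite expn0 ltnS leqn0 => /eqP ->; rewrite uu0 absv0 absv_ge0.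
rewrite expnS => nq; rewrite uu_rec exprS invfM !absvM ler_wpM2l ?absv_ge0 //.
apply: absv_ultra_le.
  apply: (@le_trans _ _ 1); first by apply: absv_span_le; exact: span_res_digit.
  rewrite absvV absvX invf_ge1 ?exprn_gt0 ?absv_gt0 ?varpi_neq0 //.
  by rewrite exprn_ile1 ?absv_ge0 // ltW // absv_varpi_lt1.
by apply: IH; rewrite ltn_divLR ?(ltnW (q_gt1 _)) // mulnC.
Qed.

Lemma Lam_int0 x : Lam x -> absv x <= 1 -> x = 0.
Proof.
by move=> Lx x1; apply/eqP/negPn/negP => /(Lam_int Lx); rewrite ltNge x1.
Qed.

Lemma uu_lt n N : absv (uu n) <= absv (varpi ^- N) -> (n < q ^ N)%N.
Proof.
move=> /Lam_cover [m mN H]; suff -> : n = m by [].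
apply: uu_inj; apply/eqP; rewrite -subr_eq0; apply/eqP; apply: Lam_int0 => //.
by apply: LamD; [exists n|apply: LamN; exists m].
Qed.

Variable chi : K -> R[i].
Hypothesis chiP : is_basic_character varpi p eps chi.

Lemma chiD x y : chi (x + y) = chi x * chi y. Proof. by case: chiP. Qed.

Lemma chi_norm x : `|chi x| = 1. Proof. by case: chiP. Qed.

Lemma chi_neq0 x : chi x != 0. Proof. by rewrite -normr_gt0 chi_norm ltr01. Qed.

Lemma chi0 : chi 0 = 1.
Proof.
by apply: (mulfI (chi_neq0 0)); rewrite -chiD addr0 mulr1.
Qed.

Lemma chi_basis i (j : int) : chi (eps i * varpi ^ (- j)) =
  if (val i == 0%N) && (j == 1)
  then Complex (cos (2 * pi / p%:R)) (sin (2 * pi / p%:R)) else 1.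
Proof. by case: chiP. Qed.

Lemma chiMn x n : chi (x *+ n) = chi x ^+ n.
Proof. by elim: n => [|n IH]; rewrite ?mulr0n ?chi0 // mulrS chiD IH exprS. Qed.

Lemma chi_sum (I : Type) (r : seq I) (f : I -> K) :
  chi (\sum_(i <- r) f i) = \prod_(i <- r) chi (f i).
Proof. by elim/big_rec2: _ => [|i y x _ <-]; rewrite ?chi0 // chiD. Qed.

Lemma chi_span s (j : int) : S s -> j != 1 -> chi (s * varpi ^ (- j)) = 1.
Proof.
move=> [a ->] j1; rewrite mulr_suml chi_sum big1 // => i _.
by rewrite -mulrA mulr_natl chiMn chi_basis (negPf j1) andbF expr1n.
Qed.

Lemma chi_varpiV : chi varpi^-1 != 1.
Proof.
have [e0 _ _] := epsP; pose i0 := Ordinal c_gt0.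
have := chi_basis i0 1; rewrite e0 // mul1r exprN1 => ->.
rewrite eqxx /=; apply/negP => /eqP [] /eqP + _; apply/negP.
rewrite neq_lt; apply/orP; left.
have p1 := prime_gt1 char_prime.
have p0 : 0 < p%:R :> R by rewrite ltr0n ltnW.
suff : cos (2 * pi / p%:R) < cos (0 : R) by rewrite cos0.
rewrite ltr_cos ?in_itv /= ?lexx ?pi_ge0 //; first by rewrite divr_gt0 // mulr_gt0 ?pi_gt0.
apply/andP; split; first by rewrite divr_ge0 ?mulr_ge0 ?pi_ge0 ?ltW.
rewrite ler_pdivrMr // mulrC ler_wpM2l ?pi_ge0 //.
by rewrite ler_nat.
Qed.

(** For a nontrivial p-th root of unity the sum of the powers of [z] vanishes, so these
    powers cannot all be close to 1. *)
Lemma root_of_unity_far (z : R[i]) : z ^+ p = 1 -> `|z| = 1 -> `|1 - z| < p%:R^-1 -> z = 1.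
Proof.
move=> zp z1 zs; apply/eqP/negPn/negP => zn1.
have p0 := prime_gt0 char_prime.
have zk k : `|1 - z ^+ k| <= `|1 - z| *+ k.
  elim: k => [|k IH]; first by rewrite expr0 subrr normr0 mulr0n.
  have -> : 1 - z ^+ k.+1 = (1 - z) + z * (1 - z ^+ k) by rewrite exprS; ring.
  apply: le_trans (ler_normD _ _) _; rewrite normrM z1 mul1r mulrS lerD2l //.
have S0 : \sum_(i < p) z ^+ i = 0.
  have := subrX1 z p; rewrite zp subrr => /esym/eqP; rewrite mulf_eq0 subr_eq0.
  by rewrite (negPf zn1) => /eqP.
have : `|\sum_(i < p) (1 - z ^+ i)| <= \sum_(i < p) `|1 - z| *+ p.
  apply: le_trans (ler_norm_sum _ _ _) _; apply: ler_sum => i _.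
  by apply: le_trans (zk i) _; rewrite -(mulr_natr _ i) -(mulr_natr _ p) ler_wpM2l // ler_nat ltnW.
rewrite sumrB S0 subr0 !sumr_const !card_ord normrMn normr1.
move=> H; have : `|1 - z| *+ p *+ p < p%:R.
  by rewrite ltr_pMn2r // -mulr_natr -ltr_pdivlMr ?ltr0n // mul1r.
by move=> /lt_geF; rewrite H.
Qed.

(** Since [p] annihilates the additive group, the values of [chi] are p-th roots of
    unity, and they are close to 1 near 0. *)
Lemma chi_locally_trivial : \forall x \near (0 : K), chi x = 1.
Proof.
have p0 := prime_gt0 char_prime.
have [cc _ _ _] := chiP.
have n1 : nbhs (chi 0 : R[i]^o) [set z | `|1 - z| < p%:R^-1].
  rewrite chi0; apply: (@nbhsx_ballx _ (R[i]^o) 1 p%:R^-1).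
  by rewrite invr_gt0 ltr0n.
have := cc 0 _ n1 => nx; change (nbhs (0 : K) [set x | `|1 - chi x| < p%:R^-1]) in nx.
apply: filterS nx => x /= xs; apply: root_of_unity_far => //; last exact: chi_norm.
by rewrite -chiMn -mulr_natr (pcharf0 K_char) mulr0 chi0.
Qed.

(** The digits of an integral element contribute trivially to [chi] one after the other,
    and the remainder ends up where [chi] is known to be 1. *)
Lemma chi_int x : absv x <= 1 -> chi x = 1.
Proof.
move=> x1.
have step N y : absv y <= 1 -> forall m, exists2 z, absv z <= 1 & chi (varpi ^+ m * y) = chi (varpi ^+ (m + N) * z).
  elim: N y => [|N IH] y y1 m; first by exists y; rewrite ?addn0.
  have [s Ss ys] := span_residue y1.
  have [|z z1 zE] := IH (varpi^-1 * (y - s)) _ m.+1.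
    by rewrite absvM absvV mulrC ler_pdivrMr ?absv_gt0 ?varpi_neq0 // mul1r absv_lt1.
  exists z => //; rewrite addnS -addSn -zE exprSr -mulrA mulVKf ?varpi_neq0 //.
  rewrite mulrBr -[X in chi X = _](subrK (varpi ^+ m * s)) chiD.
  have := @chi_span s (- m%:Z) Ss; rewrite opprK -exprnP mulrC => -> //; last by case: (m).
  by rewrite mulr1.
have [e e0 He] := nbhs0_absv chi_locally_trivial.
have [N HN] : exists N, absv varpi ^+ N < e.
  have := @cvg_expr R (absv varpi); rewrite ger0_norm ?absv_ge0 // => /(_ absv_varpi_lt1).
  move=> /cvgrPdist_lt /(_ _ e0) [N _ Hn]; exists N.
  have := Hn N (leqnn N); rewrite /= sub0r normrN ger0_norm //.
  by rewrite exprn_ge0 ?absv_ge0.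
have [z z1] := step N x x1 0%N; rewrite expr0 mul1r add0n => ->.
apply: He; rewrite absvM absvX; apply: le_lt_trans HN.
by rewrite ler_piMr // exprn_ge0 ?absv_ge0.
Qed.

Lemma chi_Lam_span l s (j : nat) : Lam l -> S s -> chi (l * s * varpi ^- j.+1) = 1.
Proof.
have [S0 S1 SD SN SM] := prime_span_ring.
move=> Ll; elim/Lam_ind: l / Ll s j => [|t l St Ll IH] s j Ss.
  by rewrite !mul0r chi0.
have -> : varpi^-1 * (t + l) * s * varpi ^- j.+1 = t * s * varpi ^- j.+2 + l * s * varpi ^- j.+2.
  by rewrite (exprS _ j.+1) invfM; ring.
rewrite chiD IH // mulr1.
have := @chi_span (t * s) j.+2%:Z; rewrite -exprnN -[X in varpi ^- X]/(j.+2); apply => //.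
exact: SM.
Qed.

(** A product of two elements of the lattice only has digits of rank at least 2 in
    [varpi^-1], on which [chi] is trivial. The lattice is therefore contained in its
    dual. *)
Lemma chi_LamM l l' : Lam l -> Lam l' -> chi (l * l') = 1.
Proof.
have [S0 S1 SD SN SM] := prime_span_ring.
move=> Ll Ll'; suff H j : chi (l * l' * varpi ^- j) = 1.
  by have := H 0%N; rewrite expr0 invr1 mulr1.
elim/Lam_ind: l / Ll j => [|t l St Ll IH] j; first by rewrite !mul0r chi0.
have -> : varpi^-1 * (t + l) * l' * varpi ^- j = l' * t * varpi ^- j.+1 + l * l' * varpi ^- j.+1.
  by rewrite (exprS _ j) invfM; ring.
by rewrite chiD IH mulr1 chi_Lam_span.
Qed.

Lemma chi_nontrivial t : 1 < absv t -> exists2 x, absv x <= 1 & chi (t * x) != 1.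
Proof.
move=> t1; have t0 : t != 0 by apply: contraTneq t1 => ->; rewrite absv0 ltr10.
exists (t^-1 * varpi^-1); last by rewrite mulVKf // chi_varpiV.
rewrite absvM absvV mulrC absvV -invfM invf_le1 ?mulr_gt0 ?absv_gt0 ?varpi_neq0 //.
have : absv t^-1 <= absv varpi by apply: absv_lt1; rewrite absvV invf_lt1 // absv_gt0.
rewrite absvV => H; rewrite -(mulVf (x := absv t)) ?gt_eqF ?absv_gt0 //.
by rewrite ler_wpM2r // absv_ge0.
Qed.

(** * Integration on the local field *)

Notation Re := complex.Re.
Notation Im := complex.Im.

Lemma affine_continuous (a b : K) : continuous (fun x : K => a * x + b).
Proof.
move=> x; have -> : (fun x : K => a * x + b) = (fun y => b + y) \o (fun x => a * x).
  by apply/funext => y /=; rewrite addrC.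
by apply: continuous_comp; [exact: mull_continuous|exact: addl_continuous].
Qed.

Lemma continuous_measurable_borel (f : K -> K) : continuous f ->
  measurable_fun [set: borel K] (f : borel K -> borel K).
Proof.
move=> cf; apply: (@measurability _ _ (borel K) (borel K) setT (f : borel K -> borel K) (@open (pointed_of K)) erefl).
move=> _ [B oB <-]; rewrite setTI; apply: open_measurable_borel.
by apply: open_comp => // x _; exact: cf.
Qed.

Lemma measurable_affine (a b : K) :
  measurable_fun [set: borel K] ((fun x : K => a * x + b) : borel K -> borel K).
Proof. by apply: continuous_measurable_borel; exact: affine_continuous. Qed.

Lemma measurable_translate (b : K) (A : set (borel K)) : measurable A ->
  measurable ([set x | A (x + b)] : set (borel K)).
Proof.
move=> mA; have := @measurable_affine 1 b measurableT A mA.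
by rewrite setTI; congr measurable; apply/funext => x; rewrite /preimage /= mul1r.
Qed.

Lemma haar_affine_preimage (a b : K) (A : set (borel K)) : a != 0 -> measurable A ->
  mu ((fun x : K => a * x + b) @^-1` A) = ((absv a)^-1%:E * mu A)%E.
Proof.
move=> a0 mA; have mA' : measurable ([set - b + x | x in A] : set (borel K)).
  rewrite translate_preimage opprK; have := @measurable_affine 1 b measurableT A mA.
  by rewrite setTI; congr measurable; apply/funext => x; rewrite /preimage /= mul1r addrC.
have -> : (fun x : K => a * x + b) @^-1` A = [set a^-1 * x | x in [set - b + x | x in A]].
  rewrite dilate_preimage ?invr_eq0 // invrK translate_preimage opprK.
  by apply/seteqP; split => x; rewrite /= addrC.
by rewrite haar_dilate ?invr_eq0 // haar_translate // absvV.
Qed.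

(** Change of variables: an affine map multiplies the Haar measure by a constant. *)
Lemma ge0_integral_affine (a b : K) (f : borel K -> \bar R) : a != 0 ->
  measurable_fun [set: borel K] f -> (forall x, 0 <= f x)%E ->
  (\int[mu]_x f (a * x + b)%R = (absv a)^-1%:E * \int[mu]_x f x)%E.
Proof.
move=> a0 mf f0; have r0 : 0 <= (absv a)^-1 by rewrite invr_ge0 absv_ge0.
pose phi : borel K -> borel K := fun x : K => a * x + b.
have mphi : measurable_fun [set: borel K] phi by exact: measurable_affine.
rewrite -(ge0_integral_mscale mu measurableT (NngNum r0) mf) //.
rewrite -[LHS](@ge0_integral_pushforward _ _ _ _ _ phi mphi mu setT f) //.
apply: eq_measure_integral => A mA _; last first.
exact: haar_affine_preimage.
Qed.

Lemma integral_affine (a b : K) (f : borel K -> \bar R) : a != 0 ->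
  mu.-integrable [set: borel K] f ->
  (\int[mu]_x f (a * x + b)%R = (absv a)^-1%:E * \int[mu]_x f x)%E.
Proof.
move=> a0 fi; have mf := measurable_int mu fi.
rewrite integralE [in RHS]integralE muleBr //; last first.
  by apply: fin_num_adde_defr; exact: integrable_pos_fin_num.
rewrite -(@ge0_integral_affine a b (f^\+)%E) //; last exact: measurable_funepos.
rewrite -(@ge0_integral_affine a b (f^\-)%E); [|by []|exact: measurable_funeneg|by []].
by congr (_ - _)%E; apply: eq_integral => x _; rewrite ?funeposE ?funenegE.
Qed.

Lemma integrable_affine (a b : K) (f : borel K -> \bar R) : a != 0 ->
  mu.-integrable [set: borel K] f ->
  mu.-integrable [set: borel K] (fun x => f (a * x + b)%R).
Proof.
move=> a0 /integrableP[mf fi]; apply/integrableP; split.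
  exact: (measurableT_comp mf (measurable_affine a b)).
rewrite (@ge0_integral_affine a b (fun y => `|f y|)%E) //; last exact: measurableT_comp.
by rewrite lte_mul_pinfty // lee_fin invr_ge0 absv_ge0.
Qed.

Lemma cmeas_affine (a b : K) (f : K -> R[i]) :
  cmeas (f : borel K -> _) -> cmeas ((fun x => f (a * x + b)) : borel K -> _).
Proof.
move=> [fr fi]; split.
  exact: (measurableT_comp fr (measurable_affine a b)).
exact: (measurableT_comp fi (measurable_affine a b)).
Qed.

Lemma cintegrable_affine (a b : K) (f : K -> R[i]) : a != 0 ->
  cintegrable mu f -> cintegrable mu (fun x => f (a * x + b)).
Proof.
by move=> a0 [fr fi]; split;
   [exact: (@integrable_affine a b _ a0 fr)|exact: (@integrable_affine a b _ a0 fi)].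
Qed.

Lemma cInt_affine (a b : K) (f : K -> R[i]) : a != 0 -> cintegrable mu f ->
  cInt mu (fun x => f (a * x + b)) = (absv a)^-1%:C * cInt mu f.
Proof.
move=> a0 [fr fi]; apply/eqP; rewrite eq_complex /= !mul0r subr0 addr0.
rewrite /Rintegral.
have -> := @integral_affine a b _ a0 fr; have -> := @integral_affine a b _ a0 fi.
by rewrite !fineM ?integrable_fin_num // !eqxx.
Qed.

Lemma sqnorm_affine (a b : K) (f : K -> R[i]) : a != 0 -> cmeas (f : borel K -> _) ->
  sqnorm mu (fun x => f (a * x + b)) = ((absv a)^-1%:E * sqnorm mu f)%E.
Proof.
move=> a0 mf; apply: (@ge0_integral_affine a b (fun y => (abs2 (f y))%:E)) => //.
  exact: emeasurable_abs2.
by move=> x; rewrite lee_fin abs2_ge0.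
Qed.

Lemma sqint_affine (a b : K) (f : K -> R[i]) : a != 0 -> sqint mu f -> sqint mu (fun x => f (a * x + b)).
Proof.
move=> a0 [mf fi]; split; first exact: cmeas_affine.
by rewrite sqnorm_affine // lte_mul_pinfty // ?sqnorm_ge0 // lee_fin invr_ge0 absv_ge0.
Qed.

(** ** Modulated indicators of disks *)

Lemma conj_opE (z : R[i]) : (z^*)%R = (z^*)%C.
Proof. by []. Qed.

Lemma conjcM (z w : R[i]) : (z * w)^* = z^* * w^*.
Proof. by rewrite -!conj_opE -rmorphM. Qed.

Lemma chi_abs2 x : abs2 (chi x) = 1.
Proof.
have := chi_norm x; rewrite normc_def => -[] E.
by rewrite -[LHS]sqr_sqrtr ?abs2_ge0 // E expr1n.
Qed.

Lemma chiN x : chi (- x) = (chi x)^*.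
Proof.
apply: (mulfI (chi_neq0 x)); rewrite -chiD subrr chi0 mulJ_abs2 chi_abs2 //.
Qed.

Lemma chi_loc x y : absv (x - y) <= 1 -> chi x = chi y.
Proof. by move=> /chi_int E; rewrite -(subrK y x) chiD E mul1r. Qed.

Lemma cmeas_locally_constant (f : K -> R[i]) (t : K) : t != 0 ->
  (forall x y, absv (x - y) <= absv t -> f x = f y) -> cmeas (f : borel K -> _).
Proof.
move=> t0 ft.
have H (g : R[i] -> R) : measurable_fun [set: borel K] ((fun x => g (f x)) : borel K -> R).
  move=> _ Y _; rewrite setTI; apply: open_measurable_borel; rewrite openE => x /= Yx.
  have nt : nbhs x (disk x t) by apply: open_nbhs_nbhs; split; [exact: open_disk|rewrite /disk /= subrr absv0 absv_ge0].
  by apply: filterS nt => y /= /ft E; rewrite /preimage /= E.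
by split; exact: H.
Qed.

Lemma cmeas_chi (b : K) : cmeas ((fun x => chi (b * x)) : borel K -> _).
Proof.
have [->|b0] := eqVneq b 0.
  rewrite (_ : (fun x => _) = fun=> 1); first exact: cmeas_cst.
  by apply/funext => x; rewrite mul0r chi0.
apply: (@cmeas_locally_constant _ b^-1); first by rewrite invr_eq0.
move=> x y xy; apply: chi_loc; rewrite -mulrBr absvM mulrC -ler_pdivlMr ?absv_gt0 //.
by rewrite mul1r -absvV.
Qed.

Definition ind (a s : K) : K -> R[i] := fun x => (\1_(disk a s) x)%:C.
(** The indicator of a disk times a character. Up to scalars this family is stable under
    the Fourier transform, and it spans a dense subspace. *)
Definition mdisk (a s b : K) : K -> R[i] := fun x => chi (b * x) * ind a s x.

Lemma disk_center a s : disk a s a.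
Proof. by rewrite /disk /= subrr absv0 absv_ge0. Qed.

Lemma indE a s x : ind a s x = if absv (x - a) <= absv s then 1 else 0.
Proof.
rewrite /ind indicE; case: ifPn => H; first by rewrite mem_set.
by rewrite memNset //; exact/negP.
Qed.

Lemma cmeas_ind a s : s != 0 -> cmeas (ind a s : borel K -> _).
Proof. by move=> s0; apply: cmeas_indic; exact: measurable_disk. Qed.

Lemma cmeas_mdisk a s b : s != 0 -> cmeas (mdisk a s b : borel K -> _).
Proof. by move=> s0; apply: cmeasM; [exact: cmeas_chi|exact: cmeas_ind]. Qed.

Lemma abs2_mdisk a s b x : abs2 (mdisk a s b x) = abs2 (ind a s x).
Proof. by rewrite /mdisk abs2M chi_abs2 mul1r. Qed.

Lemma sqnorm_ind a s : s != 0 -> sqnorm mu (ind a s) = (absv s)%:E.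
Proof.
by move=> s0; rewrite -(haar_disk a s0) -sqnorm_indic //; exact: measurable_disk.
Qed.

Lemma sqnorm_mdisk a s b : s != 0 -> sqnorm mu (mdisk a s b) = (absv s)%:E.
Proof.
by move=> s0; rewrite -(sqnorm_ind a s0); apply: eq_integral => x _; rewrite abs2_mdisk.
Qed.

Lemma sqint_mdisk a s b : s != 0 -> sqint mu (mdisk a s b).
Proof. by move=> s0; split; [exact: cmeas_mdisk|rewrite sqnorm_mdisk // ltry]. Qed.

Lemma L1_mdisk a s b : s != 0 -> (\int[mu]_x (Num.sqrt (abs2 (mdisk a s b x)))%:E < +oo)%E.
Proof.
move=> s0; rewrite (_ : integral _ _ _ = sqnorm mu (mdisk a s b)); first by rewrite sqnorm_mdisk // ltry.
apply: eq_integral => x _; rewrite abs2_mdisk indE.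
by case: ifP => _; rewrite ?abs2_1 ?abs2_0 ?sqrtr1 ?sqrtr0.
Qed.

Lemma cintegrable_mdisk a s b : s != 0 -> cintegrable mu (mdisk a s b).
Proof. by move=> s0; apply: cintegrable_L1; [exact: cmeas_mdisk|exact: L1_mdisk]. Qed.

Lemma mdisk_sub a s b x : absv (x - a) <= absv s -> absv (b * s) <= 1 -> mdisk a s b x = chi (b * a) * ind a s x.
Proof.
move=> xa bs; rewrite /mdisk; congr (_ * _); apply: chi_loc; rewrite -mulrBr.
by apply: le_trans bs; rewrite !absvM ler_wpM2l // absv_ge0.
Qed.

Lemma cInt_ind a s : s != 0 -> cInt mu (ind a s) = (absv s)%:C.
Proof.
move=> s0; apply/eqP; rewrite eq_complex /=; apply/andP; split; apply/eqP.
  rewrite /Rintegral -[RHS]/(fine (absv s)%:E) -(haar_disk a s0) -[in RHS](setIT (disk a s)).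
  by rewrite -(integral_indic mu measurableT (measurable_disk a s0)).
by rewrite /Rintegral integral0.
Qed.

(** When the character is nontrivial on the disk, a translation inside the disk
    multiplies the integral by a number other than 1. *)
Lemma cInt_mdisk a s b : s != 0 ->
  cInt mu (mdisk a s b) = if absv (b * s) <= 1 then chi (b * a) * (absv s)%:C else 0.
Proof.
move=> s0; case: ifPn => bs.
  rewrite -(cInt_ind a s0) -cIntZ; last first.
    have := @cintegrable_mdisk a s 0 s0; congr cintegrable; apply/funext => x.
    by rewrite /mdisk mul0r chi0 mul1r.
  apply: cInt_eq => x; have [xa|xa] := boolP (absv (x - a) <= absv s); first exact: mdisk_sub.
  by rewrite /mdisk /cscale indE (negPf xa) !mulr0.
have [|z z1 zn] := @chi_nontrivial (b * s); first by rewrite ltNge.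
have := @cInt_affine 1 (s * z) (mdisk a s b) (oner_neq0 _) (cintegrable_mdisk a b s0).
rewrite absv1 invr1 mul1r.
have -> : (fun x => mdisk a s b (1 * x + s * z)) = cscale (chi (b * s * z)) (mdisk a s b).
  apply/funext => x; rewrite /cscale /mdisk mul1r mulrDr chiD mulrA [chi (b * x) * _]mulrC -!mulrA.
  congr (_ * (_ * _)); rewrite !indE; congr (if _ then _ else _).
  have sz : absv (s * z) <= absv s by rewrite absvM ler_piMr // absv_ge0.
  apply/idP/idP => H.
    rewrite (_ : x - a = (x + s * z - a) + - (s * z)); last by rewrite addrAC addrK.
    by apply: absv_ultra_le => //; rewrite absvN.
  by rewrite addrAC; apply: absv_ultra_le.
rewrite cIntZ; last exact: cintegrable_mdisk.
by move=> /eqP; rewrite -subr_eq0 -[X in _ - X]mul1r -mulrBl mulf_eq0 subr_eq0 (negPf zn) => /eqP.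
Qed.

Notation Fi := (fourier_int mu chi).

Lemma FiE f xi : Fi f xi = cInt mu (fun x => f x * (chi (xi * x))^*).
Proof. by []. Qed.

Lemma Fi_mdisk a s b : s != 0 ->
  Fi (mdisk a s b) = cscale ((absv s)%:C * chi (a * b)) (mdisk b s^-1 (- a)).
Proof.
move=> s0; apply/funext => xi; rewrite FiE.
rewrite (_ : (fun x => _) = mdisk a s (b - xi)); last first.
  by apply/funext => x; rewrite /mdisk mulrBl chiD chiN mulrAC.
rewrite cInt_mdisk // /cscale /mdisk indE absvM absvV -{1}(opprB xi b) absvN.
rewrite -ler_pdivlMr ?absv_gt0 // mul1r; case: ifP => _; last by rewrite !mulr0.
by rewrite mulr1 -mulrA -chiD mulrC; congr (_ * chi _); ring.
Qed.

(** Two disks are nested or disjoint, so that the product is again a modulated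
    indicator, or 0. *)
Lemma inn_mdisk a s b a' s' b' : s != 0 -> s' != 0 -> absv s <= absv s' ->
  inn mu (mdisk a s b) (mdisk a' s' b') =
  if (absv (a - a') <= absv s') && (absv ((b - b') * s) <= 1)
  then chi ((b - b') * a) * (absv s)%:C else 0.
Proof.
move=> s0 s'0 ss'; rewrite /inn.
have P x : mdisk a s b x * (mdisk a' s' b' x)^* = chi ((b - b') * x) * (ind a s x * ind a' s' x).
  rewrite conj_opE (_ : (mdisk a' s' b' x)^* = ((chi (b' * x))^* * (ind a' s' x)^*)%C); last exact: conjcM.
  rewrite !conj_opE -chiN /mdisk.
  have -> : (ind a' s' x)^* = ind a' s' x by rewrite indE; case: ifP; rewrite ?rmorph1 ?rmorph0.
  by rewrite mulrBl chiD; ring.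
case: ifPn => [/andP[aa' bb']|H].
  have -> : (fun x => mdisk a s b x * (mdisk a' s' b' x)^*) = mdisk a s (b - b').
    apply/funext => x; rewrite P /mdisk; congr (_ * _); rewrite !indE.
    have [xa|xa] := boolP (absv (x - a) <= absv s); last by rewrite mul0r.
    suff -> : absv (x - a') <= absv s' by rewrite mulr1.
    by rewrite -(subrK a x) -addrA; apply: absv_ultra_le => //; exact: le_trans ss'.
  by rewrite cInt_mdisk // bb'.
have [aa'|aa'] := boolP (absv (a - a') <= absv s').
  rewrite aa' /= in H; rewrite -(_ : cInt mu (mdisk a s (b - b')) = 0); last by rewrite cInt_mdisk // (negPf H).
  apply: cInt_eq => x; rewrite P /mdisk; congr (_ * _); rewrite !indE.
  have [xa|xa] := boolP (absv (x - a) <= absv s); last by rewrite mul0r.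
  suff -> : absv (x - a') <= absv s' by rewrite mulr1.
  by rewrite -(subrK a x) -addrA; apply: absv_ultra_le => //; exact: le_trans ss'.
rewrite (_ : (fun x => _) = fun=> 0); last first.
  apply/funext => x; rewrite P !indE.
  have [xa|xa] := boolP (absv (x - a) <= absv s); last by rewrite mul0r mulr0.
  have [xa'|xa'] := boolP (absv (x - a') <= absv s'); last by rewrite mulr0 mulr0.
  exfalso; move/negP: aa'; apply; rewrite -(subrK x a) -addrA; apply: absv_ultra_le => //.
  by rewrite -absvN opprB; exact: le_trans ss'.
by rewrite /cInt /Rintegral /= integral0.
Qed.

(** By explicit formulas: the transform exchanges centre and frequency, and inverts the
    radius. *)
Lemma plancherel_mdisk a s b a' s' b' : s != 0 -> s' != 0 ->
  inn mu (Fi (mdisk a s b)) (Fi (mdisk a' s' b')) = inn mu (mdisk a s b) (mdisk a' s' b').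
Proof.
have H := @pre_hilbert_sqint _ _ _ mu.
wlog ss' : a s b a' s' b' / absv s <= absv s'.
  move=> W s0 s'0; case/orP: (le_total (absv s) (absv s')) => ss'; first exact: W.
  have SF a1 s1 b1 : s1 != 0 -> sqint mu (Fi (mdisk a1 s1 b1)).
    by move=> s10; rewrite Fi_mdisk //; apply: sqintZ; apply: sqint_mdisk; rewrite invr_eq0.
  by rewrite (innC (SF a' s' b' s'0) (SF a s b s0)) (innC (sqint_mdisk a' b' s'0) (sqint_mdisk a b s0)) W.
move=> s0 s'0; rewrite !Fi_mdisk //.
have sV0 : s^-1 != 0 by rewrite invr_eq0.
have s'V0 : s'^-1 != 0 by rewrite invr_eq0.
rewrite (ph_ipZ H) ?(ipZr H) //; try (by apply: sqintZ; exact: sqint_mdisk); try exact: sqint_mdisk.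
rewrite (innC (sqint_mdisk _ _ s'V0) (sqint_mdisk _ _ sV0)).
rewrite inn_mdisk // ?inn_mdisk //; last by rewrite !absvV lef_pV2 // ?posrE ?absv_gt0.
have -> : absv (b' - b) <= absv s^-1 = (absv ((b - b') * s) <= 1).
  by rewrite -(opprB b b') absvN absvM absvV -ler_pdivlMr ?absv_gt0 // mul1r.
have -> : absv ((- a' - - a) * s'^-1) <= 1 = (absv (a - a') <= absv s').
  by rewrite opprK addrC absvM absvV ler_pdivrMr ?absv_gt0 // mul1r.
rewrite andbC; case: ifP => _; last by rewrite rmorph0 !mulr0.
rewrite ?conj_opE !conjcM ?conj_opE !conjc_real -!chiN absvV.
have sr : (absv s')%:C * (absv s')^-1%:C = 1 :> R[i].
  by rewrite -rmorphM mulfV // gt_eqF // absv_gt0.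
rewrite (_ : _ * _ = (absv s)%:C * ((absv s')%:C * (absv s')^-1%:C) * (chi (a * b) * (chi (- (a' * b')) * chi (- ((- a' - - a) * b'))))); last by ring.
rewrite sr mulr1 -!chiD mulrC; congr (chi _ * _); ring.
Qed.

(** ** Density of modulated indicators *)

Lemma absv_varpiX n : absv (varpi ^+ n) = (q%:R : R)^-1 ^+ n.
Proof. by rewrite absvX absv_varpi. Qed.

Lemma q_gt1R : 1 < q%:R :> R.
Proof. by rewrite ltr1n; exact: q_gt1. Qed.

Lemma q_gt0R : 0 < q%:R :> R.
Proof. exact: lt_trans ltr01 q_gt1R. Qed.

Lemma varpiX_small (e : R) : 0 < e -> exists n, absv (varpi ^+ n) < e.
Proof.
move=> e0; have l1 : `|(q%:R : R)^-1| < 1.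
  by rewrite gtr0_norm ?invr_gt0 ?q_gt0R // invf_lt1 ?q_gt0R // q_gt1R.
have /cvgr_dist_lt/(_ _ e0)[N _ /(_ N (leqnn N))] := cvg_expr l1.
rewrite /= sub0r normrN ger0_norm ?exprn_ge0 ?invr_ge0 ?(ltW q_gt0R) // => Ke.
by exists N; rewrite absv_varpiX.
Qed.

Lemma varpiX_large (e : R) : exists n, e < absv (varpi ^- n).
Proof.
have [n] : exists n, absv (varpi ^+ n) < (`|e| + 1)^-1 by apply: varpiX_small; rewrite invr_gt0 ltr_wpDl.
rewrite -ltf_pV2 ?posrE ?invr_gt0 ?ltr_wpDl // ?absv_gt0 ?expf_neq0 ?varpi_neq0 // invrK -absvV => Ke.
by exists n; apply: le_lt_trans Ke; apply: le_trans (ler_norm e) _; rewrite lerDl.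
Qed.

Lemma diskS a s b : absv (b - a) <= absv s -> disk a s = disk b s.
Proof.
move=> ba; apply/seteqP; split => x; rewrite /disk /= => H.
  by rewrite -(subrK a x) -addrA; apply: absv_ultra_le; rewrite // -absvN opprB.
by rewrite -(subrK b x) -addrA; apply: absv_ultra_le.
Qed.

Lemma disk_cap a s b t : absv s <= absv t ->
  disk a s `&` disk b t = if absv (a - b) <= absv t then disk a s else set0.
Proof.
move=> st; case: ifPn => ab; apply/seteqP; split => x; rewrite /disk /= => // H.
- by case: H.
- split => //; rewrite -(subrK a x) -addrA; apply: absv_ultra_le => //; exact: le_trans st.
- case: H => xa xb; move/negP: ab; apply; rewrite -(subrK x a) -addrA.
  by apply: absv_ultra_le => //; rewrite -absvN opprB; exact: le_trans st.
Qed.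

Definition disks : set (set K) := [set A | A = set0 \/ exists a s, s != 0 /\ A = disk a s].

Lemma disks_setI : setI_closed disks.
Proof.
move=> A B [->|[a [s [s0 ->]]]]; first by rewrite set0I; left.
move=> [->|[b [t [t0 ->]]]]; first by rewrite setI0; left.
case/orP: (le_total (absv s) (absv t)) => st.
  by rewrite disk_cap //; case: ifP => _; [right; exists a, s|left].
by rewrite setIC disk_cap //; case: ifP => _; [right; exists b, t|left].
Qed.

(** The radii [absv (varpi ^+ n)] and the centres in [varpi ^+ n * Lam] suffice. *)
Lemma disk_countable_base (A : set K) : open A ->
  exists F : nat -> set K, (forall n, F n = set0 \/ exists a m, F n = disk a (varpi ^+ m)) /\
    A = \bigcup_n F n.
Proof.
move=> oA; pose D (i : nat * nat) := disk (varpi ^+ i.2 * uu i.1) (varpi ^+ i.2).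
pose F m := if unpickle m is Some i then if `[< D i `<=` A >] then D i else set0 else set0.
exists F; split.
  move=> n; rewrite /F; case: unpickle => [i|]; last by left.
  case: ifP => _; last by left.
  by right; exists (varpi ^+ i.2 * uu i.1), i.2.
apply/seteqP; split => x; last first.
  by move=> [m _]; rewrite /F; case: unpickle => [i|//]; case: asboolP => // iA /iA.
move=> Ax; have [e e0 eA] := @nbhs_absv x A (open_nbhs_nbhs (conj oA Ax)).
have [n ne] := varpiX_small e0.
have v0 : varpi ^+ n != 0 by rewrite expf_neq0 // varpi_neq0.
have [N] := varpiX_large (absv (varpi ^- n * x)) => /ltW /Lam_cover[k _ xk].
have xD : absv (x - varpi ^+ n * uu k) <= absv (varpi ^+ n).
  rewrite -[X in absv (X - _)]mul1r -(mulfV v0) -mulrA -mulrBr absvM.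
  by rewrite ler_piMr // absv_ge0.
exists (pickle (k, n)) => //; rewrite /F pickleK ifT //.
apply/asboolP; rewrite /D /= (diskS xD) => y /= yx; apply: eA.
by apply: le_lt_trans ne.
Qed.

Lemma borel_disks : @measurable _ (borel K) = <<s disks >>.
Proof.
apply/seteqP; split.
  apply: smallest_sub; first exact: smallest_sigma_algebra.
  move=> A oA; have [F [FD ->]] := disk_countable_base oA.
  apply: sigma_algebra_bigcup => n; apply: sub_sigma_algebra.
  have [->|[a [m ->]]] := FD n; [by left|right].
  by exists a, (varpi ^+ m); rewrite expf_neq0 // varpi_neq0.
apply: smallest_sub; first exact: sigma_algebra_measurable.
move=> A [->|[a [s [s0 ->]]]]; first exact: measurable0.
exact: measurable_disk.
Qed.

(** Centre, radius and frequency. *)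
Definition mdisk_index := {i : K * K * K | i.1.2 != 0}.
Definition mdi (i : mdisk_index) : K -> R[i] := mdisk (val i).1.1 (val i).1.2 (val i).2.

Lemma sqint_mdi i : sqint mu (mdi i).
Proof. by case: i => [[[a s] b] s0]; exact: sqint_mdisk. Qed.

Notation HK := (@pre_hilbert_sqint _ _ _ mu).
Notation csp := (cspan cscale (inn mu)).

Lemma cscale1 {T : Type} (f : T -> R[i]) : cscale 1 f = f.
Proof. by apply/funext => x; rewrite /cscale mul1r. Qed.

Lemma cscaleN1 {T : Type} (f : T -> R[i]) : cscale (- 1) f = - f.
Proof. by apply/funext => x; rewrite /cscale mulN1r. Qed.

Lemma cspan_mdisk a s b : s != 0 -> csp (range mdi) (mdisk a s b).
Proof.
move=> s0; apply: (cspan_mem HK); [exact: cscale1|exact: sqint_mdisk|].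
by exists (exist _ (a, s, b) s0).
Qed.

Lemma mdisk_ind a s : mdisk a s 0 = fun x => (\1_(disk a s) x)%:C.
Proof. by apply/funext => x; rewrite /mdisk mul0r chi0 mul1r. Qed.

Lemma range_mdi_sqint h : range mdi h -> sqint mu h.
Proof. by move=> [i _ <-]; exact: sqint_mdi. Qed.

Lemma varpiX_neq0 n : varpi ^+ n != 0.
Proof. by rewrite expf_neq0 // varpi_neq0. Qed.

Lemma varpiNX_neq0 n : varpi ^- n != 0.
Proof. by rewrite invr_neq0 // varpiX_neq0. Qed.

Definition bigdisk n : set K := disk 0 (varpi ^- n).

Lemma measurable_bigdisk n : measurable (bigdisk n : set (borel K)).
Proof. by apply: measurable_disk; exact: varpiNX_neq0. Qed.

Lemma mu_bigdisk n : (mu (bigdisk n) < +oo)%E.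
Proof. by rewrite /bigdisk haar_disk ?varpiNX_neq0 // ltry. Qed.

Lemma absv_varpiNX n : absv (varpi ^- n) = (q%:R : R) ^+ n.
Proof. by rewrite absvV absv_varpiX -exprVn invrK. Qed.

Lemma bigdiskS n m : (n <= m)%N -> bigdisk n `<=` bigdisk m.
Proof.
move=> nm x; rewrite /bigdisk /disk /= !absv_varpiNX => /le_trans; apply.
by rewrite ler_weXn2l // ltW // q_gt1R.
Qed.

Lemma bigdisk_cover (x : K) : exists n, bigdisk n x.
Proof. by have [n /ltW H] := varpiX_large (absv x); exists n; rewrite /bigdisk /disk /= subr0. Qed.

(** Dynkin induction: the disks generate the Borel sets and are stable under
    intersection. *)
Lemma cspan_mdi_trunc (N : nat) (A : set (borel K)) : measurable A ->
  csp (range mdi) (cindic (A `&` bigdisk N)).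
Proof.
move=> mA; have B0 := @varpiNX_neq0 N.
have mB := measurable_bigdisk N.
have fB (B : set (borel K)) : measurable B -> (mu ((B : set K) `&` bigdisk N) < +oo)%E.
  move=> mB'; apply: le_lt_trans (mu_bigdisk N); apply: le_measure; rewrite ?inE //.
  exact: measurableI.
have cB : csp (range mdi) (cindic (bigdisk N)) by rewrite -mdisk_ind; exact: cspan_mdisk.
rewrite borel_disks in mA; move: A mA; apply: dynkin_induction.
- exact: borel_disks.
- exact: disks_setI.
- by rewrite setTI.
- move=> A dA; have [->|[a [s [s0 ->]]]] : disks (A `&` bigdisk N).
  + by apply: disks_setI => //; right; exists 0, (varpi ^- N).
  + rewrite (_ : (cindic set0) = (0 : K -> R[i])); first exact: (cspan0 HK).
    by apply/funext => x; rewrite indic0.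
  + by rewrite -mdisk_ind; exact: cspan_mdisk.
- move=> A mA cA; rewrite (_ : (fun x => _) = (cindic (bigdisk N)) +
      cscale (-1) (cindic (A `&` bigdisk N))); last first.
    apply/funext => x; rewrite fctE /cscale mulN1r -rmorphB /= !indicE !in_setI in_setC.
    by case: (x \in A); case: (x \in bigdisk N); rewrite /= ?subrr ?subr0.
  have S1 : sqint mu (cindic (A `&` bigdisk N)).
    by apply: sqint_indic; [exact: measurableI|exact: fB].
  have SB : sqint mu (cindic (bigdisk N)) by apply: sqint_indic mB (mu_bigdisk N).
  exact: (cspanD HK range_mdi_sqint SB (sqintZ (-1) S1) cB (cspanZ HK (-1) range_mdi_sqint S1 cA)).
- move=> F mF tF cF; rewrite setI_bigcupl.
  rewrite -bigcup_bigsetU_bigcup.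
  have m1 n : measurable (\big[setU/set0]_(i < n) (F i `&` bigdisk N) : set (borel K)).
    by apply: bigsetU_measurable => i _; exact: measurableI.
  have S1 n : sqint mu (cindic (\big[setU/set0]_(i < n) (F i `&` bigdisk N))).
    apply: sqint_indic (m1 n) _; rewrite -big_distrl /=; apply: fB.
    exact: bigsetU_measurable.
  have cn n : csp (range mdi) (cindic (\big[setU/set0]_(i < n) (F i `&` bigdisk N))).
    elim: n => [|n IH].
      rewrite (_ : (fun x => _) = (0 : K -> R[i])); first exact: (cspan0 HK).
      by apply/funext => x; rewrite big_ord0 indic0.
    have S2 : sqint mu (cindic (F n `&` bigdisk N)).
      by apply: sqint_indic; [exact: measurableI|exact: fB].
    have := cspanD HK range_mdi_sqint (S1 n) S2 IH (cF n).
    congr csp; apply/funext => x.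
    transitivity ((\1_(\big[setU/set0]_(i < n) (F i `&` bigdisk N)) x)%:C +
      (\1_(F n `&` bigdisk N) x)%:C : R[i]); first by [].
    rewrite -rmorphD /= big_ord_recr /= !indicE in_setU.
    have [/set_mem xF|] := boolP (x \in F n `&` bigdisk N); last by rewrite orbF addr0.
    suff -> : (x \in \big[setU/set0]_(i < n) (F i `&` bigdisk N)) = false by rewrite add0r.
    apply: memNset; rewrite -(bigcup_mkord n (fun i => (F i : set K) `&` bigdisk N)) => -[i /= ilt xi].
    have E : n = i := tF n i I I (ex_intro _ x (conj (proj1 xF) (proj1 xi))).
    by rewrite E ltnn in ilt.
  apply: cspan_indic_cvg.
  + exact: range_mdi_sqint.
  + by move=> n; exact: m1.
  + by move=> n m nm; apply/subsetPset => x /=;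
      rewrite -!(bigcup_mkord _ (fun i => (F i : set K) `&` bigdisk N)) => -[i /= im xi];
      exists i => //=; exact: leq_trans im _.
  + rewrite (bigcup_bigsetU_bigcup (fun i => (F i : set K) `&` bigdisk N)) -setI_bigcupl; apply: fB; exact: bigcup_measurable.
  + by move=> n; exact: (cn n.+1).
Qed.

Lemma cspan_mdi f : sqint mu f -> csp (range mdi) f.
Proof.
move=> sf; apply: (cspan_trans HK (@indicators_sqint _ _ _ mu) range_mdi_sqint sf) (cspan_indicators sf).
move=> g [A [mA fA ->]].
have AE : A = \bigcup_n (A `&` bigdisk n).
  apply/seteqP; split => x; last by move=> [n _ []].
  by move=> Ax; have [n xn] := bigdisk_cover x; exists n.
rewrite AE; apply: cspan_indic_cvg.
- exact: range_mdi_sqint.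
- by move=> n; apply: measurableI => //; exact: measurable_bigdisk.
- by move=> n m nm; apply/subsetPset => x [Ax xn]; split => //; exact: bigdiskS xn.
- by rewrite -AE.
- by move=> n; exact: cspan_mdi_trunc.
Qed.

(** ** The Fourier transform *)

Local Notation Fmd := (fun i => Fi (mdi i)).

Lemma sqint_Fmd i : sqint mu (Fmd i).
Proof.
case: i => [[[a s] b] s0]; rewrite /mdi /= Fi_mdisk //.
by apply: sqintZ; apply: sqint_mdisk; rewrite invr_eq0.
Qed.

Lemma plancherel_mdi i j : inn mu (Fmd i) (Fmd j) = inn mu (mdi i) (mdi j).
Proof. by case: i => [[[a s] b] s0]; case: j => [[[a' s'] b'] s'0]; exact: plancherel_mdisk. Qed.

(** The Fourier transform of L2, extended from the modulated indicators by Plancherel's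
    formula. *)
Definition FT := uext cscale (sqint mu) (inn mu) mdi Fmd.

Lemma sqint_complete (f_ : nat -> K -> R[i]) : (forall n, sqint mu (f_ n)) ->
  (forall n m, (n <= m)%N -> nsq (inn mu) (f_ m - f_ n) <= 8^-1 ^+ n) ->
  exists f, sqint mu f /\ forall n, nsq (inn mu) (f - f_ n) <= 8^-1 ^+ n.
Proof.
move=> sf cf; have [|f [f1 f2]] := @riesz_fischer _ _ _ mu f_ sf.
  move=> n m nm; have := cf n m nm; rewrite -lee_fin nsq_fine //.
  exact: (sqintB (sf m) (sf n)).
exists f; split => // n; rewrite -lee_fin nsq_fine; first exact: f2.
exact: (sqintB f1 (sf n)).
Qed.

Lemma FTZ a f g : FT f g -> FT (cscale a f) (cscale a g).
Proof. exact: (uextZ HK sqint_mdi sqint_Fmd a). Qed.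

Lemma FT_sqint f g : FT f g -> sqint mu f /\ sqint mu g.
Proof. by move=> []. Qed.

Lemma FT_ip f g f' g' : FT f g -> FT f' g' -> inn mu g g' = inn mu f f'.
Proof. exact: (uext_ip HK sqint_mdi sqint_Fmd plancherel_mdi). Qed.

Lemma FT_exists f : sqint mu f -> exists g, FT f g.
Proof.
move=> sf; apply: (uext_exists HK cscaleN1 sqint_mdi sqint_Fmd plancherel_mdi sqint_complete sf).
exact: cspan_mdi.
Qed.

(** Modulated indicators are transforms of modulated indicators, so the inverse
    correspondence is everywhere defined as well. *)
Lemma FT_onto g : sqint mu g -> exists f, FT f g.
Proof.
move=> sg; have [| |f gf] := uext_exists HK cscaleN1 sqint_Fmd sqint_mdi _ sqint_complete sg.
- by move=> i j; rewrite plancherel_mdi.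
- have rS h : range Fmd h -> sqint mu h by move=> [i _ <-]; exact: sqint_Fmd.
  apply: (cspan_trans HK range_mdi_sqint rS sg) (cspan_mdi sg) => h [[[[a s] b] /= s0] _ <-].
  have sV0 : s^-1 != 0 by rewrite invr_eq0.
  rewrite /mdi /=; pose k : R[i] := (absv s^-1)%:C * chi (- b * a).
  have k0 : k != 0.
    by rewrite mulf_neq0 ?chi_neq0 // fmorph_eq0 gt_eqF // absv_gt0.
  have -> : mdisk a s b = cscale k^-1 (Fi (mdisk (- b) s^-1 a)).
    rewrite Fi_mdisk // invrK opprK; apply/funext => x; rewrite /cscale mulrA mulVf ?mul1r //.
  apply: (cspanZ HK) rS _ _.
    exact: (sqint_Fmd (exist _ (- b, s^-1, a) sV0)).
  apply: (cspan_mem HK); [exact: cscale1|exact: (sqint_Fmd (exist _ (- b, s^-1, a) sV0))|].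
  by exists (exist _ (- b, s^-1, a) sV0).
- by exists f; exact: uextC.
Qed.

(** ** Comparison with the integral on L1 *)

Definition L1f (f : K -> R[i]) := cmeas (f : borel K -> _) /\ (\int[mu]_x (Num.sqrt (abs2 (f x)))%:E < +oo)%E.

Lemma L1f_chi f xi : L1f f -> L1f (fun x => f x * (chi (xi * x))^*).
Proof.
move=> [mf lf]; split.
  by apply: cmeasM => //; apply: cmeasJ; exact: cmeas_chi.
rewrite (_ : integral _ _ _ = (\int[mu]_x (Num.sqrt (abs2 (f x)))%:E)%E) //.
by apply: eq_integral => x _; rewrite abs2M abs2J chi_abs2 mulr1.
Qed.

Lemma cintegrable_chi f xi : L1f f -> cintegrable mu (fun x => f x * (chi (xi * x))^*).
Proof. by move=> /(@L1f_chi _ xi)[]; exact: cintegrable_L1. Qed.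

Lemma FiD f g xi : L1f f -> L1f g -> Fi (fun x => f x + g x) xi = Fi f xi + Fi g xi.
Proof.
move=> lf lg; rewrite !FiE -(cIntD (cintegrable_chi xi lf) (cintegrable_chi xi lg)).
by apply: cInt_eq => x; rewrite mulrDl.
Qed.

Lemma FiZ a f xi : L1f f -> Fi (cscale a f) xi = a * Fi f xi.
Proof.
move=> lf; rewrite !FiE -(cIntZ a (cintegrable_chi xi lf)).
by apply: cInt_eq => x; rewrite /cscale mulrA.
Qed.

Lemma L1f_mdi i : L1f (mdi i).
Proof. by case: i => [[[a s] b] s0]; split; [exact: cmeas_mdisk|exact: L1_mdisk]. Qed.

Lemma L1fD f g : L1f f -> L1f g -> L1f (fun x => f x + g x).
Proof.
move=> [mf lf] [mg lg]; split; first exact: cmeasD.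
apply: (@le_lt_trans _ _ (\int[mu]_x ((Num.sqrt (abs2 (f x)))%:E + (Num.sqrt (abs2 (g x)))%:E))%E).
  apply: ge0_le_integral => //.
  - by apply/measurable_EFinP; apply: measurable_normc; exact: cmeasD.
  - by apply: emeasurable_funD; apply/measurable_EFinP; exact: measurable_normc.
  - move=> x _; rewrite -EFinD lee_fin.
    by have := ler_normD (f x) (g x); rewrite !normc_def -rmorphD lecR.
rewrite ge0_integralD //; first exact: lte_add_pinfty.
- by apply/measurable_EFinP; exact: measurable_normc.
- by apply/measurable_EFinP; exact: measurable_normc.
Qed.

Lemma L1fZ a f : L1f f -> L1f (cscale a f).
Proof.
move=> [mf lf]; split; first exact: cmeas_scale.
rewrite (_ : integral _ _ _ = ((Num.sqrt (abs2 a))%:E * \int[mu]_x (Num.sqrt (abs2 (f x)))%:E)%E).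
  by rewrite lte_mul_pinfty // lee_fin sqrtr_ge0.
rewrite -ge0_integralZl //.
- by apply: eq_integral => x _; rewrite /cscale abs2M sqrtrM ?abs2_ge0.
- by apply/measurable_EFinP; exact: measurable_normc.
Qed.

Lemma L1f_lc s : L1f (lc cscale mdi s).
Proof.
elim: s => [|x s IH].
  have -> : lc cscale mdi [::] = cscale 0 (mdisk 0 1 0).
    by rewrite /lc big_nil; apply/funext => x; rewrite /cscale mul0r.
  by apply: L1fZ; split; [exact: (cmeas_mdisk _ _ (oner_neq0 _))|exact: (L1_mdisk _ _ (oner_neq0 _))].
rewrite /lc big_cons; apply: L1fD => //; apply: L1fZ; exact: L1f_mdi.
Qed.

Lemma Fi_lc s : Fi (lc cscale mdi s) = lc cscale Fmd s.
Proof.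
apply/funext => xi; elim: s => [|x s IH].
  rewrite /lc !big_nil; transitivity (Fi (cscale 0 (mdisk 0 1 0)) xi).
    by congr (Fi _ _); apply/funext => x; rewrite /cscale mul0r.
  by rewrite FiZ ?mul0r //; split; [exact: (cmeas_mdisk _ _ (oner_neq0 _))|exact: (L1_mdisk _ _ (oner_neq0 _))].
rewrite /lc !big_cons; transitivity (Fi (cscale x.1 (mdi x.2)) xi + Fi (lc cscale mdi s) xi).
  by apply: FiD; [apply: L1fZ; exact: L1f_mdi|exact: L1f_lc].
by rewrite IH FiZ //; exact: L1f_mdi.
Qed.

Lemma Fi_inn N (r : K -> R[i]) xi : (forall x, ~ bigdisk N x -> r x = 0) ->
  Fi r xi = inn mu r (mdisk 0 (varpi ^- N) xi).
Proof.
move=> r0; rewrite FiE; apply: cInt_eq => x; rewrite /mdisk indE.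
case: ifPn => xN; first by rewrite mulr1.
by rewrite r0 ?mul0r //; exact/negP.
Qed.

Lemma Fi_bound N (r : K -> R[i]) xi : sqint mu r -> (forall x, ~ bigdisk N x -> r x = 0) ->
  abs2 (Fi r xi) <= nsq (inn mu) r * absv (varpi ^- N).
Proof.
move=> sr r0; rewrite (Fi_inn _ r0).
have sm : sqint mu (mdisk 0 (varpi ^- N) xi) by apply: sqint_mdisk; exact: varpiNX_neq0.
apply: le_trans (cauchy_schwarz HK sr sm) _.
suff -> : nsq (inn mu) (mdisk 0 (varpi ^- N) xi) = absv (varpi ^- N) by [].
by apply/EFin_inj; rewrite nsq_fine // sqnorm_mdisk // varpiNX_neq0.
Qed.

Definition restr (A : set K) (f : K -> R[i]) : K -> R[i] := fun x => f x * (\1_A x)%:C.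

Lemma abs2_restr A f x : abs2 (restr A f x) = abs2 (f x) * \1_A x.
Proof. by rewrite /restr abs2M abs2_real indicE; case: (_ \in _); rewrite ?expr1n ?expr0n. Qed.

Lemma abs2_restr_le A f x : abs2 (restr A f x) <= abs2 (f x).
Proof.
rewrite abs2_restr ler_piMr ?abs2_ge0 // indicE; by case: (_ \in _); rewrite ?lexx ?ler01.
Qed.

Lemma cmeas_restr (A : set (borel K)) f : measurable A -> cmeas (f : borel K -> _) -> cmeas (restr A f : borel K -> _).
Proof. by move=> mA mf; apply: cmeasM => //; exact: cmeas_indic. Qed.

Lemma sqnorm_restr (A : set (borel K)) f : measurable A -> cmeas (f : borel K -> _) ->
  sqnorm mu (restr A f) = (\int[mu]_(x in A) (abs2 (f x))%:E)%E.
Proof.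
move=> mA mf; rewrite integral_mkcond /sqnorm; apply: eq_integral => x _.
rewrite abs2_restr patchE indicE; case: (x \in A); by rewrite ?mulr1 ?mulr0.
Qed.

Lemma sqnorm_restr_le (A : set (borel K)) f : measurable A -> cmeas (f : borel K -> _) ->
  (sqnorm mu (restr A f) <= sqnorm mu f)%E.
Proof.
move=> mA mf; apply: ge0_le_integral => //; try by (apply: emeasurable_abs2 => //; exact: cmeas_restr).
  by move=> x _; rewrite lee_fin abs2_ge0.
by move=> x _; rewrite lee_fin abs2_restr_le.
Qed.

Lemma sqint_restr (A : set (borel K)) f : measurable A -> sqint mu f -> sqint mu (restr A f).
Proof.
by move=> mA [mf lf]; split; [exact: cmeas_restr|exact: le_lt_trans (sqnorm_restr_le mA mf) lf].
Qed.

Definition trunc N (f : K -> R[i]) : K -> R[i] := restr (bigdisk N) f.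

Lemma trunc_out N f x : ~ bigdisk N x -> trunc N f x = 0.
Proof. by move=> xN; rewrite /trunc /restr indicE memNset // mulr0. Qed.

Lemma sqnorm_trunc N f : cmeas (f : borel K -> _) -> (sqnorm mu (trunc N f) <= sqnorm mu f)%E.
Proof. exact: sqnorm_restr_le (measurable_bigdisk N). Qed.

Lemma sqint_trunc N f : sqint mu f -> sqint mu (trunc N f).
Proof. exact: sqint_restr (measurable_bigdisk N). Qed.

Lemma L1f_trunc N f : L1f f -> L1f (trunc N f).
Proof.
move=> [mf lf]; split; first exact: cmeas_restr (measurable_bigdisk N) mf.
apply: le_lt_trans lf; apply: ge0_le_integral => //.
- by apply/measurable_EFinP; apply: measurable_normc; exact: cmeas_restr (measurable_bigdisk N) mf.
- by apply/measurable_EFinP; exact: measurable_normc.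
- by move=> x _; rewrite lee_fin ler_sqrt ?abs2_ge0 // abs2_restr_le.
Qed.

Lemma trunc_mdisk N a s b : s != 0 -> exists2 t, trunc N (mdisk a s b) = lc cscale mdi t & True.
Proof.
move=> s0; have v0 := @varpiNX_neq0 N.
have E x : trunc N (mdisk a s b) x = chi (b * x) * (\1_(disk a s `&` bigdisk N) x)%:C.
  by rewrite /trunc /restr /mdisk -mulrA; congr (_ * _); rewrite /ind indicI rmorphM.
have [E0|[a' [s' [s'0 E0]]]] : disks (disk a s `&` bigdisk N).
  by apply: disks_setI; right; [exists a, s|exists 0, (varpi ^- N)].
  exists [::] => //; rewrite /lc big_nil; apply/funext => x.
  by rewrite E E0 indic0 mulr0.
exists [:: (1, exist _ (a', s', b) s'0)] => //; rewrite /lc big_seq1 /=.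
by apply/funext => x; rewrite E E0 /cscale mul1r.
Qed.

Lemma trunc_lc N s : exists t, trunc N (lc cscale mdi s) = lc cscale mdi t.
Proof.
elim: s => [|[a [[[c0 r] b] r0]] s [t IH]].
  by exists [::]; apply/funext => x; rewrite /trunc /restr /lc big_nil mul0r.
have [t1 T1 _] := @trunc_mdisk N c0 r b r0.
exists ([seq (a * x.1, x.2) | x <- t1] ++ t).
rewrite lc_cat (lcZ HK) -T1 -IH; apply/funext => x.
rewrite /trunc /lc big_cons /=.
transitivity ((a * mdisk c0 r b x + lc cscale mdi s x) * ind 0 (varpi ^- N) x); first by [].
by rewrite mulrDl -mulrA.
Qed.

Lemma sqint_lc s : sqint mu (lc cscale mdi s).
Proof. exact: (lc_S HK s sqint_mdi). Qed.

(** The step functions [lc cscale mdi (s n)] are supported by [bigdisk n] and so close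
    to [trunc n f] that the error remains small when multiplied by the measure of that
    disk. By [Fi_bound], their transforms then follow that of [trunc n f] uniformly. *)
Lemma approx_steps f (eta : R) : sqint mu f -> 0 < eta -> exists s : nat -> seq (R[i] * mdisk_index),
  forall n, [/\ forall x, ~ bigdisk n x -> lc cscale mdi (s n) x = 0,
    nsq (inn mu) (trunc n f - lc cscale mdi (s n)) * absv (varpi ^- n) < eta / n.+1%:R &
    nsq (inn mu) (trunc n f - lc cscale mdi (s n)) < eta].
Proof.
move=> sf eta0; suff /choice[s sE] : forall n, exists s, [/\ forall x, ~ bigdisk n x -> lc cscale mdi s x = 0,
    nsq (inn mu) (trunc n f - lc cscale mdi s) * absv (varpi ^- n) < eta / n.+1%:R &
    nsq (inn mu) (trunc n f - lc cscale mdi s) < eta] by exists s.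
move=> n; pose d := Num.min eta (eta / n.+1%:R / absv (varpi ^- n)).
have v0 := @varpiNX_neq0 n.
have d0 : 0 < d by rewrite lt_min eta0 !divr_gt0 // absv_gt0.
have [s sE] := cspan_lc (cspan_mdi sf) d0.
have [t tE] := trunc_lc n s; exists t.
have B : nsq (inn mu) (trunc n f - lc cscale mdi t) < d.
  apply: le_lt_trans sE; rewrite -lee_fin.
  have sB : sqint mu (f - lc cscale mdi s) by apply: sqintB => //; exact: sqint_lc.
  rewrite !nsq_fine //; last by apply: sqintB; [exact: sqint_trunc|exact: sqint_lc].
  rewrite -tE; apply: le_trans (sqnorm_trunc n (proj1 sB)).
  rewrite le_eqVlt; apply/orP; left; apply/eqP; congr (sqnorm mu _); apply/funext => x.
  by rewrite /trunc /restr mulrBl.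
split.
- by move=> x xn; rewrite -tE trunc_out.
- by rewrite -ltr_pdivlMr ?absv_gt0 //; apply: lt_le_trans B _; rewrite ge_min lexx orbT.
- by apply: lt_le_trans B _; rewrite ge_min lexx.
Qed.

Lemma dominated_trunc (u : K -> R) : mu.-integrable [set: borel K] (EFin \o u) ->
  (Rintegral mu [set: borel K] (fun x => u x * \1_(bigdisk n) x) @[n --> \oo] -->
   Rintegral mu [set: borel K] u).
Proof.
move=> iu; have mu' := measurable_int mu iu.
have := @dominated_convergence _ (borel K) R mu setT measurableT
  (fun n x => (u x * \1_(bigdisk n) x)%:E) (EFin \o u) (fun x => `|(EFin \o u) x|)%E.
case.
- move=> n; apply/measurable_EFinP; apply: measurable_funM; first exact/measurable_EFinP.
  by apply: measurable_indic; exact: measurable_bigdisk.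
- exact: mu'.
- apply: aeW => x _; have [N xN] := bigdisk_cover x.
  apply: cvg_near_cst; exists N => // n /= Nn.
  by rewrite indicE mem_set ?mulr1 //; exact: bigdiskS Nn x xN.
- exact: integrable_abse.
- apply: aeW => x n _; rewrite /= lee_fin normrM ler_piMr // indicE.
  by case: (_ \in _); rewrite ?normr1 ?normr0 ?ler01.
move=> _ _; rewrite /Rintegral => H; apply: fine_cvg.
by rewrite fineK ?integrable_fin_num //; exact: H.
Qed.

Lemma cInt_trunc g : cintegrable mu g ->
  forall e : R, 0 < e -> exists N, forall n, (N <= n)%N -> abs2 (cInt mu (trunc n g) - cInt mu g) < e.
Proof.
move=> [gr gi] e e0; have e1 : 0 < Num.min 1 (e / 2) by rewrite lt_min ltr01 divr_gt0.
have /cvgr_dist_lt/(_ _ e1)[N1 _ H1] := dominated_trunc gr.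
have /cvgr_dist_lt/(_ _ e1)[N2 _ H2] := dominated_trunc gi.
exists (maxn N1 N2) => n; rewrite geq_max => /andP[/H1 /= A /H2 /= B].
have S2 (z : R) : `|z| < Num.min 1 (e / 2) -> z ^+ 2 < e / 2.
  rewrite lt_min => /andP[z1 z2]; rewrite -real_normK ?num_real //.
  by apply: le_lt_trans z2; rewrite expr2 ler_piMr // ltW.
have -> : cInt mu (trunc n g) = Complex (Rintegral mu [set: borel K] (fun x => Re (g x) * \1_(bigdisk n) x))
    (Rintegral mu [set: borel K] (fun x => Im (g x) * \1_(bigdisk n) x)).
  rewrite /cInt; congr (Complex _ _); congr Rintegral; apply/funext => x; rewrite /trunc /restr.
    by case: (g x) => y z /=; rewrite mulr0 subr0.
  by case: (g x) => y z /=; rewrite mulr0 add0r.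
rewrite /abs2 /=; have := S2 _ A; have := S2 _ B; rewrite -[X in X < _]sqrrN -[X in _ -> X < _ -> _]sqrrN !opprB.
by lra.
Qed.

(** The transforms of the truncations converge by dominated convergence, and those of
    the steps stay close to them. *)
Lemma Fi_cvg f (s : nat -> seq (R[i] * mdisk_index)) xi (eta : R) : sqint mu f -> L1f f -> 0 < eta ->
  (forall n, [/\ forall x, ~ bigdisk n x -> lc cscale mdi (s n) x = 0,
    nsq (inn mu) (trunc n f - lc cscale mdi (s n)) * absv (varpi ^- n) < eta / n.+1%:R &
    nsq (inn mu) (trunc n f - lc cscale mdi (s n)) < eta]) ->
  forall e : R, 0 < e -> exists N, forall n, (N <= n)%N ->
    abs2 (Fi (lc cscale mdi (s n)) xi - Fi f xi) < e.
Proof.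
move=> sf lf eta0 sE e e0; have e4 : 0 < e / 4 by rewrite divr_gt0.
have [N1 H1] := cInt_trunc (cintegrable_chi xi lf) e4.
have [N2 H2] : exists N2 : nat, forall n, (N2 <= n)%N -> eta / n.+1%:R < e / 4.
  exists (Num.truncn (eta / (e / 4))).+1 => n Nn.
  rewrite ltr_pdivrMr // mulrC -ltr_pdivrMr //.
  apply: (lt_le_trans (truncnS_gt _)); rewrite ler_nat.
  exact: leqW.
exists (maxn N1 N2) => n; rewrite geq_max => /andP[/H1 A /H2 B].
have [s1 s2 _] := sE n.
have lt : L1f (trunc n f) by exact: L1f_trunc.
have lB : L1f (fun x => trunc n f x + cscale (-1) (lc cscale mdi (s n)) x).
  by apply: L1fD => //; apply: L1fZ; exact: L1f_lc.
have C : abs2 (Fi (trunc n f) xi - Fi (lc cscale mdi (s n)) xi) < e / 4.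
  rewrite -mulN1r -FiZ; last exact: L1f_lc.
  rewrite -FiD //; last by apply: L1fZ; exact: L1f_lc.
  apply: lt_trans B; apply: le_lt_trans s2.
  rewrite (_ : (fun x => _) = trunc n f - lc cscale mdi (s n)); last first.
    by apply/funext => x; rewrite /cscale mulN1r.
  apply: Fi_bound; first by apply: sqintB; [exact: sqint_trunc|exact: sqint_lc].
  move=> x xn; transitivity (trunc n f x - lc cscale mdi (s n) x); first by [].
  by rewrite trunc_out // s1 // subr0.
have E : Fi (trunc n f) xi = cInt mu (trunc n (fun x => f x * (chi (xi * x))^*)).
  by rewrite FiE; apply: cInt_eq => x; rewrite /trunc mulrAC.
rewrite (_ : _ - _ = - (Fi (trunc n f) xi - Fi (lc cscale mdi (s n)) xi) + (Fi (trunc n f) xi - Fi f xi)).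
  apply: le_lt_trans (abs2D_le _ _) _; rewrite abs2N.
  by move: A C; rewrite E FiE; lra.
by rewrite opprB addrA subrK.
Qed.

Lemma abs2_sub_cvg (u : nat -> R[i]) (v : R[i]) :
  (forall e : R, 0 < e -> exists N, forall n, (N <= n)%N -> abs2 (u n - v) < e) ->
  (Re (u n) @[n --> \oo] --> Re v) /\ (Im (u n) @[n --> \oo] --> Im v).
Proof.
move=> H; have gcvg (g : R[i] -> R) : (forall z w, g w - g z = - g (z - w)) ->
    (forall z, `|g z| <= Num.sqrt (abs2 z)) -> g (u n) @[n --> \oo] --> g v.
  move=> gB g2; apply/cvgrPdist_lt => e e0.
  have [N HN] := H _ (exprn_gt0 2 e0); exists N => // n /= /HN un.
  rewrite gB normrN; apply: le_lt_trans (g2 _) _.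
  by rewrite -[e]ger0_norm ?ltW // -sqrtr_sqr ltr_sqrt // exprn_gt0.
split; apply: gcvg; do ?[exact: abs_Re_le|exact: abs_Im_le] => -[a b] [a' b'] /=; by rewrite opprB.
Qed.

(** Fatou's lemma along the approximating steps, whose transforms obey Plancherel's
    formula. *)
Lemma Fi_sqint f : sqint mu f -> L1f f ->
  cmeas (Fi f : borel K -> _) /\ (sqnorm mu (Fi f) <= 4%:E * sqnorm mu f)%E.
Proof.
move=> sf lf; have K1 eta : 0 < eta ->
    cmeas (Fi f : borel K -> _) /\ (sqnorm mu (Fi f) <= 4%:E * sqnorm mu f + (4 * eta)%:E)%E.
  move=> eta0; have [s sE] := approx_steps sf eta0.
  have cv xi := abs2_sub_cvg (Fi_cvg xi sf lf eta0 sE).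
  have mF n : cmeas (Fi (lc cscale mdi (s n)) : borel K -> _).
    by rewrite Fi_lc; exact: (proj1 (lc_S HK (s n) sqint_Fmd)).
  have mf : cmeas (Fi f : borel K -> _).
    split.
      apply: (@measurable_fun_cvg _ _ R setT (fun n (x : borel K) => Re (Fi (lc cscale mdi (s n)) x))).
        by move=> n; exact: (proj1 (mF n)).
      by move=> x _; exact: (proj1 (cv x)).
    apply: (@measurable_fun_cvg _ _ R setT (fun n (x : borel K) => Im (Fi (lc cscale mdi (s n)) x))).
      by move=> n; exact: (proj2 (mF n)).
    by move=> x _; exact: (proj2 (cv x)).
  split => //.
  apply: (@fatou_bound _ _ _ mu (fun n x => (abs2 (Fi (lc cscale mdi (s n)) x))%:E) (fun x => (abs2 (Fi f x))%:E)).
  - by move=> n; exact: emeasurable_abs2.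
  - by move=> n x; rewrite lee_fin abs2_ge0.
  - move=> x; apply/cvg_EFin; first by near=> n.
    exact: (cvgD (cvgM (proj1 (cv x)) (proj1 (cv x))) (cvgM (proj2 (cv x)) (proj2 (cv x)))).
  - move=> n; have [_ _ sn] := sE n.
    have sl : sqint mu (lc cscale mdi (s n)) by exact: sqint_lc.
    have st : sqint mu (trunc n f) by exact: sqint_trunc.
    have -> : (\int[mu]_x (abs2 (Fi (lc cscale mdi (s n)) x))%:E = (nsq (inn mu) (lc cscale mdi (s n)))%:E)%E.
      rewrite -(nsq_lc HK sqint_mdi sqint_Fmd plancherel_mdi) nsq_fine -?Fi_lc //.
      rewrite Fi_lc; exact: (lc_S HK (s n) sqint_Fmd).
    have := sqnorm_trunc n (proj1 sf); rewrite -!nsq_fine // lee_fin -EFinM -EFinD lee_fin => T.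
    have sB : sqint mu (trunc n f - lc cscale mdi (s n)) by exact: (phB HK).
    have := nsqD_le HK st (phN HK sB); rewrite (nsqN HK sB) opprB addrCA subrr addr0.
    by move: sn T; have := nsq_ge0 HK sf; lra.
have [mf _] := K1 1 ltr01; split => //.
apply/lee_addgt0Pr => e e0; have [_] := K1 (e / 4) ltac:(by rewrite divr_gt0).
by congr (_ <= _ + _%:E)%E; lra.
Unshelve. all: end_near. Qed.

(** A combination of modulated indicators close to [f] has a transform close to [Fi f],
    by [Fi_sqint] applied to the difference. *)
Lemma FT_Fi f : sqint mu f -> L1f f -> FT f (Fi f).
Proof.
move=> sf lf; have sF : sqint mu (Fi f).
  have [mf bf] := Fi_sqint sf lf; split => //; apply: le_lt_trans bf _.
  by rewrite lte_mul_pinfty // ?sqnorm_ge0 // (proj2 sf).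
split => // d d0; have [s sE] := cspan_lc (cspan_mdi sf) (divr_gt0 d0 (ltr0n _ 4 : 0 < 4)).
exists s; have sB : sqint mu (f - lc cscale mdi s) by apply: (phB HK) => //; exact: sqint_lc.
have lN : L1f (cscale (-1) (lc cscale mdi s)) by apply: L1fZ; exact: L1f_lc.
have lB : L1f (f - lc cscale mdi s).
  rewrite (_ : f - _ = fun x => f x + cscale (-1) (lc cscale mdi s) x); first exact: L1fD.
  by apply/funext => x; rewrite /cscale mulN1r.
have [mB bB] := Fi_sqint sB lB.
have E : Fi f - lc cscale Fmd s = Fi (f - lc cscale mdi s).
  apply/funext => xi; rewrite -Fi_lc; transitivity (Fi f xi - Fi (lc cscale mdi s) xi); first by [].
  rewrite -mulN1r -FiZ; last exact: L1f_lc.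
  rewrite -FiD //; congr (Fi _ _); apply/funext => x; by rewrite /cscale mulN1r.
split; first by apply: lt_le_trans sE _; rewrite ler_pdivrMr // ler_peMr ?ler1n // ltW.
have sFB : sqint mu (Fi (f - lc cscale mdi s)).
  by split => //; apply: le_lt_trans bB _; rewrite lte_mul_pinfty // ?sqnorm_ge0 // (proj2 sB).
rewrite E -lte_fin nsq_fine //; apply: le_lt_trans bB _.
by rewrite -nsq_fine // -EFinM lte_fin -ltr_pdivlMl // mulrC.
Qed.

Lemma L2P f : L2 mu f <-> sqint mu f.
Proof. by split=> -[mf lf]; split => //; exact/Lnorm2_lty. Qed.

Lemma L1P f : L1 mu f <-> L1f f.
Proof.
have E := Lnorm1E mu f; split=> -[mf lf]; split => //; first by rewrite -E.
by rewrite /cLnorm E.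
Qed.

Lemma L2dist_lt f g (e : R) : 0 < e -> (L2dist mu f g < e%:E)%E <-> (sqnorm mu (fun x => f x - g x)%R < (e ^+ 2)%:E)%E.
Proof. by move=> e0; exact: Lnorm2_lt. Qed.

Lemma L2dist_cvg0 (f_ : nat -> K -> R[i]) f : (fun n => L2dist mu (f_ n) f) @ \oo --> 0%E ->
  forall d : R, 0 < d -> \forall n \near \oo, (sqnorm mu (fun x => f_ n x - f x)%R < d%:E)%E.
Proof.
move=> H d d0; have s0 : 0 < Num.sqrt d by rewrite sqrtr_gt0.
have : \forall n \near \oo, (L2dist mu (f_ n) f < (Num.sqrt d)%:E)%E.
  apply: (H [set y | (y < (Num.sqrt d)%:E)%E]); apply: open_nbhs_nbhs; split; first exact: open_ereal_lt_ereal.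
  by rewrite /= lte_fin.
by apply: filterS => n /(L2dist_lt _ _ s0); rewrite sqr_sqrtr // ltW.
Qed.

Lemma FT_of_fourier f g : sqint mu f -> is_fourier mu chi f g -> FT f g.
Proof.
move=> sf [/L2P sg [f_ [lf /L2dist_cvg0 cf /L2dist_cvg0 cg]]].
apply: (uext_closed HK sqint_mdi sqint_Fmd) => // d d0.
have [N1 _ H1] := cf _ d0; have [N2 _ H2] := cg _ d0; pose n := maxn N1 N2.
have [/L1P l1 /L2P l2] := lf n.
have F := FT_Fi l2 l1; have [_ sF] := FT_sqint F.
exists (f_ n), (Fi (f_ n)); split => //.
  rewrite (nsqC HK) // -lte_fin nsq_fine; last exact: (phB HK).
  by apply: H1; exact: leq_maxl.
rewrite (nsqC HK) // -lte_fin nsq_fine; last exact: (phB HK).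
by apply: H2; exact: leq_maxr.
Qed.

Lemma is_fourier_FT f g : FT f g -> is_fourier mu chi f g.
Proof.
move=> [sf sg fg]; split; first exact/L2P.
have d0 n : 0 < (n.+1%:R^-1 : R) ^+ 2 by rewrite exprn_gt0 // invr_gt0.
have [s sE] := choice (fun n => fg _ (d0 n)).
exists (fun n => lc cscale mdi (s n)); split.
- by move=> n; split; [apply/L1P; exact: L1f_lc|apply/L2P; exact: sqint_lc].
- apply: (@squeeze_cvge _ _ _ _ (fun=> 0%E) _ (fun n => (n.+1%:R^-1)%:E)).
  + apply: nearW => n; apply/andP; split; first exact: Lnorm_ge0.
    apply: ltW; apply/(L2dist_lt _ _ (_ : 0 < n.+1%:R^-1)); first by rewrite invr_gt0.
    rewrite -nsq_fine; last by apply: (phB HK) => //; exact: sqint_lc.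
    by rewrite lte_fin (nsqC HK) ?(proj1 (sE n)) //; exact: sqint_lc.
  + exact: cvg_cst.
  + by apply: cvg_EFin; [exact: nearW|exact: cvg_harmonic].
- apply: (@squeeze_cvge _ _ _ _ (fun=> 0%E) _ (fun n => (n.+1%:R^-1)%:E)).
  + apply: nearW => n; apply/andP; split; first exact: Lnorm_ge0.
    apply: ltW; apply/(L2dist_lt _ _ (_ : 0 < n.+1%:R^-1)); first by rewrite invr_gt0.
    have sl := lc_S HK (s n) sqint_Fmd.
    rewrite Fi_lc -nsq_fine; last exact: (phB HK).
    by rewrite lte_fin (nsqC HK) ?(proj2 (sE n)).
  + exact: cvg_cst.
  + by apply: cvg_EFin; [exact: nearW|exact: cvg_harmonic].
Qed.

(** [FT_exists] and [is_fourier_FT] give the choice something to choose from, and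
    [FT_of_fourier] recognizes whatever is chosen. *)
Lemma fourierP f : sqint mu f -> FT f (fourier mu chi f).
Proof.
move=> sf; have [g fg] := FT_exists sf; apply: FT_of_fourier => //.
by rewrite /fourier; apply: (xgetPex (fun=> 0)); exists g; exact: is_fourier_FT.
Qed.

(** ** Affine covariance *)

(** The transform of [fun x => f (a * x + b)] when [g] is the transform of [f]. The term
    [+ 0] gives the argument the affine form of the change of variables. *)
Definition affF (a b : K) (g : K -> R[i]) : K -> R[i] :=
  fun xi => (absv a)^-1%:C * chi (xi * (b / a)) * g (a^-1 * xi + 0).

Lemma abs2_affF a b g xi : abs2 (affF a b g xi) = (absv a)^-1 ^+ 2 * abs2 (g (a^-1 * xi + 0)).
Proof. by rewrite /affF !abs2M chi_abs2 mulr1 abs2_real. Qed.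

Lemma sqint_affF a b g : a != 0 -> sqint mu g ->
  sqint mu (affF a b g) /\ sqnorm mu (affF a b g) = ((absv a)^-1%:E * sqnorm mu g)%E.
Proof.
move=> a0 sg; have aV0 : a^-1 != 0 by rewrite invr_eq0.
have E : sqnorm mu (affF a b g) = ((absv a)^-1%:E * sqnorm mu g)%E.
  transitivity (\int[mu]_x ((absv a)^-1 ^+ 2 * abs2 (g (a^-1 * x + 0)))%:E)%E.
    by apply: eq_integral => x _; rewrite abs2_affF.
  have -> := @sqnorm_cst_mul _ _ _ mu ((absv a)^-1 ^+ 2) (fun x => g (a^-1 * x + 0)) _ _.
  - have := @sqnorm_affine a^-1 0 g aV0 (proj1 sg); rewrite /sqnorm => ->.
    by rewrite muleA -EFinM absvV invrK expr2 mulrAC -mulrA mulfV ?mulr1 // gt_eqF // absv_gt0.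
  - by rewrite exprn_ge0 // invr_ge0 absv_ge0.
  - exact: (cmeas_affine a^-1 0 (proj1 sg)).
split => //; split; last by rewrite E lte_mul_pinfty // ?sqnorm_ge0 ?(proj2 sg) // lee_fin invr_ge0 absv_ge0.
apply: cmeasM; last exact: (cmeas_affine a^-1 0 (proj1 sg)).
apply: cmeasM; first exact: cmeas_cst.
rewrite (_ : (fun x => _) = (fun x => chi ((b / a) * x))); first exact: cmeas_chi.
by apply/funext => x; rewrite mulrC.
Qed.

Lemma L1f_affine a b f : a != 0 -> L1f f -> L1f (fun x => f (a * x + b)).
Proof.
move=> a0 [mf lf]; split; first exact: (cmeas_affine a b mf).
rewrite (@ge0_integral_affine a b (fun y => (Num.sqrt (abs2 (f y)))%:E)) //.
- by rewrite lte_mul_pinfty // lee_fin invr_ge0 absv_ge0.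
- by apply/measurable_EFinP; exact: measurable_normc.
Qed.

Lemma Fi_affine a b f : a != 0 -> L1f f -> Fi (fun x => f (a * x + b)) = affF a b (Fi f).
Proof.
move=> a0 lf; apply/funext => xi; rewrite /affF !FiE addr0.
pose h x := f x * (chi (a^-1 * xi * x))^*.
have := @cInt_affine a b h a0 (cintegrable_chi _ lf); rewrite -/h => E.
rewrite mulrAC -E mulrC -cIntZ; last exact: (@cintegrable_affine a b h a0 (cintegrable_chi _ lf)).
apply: cInt_eq => x; rewrite /cscale /h mulrCA; congr (_ * _).
rewrite !conj_opE -!chiN -chiD; congr chi.
by rewrite mulrDr opprD; field.
Qed.

Lemma FT_affine a b f g : a != 0 -> FT f g -> FT (fun x => f (a * x + b)) (affF a b g).
Proof.
move=> a0; apply: (uext_map HK sqint_mdi sqint_Fmd (A := fun f x => f (a * x + b)) (A' := affF a b) (C := (absv a)^-1)).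
- by move=> h; exact: sqint_affine.
- by move=> h /(sqint_affF b a0)[].
- by [].
- by move=> h1 h2; apply/funext => x; rewrite /affF -mulrDr.
- by [].
- by move=> k h; apply/funext => x; rewrite /affF /cscale mulrCA.
- move=> h sh; rewrite -lee_fin EFinM !nsq_fine //; last exact: sqint_affine.
  by rewrite (sqnorm_affine _ a0 (proj1 sh)).
- move=> h sh; have [s1 s2] := sqint_affF b a0 sh.
  by rewrite -lee_fin EFinM !nsq_fine // s2.
- move=> i; rewrite -Fi_affine //; last exact: L1f_mdi.
  by apply: FT_Fi; [apply: sqint_affine => //; exact: sqint_mdi|apply: L1f_affine => //; exact: L1f_mdi].
Qed.

(** * Characters of the integer ring and Parseval on disks *)

Lemma uu_absv n k : (k < q ^ n)%N = (absv (uu k * varpi ^+ n) <= 1).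
Proof.
have v0 := varpiX_neq0 n; rewrite absvM -ler_pdivlMr ?absv_gt0 // mul1r -absvV.
by apply/idP/idP => [|H]; [exact: absv_uu|exact: uu_lt].
Qed.

(** The first [q ^ n] elements of [Lam] form a group, in which adding [uu k0] is a
    permutation; sums over this group can be reindexed. *)
Lemma uu_shift n (k0 : 'I_(q ^ n)) : exists2 s : 'I_(q ^ n) -> 'I_(q ^ n), bijective s &
  forall k, uu (s k) = uu k0 + uu k.
Proof.
have [s sE] : exists s : 'I_(q ^ n) -> 'I_(q ^ n), forall k, uu (s k) = uu k0 + uu k.
  suff /choice[s sE] : forall k : 'I_(q ^ n), exists j : 'I_(q ^ n), uu j = uu k0 + uu k by exists s.
  move=> k; have [j _ jE] := LamD (ex_intro2 _ _ (k0 : nat) I erefl) (ex_intro2 _ _ (k : nat) I erefl).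
  have jn : (j < q ^ n)%N.
    rewrite uu_absv jE mulrDl; apply: absv_ultra_le; rewrite -uu_absv //.
  by exists (Ordinal jn).
exists s => //; apply: injF_bij => k k' /(congr1 (fun i : 'I_(q ^ n) => uu i)).
by rewrite !sE => /addrI/uu_inj/val_inj.
Qed.

(** A nontrivial character makes the sum invariant under multiplication by one of its
    values other than 1. *)
Lemma sum_chi n y : absv y <= 1 ->
  \sum_(k < q ^ n) chi (uu k * y) = if absv y <= absv (varpi ^+ n) then (q ^ n)%:R else 0.
Proof.
move=> y1; have v0 := varpiX_neq0 n; case: ifPn => yn.
  rewrite (eq_bigr (fun=> 1)); first by rewrite sumr_const card_ord.
  move=> k _; apply: chi_int; have := ltn_ord k; rewrite uu_absv !absvM => H.
  by apply: le_trans H; rewrite ler_wpM2l // absv_ge0.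
have y0 : 1 < absv (y * varpi ^- n).
  by rewrite absvM absvV ltr_pdivlMr ?absv_gt0 // mul1r ltNge.
have [z z1 zn] := chi_nontrivial y0.
have [k0 k0n k0E] : exists2 k, (k < q ^ n)%N & absv (varpi ^- n * z - uu k) <= 1.
  by apply: Lam_cover; rewrite absvM ler_piMr // absv_ge0.
have c1 : chi (uu k0 * y) != 1.
  apply: contra_neq zn => <-; apply: chi_loc.
  rewrite (_ : _ - _ = y * (varpi ^- n * z - uu k0)); last by ring.
  by rewrite absvM mulr_ile1 // absv_ge0.
have [s bs sE] := uu_shift (Ordinal k0n).
apply: (mulfI (_ : chi (uu k0 * y) - 1 != 0)); first by rewrite subr_eq0.
rewrite mulr0 mulrBl mul1r mulr_sumr; apply/eqP; rewrite subr_eq0; apply/eqP.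
rewrite [RHS](reindex s) /=; last exact: onW_bij.
by apply: eq_bigr => k _; rewrite sE mulrDl chiD.
Qed.

Lemma absv_value t : t != 0 -> absv t <= 1 -> exists n, absv t = absv (varpi ^+ n).
Proof.
move=> t0 t1; have ex : exists n, absv (varpi ^+ n) < absv t by apply: varpiX_small; exact: absv_gt0.
case: (ex_minnP ex) => -[|n] nt nmin; first by rewrite expr0 absv1 ltNge t1 in nt.
exists n; apply/eqP; rewrite eq_le; apply/andP; split.
  rewrite leNgt; apply/negP => nt'; by have := nmin n nt'; rewrite ltnn.
rewrite leNgt; apply/negP => nt'; have tn := varpiX_neq0 n.
have : absv (t * varpi ^- n) < 1.
  by rewrite absvM absvV ltr_pdivrMr ?absv_gt0 // mul1r.
move/absv_lt1; rewrite absvM absvV ler_pdivrMr ?absv_gt0 // -absvM -exprS => le.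
by move: nt; rewrite ltNge le.
Qed.

Definition disk_chars b s : set (K -> R[i]) := range (fun k => mdisk b s (uu k / s)).

Lemma disk_chars_sqint b s h : s != 0 -> disk_chars b s h -> sqint mu h.
Proof. by move=> s0 [k _ <-]; exact: sqint_mdisk. Qed.

(** By [sum_chi], the indicator of a smaller disk is a combination of characters of the
    larger one; the frequency [beta] is absorbed by a translation in [Lam]. *)
Lemma cspan_disk_mdisk b s a r beta : s != 0 -> r != 0 -> absv r <= absv s -> absv (a - b) <= absv s ->
  csp (disk_chars b s) (mdisk a r beta).
Proof.
move=> s0 r0 rs ab; have [|n nE] := @absv_value (r / s) (mulf_neq0 r0 (invr_neq0 s0)).
  by rewrite absvM absvV ler_pdivrMr ?absv_gt0 // mul1r.
have [N Nb] := varpiX_large (absv (beta * s)).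
have [l _ lE] := Lam_cover (ltW Nb).
pose d := beta * s - uu l.
have [f fE] : exists f : 'I_(q ^ n) -> nat, forall k, uu (f k) = uu k + uu l.
  suff /choice[f fE] : forall k : 'I_(q ^ n), exists j, uu j = uu k + uu l by exists f.
  by move=> k; have [j _ jE] := LamD (ex_intro2 _ _ (k : nat) I erefl) (ex_intro2 _ _ l I erefl); exists j.
have qn0 : (q ^ n)%:R != 0 :> R[i] by rewrite pnatr_eq0 -lt0n expn_gt0 (ltnW (q_gt1 c_gt0)).
pose co (k : 'I_(q ^ n)) := (q ^ n)%:R^-1 * chi (- (uu k * (a / s))) * chi (d * (b / s)).
have -> : mdisk a r beta = \sum_(k < q ^ n) cscale (co k) (mdisk b s (uu (f k) / s)).
  apply/funext => x; rewrite fct_sumE /mdisk indE.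
  under eq_bigr do rewrite /cscale indE mulrA.
  rewrite -mulr_suml; have [xb|xb] := boolP (absv (x - b) <= absv s); last first.
    rewrite mulr0 ifN ?mulr0 //; apply: contra xb => xa.
    by rewrite -(subrK a x) -addrA; apply: absv_ultra_le => //; exact: le_trans rs.
  rewrite mulr1; have E : beta * x = uu l * (x / s) + d * (x / s) by rewrite -mulrDl addrC subrK mulrA -(mulrA beta) (mulrC s) -mulrA mulfK.
  have dE : chi (d * (x / s)) = chi (d * (b / s)).
    apply: chi_loc; rewrite -mulrBr -mulrBl absvM mulr_ile1 ?absv_ge0 //.
    by rewrite absvM absvV ler_pdivrMr ?absv_gt0 // mul1r.
  rewrite E chiD dE.
  transitivity (chi (uu l * (x / s)) * chi (d * (b / s)) * ((q ^ n)%:R^-1 * \sum_(k < q ^ n) chi (uu k * ((x - a) / s)))).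
    rewrite sum_chi; last first.
      rewrite absvM absvV ler_pdivrMr ?absv_gt0 // mul1r.
      rewrite (_ : x - a = (x - b) + - (a - b)); last by rewrite opprB addrA subrK.
      by apply: absv_ultra_le => //; rewrite absvN.
    rewrite -nE !absvM absvV ler_pM2r ?invr_gt0 ?absv_gt0 //.
    by case: ifP => _; rewrite ?mulr0 // mulVf.
  rewrite !mulr_sumr; apply: eq_bigr => k _; rewrite fE /co.
  rewrite (_ : uu k * ((x - a) / s) = uu k * (x / s) + - (uu k * (a / s))); last by ring.
  rewrite (_ : (uu k + uu l) / s * x = uu k * (x / s) + uu l * (x / s)); last by ring.
  by rewrite !chiD; ring.
apply: (cspan_comb HK); first by move=> h; exact: disk_chars_sqint.
  by move=> k; exact: sqint_mdisk.
move=> k; apply: (cspan_mem HK); [exact: cscale1|exact: sqint_mdisk|].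
by exists (f k).
Qed.

Lemma restr_mdisk b s a r beta : s != 0 -> r != 0 -> csp (disk_chars b s) (restr (disk b s) (mdisk a r beta)).
Proof.
move=> s0 r0; have E x : restr (disk b s) (mdisk a r beta) x = chi (beta * x) * (\1_(disk a r `&` disk b s) x)%:C.
  by rewrite /restr /mdisk -mulrA; congr (_ * _); rewrite /ind indicI rmorphM.
case/orP: (le_total (absv r) (absv s)) => rs.
  rewrite disk_cap // in E; case: ifPn E => ab E.
    rewrite (_ : restr _ _ = mdisk a r beta); first exact: cspan_disk_mdisk.
    by apply/funext => x; rewrite E.
  rewrite (_ : restr _ _ = (0 : K -> R[i])); first exact: (cspan0 HK).
  by apply/funext => x; rewrite E indic0 mulr0.
rewrite setIC disk_cap // in E; case: ifPn E => ab E.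
  rewrite (_ : restr _ _ = mdisk b s beta); last by apply/funext => x; rewrite E.
  by apply: cspan_disk_mdisk => //; rewrite subrr absv0 absv_ge0.
rewrite (_ : restr _ _ = (0 : K -> R[i])); first exact: (cspan0 HK).
by apply/funext => x; rewrite E indic0 mulr0.
Qed.

(** Restriction is a contraction, so it carries closed spans into closed spans. *)
Lemma cspan_restr (A : set (borel K)) E E' f : measurable A ->
  (forall h, E h -> sqint mu h) -> (forall h, E' h -> sqint mu h) -> sqint mu f ->
  (forall h, E h -> csp E' (restr A h)) -> csp E f -> csp E' (restr A f).
Proof.
move=> mA ES ES' sf EE' cf; apply: (cspan_closed HK ES' (sqint_restr mA sf)) => e e0.
have [n [a [g [gE gd]]]] := cf e e0.
have sg i : sqint mu (g i) by apply: ES.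
have srg i : sqint mu (restr A (g i)) by exact: sqint_restr.
have S1 : sqint mu (\sum_(i < n) cscale (a i) (g i)) by apply: (ph_sum HK) => i _; exact: sqintZ.
have S2 : sqint mu (\sum_(i < n) cscale (a i) (restr A (g i))) by apply: (ph_sum HK) => i _; exact: sqintZ.
exists (\sum_(i < n) cscale (a i) (restr A (g i))); split => //.
  by apply: (cspan_comb HK) => // i; exact: EE'.
apply: le_lt_trans gd; rewrite -lee_fin !nsq_fine; try (by apply: (phB HK)); last first.
  by apply: (phB HK) => //; exact: sqint_restr.
have sB : sqint mu (f - \sum_(i < n) cscale (a i) (g i)) by exact: (phB HK).
have -> : restr A f - \sum_(i < n) cscale (a i) (restr A (g i)) = restr A (f - \sum_(i < n) cscale (a i) (g i)).
  apply/funext => x; rewrite /restr.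
  transitivity (f x * (\1_A x)%:C - \sum_(i < n) a i * (g i x * (\1_A x)%:C)).
    by congr (_ - _); rewrite fct_sumE.
  transitivity ((f x - \sum_(i < n) a i * g i x) * (\1_A x)%:C); last first.
    by congr (_ * _); congr (_ - _); rewrite fct_sumE.
  by rewrite mulrBl mulr_suml; congr (_ - _); apply: eq_bigr => i _; rewrite mulrA.
exact: sqnorm_restr_le mA (proj1 sB).
Qed.

Lemma cspan_disk_chars b s f : s != 0 -> sqint mu f -> csp (disk_chars b s) (restr (disk b s) f).
Proof.
move=> s0 sf; apply: (@cspan_restr _ (range mdi)) (cspan_mdi sf) => //.
- exact: measurable_disk.
- exact: range_mdi_sqint.
- by move=> h; exact: disk_chars_sqint.
- by move=> h [[[[a r] be] /= r0] _ <-]; exact: restr_mdisk.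
Qed.

Lemma inn_disk_chars b s k k' : s != 0 ->
  inn mu (mdisk b s (uu k / s)) (mdisk b s (uu k' / s)) = (k == k')%:R * (absv s)%:C.
Proof.
move=> s0; rewrite inn_mdisk // subrr absv0 absv_ge0 /= -mulrBl mulfVK //.
have [->|kk'] := eqVneq k k'.
  by rewrite !subrr mul0r absv0 ler01 mul0r chi0 mul1r.
rewrite ifN ?mul0r //; apply: contra kk' => /Lam_int0 E; apply/eqP/uu_inj/eqP.
rewrite -subr_eq0; apply/eqP; apply: E; apply: LamD; first by exists k.
by apply: LamN; exists k'.
Qed.

(** On the disk, the characters of frequency [uu k / s] form an orthogonal basis, all of
    squared norm [absv s]. *)
Lemma parseval_disk b s f : s != 0 -> sqint mu f ->
  (\esum_(k in [set: nat]) (abs2 (inn mu (restr (disk b s) f) (mdisk b s (uu k / s))))%:E =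
   (absv s)%:E * sqnorm mu (restr (disk b s) f))%E.
Proof.
move=> s0 sf; have mD : measurable (disk b s : set (borel K)) by exact: measurable_disk.
have sr := sqint_restr mD sf; pose r := Num.sqrt (absv s)^-1.
have as0 : 0 < absv s by exact: absv_gt0.
have rE : r * r = (absv s)^-1 by rewrite -expr2 sqr_sqrtr // invr_ge0 ltW.
pose e k := cscale r%:C (mdisk b s (uu k / s)).
have se k : sqint mu (e k) by apply: sqintZ; exact: sqint_mdisk.
have oe : orthonormal (sqint mu) (inn mu) e.
  split => // k k'; rewrite /e (ph_ipZ HK) ?(ipZr HK) //; try exact: sqint_mdisk; try exact: se.
  rewrite inn_disk_chars // ?conj_opE conjc_real mulrA -rmorphM rE mulrCA -rmorphM mulVf ?(gt_eqF as0) //.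
  by rewrite mulr1.
have ce : csp (range e) (restr (disk b s) f).
  apply: (cspan_trans HK _ _ sr _ (cspan_disk_chars b s0 sf)).
  - by move=> h; exact: disk_chars_sqint.
  - by move=> h [k _ <-].
  - move=> h [k _ <-]; have r0 : r%:C != 0 :> R[i].
      by rewrite fmorph_eq0 gt_eqF // sqrtr_gt0 invr_gt0.
    rewrite (_ : mdisk b s _ = cscale r%:C^-1 (e k)); last first.
      by apply/funext => x; rewrite /e /cscale mulrA mulVf // mul1r.
    apply: (cspanZ HK) => //; first by move=> h' [k' _ <-].
    by apply: (cspan_mem HK); [exact: cscale1|exact: se|exists k].
have := cspan_parseval HK oe sr ce; rewrite nsq_fine // => <-.
rewrite /energy -esumZl ?ltW //; last by move=> i; rewrite lee_fin abs2_ge0.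
apply: eq_esum => k _; rewrite (ipZr HK) //; last exact: sqint_mdisk.
by rewrite abs2M ?conj_opE conjc_real abs2_real expr2 rE -EFinM mulrA mulfV ?mul1r // gt_eqF.
Qed.

(** * Periodic sets and averaging over characters *)

(** Multiplication by a character: a translation, seen on the Fourier side. *)
Definition modl (b : K) (g : K -> R[i]) : K -> R[i] := fun x => chi (b * x) * g x.

Lemma abs2_modl b g x : abs2 (modl b g x) = abs2 (g x).
Proof. by rewrite /modl abs2M chi_abs2 mul1r. Qed.

Lemma sqint_modl b g : sqint mu g -> sqint mu (modl b g).
Proof.
move=> [mg lg]; split; first by apply: cmeasM => //; exact: cmeas_chi.
rewrite (_ : sqnorm _ _ = sqnorm mu g) //; apply: eq_integral => x _; by rewrite abs2_modl.
Qed.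

Lemma inn_modl b g h : inn mu (modl b g) h = inn mu g (modl (- b) h).
Proof.
apply: cInt_eq => x; rewrite /modl !conj_opE conjcM ?conj_opE mulNr chiN conjcK.
by rewrite mulrCA mulrA.
Qed.

Lemma modlK b g : modl (- b) (modl b g) = g.
Proof. by apply/funext => x; rewrite /modl mulrA -chiD mulNr addrC subrr chi0 mul1r. Qed.

Lemma inn_modl2 b g h : inn mu (modl b g) (modl b h) = inn mu g h.
Proof. by rewrite inn_modl modlK. Qed.

(** The disk [disk a s] made periodic under [Lam]. *)
Definition pset (a s : K) : set K := [set x | exists k, disk (a + uu k) s x].

Lemma pset_bigcup a s : pset a s = \bigcup_k disk (a + uu k) s.
Proof. by apply/seteqP; split => x [k]; [exists k|move=> _ H; exists k]. Qed.

Lemma measurable_pset a s : s != 0 -> measurable (pset a s : set (borel K)).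
Proof. by move=> s0; rewrite pset_bigcup; apply: bigcup_measurable => k _; exact: measurable_disk. Qed.

Lemma coset_cover x : exists2 k, True & absv (x - uu k) <= 1.
Proof.
have [N /ltW/Lam_cover[k _ H]] := varpiX_large (absv x).
by exists k.
Qed.

Lemma uuD k l : exists j, uu j = uu k + uu l.
Proof. by have [j _ jE] := LamD (ex_intro2 _ _ k I erefl) (ex_intro2 _ _ l I erefl); exists j. Qed.

Lemma uuN k : exists j, uu j = - uu k.
Proof. by have [j _ jE] := LamN (ex_intro2 _ _ k I erefl); exists j. Qed.

Lemma uuB_small k l : absv (uu k - uu l) <= 1 -> k = l.
Proof.
have [j jE] := uuN l; have [i iE] := uuD k j; rewrite -jE -iE => H.
have := Lam_int0 (ex_intro2 _ _ i I erefl) H; rewrite iE jE => /eqP.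
by rewrite subr_eq0 => /eqP/uu_inj.
Qed.

(** Representatives of the integer ring modulo the n-th power of the maximal ideal. *)
Definition rep n (t : 'I_(q ^ n)) : K := varpi ^+ n * uu t.
Arguments rep : clear implicits.

Lemma rep_int n t : absv (rep n t) <= 1.
Proof. by rewrite /rep mulrC -uu_absv. Qed.

Lemma rep_cover n x : absv x <= 1 -> exists t, absv (x - rep n t) <= absv (varpi ^+ n).
Proof.
move=> x1; have v0 := varpiX_neq0 n.
have [k kn kE] : exists2 k, (k < q ^ n)%N & absv (varpi ^- n * x - uu k) <= 1.
  by apply: Lam_cover; rewrite absvM ler_piMr // absv_ge0.
exists (Ordinal kn); rewrite /rep /= (_ : x - _ = varpi ^+ n * (varpi ^- n * x - uu k)).
  by rewrite absvM ler_piMr // absv_ge0.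
by rewrite mulrBr mulVKf.
Qed.

Lemma rep_inj n t t' : absv (rep n t - rep n t') <= absv (varpi ^+ n) -> t = t'.
Proof.
have v0 := varpiX_neq0 n; rewrite /rep -mulrBr absvM -ler_pdivlMl ?absv_gt0 // mulVf ?gt_eqF ?absv_gt0 //.
by move=> /uuB_small/val_inj.
Qed.

Local Notation per n t := (pset (rep n t) (varpi ^+ n)).

Lemma per_cover n x : exists t, per n t x.
Proof.
have [k _ xk] := coset_cover x; have [t tE] := rep_cover n xk.
by exists t, k; rewrite /disk /= (_ : x - _ = x - uu k - rep n t) //; ring.
Qed.

Lemma per_inj n t t' x : per n t x -> per n t' x -> t = t'.
Proof.
move=> [k xk] [k' xk']; rewrite /disk /= in xk xk'.
have E : absv ((rep n t' + uu k') - (rep n t + uu k)) <= absv (varpi ^+ n).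
  rewrite (_ : _ - _ = (x - (rep n t + uu k)) + - (x - (rep n t' + uu k'))); last by ring.
  by apply: absv_ultra_le => //; rewrite absvN.
have v1 := absv_varpiX_le1 n.
have kk : k' = k.
  apply: uuB_small; rewrite (_ : uu k' - uu k = ((rep n t' + uu k') - (rep n t + uu k)) + (rep n t + - rep n t')); last by ring.
  apply: absv_ultra_le; first exact: le_trans v1.
  by apply: absv_ultra_le; rewrite ?absvN rep_int.
move: E; rewrite kk (_ : _ - _ = rep n t' - rep n t); last by ring.
by move/rep_inj.
Qed.

Lemma chi_per n t x k : (k < q ^ n)%N -> per n t x -> chi (uu k * x) = chi (uu k * rep n t).
Proof.
move=> kn [j xj]; have -> : chi (uu k * rep n t) = chi (uu k * (rep n t + uu j)).
  by rewrite mulrDr chiD (chi_LamM (ex_intro2 _ _ k I erefl) (ex_intro2 _ _ j I erefl)) mulr1.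
apply: chi_loc; rewrite -mulrBr absvM; move: kn; rewrite uu_absv absvM => H.
by apply: le_trans H; rewrite ler_wpM2l // absv_ge0.
Qed.

(** Parseval's identity for the finite group formed by the first [q ^ n] elements of
    [Lam]. *)
Lemma finite_parseval n (co : 'I_(q ^ n) -> R[i]) :
  \sum_(k < q ^ n) abs2 (\sum_(t < q ^ n) chi (uu k * rep n t) * co t) =
  (q ^ n)%:R * \sum_(t < q ^ n) abs2 (co t).
Proof.
have E (k : 'I_(q ^ n)) : (abs2 (\sum_(t < q ^ n) chi (uu k * rep n t) * co t))%:C =
    \sum_(t < q ^ n) \sum_(t' < q ^ n) chi (uu k * (rep n t - rep n t')) * (co t * (co t')^*).
  rewrite -mulJ_abs2 rmorph_sum /= mulr_suml; apply: eq_bigr => t _.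
  rewrite mulr_sumr; apply: eq_bigr => t' _.
  by rewrite !conj_opE conjcM ?conj_opE -chiN mulrACA -chiD -mulrN -mulrDr.
apply: (@complexI R); rewrite rmorphM /= !rmorph_sum /= rmorph_nat.
under eq_bigr do rewrite E.
rewrite exchange_big /= mulr_sumr; apply: eq_bigr => t _.
rewrite exchange_big /= (bigD1 t) //= [X in _ + X]big1 ?addr0.
  under eq_bigr do rewrite subrr mulr0 chi0 mul1r.
  by rewrite sumr_const card_ord mulJ_abs2 mulr_natl.
move=> t' tt'; rewrite -mulr_suml sum_chi.
  by rewrite ifN ?mul0r //; apply: contra tt' => /rep_inj ->.
by apply: absv_ultra_le; rewrite ?absvN rep_int.
Qed.

Lemma restr_per_sum n g : g = \sum_(t < q ^ n) restr (per n t) g.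
Proof.
apply/funext => x; rewrite fct_sumE; have [t xt] := per_cover n x.
rewrite (bigD1 t) //= big1 ?addr0; first by rewrite /restr indicE mem_set ?mulr1.
move=> t' tt'; rewrite /restr indicE memNset ?mulr0 // => xt'.
by rewrite (per_inj xt xt') eqxx in tt'.
Qed.

Lemma modl_per_sum n k g : (k < q ^ n)%N ->
  modl (uu k) g = \sum_(t < q ^ n) cscale (chi (uu k * rep n t)) (restr (per n t) g).
Proof.
move=> kn; apply/funext => x; rewrite {1}(restr_per_sum n g) /modl !fct_sumE mulr_sumr.
apply: eq_bigr => t _; rewrite /cscale /restr indicE.
have [/set_mem xt|_] := boolP (x \in per n t); last by rewrite !mulr0.
by rewrite (chi_per kn xt).
Qed.

(** An energy invariant under the characters of [Lam] is additive on the periodic disks: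
    average the invariance over the first [q ^ n] elements of [Lam] and apply
    [finite_parseval] to each coefficient. *)
Lemma energy_per_split (I : choiceType) (e : I -> K -> R[i]) n g :
  (forall i, sqint mu (e i)) -> sqint mu g ->
  (forall k, energy (inn mu) e (modl (uu k) g) = energy (inn mu) e g) ->
  energy (inn mu) e g = (\sum_(t < q ^ n) energy (inn mu) e (restr (per n t) g))%E.
Proof.
move=> se sg inv; have v0 := varpiX_neq0 n.
have N0 : 0 < (q ^ n)%:R :> R by rewrite ltr0n expn_gt0 (ltnW (q_gt1 c_gt0)).
have sr t : sqint mu (restr (per n t) g) by apply: sqint_restr sg; exact: measurable_pset.
have iE i (k : 'I_(q ^ n)) : inn mu (modl (uu k) g) (e i) =
    \sum_(t < q ^ n) chi (uu k * rep n t) * inn mu (restr (per n t) g) (e i).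
  rewrite (modl_per_sum g (ltn_ord k)).
  rewrite (ip_suml HK) //; last by move=> t; exact: sqintZ.
  by apply: eq_bigr => t _; rewrite (ph_ipZ HK).
suff : ((q ^ n)%:R%:E * energy (inn mu) e g =
        (q ^ n)%:R%:E * \sum_(t < q ^ n) energy (inn mu) e (restr (per n t) g))%E.
  move=> /(congr1 (fun z => ((q ^ n)%:R^-1)%:E * z)%E).
  by rewrite !muleA -!EFinM mulVf ?gt_eqF // !mul1e.
transitivity (\sum_(k < q ^ n) energy (inn mu) e (modl (uu k) g))%E.
  under eq_bigr do rewrite inv.
  by rewrite sumr_const card_ord mule_natl.
rewrite /energy -esum_sum; last by move=> i k _ _; rewrite lee_fin abs2_ge0.
rewrite -(@esum_sum _ _ _ setT (index_enum 'I_(q ^ n)) xpredT (fun i t => (abs2 (inn mu (restr (per n t) g) (e i)))%:E)); last first.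
  by move=> i k _ _; rewrite lee_fin abs2_ge0.
rewrite -esumZl ?ltW //; last by move=> i; apply: sume_ge0 => t _; rewrite lee_fin abs2_ge0.
apply: eq_esum => i _; rewrite !sumEFin -EFinM; congr EFin.
by under eq_bigr do rewrite iE; exact: finite_parseval.
Qed.

(** * Small sets, periodization and uniqueness *)

Lemma mu_sub_disk (E : set (borel K)) b s : s != 0 -> measurable E -> E `<=` disk b s -> (mu E < +oo)%E.
Proof.
move=> s0 mE Eb; apply: (@le_lt_trans _ _ (mu (disk b s))); last by rewrite haar_disk // ltry.
by apply: le_measure; rewrite ?inE //; exact: measurable_disk.
Qed.

(** Sets inside a disk avoiding 0. The absolute value is constant on such a set, so that
    its dilates by powers of [varpi] are pairwise disjoint. *)
Definition small (E : set (borel K)) := measurable E /\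
  exists a s, [/\ s != 0, absv s <= 1, absv s < absv a & E `<=` disk a s].

Lemma small_norm E : small E -> exists2 r : R, 0 < r & forall x, E x -> absv x = r.
Proof.
move=> [_ [a [s [s0 _ sa Ea]]]]; exists (absv a).
  by apply: le_lt_trans sa; exact: absv_ge0.
move=> x /Ea xa; rewrite -(subrK a x) addrC; apply: absv_near.
exact: le_lt_trans sa.
Qed.

Lemma small_in_disk1 E : small E -> exists a, E `<=` disk a 1.
Proof.
move=> [_ [a [s [_ s1 _ Ea]]]]; exists a => x /Ea; rewrite /disk /= absv1.
by move=> /le_trans; apply.
Qed.

Lemma measurable_point0 : measurable ([set 0] : set (borel K)).
Proof.
rewrite -(setCK [set (0 : K)]); apply: measurableC; apply: open_measurable_borel.
by rewrite openC; apply: closed_point; case: K_local.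
Qed.

Lemma haar_point : mu [set (0 : K)] = 0%E.
Proof.
apply/eqP; rewrite eq_le measure_ge0 andbT; apply/lee_addgt0Pr => e e0; rewrite add0e.
have [n /ltW ne] := varpiX_small e0; have v0 := varpiX_neq0 n.
apply: (@le_trans _ _ (mu (disk 0 (varpi ^+ n)))); last by rewrite haar_disk // lee_fin.
by apply: le_measure; rewrite ?inE //; [exact: measurable_point0|exact: measurable_disk|move=> _ ->; exact: disk_center].
Qed.

Lemma small_sub E F : small E -> measurable F -> F `<=` E -> small F.
Proof.
by move=> [_ [a [s [s0 s1 sa Ea]]]] mF FE; split => //; exists a, s; split => // x /FE/Ea.
Qed.

(** The disks avoiding 0 form a base of the punctured field. *)
Lemma small_pieces : exists P : nat -> set (borel K),
  [/\ forall n, small (P n), trivIset setT P & \bigcup_n P n = ~` [set 0]].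
Proof.
have oA : open (~` [set (0 : K)]) by rewrite openC; apply: closed_point; case: K_local.
have [F [FD FE]] := disk_countable_base oA.
have sF n : small (F n).
  have [E|[a [m E]]] := FD n; rewrite E.
    split; first exact: measurable0.
    exists 1, varpi; rewrite varpi_neq0 absv1; have v1 := absv_varpi_lt1.
    by split => //; exact: ltW.
  have v0 := varpiX_neq0 m; split; first exact: measurable_disk.
  exists a, (varpi ^+ m); split => //.
    exact: absv_varpiX_le1.
  rewrite ltNge; apply/negP => am; have : (\bigcup_n F n) 0.
    by exists n => //; rewrite E /disk /= sub0r absvN.
  by rewrite -FE; apply.
exists (seqDU F); split.
- move=> n; apply: small_sub (sF n) _ _; last exact: subset_seqDU.
  by apply: seqDU_measurable => k; case: (sF k).
- exact: trivIset_seqDU.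
- by rewrite -seqDU_bigcup_eq FE.
Qed.

Lemma integral_small_split (f : borel K -> \bar R) (A : set (borel K)) (P : nat -> set (borel K)) :
  (forall n, small (P n)) -> trivIset setT P -> \bigcup_n P n = ~` [set 0] ->
  measurable_fun [set: borel K] f -> (forall x, (0 <= f x)%E) -> measurable A ->
  (\int[mu]_(x in A) f x = \sum_(0 <= n <oo) \int[mu]_(x in P n `&` A) f x)%E.
Proof.
move=> sP tP PE mf f0 mA.
rewrite (ge0_negligible_integral measurable_point0 mA) ?haar_point //; last exact: measurable_funTS mf.
have -> : A `\` [set 0] = \bigcup_n (P n `&` A).
  by rewrite -setI_bigcupl PE setDE setIC.
have mP n : measurable (P n) by case: (sP n).
rewrite ge0_integral_bigcup //.
- by move=> n; exact: measurableI.
- exact: measurable_funTS mf.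
- exact: trivIset_setIr.
Qed.

Lemma le_integral_small (f g : borel K -> \bar R) (A : set (borel K)) :
  measurable_fun [set: borel K] f -> (forall x, (0 <= f x)%E) ->
  measurable_fun [set: borel K] g -> (forall x, (0 <= g x)%E) ->
  (forall E, small E -> (\int[mu]_(x in E) f x <= \int[mu]_(x in E) g x)%E) ->
  measurable A -> (\int[mu]_(x in A) f x <= \int[mu]_(x in A) g x)%E.
Proof.
move=> mf f0 mg g0 fg mA; have [P [sP tP PE]] := small_pieces.
rewrite (integral_small_split sP tP PE mf f0 mA) (integral_small_split sP tP PE mg g0 mA).
apply: lee_nneseries => n _; first by move=> _; apply: integral_ge0.
apply: fg; apply: (small_sub (sP n)); last by move=> x [].
by apply: measurableI => //; case: (sP n).
Qed.

Definition small_indicators : set (K -> R[i]) :=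
  [set g | exists2 E, small E & g = fun x => (\1_E x)%:C].

Lemma small_indicators_sqint g : small_indicators g -> sqint mu g.
Proof.
move=> [E sE ->]; have [a Ea] := small_in_disk1 sE; case: sE => mE _.
by apply: sqint_indic => //; exact: mu_sub_disk (oner_neq0 _) mE Ea.
Qed.

(** The origin is a null set, and its complement is exhausted by finite unions of small
    sets. *)
Lemma cspan_small f : sqint mu f -> csp small_indicators f.
Proof.
move=> sf; apply: (cspan_trans HK (@indicators_sqint _ _ _ mu) small_indicators_sqint sf) (cspan_indicators sf).
move=> g [A [mA fA ->]]; have [P [sP tP PE]] := small_pieces.
have mP n : measurable (P n) by case: (sP n).
pose B n : set (borel K) := A `&` \big[setU/set0]_(i < n) P i.
have mB n : measurable (B n) by apply: measurableI => //; exact: bigsetU_measurable.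
have fB (C : set (borel K)) : measurable C -> (mu (A `&` C) < +oo)%E.
  by move=> mC; apply: le_lt_trans fA; apply: le_measure; rewrite ?inE //; exact: measurableI.
have BE : \bigcup_n B n = A `\` [set 0].
  rewrite -setI_bigcupr setDE -PE; congr (_ `&` _); apply/seteqP; split => x.
    by move=> [n _]; rewrite -bigcup_mkord => -[i _ xi]; exists i.
  by move=> [n _ xn]; exists n.+1 => //; rewrite -bigcup_mkord; exists n => /=.
have cB n : csp small_indicators (cindic (B n)).
  elim: n => [|n IH].
    rewrite (_ : (fun x => _) = (0 : K -> R[i])); first exact: (cspan0 HK).
    by apply/funext => x; rewrite /B big_ord0 setI0 indic0.
  have sAP : small (A `&` P n) by apply: small_sub (sP n) _ _; [exact: measurableI|move=> x []].
  have S1 : sqint mu (cindic (B n)).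
    by apply: sqint_indic => //; apply: fB; exact: bigsetU_measurable.
  have S2 : sqint mu (cindic (A `&` P n)).
    by apply: small_indicators_sqint; exists (A `&` P n).
  have c2 : csp small_indicators (cindic (A `&` P n)).
    by apply: (cspan_mem HK) => //; [exact: cscale1|exists (A `&` P n)].
  have := cspanD HK small_indicators_sqint S1 S2 IH c2.
  congr csp; apply/funext => x.
  transitivity ((\1_(B n) x)%:C + (\1_(A `&` P n) x)%:C : R[i]); first by [].
  rewrite -rmorphD /= /B big_ord_recr /= !indicE !in_setI in_setU.
  case: (x \in A); rewrite /= ?addr0 //.
  have [/set_mem xP|] := boolP (x \in P n); last by rewrite orbF addr0.
  suff -> : (x \in \big[setU/set0]_(i < n) P i) = false by rewrite add0r.
  apply: memNset; rewrite -bigcup_mkord => -[i /= ilt xi].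
  have E : n = i := tP n i I I (ex_intro _ x (conj xP xi)).
  by rewrite E ltnn in ilt.
have c0 : csp small_indicators (cindic (A `\` [set 0])).
  rewrite -BE; apply: cspan_indic_cvg => //.
  - exact: small_indicators_sqint.
  - move=> n m nm; apply/subsetPset => x [xA]; rewrite -bigcup_mkord => -[i /= im xi].
    by split => //; rewrite -bigcup_mkord; exists i => //=; exact: leq_trans nm.
  - rewrite -setI_bigcupr; apply: fB; apply: bigcup_measurable => n _; exact: bigsetU_measurable.
have mA0 : measurable (A `\` [set 0] : set (borel K)) by apply: measurableD => //; exact: measurable_point0.
have sA := sqint_indic mA fA.
have sA0 : sqint mu (cindic (A `\` [set 0])).
  by apply: sqint_indic => //; rewrite setDE; apply: fB; exact: measurableC measurable_point0.
apply: (cspan_closed HK small_indicators_sqint sA) => e e0.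
exists (cindic (A `\` [set 0])); split => //.
rewrite -lte_fin nsq_fine; last exact: (sqintB sA sA0).
apply: (@le_lt_trans _ _ (mu [set 0])); last by rewrite haar_point lte_fin.
rewrite -(sqnorm_indic mu measurable_point0); apply: ge0_le_integral => //.
- by move=> x _; rewrite lee_fin abs2_ge0.
- by apply: emeasurable_abs2; exact: (proj1 (sqintB sA sA0)).
- by apply: emeasurable_abs2; apply: cmeas_indic; exact: measurable_point0.
move=> x _; rewrite lee_fin.
rewrite (_ : (_ - _) x = (\1_A x)%:C - (\1_(A `\` [set 0]) x)%:C) //.
rewrite -rmorphB /= !abs2_real !indicE in_setD.
by case: (x \in A); case: (x \in [set 0]); rewrite /= ?subrr ?subr0 ?expr0n ?expr1n.
Qed.

(** ** Periodization *)

Lemma disk_unit_inj a k l s x : absv s <= 1 -> disk (a + uu k) s x -> disk (a + uu l) s x -> k = l.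
Proof.
move=> s1; rewrite /disk /= => xk xl; apply: uuB_small.
rewrite (_ : uu k - uu l = (x - (a + uu l)) + - (x - (a + uu k))); last by ring.
by apply: absv_ultra_le; rewrite ?absvN; exact: le_trans s1.
Qed.

Lemma integral_shift (A : set (borel K)) (f : borel K -> \bar R) (b : K) : measurable A ->
  measurable_fun [set: borel K] f -> (forall x, (0 <= f x)%E) ->
  (\int[mu]_(x in A) f (x + b)%R = \int[mu]_(x in [set x | A (x - b)%R]) f x)%E.
Proof.
move=> mA mf f0.
have mA' := measurable_translate (- b) mA.
rewrite integral_mkcond [RHS]integral_mkcond.
have mg : measurable_fun [set: borel K] (f \_ [set x | A (x - b)]).
  by apply: (measurable_restrictT f mA').1; exact: measurable_funTS mf.
have := @ge0_integral_affine 1 b _ (oner_neq0 _) mg; rewrite absv1 invr1 mul1e => <-.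
  apply: eq_integral => x _; rewrite !patchE mul1r; congr (if _ then _ else _).
  by apply/idP/idP; rewrite !inE /= addrK.
by move=> x; rewrite patchE; case: ifP.
Qed.

Definition periodize (f : borel K -> \bar R) : borel K -> \bar R :=
  fun x => (\esum_(k in [set: nat]) f (x + uu k)%R)%E.

Lemma measurable_shift (f : borel K -> \bar R) b : measurable_fun [set: borel K] f ->
  measurable_fun [set: borel K] (fun x : borel K => f (x + b)).
Proof.
move=> mf; have := measurableT_comp mf (measurable_affine 1 b).
by congr measurable_fun; apply/funext => x; rewrite /= mul1r.
Qed.

Lemma measurable_periodize f : measurable_fun [set: borel K] f -> (forall x, (0 <= f x)%E) ->
  measurable_fun [set: borel K] (periodize f).
Proof.
by move=> mf f0; apply: (@measurable_esum _ (borel K) R setT nat (fun k (x : borel K) => f (x + uu k))) => // k; exact: measurable_shift.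
Qed.

Lemma periodize_ge0 f x : (forall x, (0 <= f x)%E) -> (0 <= periodize f x)%E.
Proof. by move=> f0; apply: esum_ge0 => k _. Qed.

Lemma integral_periodize (A : set (borel K)) f : measurable A ->
  measurable_fun [set: borel K] f -> (forall x, (0 <= f x)%E) ->
  (\int[mu]_(x in A) periodize f x =
   \esum_(k in [set: nat]) \int[mu]_(x in [set x | A (x - uu k)%R]) f x)%E.
Proof.
move=> mA mf f0; rewrite (@integral_esum _ (borel K) R mu A nat (fun k (x : borel K) => f (x + uu k))) //.
- by apply: eq_esum => k _; exact: integral_shift.
- by move=> k; apply: measurable_funTS; exact: measurable_shift.
Qed.

(** The translates of the disk by [Lam] are disjoint, so that the periodization collects
    the integrals over them. *)
Lemma integral_pset a s f : s != 0 -> absv s <= 1 ->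
  measurable_fun [set: borel K] f -> (forall x, (0 <= f x)%E) ->
  (\int[mu]_(x in pset a s) f x = \int[mu]_(x in disk a s) periodize f x)%E.
Proof.
move=> s0 s1 mf f0; rewrite integral_periodize //; last exact: measurable_disk.
rewrite pset_bigcup ge0_integral_bigcup //.
- rewrite nneseries_esumT; last by move=> k; apply: integral_ge0.
  apply: eq_esum => k _; congr integral; apply/funext => x; rewrite /disk /=.
  by rewrite opprD addrA addrAC.
- by move=> k; exact: measurable_disk.
- exact: measurable_funTS mf.
- by move=> k l _ _ [x [xk xl]]; exact: disk_unit_inj s1 xk xl.
Qed.

Lemma psetT : pset 0 1 = setT.
Proof.
apply/seteqP; split => // x _; have [k _ xk] := coset_cover x; exists k.
by rewrite /disk /= add0r absv1.
Qed.

(** * Functions with orthonormal modulates *)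

(** By [sum_chi] the indicator of a periodic disk is a trigonometric polynomial with
    frequencies in [Lam]. Integrals over periodic disks are thereby combinations of
    inner products with modulates. *)
Lemma indic_pset n a x :
  (\1_(pset a (varpi ^+ n)) x)%:C = (q ^ n)%:R^-1 * \sum_(k < q ^ n) chi (- (uu k * a)) * chi (uu k * x) :> R[i].
Proof.
have qn0 : (q ^ n)%:R != 0 :> R[i] by rewrite pnatr_eq0 -lt0n expn_gt0 (ltnW (q_gt1 c_gt0)).
have [l _ xl] := coset_cover (x - a).
have E (k : 'I_(q ^ n)) : chi (- (uu k * a)) * chi (uu k * x) = chi (uu k * (x - a - uu l)).
  rewrite -chiD (_ : uu k * (x - a - uu l) = - (uu k * a) + uu k * x + - (uu k * uu l)); last by ring.
  by rewrite [RHS]chiD chiN (chi_LamM (ex_intro2 _ _ (k : nat) I erefl) (ex_intro2 _ _ l I erefl)) conjc1 mulr1.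
under eq_bigr do rewrite E.
rewrite sum_chi // indicE; case: ifPn => xn.
  by rewrite mem_set ?mulVf //; exists l; rewrite /disk /= opprD addrA.
rewrite mulr0 memNset // => -[j]; rewrite /disk /= => xj.
have v1 := absv_varpiX_le1 n.
have jl : j = l.
  apply: uuB_small; rewrite (_ : uu j - uu l = (x - a - uu l) + - (x - (a + uu j))); last by ring.
  by apply: absv_ultra_le; rewrite // absvN; exact: le_trans v1.
by move/negP: xn; apply; rewrite -jl -addrA -opprD.
Qed.

Lemma restr_pset n a g : restr (pset a (varpi ^+ n)) g =
  \sum_(k < q ^ n) cscale ((q ^ n)%:R^-1 * chi (- (uu k * a))) (modl (uu k) g).
Proof.
apply/funext => x; rewrite fct_sumE /restr indic_pset mulrCA mulr_sumr !mulr_sumr.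
by apply: eq_bigr => k _; rewrite /cscale /modl; ring.
Qed.

Lemma inn_restr (A : set (borel K)) g h : inn mu (restr A g) h = inn mu g (restr A h).
Proof.
by apply: cInt_eq => x; rewrite /restr !conj_opE conjcM ?conj_opE conjc_real mulrAC mulrA.
Qed.

Lemma restr_idem (A : set (borel K)) g : restr A (restr A g) = restr A g.
Proof.
apply/funext => x; rewrite /restr -mulrA -rmorphM indicE.
by case: (x \in A); rewrite ?mulr1 ?mulr0.
Qed.

Lemma inn_restr_pset n a g h : sqint mu g -> sqint mu h ->
  inn mu (restr (pset a (varpi ^+ n)) g) h =
  \sum_(k < q ^ n) (q ^ n)%:R^-1 * chi (- (uu k * a)) * inn mu (modl (uu k) g) h.
Proof.
move=> sg sh; rewrite restr_pset (ip_suml HK) //; last by move=> k; apply: sqintZ; exact: sqint_modl.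
by apply: eq_bigr => k _; rewrite (ph_ipZ HK) //; exact: sqint_modl.
Qed.

Lemma nsq_restr (A : set (borel K)) g : inn mu (restr A g) g = inn mu (restr A g) (restr A g).
Proof. by rewrite -inn_restr restr_idem. Qed.

(** The periodization of the squared modulus is 1 almost everywhere, expressed through
    integrals over periodic disks. *)
Definition unit_mass g := forall n a, sqnorm mu (restr (pset a (varpi ^+ n)) g) = (absv (varpi ^+ n))%:E.

Lemma ortho_unit_mass g : sqint mu g -> (forall k, inn mu (modl (uu k) g) g = (k == 0%N)%:R) -> unit_mass g.
Proof.
move=> sg og n a; have mP : measurable (pset a (varpi ^+ n) : set (borel K)).
  by apply: measurable_pset; exact: varpiX_neq0.
have sr := sqint_restr mP sg; rewrite -nsq_fine // /nsq -nsq_restr inn_restr_pset //.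
have N0 : (0 < q ^ n)%N by rewrite expn_gt0 (ltnW (q_gt1 c_gt0)).
rewrite (bigD1 (Ordinal N0)) //= big1 ?addr0; last first.
  by move=> k k0; rewrite og (_ : (k == 0%N :> nat) = false) ?mulr0 //; apply: negbTE.
rewrite og eqxx uu0 mul0r oppr0 chi0 !mulr1 absv_varpiX exprVn -natrX.
by rewrite -(rmorph_nat (real_complex R)) -fmorphV.
Qed.

(** On a periodic disk of radius small enough for [k] the character is constant; what
    remains is its sum over the representatives [rep n t]. *)
Lemma unit_mass_ortho g : sqint mu g -> unit_mass g ->
  forall k, inn mu (modl (uu k) g) g = (k == 0%N)%:R.
Proof.
move=> sg ug k; have [n] := varpiX_large (absv (uu k)) => /ltW kn.
have {}kn : (k < q ^ n)%N by exact: uu_lt.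
have sr t : sqint mu (restr (per n t) g).
  by apply: sqint_restr sg; apply: measurable_pset; exact: varpiX_neq0.
rewrite (modl_per_sum g kn).
rewrite (ip_suml HK) //; last by move=> t; exact: sqintZ.
have E t : inn mu (cscale (chi (uu k * rep n t)) (restr (per n t) g)) g =
    chi (uu t * (varpi ^+ n * uu k)) * (q ^ n)%:R^-1.
  rewrite (ph_ipZ HK) // nsq_restr (ip_self HK) //; congr (_ * _).
    by congr chi; rewrite /rep; ring.
  have := ug n (rep n t); rewrite -nsq_fine // => -[->].
  by rewrite absv_varpiX exprVn -natrX fmorphV rmorph_nat.
under eq_bigr do rewrite E.
have qn0 : (q ^ n)%:R != 0 :> R[i] by rewrite pnatr_eq0 -lt0n expn_gt0 (ltnW (q_gt1 c_gt0)).
rewrite -mulr_suml sum_chi; last by rewrite mulrC -uu_absv.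
have [->|k0] := eqVneq k 0%N.
  by rewrite uu0 mulr0 absv0 absv_ge0 mulfV.
have av := absv_gt0 (varpiX_neq0 n).
rewrite ifN ?mul0r //; apply: contra k0; rewrite absvM -(ler_pdivlMl _ _ av) (mulVf (lt0r_neq0 av)).
by rewrite -[uu k]subr0 -uu0 => /uuB_small ->.
Qed.

(** ** Uniqueness from integrals on small disks *)

Lemma adde_cancel (a b e : \bar R) : a \is a fin_num -> (a + b = a + e)%E -> b = e.
Proof. by move: a b e => [a| |] [b| |] [e| |] //= _; rewrite -?EFinD // => -[/addrI ->]. Qed.

Lemma eq_integral_disks (f g : borel K -> \bar R) x (A : set (borel K)) :
  measurable_fun [set: borel K] f -> (forall x, (0 <= f x)%E) ->
  measurable_fun [set: borel K] g -> (forall x, (0 <= g x)%E) ->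
  (forall a n, (\int[mu]_(x in disk a (varpi ^+ n)%R) f x = \int[mu]_(x in disk a (varpi ^+ n)%R) g x)%E) ->
  (\int[mu]_(x in disk x 1%R) f x < +oo)%E -> measurable A ->
  (\int[mu]_(y in A `&` disk x 1%R) f y = \int[mu]_(y in A `&` disk x 1%R) g y)%E.
Proof.
move=> mf f0 mg g0 fg fin mA; have o0 := oner_neq0 K.
have mD : measurable (disk x 1 : set (borel K)) by exact: measurable_disk.
have fg1 : (\int[mu]_(x in disk x 1%R) f x = \int[mu]_(x in disk x 1%R) g x)%E.
  by have := fg x 0%N; rewrite expr0.
rewrite borel_disks in mA; move: A mA; apply: dynkin_induction.
- exact: borel_disks.
- exact: disks_setI.
- by rewrite setTI.
- move=> A dA; have [->|[a [s [s0 E]]]] : disks (A `&` disk x 1).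
  + by apply: disks_setI => //; right; exists x, 1.
  + by rewrite !integral_set0.
  have s1 : absv s <= 1.
    rewrite -lee_fin -(haar_disk a s0) -(absv1) -(haar_disk x o0) -E.
    by apply: le_measure; rewrite ?inE ?E //; [exact: measurable_disk|rewrite -E => y []].
  have [n nE] := absv_value s0 s1; rewrite E.
  have -> : disk a s = disk a (varpi ^+ n) by rewrite /disk nE.
  exact: fg.
- move=> A mA IH; have mI : measurable (A `&` disk x 1) by exact: measurableI.
  have K1 (h : borel K -> \bar R) : measurable_fun [set: borel K] h -> (forall x, (0 <= h x)%E) ->
      (\int[mu]_(x in disk x 1%R) h x = \int[mu]_(y in A `&` disk x 1%R) h y + \int[mu]_(y in ~` A `&` disk x 1%R) h y)%E.
    move=> mh h0; rewrite -ge0_integral_setU //.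
    - by rewrite -setIUl setUv setTI.
    - by apply: measurableI => //; exact: measurableC.
    - exact: measurable_funTS mh.
    - by rewrite disj_set2E; apply/eqP; rewrite -subset0 => y [[yA _] [nyA _]].
  have fA : (\int[mu]_(y in A `&` disk x 1%R) f y)%E \is a fin_num.
    rewrite ge0_fin_numE; last by apply: integral_ge0.
    apply: le_lt_trans fin; apply: ge0_subset_integral => //.
    exact: measurable_funTS mf.
  have := fg1; rewrite (K1 f mf f0) (K1 g mg g0) -IH.
  exact: adde_cancel.
- move=> F mF tF IH; rewrite setI_bigcupl.
  rewrite !ge0_integral_bigcup //; try (by move=> n; exact: measurableI); try (exact: measurable_funTS); try exact: trivIset_setIr.
  by apply: eq_eseriesr => n _; exact: IH.
Qed.

(** The disks of radius at most 1 are stable under intersection and generate the Borel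
    sets. *)
Lemma ae_eq_disks (f g : borel K -> \bar R) :
  measurable_fun [set: borel K] f -> (forall x, (0 <= f x)%E) ->
  measurable_fun [set: borel K] g -> (forall x, (0 <= g x)%E) ->
  (forall a n, (\int[mu]_(x in disk a (varpi ^+ n)%R) f x = \int[mu]_(x in disk a (varpi ^+ n)%R) g x)%E) ->
  (forall a, (\int[mu]_(x in disk a 1%R) f x < +oo)%E) ->
  {ae mu, forall x, f x = g x}.
Proof.
move=> mf f0 mg g0 fg fin; have o0 := oner_neq0 K.
have H k : {ae mu, forall x, disk (uu k) 1 x -> f x = g x}.
  have mD : measurable (disk (uu k) 1 : set (borel K)) by exact: measurable_disk.
  apply: (integral_ae_eq mD).
  - apply/integrableP; split; first exact: measurable_funTS mf.
    by under eq_integral do rewrite gee0_abs //.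
  - exact: measurable_funTS mg.
  - move=> E ED mE; rewrite -(setIidl ED); exact: eq_integral_disks.
have : {ae mu, forall x, forall k, disk (uu k) 1 x -> f x = g x} by apply/ae_foralln.
apply: filterS; first exact: (ae_filter_ringOfSetsType mu).
move=> x Hx; have [k _ xk] := coset_cover x.
by apply: (Hx k); rewrite /disk /= absv1.
Qed.

(** ** Orthogonality is preserved by periodic multipliers *)

(** By [ae_eq_disks] the positive and negative parts of [u] have the same periodization,
    and the integral of [P * u] depends on [u] only through its periodization. *)
Lemma periodic_integral0 (u P : K -> R) : mu.-integrable [set: borel K] (EFin \o u) ->
  mu.-integrable [set: borel K] (EFin \o (fun x => P x * u x)) ->
  measurable_fun [set: borel K] (P : borel K -> R) -> (forall x, 0 <= P x) ->
  (forall x k, P (x + uu k) = P x) ->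
  (forall a n, Rintegral mu [set: borel K] (fun x => u x * \1_(pset a (varpi ^+ n)) x) = 0) ->
  Rintegral mu [set: borel K] (fun x => P x * u x) = 0.
Proof.
move=> iu iPu mP P0 Pper u0; have mu' := measurable_int mu iu.
pose up := ((EFin \o u) : borel K -> \bar R)^\+%E; pose un := ((EFin \o u) : borel K -> \bar R)^\-%E.
have mup : measurable_fun [set: borel K] up by exact: measurable_funepos.
have mun : measurable_fun [set: borel K] un by exact: measurable_funeneg.
have up0 x : (0 <= up x)%E by exact: funepos_ge0.
have un0 x : (0 <= un x)%E by exact: funeneg_ge0.
have v1 := absv_varpiX_le1.
have mps a s : s != 0 -> measurable (pset a s : set (borel K)) by exact: measurable_pset.
have ups (f : borel K -> \bar R) (A : set (borel K)) : measurable A -> mu.-integrable [set: borel K] f ->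
    (\int[mu]_(x in A) f^\+ x)%E \is a fin_num.
  move=> mA intf; apply: integrable_pos_fin_num => //.
  exact: (integrableS measurableT mA (@subsetT _ _) intf).
have eqB a n : (\int[mu]_(x in pset a (varpi ^+ n)%R) up x = \int[mu]_(x in pset a (varpi ^+ n)%R) un x)%E.
  have mB := mps a _ (varpiX_neq0 n).
  have := u0 a n; rewrite /Rintegral.
  have -> : (\int[mu]_x (u x * \1_(pset a (varpi ^+ n)%R) x)%:E = \int[mu]_(x in pset a (varpi ^+ n)%R) (EFin \o u) x)%E.
    rewrite [RHS]integral_mkcond; apply: eq_integral => x _; rewrite patchE indicE.
    by case: ifP => _; rewrite ?mulr1 ?mulr0.
  have iB := integrableS measurableT mB (@subsetT _ _) iu.
  have f1 : (\int[mu]_(x in pset a (varpi ^+ n)%R) up x)%E \is a fin_num by exact: integrable_pos_fin_num.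
  have f2 : (\int[mu]_(x in pset a (varpi ^+ n)%R) un x)%E \is a fin_num by exact: integrable_neg_fin_num.
  rewrite integralE -/up -/un fineB // => /eqP; rewrite subr_eq0 => /eqP E.
  by rewrite -(fineK f1) -(fineK f2) E.
have aeU : {ae mu, forall x, periodize up x = periodize un x}.
  apply: ae_eq_disks.
  - exact: measurable_periodize.
  - by move=> x; exact: periodize_ge0.
  - exact: measurable_periodize.
  - by move=> x; exact: periodize_ge0.
  - by move=> a n; rewrite -!integral_pset ?varpiX_neq0 // eqB.
  - move=> a; rewrite -integral_pset ?oner_neq0 ?absv1 //.
    have mB := mps a _ (oner_neq0 K).
    have : (\int[mu]_(x in pset a 1%R) up x)%E \is a fin_num.
      by apply: integrable_pos_fin_num => //; exact: (integrableS measurableT mB (@subsetT _ _) iu).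
    by rewrite ge0_fin_numE //; apply: integral_ge0.
have mPE : measurable_fun [set: borel K] (EFin \o P : borel K -> \bar R) by exact/measurable_EFinP.
have fold (f : borel K -> \bar R) : measurable_fun [set: borel K] f -> (forall x, (0 <= f x)%E) ->
    (\int[mu]_x ((P x)%:E * f x) = \int[mu]_(x in disk 0%R 1%R) ((P x)%:E * periodize f x))%E.
  move=> mf f0; rewrite -psetT integral_pset ?oner_neq0 ?absv1 //.
  - apply: eq_integral => x _; rewrite /periodize.
    under eq_esum => k _ do rewrite Pper.
    by rewrite esumZl.
  - exact: emeasurable_funM.
  - by move=> x; rewrite mule_ge0 // lee_fin.
have EP : (\int[mu]_x ((P x)%:E * up x) = \int[mu]_x ((P x)%:E * un x))%E.
  rewrite !fold //; apply: ge0_ae_eq_integral.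
  - by apply: measurable_disk; exact: oner_neq0.
  - by apply: measurable_funTS; apply: emeasurable_funM => //; exact: measurable_periodize.
  - by apply: measurable_funTS; apply: emeasurable_funM => //; exact: measurable_periodize.
  - by move=> x _; rewrite mule_ge0 ?lee_fin // periodize_ge0.
  - by move=> x _; rewrite mule_ge0 ?lee_fin // periodize_ge0.
  - by move: aeU; apply: filterS => x E _ /=; rewrite E.
pose Pu := (EFin \o (fun x : borel K => P x * u x)).
have pE x : (Pu^\+ x = (P x)%:E * up x)%E.
  rewrite /up !funeposE /= -!EFin_max -EFinM maxr_pMr // mulr0 //.
have nE x : (Pu^\- x = (P x)%:E * un x)%E.
  rewrite /un !funenegE /= -!EFin_max -EFinM maxr_pMr // mulr0 mulrN //.
transitivity (fine (\int[mu]_x Pu x)%E); first by [].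
have E1 : (\int[mu]_x Pu^\+ x = \int[mu]_x ((P x)%:E * up x))%E by apply: eq_integral => x _; exact: pE.
have E2 : (\int[mu]_x Pu^\- x = \int[mu]_x ((P x)%:E * un x))%E by apply: eq_integral => x _; exact: nE.
have fin : (\int[mu]_x Pu^\- x)%E \is a fin_num by exact: (integrable_neg_fin_num measurableT iPu).
by rewrite integralE E1 EP -E2 subee.
Qed.

(** Orthogonality of [w] to all the modulates of [h] says that the periodization of [h]
    times the conjugate of [w] vanishes. *)
Lemma periodic_orth (h w : K -> R[i]) (P : K -> R) : sqint mu h -> sqint mu w ->
  (forall k, inn mu (modl (uu k) h) w = 0) ->
  measurable_fun [set: borel K] (P : borel K -> R) -> (forall x, 0 <= P x) ->
  (forall x k, P (x + uu k) = P x) -> sqint mu (fun x => (P x)%:C * h x) ->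
  inn mu (fun x => (P x)%:C * h x) w = 0.
Proof.
move=> sh sw hw mP P0 Pper sPh.
pose f x := h x * (w x)^*; have cf : cintegrable mu f by exact: sqint_mul.
have cPf : cintegrable mu (fun x => (P x)%:C * h x * (w x)^*) by exact: sqint_mul.
have f0 a n : cInt mu (restr (pset a (varpi ^+ n)) f) = 0.
  have := inn_restr_pset n a sh sw; rewrite big1; last by move=> k _; rewrite hw mulr0.
  by move=> <-; apply: cInt_eq => x; rewrite /restr /f mulrAC.
rewrite /inn /cInt.
rewrite (_ : (fun x => complex.Re _) = (fun x => P x * Re (f x))); last first.
  by apply/funext => x; rewrite /f -mulrA; case: (h x * _) => a b /=; rewrite mul0r subr0.
rewrite (_ : (fun x => complex.Im _) = (fun x => P x * Im (f x))); last first.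
  by apply/funext => x; rewrite /f -mulrA; case: (h x * _) => a b /=; rewrite mul0r addr0.
have [fr fi] := cf; have [pfr pfi] := cPf.
rewrite !periodic_integral0 //.
- by move: pfi; congr (_.-integrable _ _); apply/funext => x /=; rewrite /f -mulrA; case: (h x * _) => a b /=; rewrite mul0r addr0.
- move=> a n; have := f0 a n; rewrite /cInt => -[_ E]; rewrite -[RHS]E; congr Rintegral; apply/funext => x.
  by rewrite /restr; case: (f x) => y z /=; rewrite mulr0 add0r.
- by move: pfr; congr (_.-integrable _ _); apply/funext => x /=; rewrite /f -mulrA; case: (h x * _) => a b /=; rewrite mul0r subr0.
- move=> a n; have := f0 a n; rewrite /cInt => -[E _]; rewrite -[RHS]E; congr Rintegral; apply/funext => x.
  by rewrite /restr; case: (f x) => y z /=; rewrite mulr0 subr0.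
Qed.

(** * Reduction of the multiresolution axioms *)

Lemma closed_spanP (E : set (K -> R[i])) f : (forall h, E h -> sqint mu h) ->
  closed_span mu E f <-> sqint mu f /\ csp E f.
Proof.
move=> ES; have sS n (a : 'I_n -> R[i]) (g : 'I_n -> K -> R[i]) : (forall i, E (g i)) ->
    sqint mu (\sum_(i < n) cscale (a i) (g i)).
  by move=> gE; apply: (ph_sum HK) => i _; apply: sqintZ; exact: ES.
have sE n (a : 'I_n -> R[i]) (g : 'I_n -> K -> R[i]) :
    (fun x => \sum_(i < n) a i * g i x) = \sum_(i < n) cscale (a i) (g i).
  by apply/funext => x; rewrite fct_sumE.
have sE2 n (a : 'I_n -> R[i]) (g : 'I_n -> K -> R[i]) :
    (fun x => f x - \sum_(i < n) a i * g i x) = f - \sum_(i < n) cscale (a i) (g i).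
  by rewrite -sE.
split=> [[/L2P sf H]|[sf H]]; split => //.
- move=> e e0; have s0 : 0 < Num.sqrt e by rewrite sqrtr_gt0.
  have [h [n [a [g [gE ->]]]] /(L2dist_lt _ _ s0)] := H _ s0.
  rewrite sE2 sqr_sqrtr ?ltW // => hd; exists n, a, g; split => //.
  by rewrite -lte_fin nsq_fine //; apply: (phB HK) => //; exact: sS.
- exact/L2P.
- move=> e e0; have [n [a [g [gE]]]] := H _ (exprn_gt0 2 e0).
  rewrite -lte_fin nsq_fine; last by apply: (phB HK) => //; exact: sS.
  move=> hd; exists (fun x => \sum_(i < n) a i * g i x); first by exists n, a, g.
  by apply/(L2dist_lt _ _ e0); rewrite sE2.
Qed.

Section Wavelet.
Variables (L : nat) (psi : 'I_L -> K -> R[i]).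
Hypothesis psiP : is_wavelet mu varpi q uu psi.

Local Notation V := (scale_space mu varpi q uu psi).

Definition wave_ (i : 'I_L * int * nat) : K -> R[i] := wave varpi q uu (psi i.1.1) i.1.2 i.2.

Lemma sqint_psi l : sqint mu (psi l).
Proof. by apply/L2P; case: psiP => H _; exact: H. Qed.

Lemma sqint_wave i : sqint mu (wave_ i).
Proof. by apply/L2P; case: psiP => _ [H _ _]; exact: H. Qed.

Lemma orthonormal_wave : orthonormal (sqint mu) (inn mu) wave_.
Proof. by split; [exact: sqint_wave|case: psiP => _ [_ H _]; exact: H]. Qed.

Lemma range_wave_sqint h : range wave_ h -> sqint mu h.
Proof. by move=> [i _ <-]; exact: sqint_wave. Qed.

Lemma cspan_wave f : sqint mu f -> csp (range wave_) f.
Proof.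
move=> sf; have [] := (closed_spanP f range_wave_sqint).1 => //.
case: psiP => _ [_ _ ->]; exact/L2P.
Qed.

Lemma parseval_wave f : sqint mu f -> energy (inn mu) wave_ f = (nsq (inn mu) f)%:E.
Proof. by move=> sf; apply: (cspan_parseval HK orthonormal_wave sf); exact: cspan_wave. Qed.

(** Orthogonality to all the scales from [J] on; by Parseval this describes the space of
    scale [J]. *)
Definition fine_orth (J : int) (f : K -> R[i]) :=
  forall l m k, J <= m -> inn mu f (wave_ (l, m, k)) = 0.

Lemma wave_spaceP m h : wave_space mu varpi q uu psi m h ->
  sqint mu h /\ forall l m' k, m < m' -> inn mu h (wave_ (l, m', k)) = 0.
Proof.
have ES h0 : [set f | exists l k, f = wave varpi q uu (psi l) m k] h0 -> sqint mu h0.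
  by move=> [l [k ->]]; exact: (sqint_wave (l, m, k)).
move=> /(closed_spanP _ ES)[sh ch]; split => // l m' k mm'.
apply: (cspan_orth HK ES sh (sqint_wave _) ch) => _ [l' [k' ->]].
rewrite -[wave _ _ _ _ _ _]/(wave_ (l', m, k')) (proj2 orthonormal_wave).
by case: eqP => // -[_ E _]; rewrite E ltxx in mm'.
Qed.

(** In the wavelet expansion of a vector orthogonal to the scales [m >= J], only the
    scales [m < J] occur. *)
Lemma scale_spaceP J f : V J f <-> sqint mu f /\ fine_orth J f.
Proof.
have ES h : (\bigcup_(m in [set m : int | m < J]) wave_space mu varpi q uu psi m) h -> sqint mu h.
  by move=> [m _ /wave_spaceP[]].
split=> [/(closed_spanP _ ES)[sf cf]|[sf of_]].
  split => // l m k Jm; apply: (cspan_orth HK ES sf (sqint_wave _) cf) => h [m' /= m'J /wave_spaceP[_]].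
  by apply; exact: lt_le_trans Jm.
apply/(closed_spanP _ ES); split => //.
apply: (parseval_cspan HK orthonormal_wave sf (parseval_wave sf)) => -[[l m] k] nz.
exists m; rewrite /=.
  by rewrite ltNge; apply: contra nz => Jm; rewrite of_.
have ES' h0 : [set f | exists l k, f = wave varpi q uu (psi l) m k] h0 -> sqint mu h0.
  by move=> [l' [k' ->]]; exact: (sqint_wave (l', m, k')).
apply/(closed_spanP _ ES'); split; first exact: sqint_wave.
apply: (cspan_mem HK); [exact: cscale1|exact: sqint_wave|].
by exists l, k.
Qed.

Lemma inn_close0 f w : sqint mu f -> sqint mu w ->
  (forall d : R, 0 < d -> exists g, [/\ sqint mu g, inn mu g w = 0 & nsq (inn mu) (f - g) < d]) ->
  inn mu f w = 0.
Proof.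
move=> sf sw H; apply/abs2_eq0/le_anti; rewrite abs2_ge0 andbT.
apply/ler_addgt0Pr => e e0; rewrite add0r.
have w0 := nsq_ge0 HK sw; have w1 : 0 < nsq (inn mu) w + 1 by rewrite ltr_wpDl.
have [g [sg gw fg]] := H (e / (nsq (inn mu) w + 1)) ltac:(by rewrite divr_gt0).
have sB : sqint mu (f - g) by exact: (phB HK).
rewrite -[inn mu f w]subr0 -gw -(ipBl HK sf sg sw).
apply: le_trans (cauchy_schwarz HK sB sw) _.
move: fg; rewrite ltr_pdivlMr // => /ltW; apply: le_trans.
by rewrite ler_wpM2l ?(nsq_ge0 HK sB) // lerDl.
Qed.

Lemma scale_space_closed J : is_closed_subspace mu (V J).
Proof.
split.
- by move=> f /scale_spaceP[sf _]; exact/L2P.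
- move=> _ [n [a [g [gV ->]]]].
  have E : (fun x => \sum_(i < n) a i * g i x) = \sum_(i < n) cscale (a i) (g i).
    by apply/funext => x; rewrite fct_sumE.
  have sg i : sqint mu (g i) by have /scale_spaceP[] := gV i.
  apply/scale_spaceP; rewrite E; split.
    by apply: (ph_sum HK) => i _; exact: sqintZ.
  move=> l m k Jm; rewrite (ip_suml HK) ?big1 //; try exact: sqint_wave; last by move=> i; exact: sqintZ.
  move=> i _; have /scale_spaceP[_ /(_ l m k Jm) E0] := gV i.
  by rewrite (ph_ipZ HK) ?E0 ?mulr0 //; exact: sqint_wave.
- move=> f [/L2P sf H]; apply/scale_spaceP; split => // l m k Jm.
  apply: inn_close0 => // [|d d0]; first exact: sqint_wave.
  have s0 : 0 < Num.sqrt d by rewrite sqrtr_gt0.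
  have [g /scale_spaceP[sg og] /(L2dist_lt _ _ s0)] := H _ s0.
  rewrite sqr_sqrtr ?ltW // => fg; exists g; split => //; first exact: og.
  by rewrite -lte_fin nsq_fine //; exact: (phB HK).
Qed.

Lemma scale_space_incr J : V J `<=` V (J + 1).
Proof.
move=> f /scale_spaceP[sf of_]; apply/scale_spaceP; split => // l m k Jm; apply: of_.
by apply: le_trans Jm; rewrite lerDl.
Qed.

Lemma scale_space_dense :
  L2closure mu (\bigcup_J V J) = L2 mu.
Proof.
apply/seteqP; split => [f []//|f Lf]; split => // e e0; have sf := (L2P f).1 Lf.
have [s us sd] := parseval_proj HK orthonormal_wave sf (parseval_wave sf) (exprn_gt0 2 e0).
have sp : sqint mu (proj cscale (inn mu) wave_ s f) by exact: (proj_S HK orthonormal_wave).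
exists (proj cscale (inn mu) wave_ s f); last first.
  by apply/(L2dist_lt _ _ e0); rewrite -nsq_fine // ; exact: (phB HK).
have [J HJ] : exists J : int, forall i, i \in s -> i.1.2 < J.
  elim: s {us sd sp} => [|i s [J HJ]]; first by exists 0.
  exists (Num.max (i.1.2 + 1) J) => j; rewrite inE => /orP[/eqP ->|/HJ H].
    by rewrite lt_max ltrDl ltr01.
  by rewrite lt_max H orbT.
exists J => //; apply/scale_spaceP; split => // l m k Jm.
rewrite /proj (ip_comb HK orthonormal_wave (fun i => inn mu f (wave_ i)) _ us).
by case: ifP => // /HJ /=; rewrite ltNge Jm.
Qed.

Lemma scale_space_cap : \bigcap_J V J =
  [set f | L2 mu f /\ {ae mu, forall x, f x = 0}].
Proof.
apply/seteqP; split => f.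
  move=> H; have /scale_spaceP[sf _] := H 0 I; split; first exact/L2P.
  apply: sqnorm_eq0 (proj1 sf) _; rewrite -nsq_fine // -parseval_wave //.
  rewrite /energy esum1 // => -[[l m] k] _; have /scale_spaceP[_ /(_ l m k (lexx m)) ->] := H m I.
  by rewrite abs2_0.
move=> [/L2P sf f0] J _; apply/scale_spaceP; split => // l m k _.
have n0 : nsq (inn mu) f = 0.
  apply/EFin_inj; rewrite nsq_fine //.
  have -> := sqnorm_ae (proj1 sf) (cmeas_cst (0 : R[i])) f0.
  by rewrite /sqnorm integral0_eq // => x _; rewrite abs2_0.
apply/abs2_eq0/le_anti; rewrite abs2_ge0 andbT.
by have := cauchy_schwarz HK sf (sqint_wave (l, m, k)); rewrite n0 mul0r.
Qed.

Lemma wave_dilate l m k x : wave_ (l, m + 1, k) x = ((q%:R : R) `^ 2^-1)%:C * wave_ (l, m, k) (varpi^-1 * x).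
Proof.
rewrite /wave_ /wave /= mulrA -rmorphM /= -powRD; last by rewrite (gt_eqF q_gt0R) implybT.
congr (_%:C * psi l (_ - _)).
  by congr (_ `^ _); rewrite intrD mulrDl mul1r addrC.
by rewrite mulrA opprD expfzDr ?varpi_neq0.
Qed.

Lemma scale_space_dilate J f : V J f <->
  V (J + 1) (fun x => f (varpi^-1 * x)).
Proof.
have v0 : varpi^-1 != 0 by rewrite invr_neq0 // varpi_neq0.
have c0 : ((q%:R : R) `^ 2^-1)%:C != 0.
  by rewrite fmorph_eq0 gt_eqF // powR_gt0 // q_gt0R.
have sE h : (fun x => h (varpi^-1 * x)) = (fun x => h (varpi^-1 * x + 0)) :> (K -> R[i]).
  by apply/funext => x; rewrite addr0.
have S1 h : sqint mu h <-> sqint mu (fun x => h (varpi^-1 * x)).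
  split=> sh; first by rewrite sE; exact: sqint_affine.
  have := @sqint_affine varpi 0 _ varpi_neq0 sh; congr sqint.
  by apply/funext => x; rewrite addr0 mulKf // varpi_neq0.
have IE h l m k : sqint mu h -> inn mu (fun x => h (varpi^-1 * x)) (wave_ (l, m + 1, k)) =
    ((q%:R : R) `^ 2^-1)%:C * ((absv varpi^-1)^-1%:C * inn mu h (wave_ (l, m, k))).
  move=> sh; have ci := sqint_mul sh (sqint_wave (l, m, k)).
  rewrite -(@cInt_affine varpi^-1 0 _ v0 ci) -cIntZ; last exact: (@cintegrable_affine varpi^-1 0 _ v0 ci).
  apply: cInt_eq => x; rewrite wave_dilate /cscale addr0 !conj_opE conjcM ?conj_opE conjc_real.
  by rewrite mulrCA.
have a0 : (absv varpi^-1)^-1%:C != 0 :> R[i].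
  by rewrite fmorph_eq0 invr_eq0 gt_eqF // absv_gt0.
split=> /scale_spaceP[sf of_]; apply/scale_spaceP.
  split; first exact: (S1 f).1 sf.
  move=> l m k Jm; rewrite -(subrK 1 m) IE // of_ ?mulr0 //.
  by rewrite lerBrDr.
have sh := (S1 f).2 sf; split => // l m k Jm.
have := of_ l (m + 1) k; rewrite lerD2r Jm IE // => /(_ isT)/eqP.
by rewrite !mulf_eq0 (negPf c0) (negPf a0) => /eqP.
Qed.

(** Dilations shift the scales, and the scales exhaust the space: all the axioms but the
    existence of a scaling function hold for every wavelet. *)
Lemma is_MRA_waveletP : is_MRA_wavelet mu varpi q uu psi <->
  exists2 phi, V 0 phi &
    is_orthonormal_basis mu (V 0) (fun k x => phi (x - uu k)).
Proof.
split=> [[_ []//]|H]; split; first exact: scale_space_closed.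
split => //; [exact: scale_space_incr|exact: scale_space_dense|exact: scale_space_cap|].
exact: scale_space_dilate.
Qed.

(** * The wavelet system on the Fourier side *)

Notation "psi ^F" := (fourier mu chi psi) (at level 2, format "psi ^F").

Definition waveF (i : 'I_L * int * nat) : K -> R[i] :=
  cscale ((q%:R : R) `^ (i.1.2%:~R / 2))%:C
    (affF (varpi ^ (- i.1.2)) (- uu i.2) (psi i.1.1)^F).

Lemma varpiZ_neq0 (m : int) : varpi ^ m != 0.
Proof. by rewrite expfz_neq0 // varpi_neq0. Qed.

Lemma FT_psi l : FT (psi l) (psi l)^F.
Proof. by apply: fourierP; exact: sqint_psi. Qed.

Lemma FT_wave i : FT (wave_ i) (waveF i).
Proof.
case: i => [[l m] k]; apply: FTZ; rewrite /=.
exact: (FT_affine (- uu k) (varpiZ_neq0 (- m)) (FT_psi l)).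
Qed.

Lemma sqint_waveF i : sqint mu (waveF i).
Proof. by have [] := FT_sqint (FT_wave i). Qed.

Lemma FT_orthonormal (I : choiceType) (e e' : I -> K -> R[i]) : (forall i, FT (e i) (e' i)) ->
  orthonormal (sqint mu) (inn mu) e <-> orthonormal (sqint mu) (inn mu) e'.
Proof.
move=> ee'; split=> -[se oe]; split.
- by move=> i; have [] := FT_sqint (ee' i).
- by move=> i j; rewrite (FT_ip (ee' i) (ee' j)).
- by move=> i; have [] := FT_sqint (ee' i).
- by move=> i j; rewrite -(FT_ip (ee' i) (ee' j)).
Qed.

Lemma FT_energy (I : choiceType) (e e' : I -> K -> R[i]) f g : (forall i, FT (e i) (e' i)) ->
  FT f g -> energy (inn mu) e' g = energy (inn mu) e f.
Proof.
by move=> ee' fg; apply: eq_esum => i _; rewrite (FT_ip fg (ee' i)).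
Qed.

Lemma FT_nsq f g : FT f g -> nsq (inn mu) g = nsq (inn mu) f.
Proof. by move=> fg; rewrite /nsq (FT_ip fg fg). Qed.

Lemma orthonormal_waveF : orthonormal (sqint mu) (inn mu) waveF.
Proof. exact: (FT_orthonormal FT_wave).1 orthonormal_wave. Qed.

Lemma parseval_waveF g : sqint mu g -> energy (inn mu) waveF g = (nsq (inn mu) g)%:E.
Proof.
move=> sg; have [f fg] := FT_onto sg; have [sf _] := FT_sqint fg.
by rewrite (FT_energy FT_wave fg) parseval_wave // (FT_nsq fg).
Qed.

(** The index [(l, j, k)] stands for the scale [- j.+1]. *)
Definition neg_wave (i : 'I_L * nat * nat) : K -> R[i] := wave_ (i.1.1, Negz i.1.2, i.2).
Definition neg_waveF (i : 'I_L * nat * nat) : K -> R[i] := waveF (i.1.1, Negz i.1.2, i.2).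

Lemma FT_neg_wave i : FT (neg_wave i) (neg_waveF i).
Proof. exact: FT_wave. Qed.

Lemma orthonormal_neg_wave : orthonormal (sqint mu) (inn mu) neg_wave.
Proof.
split=> [i|[[l j] k] [[l' j'] k']]; first exact: sqint_wave.
rewrite (proj2 orthonormal_wave); congr (_%:R).
Qed.

Lemma orthonormal_neg_waveF : orthonormal (sqint mu) (inn mu) neg_waveF.
Proof. exact: (FT_orthonormal FT_neg_wave).1 orthonormal_neg_wave. Qed.

Lemma sqint_neg_waveF i : sqint mu (neg_waveF i). Proof. exact: sqint_waveF. Qed.

Local Notation parseval := (parseval_set (sqint mu) (inn mu)).

Lemma parseval_neg_waveFP g : sqint mu g -> (forall l (m : nat) k, inn mu g (waveF (l, Posz m, k)) = 0) ->
  parseval neg_waveF g.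
Proof.
move=> sg og; split => //; apply: (cspan_parseval HK orthonormal_neg_waveF sg).
apply: (parseval_cspan HK orthonormal_waveF sg (parseval_waveF sg)) => -[[l [m|j]] k].
  by move=> nz; case/eqP: nz; exact: og.
by move=> _; exists (l, j, k).
Qed.

Lemma parseval_neg_waveP f : parseval neg_wave f <-> V 0 f.
Proof.
split=> [[sf pf]|/scale_spaceP[sf of_]].
  apply/scale_spaceP; split => // l m k m0.
  have c0 : csp (range neg_wave) f.
    by apply: (parseval_cspan HK orthonormal_neg_wave sf pf) => i _; exists i.
  apply: (cspan_orth HK _ sf (sqint_wave _) c0); first by move=> h [i _ <-]; exact: sqint_wave.
  move=> _ [[[l' j'] k'] _ <-]; rewrite (proj2 orthonormal_wave).
  by case: eqP => // -[_ E _]; move: m0; rewrite -E.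
split => //; apply: (cspan_parseval HK orthonormal_neg_wave sf).
apply: (parseval_cspan HK orthonormal_wave sf (parseval_wave sf)) => -[[l [m|j]] k].
  by move=> nz; case/eqP: nz; exact: of_.
by move=> _; exists (l, j, k).
Qed.

Lemma Lam_varpiX n x : Lam x -> Lam (varpi ^- n * x).
Proof.
elim: n x => [|n IH] x lx; first by rewrite expr0 invr1 mul1r.
by rewrite exprSr invfM -mulrA; apply: IH; exact: Lam_varpi.
Qed.

(** For [m >= 0] the lattice contains [varpi ^- m * b], which is the translation that
    multiplication by the character of frequency [b] causes at scale [m]. *)
Lemma modl_waveF b l (m : nat) k : Lam b -> exists k', modl b (waveF (l, Posz m, k)) = waveF (l, Posz m, k').
Proof.
move=> lb; have v0 := varpiX_neq0 m.
have [k' _ k'E] : Lam (uu k - varpi ^- m * b).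
  by apply: LamD; [exists k|apply: LamN; exact: Lam_varpiX].
exists k'; apply/funext => x; rewrite /modl /waveF /cscale /affF /= mulrCA; congr (_ * _).
rewrite (_ : chi (x * (- uu k' / _)) = chi (b * x) * chi (x * (- uu k / varpi ^ (- Posz m)))); first by ring.
rewrite -chiD -exprnN invrK k'E; congr chi.
by rewrite opprB mulrBl mulrAC mulVf // mul1r mulNr; ring.
Qed.

(** * The energy of the negative scales on small sets *)

Local Notation energy0 := (energy (inn mu) neg_waveF).

(** The characters of [Lam] permute the wavelets of nonnegative scale, hence preserve
    their orthogonal complement, the transform of [V_0]. The modulated family lies in
    it, and [energy_mono] applies. *)
Lemma energy0_modl_le b g : Lam b -> sqint mu g -> (energy0 (modl b g) <= energy0 g)%E.
Proof.
move=> lb sg; pose w1 i := modl (- b) (neg_waveF i).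
have -> : energy0 (modl b g) = energy (inn mu) w1 g by apply: eq_esum => i _; rewrite inn_modl.
have o1 : orthonormal (sqint mu) (inn mu) w1.
  split=> [i|i j]; first by apply: sqint_modl; exact: sqint_neg_waveF.
  by rewrite inn_modl2; exact: (proj2 orthonormal_neg_waveF).
apply: (energy_mono HK orthonormal_neg_waveF o1) => // i.
apply: parseval_neg_waveFP; first exact: (proj1 o1).
move=> l m k; rewrite inn_modl opprK; have [k' ->] := modl_waveF l m k lb.
by case: i => [[l' j] k'']; rewrite (proj2 orthonormal_waveF); case: eqP => // -[].
Qed.

Lemma energy0_modl k g : sqint mu g -> energy0 (modl (uu k) g) = energy0 g.
Proof.
move=> sg; have lk : Lam (uu k) by exists k.
apply/eqP; rewrite eq_le energy0_modl_le //=.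
by rewrite -{1}(modlK (uu k) g); apply: energy0_modl_le; [exact: LamN|exact: sqint_modl].
Qed.

(** The dilated transforms of which the dimension function is made. *)
Definition hatpsi (i : 'I_L * nat) : K -> R[i] := fun xi => (psi i.1)^F (varpi ^- i.2.+1 * xi + 0).

Lemma sqint_hatpsi i : sqint mu (hatpsi i).
Proof.
apply: sqint_affine; first exact: varpiNX_neq0.
by have [] := FT_sqint (FT_psi i.1).
Qed.

Lemma powR_half (m : nat) : ((q%:R : R) `^ ((Negz m)%:~R / 2)) ^+ 2 = (q%:R : R)^-1 ^+ m.+1.
Proof.
rewrite -powR_mulrn ?powR_ge0 // -powRrM mulfVK // powR_intmul ?ltW ?q_gt0R //.
by rewrite NegzE -exprnN exprVn.
Qed.

(** Up to a constant factor, a coefficient at scale [- j.+1] of an indicator is the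
    conjugate of a character coefficient of [hatpsi (l, j)] on the set. *)
Lemma abs2_inn_neg_waveF l j k (E : set (borel K)) b :
  measurable E -> (mu E < +oo)%E -> E `<=` disk b (varpi ^+ j.+1) ->
  abs2 (inn mu (cindic E) (neg_waveF (l, j, k))) =
  (q%:R : R) ^+ j.+1 *
    abs2 (inn mu (restr (disk b (varpi ^+ j.+1)) (restr E (hatpsi (l, j)))) (mdisk b (varpi ^+ j.+1) (uu k / varpi ^+ j.+1))).
Proof.
move=> mE fE Eb; have v0 := varpiX_neq0 j.+1.
have sE := sqint_indic mE fE; have sr := sqint_restr mE (sqint_hatpsi (l, j)).
have mD : measurable (disk b (varpi ^+ j.+1) : set (borel K)) by exact: measurable_disk.
have srr := sqint_restr mD sr.
have sm : sqint mu (mdisk b (varpi ^+ j.+1) (uu k / varpi ^+ j.+1)) by exact: sqint_mdisk.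
pose r := (q%:R : R) `^ ((Negz j)%:~R / 2) * (absv (varpi ^+ j.+1))^-1.
have -> : inn mu (cindic E) (neg_waveF (l, j, k)) =
    r%:C * inn mu (mdisk b (varpi ^+ j.+1) (uu k / varpi ^+ j.+1)) (restr (disk b (varpi ^+ j.+1)) (restr E (hatpsi (l, j)))).
  rewrite -[RHS]cIntZ; last exact: sqint_mul.
  apply: cInt_eq => x; rewrite /cscale /neg_waveF /waveF /cscale /affF /= /restr /hatpsi /=.
  set h := (psi l)^F _; set c1 := chi _; set c0 := _ `^ _; set a0 := (absv _)^-1.
  have [xE|xE] := boolP (x \in E); last by rewrite !indicE (negPf xE) /= mul0r mulr0 mul0r conj_opE conjc0 !mulr0.
  have xD : disk b (varpi ^+ j.+1) x by apply: Eb; exact: set_mem.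
  rewrite /mdisk indE !indicE xE mem_set // ifT // !mulr1 mul1r.
  rewrite /r !(conj_opE, conjcM) !conjc_real /c1 -chiN rmorphM /=.
  have -> : chi (- (x * (- uu k / varpi ^ (- Negz j)))) = chi (uu k / varpi ^+ j.+1 * x).
    by congr chi; rewrite mulNr mulrN opprK mulrC.
  by rewrite -/c0 -[(absv _)^-1]/a0; ring.
rewrite abs2M abs2_real (ph_ipC HK srr sm) abs2J; congr (_ * _).
rewrite /r exprMn powR_half absv_varpiX !exprVn invrK expr2 mulrA mulVf ?mul1r //.
by rewrite expf_neq0 // gt_eqF // q_gt0R.
Qed.

(** Inside a disk of radius [absv (varpi ^+ j.+1)], the coefficients at scale [- j.+1]
    are all the character coefficients on that disk, and [parseval_disk] sums them. *)
Lemma scale_energy l j (E : set (borel K)) b :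
  measurable E -> (mu E < +oo)%E -> E `<=` disk b (varpi ^+ j.+1) ->
  (\esum_(k in [set: nat]) (abs2 (inn mu (cindic E) (neg_waveF (l, j, k))))%:E =
   \int[mu]_(x in E) (abs2 (hatpsi (l, j) x))%:E)%E.
Proof.
move=> mE fE Eb; have v0 := varpiX_neq0 j.+1.
have sh := sqint_hatpsi (l, j); have sr := sqint_restr mE sh.
under eq_esum => k _ do rewrite (abs2_inn_neg_waveF l k mE fE Eb) EFinM.
rewrite esumZl; last 2 first.
- by rewrite exprn_ge0 // ltW // q_gt0R.
- by move=> k; rewrite lee_fin abs2_ge0.
rewrite parseval_disk // muleA -EFinM absv_varpiX -exprMn mulfV ?expr1n ?mul1e; last by rewrite gt_eqF // q_gt0R.
rewrite -(sqnorm_restr mE (proj1 sh)); congr (sqnorm mu _); apply/funext => x.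
rewrite /restr !indicE; have [xE|_] := boolP (x \in E); last by rewrite !mulr0 mul0r.
by rewrite mem_set ?mulr1 //; apply: Eb; exact: set_mem.
Qed.

Lemma energy0_iter g : energy0 g = (\esum_(i in [set: 'I_L * nat]) \esum_(k in [set: nat]) (abs2 (inn mu g (neg_waveF (i, k))))%:E)%E.
Proof. by rewrite /energy esum_pair // => i; exact: abs2_EFin_ge0. Qed.

Lemma abs2_sum_le n (co : 'I_(q ^ n) -> R[i]) :
  abs2 (\sum_(t < q ^ n) co t) <= (q ^ n)%:R * \sum_(t < q ^ n) abs2 (co t).
Proof.
rewrite -finite_parseval; have N0 : (0 < q ^ n)%N by rewrite expn_gt0 (ltnW (q_gt1 c_gt0)).
rewrite [leRHS](bigD1 (Ordinal N0)) //= (_ : \sum_(t < q ^ n) chi (uu 0 * rep n t) * co t = \sum_(t < q ^ n) co t).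
  by rewrite lerDl; apply: sumr_ge0 => k _; exact: abs2_ge0.
by apply: eq_bigr => t _; rewrite uu0 mul0r chi0 mul1r.
Qed.

Lemma integral_partition n (F : 'I_n -> set (borel K)) (E : set (borel K)) (f : K -> \bar R) :
  measurable E -> (forall t, measurable (F t)) -> (forall x, (0 <= f x)%E) ->
  measurable_fun [set: borel K] f ->
  (forall x, E x -> exists2 t, F t x & forall t', F t' x -> t' = t) ->
  (\int[mu]_(x in E) f x = \sum_(t < n) \int[mu]_(x in E `&` F t) f x)%E.
Proof.
move=> mE mF f0 mf FE; rewrite integral_mkcond.
under [RHS]eq_bigr do rewrite integral_mkcond.
have mr (A : set (borel K)) : measurable A -> measurable_fun [set: borel K] (f \_ A).
  by move=> mA; apply: (measurable_restrictT (f : borel K -> _) mA).1; exact: measurable_funTS mf.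
rewrite -ge0_integral_sum //.
- apply: eq_integral => x _; rewrite patchE.
  case: ifPn => [/set_mem xE|xE].
    have [t xt ut] := FE x xE; rewrite (bigD1 t) //= big1 ?adde0.
      by rewrite patchE mem_set.
    move=> t' t't; rewrite patchE memNset // => -[_ /ut E'].
    by rewrite E' eqxx in t't.
  rewrite big1 // => t _; rewrite patchE memNset // => -[xE' _].
  by move/negP: xE; apply; rewrite inE.
- by move=> t; apply: mr; exact: measurableI.
- by move=> t x _; rewrite patchE; case: ifP.
Qed.

(** A set in a larger disk is cut into pieces for which [scale_energy] is exact; by the
    Cauchy-Schwarz inequality, adding up the coefficients of the pieces costs at most a
    factor equal to their number. *)
Lemma scale_energy_le l j n (E : set (borel K)) b :
  measurable E -> E `<=` disk b (varpi ^+ n) ->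
  (\esum_(k in [set: nat]) (abs2 (inn mu (cindic E) (neg_waveF (l, j, k))))%:E <=
   (q ^ (j.+1 - n))%:R%:E * \int[mu]_(x in E) (abs2 (hatpsi (l, j) x))%:E)%E.
Proof.
move=> mE Eb; pose m := (j.+1 - n)%N.
pose D (t : 'I_(q ^ m)) := disk (b + varpi ^+ n * rep m t) (varpi ^+ j.+1).
have mD t : measurable (D t : set (borel K)) by apply: measurable_disk; exact: varpiX_neq0.
have v0 := varpiX_neq0 n.
have jn : absv (varpi ^+ (n + m)) <= absv (varpi ^+ j.+1).
  rewrite !absv_varpiX ler_wiXn2l ?invr_ge0 ?(ltW q_gt0R) ?invf_le1 ?q_gt0R ?(ltW q_gt1R) //.
  by rewrite -leq_subLR.
have DP x : E x -> exists2 t, D t x & forall t', D t' x -> t' = t.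
  move=> /Eb xb; have x1 : absv ((x - b) / varpi ^+ n) <= 1.
    by rewrite absvM absvV ler_pdivrMr ?absv_gt0 // mul1r.
  have [t tE] := rep_cover m x1.
  have xt : D t x.
    rewrite /D /disk /= (_ : x - _ = varpi ^+ n * ((x - b) / varpi ^+ n - rep m t)).
      by apply: le_trans jn; rewrite exprD !absvM ler_wpM2l // absv_ge0.
    by field.
  exists t => // t' xt'; have [nj|jn'] := leqP n j.+1.
    apply: rep_inj; rewrite -(@ler_pM2l _ (absv (varpi ^+ n))) ?absv_gt0 // -!absvM -exprD.
    rewrite (subnKC nj) (_ : _ * _ = (x - (b + varpi ^+ n * rep m t)) + - (x - (b + varpi ^+ n * rep m t'))); last by ring.
    by apply: absv_ultra_le => //; rewrite absvN.
  have m0 : m = 0%N by rewrite /m; apply/eqP; rewrite subn_eq0 ltnW.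
  have q1 : (q ^ m = 1)%N by rewrite m0 expn0.
  have ord0 (i : 'I_(q ^ m)) : nat_of_ord i = 0%N.
    by have := ltn_ord i; rewrite [X in (_ < X)%N]q1 ltnS leqn0 => /eqP.
  by apply/val_inj; rewrite /= !ord0.
have fE : (mu E < +oo)%E by exact: mu_sub_disk Eb.
have fI t : (mu (E `&` D t) < +oo)%E.
  by apply: le_lt_trans fE; apply: le_measure; rewrite ?inE //; exact: measurableI.
have mI t : measurable (E `&` D t) by exact: measurableI.
have iE k : inn mu (cindic E) (neg_waveF (l, j, k)) =
    \sum_(t < q ^ m) inn mu (cindic (E `&` D t)) (neg_waveF (l, j, k)).
  rewrite -(ip_suml HK) //; last 2 first.
  - exact: sqint_neg_waveF.
  - by move=> t; apply: sqint_indic.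
  congr inn; apply/funext => x; rewrite fct_sumE.
  have [xE|xE] := pselect (E x).
    have [t xt ut] := DP x xE; rewrite (bigD1 t) //= big1 ?addr0.
      by rewrite !indicE !mem_set.
    move=> t' t't; rewrite indicE memNset // => -[_ /ut E'].
    by rewrite E' eqxx in t't.
  rewrite big1; first by rewrite indicE memNset.
  by move=> t _; rewrite indicE memNset // => -[].
apply: (@le_trans _ _ (\esum_(k in [set: nat]) ((q ^ m)%:R%:E * \sum_(t < q ^ m) (abs2 (inn mu (cindic (E `&` D t)) (neg_waveF (l, j, k))))%:E))%E).
  by apply: le_esum => k _; rewrite sumEFin -EFinM lee_fin iE; exact: abs2_sum_le.
rewrite esumZl //; last by move=> k; apply: sume_ge0 => t _; rewrite lee_fin abs2_ge0.
rewrite esum_sum; last by move=> k t _ _; rewrite lee_fin abs2_ge0.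
rewrite (integral_partition mE mD _ _ DP).
- rewrite le_eqVlt; apply/orP; left; apply/eqP; congr (_ * _)%E; apply: eq_bigr => t _.
  by apply: (@scale_energy l j _ (b + varpi ^+ n * rep m t) (mI t) (fI t)) => x [_].
- by move=> x; rewrite lee_fin abs2_ge0.
- by apply: emeasurable_abs2; exact: (proj1 (sqint_hatpsi (l, j))).
Qed.

Definition mass (i : 'I_L * nat) (E : set (borel K)) : \bar R := (\int[mu]_(x in E) (abs2 (hatpsi i x))%:E)%E.

Lemma mass_ge0 i E : (0 <= mass i E)%E.
Proof. by apply: integral_ge0 => x _; rewrite lee_fin abs2_ge0. Qed.

Lemma measurable_hatpsi i : measurable_fun [set: borel K] (fun x => (abs2 (hatpsi i x))%:E).
Proof. by apply: emeasurable_abs2; exact: (proj1 (sqint_hatpsi i)). Qed.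

(** Two points of a unit disk lying in a common periodic disk cannot be near different
    translates of it, because lattice elements are at distance more than 1. *)
Lemma per_in_disk (E : set (borel K)) x n t : E `<=` disk x 1 ->
  exists b, E `&` per n t `<=` disk b (varpi ^+ n).
Proof.
move=> Ex; have [[b [bE [k bk]]]|H] := pselect (exists b, (E `&` per n t) b); last first.
  by exists 0 => y Hy; exfalso; apply: H; exists y.
have v1 := absv_varpiX_le1 n.
exists b => y [yE [k' yk']]; have yb : absv (y - b) <= 1.
  have := Ex y yE; have := Ex b bE; rewrite /disk /= absv1 => b1 y1.
  by rewrite (_ : y - b = (y - x) + - (b - x)); [apply: absv_ultra_le; rewrite ?absvN|ring].
move: bk yk'; rewrite /disk /= => bk yk'.
have kk : k' = k.
  apply: uuB_small; rewrite (_ : uu k' - uu k = - (y - (rep n t + uu k')) + ((b - (rep n t + uu k)) + (y - b))); last by ring.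
  by apply: absv_ultra_le; [rewrite absvN; exact: le_trans v1|apply: absv_ultra_le => //; exact: le_trans v1].
rewrite kk in yk'; rewrite (_ : y - b = (y - (rep n t + uu k)) + - (b - (rep n t + uu k))); last by ring.
by apply: absv_ultra_le; rewrite ?absvN.
Qed.

Lemma indic_sqint (E : set (borel K)) x : measurable E -> E `<=` disk x 1 -> sqint mu (cindic E).
Proof. by move=> mE Ex; apply: sqint_indic => //; exact: mu_sub_disk (oner_neq0 _) mE Ex. Qed.

Lemma energy0_split n (E : set (borel K)) x : measurable E -> E `<=` disk x 1 ->
  energy0 (cindic E) =
  (\sum_(t < q ^ n) energy0 (cindic (E `&` per n t)))%E.
Proof.
move=> mE Ex; have sE := indic_sqint mE Ex.
rewrite (energy_per_split n sqint_neg_waveF sE); last by move=> k; exact: energy0_modl.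
apply: eq_bigr => t _; congr energy; apply/funext => y.
by rewrite /restr indicI rmorphM.
Qed.

Lemma mass_split n i (E : set (borel K)) : measurable E ->
  mass i E = (\sum_(t < q ^ n) mass i (E `&` per n t))%E.
Proof.
move=> mE; apply: integral_partition => //.
- by move=> t; apply: measurable_pset; exact: varpiX_neq0.
- by move=> x; rewrite lee_fin abs2_ge0.
- exact: measurable_hatpsi.
- move=> x _; have [t xt] := per_cover n x; exists t => // t' xt'.
  exact: per_inj xt' xt.
Qed.

(** On the pieces cut by periodic disks of radius [absv (varpi ^+ n)], the scales with
    [j.+1 <= n] are exact, and [scale_energy_le] bounds the others. *)
Lemma energy0_upper n (E : set (borel K)) x : measurable E -> E `<=` disk x 1 ->
  (energy0 (cindic E) <= \esum_(i in [set: 'I_L * nat]) ((q ^ (i.2.+1 - n))%:R%:E * mass i E))%E.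
Proof.
move=> mE Ex; rewrite (energy0_split n mE Ex).
have mI t : measurable (E `&` per n t).
  by apply: measurableI => //; apply: measurable_pset; exact: varpiX_neq0.
apply: (@le_trans _ _ (\sum_(t < q ^ n) \esum_(i in [set: 'I_L * nat])
    ((q ^ (i.2.+1 - n))%:R%:E * mass i (E `&` per n t)))%E).
  apply: lee_sum => t _; rewrite energy0_iter; apply: le_esum => -[l j] _.
  have [b bE] := per_in_disk t Ex.
  exact: scale_energy_le (mI t) bE.
rewrite -esum_sum; last by move=> i t _ _; rewrite mule_ge0 ?mass_ge0 // lee_fin.
apply: le_esum => i _; rewrite -ge0_sume_distrr; last by move=> t _; exact: mass_ge0.
by rewrite -mass_split.
Qed.

Lemma energy0_lower n (E : set (borel K)) x : measurable E -> E `<=` disk x 1 ->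
  (\esum_(i in [set: 'I_L * nat]) (if (i.2 < n)%N then mass i E else 0) <= energy0 (cindic E))%E.
Proof.
move=> mE Ex; rewrite (energy0_split n mE Ex).
have mI t : measurable (E `&` per n t).
  by apply: measurableI => //; apply: measurable_pset; exact: varpiX_neq0.
apply: (@le_trans _ _ (\sum_(t < q ^ n) \esum_(i in [set: 'I_L * nat])
    (if (i.2 < n)%N then mass i (E `&` per n t) else 0))%E).
  rewrite -esum_sum; last by move=> i t _ _; case: ifP; rewrite ?mass_ge0.
  apply: le_esum => i _; case: ifP => _; first by rewrite -mass_split.
  by rewrite big1.
apply: lee_sum => t _; rewrite energy0_iter; apply: le_esum => -[l j] _ /=; case: ifPn => jn; last first.
  by apply: esum_ge0 => k _; rewrite lee_fin abs2_ge0.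
have [b bE] := per_in_disk t Ex.
have bE' : E `&` per n t `<=` disk b (varpi ^+ j.+1).
  move=> y /bE; rewrite /disk /= => /le_trans; apply.
  by rewrite !absv_varpiX ler_wiXn2l ?invr_ge0 ?(ltW q_gt0R) ?invf_le1 ?q_gt0R ?(ltW q_gt1R).
by rewrite (scale_energy l (mI t) _ bE') //; exact: mu_sub_disk (varpiX_neq0 _) (mI t) bE'.
Qed.

Lemma mass_le_energy0 (E : set (borel K)) x : measurable E -> E `<=` disk x 1 ->
  (\esum_(i in [set: 'I_L * nat]) mass i E <= energy0 (cindic E))%E.
Proof.
move=> mE Ex; apply: esum_le_seq => s us.
have [n Hn] : exists n, forall i, i \in s -> (i.2 < n)%N.
  elim: s {us} => [|i s [n IH]]; first by exists 0%N.
  exists (maxn i.2.+1 n) => j; rewrite inE => /orP[/eqP ->|/IH H]; first exact: leq_maxl.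
  by apply: leq_trans H _; exact: leq_maxr.
apply: le_trans (energy0_lower n mE Ex).
apply: le_trans (esum_ge_seq _ us).
rewrite le_eqVlt; apply/orP; left; apply/eqP; apply: eq_big_seq => i /Hn /= ->.
by [].
Qed.

Lemma mass_dilate l j (E : set (borel K)) : measurable E ->
  ((q ^ j.+1)%:R%:E * mass (l, j) E =
   \int[mu]_y (\1_E (varpi ^+ j.+1 * y)%R * abs2 ((psi l)^F y))%:E)%E.
Proof.
move=> mE; have v0 := varpiX_neq0 j.+1; have vN0 := @varpiNX_neq0 j.+1.
pose F (y : borel K) : \bar R := (\1_E (varpi ^+ j.+1 * y)%R * abs2 ((psi l)^F y))%:E.
have mF : measurable_fun [set: borel K] F.
  apply/measurable_EFinP; apply: measurable_funM.
    have := measurableT_comp (measurable_indic mE : measurable_fun [set: borel K] (\1_E : borel K -> R)) (measurable_affine (varpi ^+ j.+1) 0).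
    by congr measurable_fun; apply/funext => y; rewrite /= addr0.
  by apply: measurable_abs2; have [_ []] := FT_sqint (FT_psi l).
have F0 y : (0 <= F y)%E by rewrite lee_fin mulr_ge0 ?abs2_ge0.
have := ge0_integral_affine 0 vN0 mF F0.
have -> : (\int[mu]_x F (varpi ^- j.+1 * x + 0)%R = mass (l, j) E)%E.
  rewrite /mass -(sqnorm_restr mE (proj1 (sqint_hatpsi (l, j)))); apply: eq_integral => x _.
  by rewrite abs2_restr /F addr0 mulVKf // /hatpsi addr0 mulrC.
move=> ->; rewrite muleA -EFinM -absvV invrK absv_varpiX exprVn natrX mulfV ?mul1e //.
by rewrite expf_neq0 // gt_eqF // q_gt0R.
Qed.

(** The absolute value is constant on [E], so at most one dilate of [y] is in [E]. *)
Lemma sum_dilates_le1 E y (s : seq nat) : small E -> uniq s ->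
  \sum_(j <- s) \1_E (varpi ^+ j.+1 * y) <= 1 :> R.
Proof.
move=> /small_norm[r r0 Er] us.
have [[j0 js Ej]|H] := pselect (exists2 j, j \in s & E (varpi ^+ j.+1 * y)); last first.
  rewrite big_seq big1 // => j js; rewrite indicE memNset // => Ej.
  by apply: H; exists j.
rewrite (bigD1_seq j0) //= big1 ?addr0 ?indicE ?lef_nat //; first by case: (_ \in _); rewrite ?ler01.
move=> j jj0; rewrite indicE memNset // => Ej'.
have := Er _ Ej; rewrite -(Er _ Ej') !absvM => /mulIf; rewrite !absv_varpiX => E0.
have y0 : absv y != 0.
  apply: contraTneq r0 => y0; by rewrite -(Er _ Ej) absvM y0 mulr0 ltxx.
have q1 : (q%:R : R)^-1 != 1 by rewrite invr_eq1 gt_eqF // q_gt1R.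
have qV : 0 < (q%:R : R)^-1 by rewrite invr_gt0 q_gt0R.
by have [E1] := ieexprIn qV q1 (E0 y0); rewrite E1 eqxx in jj0.
Qed.

(** The weights undo the dilations: the sum is made of the integrals of [abs2 (psi l)^F]
    over disjoint dilates of [E]. *)
Lemma mass_tail E : small E ->
  (\esum_(i in [set: 'I_L * nat]) ((q ^ i.2.+1)%:R%:E * mass i E) < +oo)%E.
Proof.
move=> sE; have [mE _] := sE.
have b l : (\esum_(j in [set: nat]) ((q ^ j.+1)%:R%:E * mass (l, j) E) <= sqnorm mu (psi l)^F)%E.
  apply: esum_le_seq => s us; under eq_bigr do rewrite mass_dilate //.
  have mp := measurable_abs2 (proj1 (proj2 (FT_sqint (FT_psi l)))).
  have mF j : measurable_fun [set: borel K] (fun y => (\1_E (varpi ^+ j.+1 * y)%R * abs2 ((psi l)^F y))%:E).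
    apply/measurable_EFinP; apply: measurable_funM => //.
    have := measurableT_comp (measurable_indic mE : measurable_fun [set: borel K] (\1_E : borel K -> R)) (measurable_affine (varpi ^+ j.+1) 0).
    by congr measurable_fun; apply/funext => y; rewrite /= addr0.
  rewrite -ge0_integral_sum //; last by move=> j y _; rewrite lee_fin mulr_ge0 ?abs2_ge0.
  apply: ge0_le_integral => //.
  - by move=> y _; apply: sume_ge0 => j _; rewrite lee_fin mulr_ge0 ?abs2_ge0.
  - by apply: emeasurable_sum.
  - exact/measurable_EFinP.
  - move=> y _; rewrite sumEFin lee_fin -mulr_suml ler_piMl ?abs2_ge0 //.
    exact: sum_dilates_le1.
rewrite esum_pair; last by move=> i; rewrite mule_ge0 ?mass_ge0 // lee_fin.
rewrite esum_fintype; last by move=> l; apply: esum_ge0 => j _; rewrite mule_ge0 ?mass_ge0 // lee_fin.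
apply: (@le_lt_trans _ _ (\sum_(l < L) sqnorm mu (psi l)^F)%E).
  by apply: lee_sum => l _; exact: b.
apply: lte_sum_pinfty => l _; exact: (proj2 (proj2 (FT_sqint (FT_psi l)))).
Qed.

(** The lower bound is [mass_le_energy0]. The upper bound [energy0_upper] exceeds it by
    at most [q ^- n] times the convergent sum of [mass_tail], for every [n]. *)
Lemma energy0_small E : small E -> energy0 (cindic E) = (\esum_(i in [set: 'I_L * nat]) mass i E)%E.
Proof.
move=> sE; have [mE _] := sE; have [a Ea] := small_in_disk1 sE.
apply/eqP; rewrite eq_le (mass_le_energy0 mE Ea) andbT.
pose C := (\esum_(i in [set: 'I_L * nat]) ((q ^ i.2.+1)%:R%:E * mass i E))%E.
have C0 : (0 <= C)%E by apply: esum_ge0 => i _; rewrite mule_ge0 ?mass_ge0 // lee_fin.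
have Cf : C \is a fin_num by rewrite ge0_fin_numE //; exact: mass_tail.
apply/lee_addgt0Pr => e e0.
have [n ne] : exists n, (q%:R : R)^-1 ^+ n * (fine C + 1) <= e.
  have [n nE] := @varpiX_small (e / (fine C + 1)) ltac:(by rewrite divr_gt0 // ltr_wpDl // fine_ge0).
  exists n; move: nE; rewrite absv_varpiX ltr_pdivlMr ?ltr_wpDl ?fine_ge0 // => /ltW.
  by [].
apply: le_trans (energy0_upper n mE Ea) _.
(* The weight in [energy0_upper] is 1 when [j.+1 <= n], and else [q ^- n] times that in [C]. *)
apply: (@le_trans _ _ (\esum_(i in [set: 'I_L * nat]) (mass i E + ((q%:R : R)^-1 ^+ n)%:E * ((q ^ i.2.+1)%:R%:E * mass i E)))%E).
  apply: le_esum => i _; rewrite muleA -EFinM -[X in (_ <= X + _)%E]mul1e -ge0_muleDl ?lee_fin //.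
  apply: lee_wpmul2r; first exact: mass_ge0.
  rewrite -EFinD lee_fin; have [nj|jn] := leqP n i.2.+1.
    have -> : (q ^ i.2.+1)%:R = q%:R ^+ n * (q ^ (i.2.+1 - n))%:R :> R.
      by rewrite -natrX -natrM -expnD subnKC.
    rewrite exprVn mulKf ?lerDr //.
    by rewrite expf_neq0 // gt_eqF // q_gt0R.
  rewrite (_ : i.2.+1 - n = 0)%N; last by apply/eqP; rewrite subn_eq0 ltnW.
  by rewrite expn0 lerDl mulr_ge0 // exprn_ge0 // invr_ge0 ltW // q_gt0R.
rewrite esumD; last 2 first.
- by move=> i _; exact: mass_ge0.
- move=> i _; rewrite mule_ge0 ?mule_ge0 ?mass_ge0 // lee_fin ?exprn_ge0 ?invr_ge0 ?(ltW q_gt0R) //.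
rewrite esumZl; last 2 first.
- by rewrite exprn_ge0 // invr_ge0 ltW // q_gt0R.
- by move=> i; rewrite mule_ge0 ?mass_ge0 // lee_fin.
apply: leeD => //; rewrite -/C -(fineK Cf) -EFinM lee_fin.
apply: le_trans ne; rewrite ler_wpM2l ?lerDl // exprn_ge0 // invr_ge0 ltW // q_gt0R.
Qed.

(** * The dimension function *)

(** The density of [V_0] in frequency: its integral over a small set is the energy of
    the indicator, by [energy0_spectral]. *)
Definition spectral (x : borel K) : \bar R := (\esum_(i in [set: 'I_L * nat]) (abs2 (hatpsi i x))%:E)%E.

Lemma spectral_ge0 x : (0 <= spectral x)%E.
Proof. by apply: esum_ge0 => i _; rewrite lee_fin abs2_ge0. Qed.

Lemma measurable_spectral : measurable_fun [set: borel K] spectral.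
Proof.
apply: (@measurable_esum _ (borel K) R setT ('I_L * nat)%type (fun i (x : borel K) => (abs2 (hatpsi i x))%:E)) => //.
- by move=> i; exact: measurable_hatpsi.
- by move=> i x; rewrite lee_fin abs2_ge0.
Qed.

Lemma dimension_functionE xi :
  dimension_function mu varpi uu chi psi xi = periodize spectral xi.
Proof.
have p0 i x : (0 <= (abs2 (hatpsi i x))%:E)%E by rewrite lee_fin abs2_ge0.
rewrite /periodize esum_swap // esum_pair; last by move=> i; apply: esum_ge0 => k _.
rewrite esum_fintype; last by move=> l; apply: esum_ge0 => j _; apply: esum_ge0 => k _.
apply: eq_bigr => l _.
rewrite -(nneseries_addn 1); last first.
  by move=> j; apply: nneseries_ge0 => k _ _; rewrite lee_fin sqr_ge0.
rewrite nneseries_esumT; last first.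
  by move=> j; apply: nneseries_ge0 => k _ _; rewrite lee_fin sqr_ge0.
apply: eq_esum => j _; rewrite nneseries_esumT; last by move=> k; rewrite lee_fin sqr_ge0.
by apply: eq_esum => k _; rewrite abs2_normc /hatpsi addr0 addn1.
Qed.

Lemma integral_spectral (E : set (borel K)) : measurable E ->
  (\int[mu]_(x in E) spectral x = \esum_(i in [set: 'I_L * nat]) mass i E)%E.
Proof.
move=> mE; rewrite (@integral_esum _ (borel K) R mu E ('I_L * nat)%type (fun i (x : borel K) => (abs2 (hatpsi i x))%:E)) //.
- by move=> i; apply: measurable_funTS; exact: measurable_hatpsi.
- by move=> i x; rewrite lee_fin abs2_ge0.
Qed.

(** The transforms of the translates of the function whose transform is [g]. *)
Definition modulates (g : K -> R[i]) (k : nat) : K -> R[i] := modl (- uu k) g.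

Lemma FT_translate phi g k : FT phi g -> FT (fun x => phi (x - uu k)) (modulates g k).
Proof.
move=> /(FT_affine (- uu k) (oner_neq0 K)).
rewrite (_ : affF _ _ _ = modulates g k).
  by congr FT; apply/funext => x; rewrite mul1r.
apply/funext => x; rewrite /affF /modulates /modl absv1 !invr1 mulr1 mul1r mul1r addr0.
by rewrite [x * _]mulrC.
Qed.

(** Parseval's identity on a disk of radius 1, whose characters have their frequencies
    in [Lam]. *)
Lemma energy_modulates g (E : set (borel K)) x : sqint mu g -> measurable E -> E `<=` disk x 1 ->
  energy (inn mu) (modulates g) (cindic E) = (\int[mu]_(x in E) (abs2 (g x))%:E)%E.
Proof.
move=> sg mE Ex; have sr := sqint_restr mE sg; have o0 := oner_neq0 K.
have mD : measurable (disk x 1 : set (borel K)) by exact: measurable_disk.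
have srr := sqint_restr mD sr.
have -> : energy (inn mu) (modulates g) (cindic E) =
    (\esum_(k in [set: nat]) (abs2 (inn mu (restr (disk x 1) (restr E g)) (mdisk x 1 (uu k / 1))))%:E)%E.
  apply: eq_esum => k _; congr (_%:E).
  have sm : sqint mu (mdisk x 1 (uu k / 1)) by exact: sqint_mdisk.
  rewrite -[RHS]abs2J -(ph_ipC HK srr sm) /=; congr abs2; apply: cInt_eq => y.
  rewrite /modulates /modl /restr /mdisk indE invr1 mulr1 !(conj_opE, conjcM) !conjc_real mulNr chiN conjcK.
  have [yE|yE] := boolP (y \in E); last by rewrite !indicE (negPf yE) /= !(mulr0, mul0r).
  have yD : disk x 1 y by apply: Ex; exact: set_mem.
  by rewrite !indicE yE mem_set // ifT // !mulr1 mul1r.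
rewrite parseval_disk // absv1 mul1e -(sqnorm_restr mE (proj1 sg)); congr (sqnorm mu _); apply/funext => y.
rewrite /restr !indicE; have [yE|_] := boolP (y \in E); last by rewrite !mulr0 mul0r.
by rewrite mem_set ?mulr1 //; apply: Ex; exact: set_mem.
Qed.

Lemma energy0_spectral E : small E -> energy0 (cindic E) = (\int[mu]_(x in E) spectral x)%E.
Proof. by move=> sE; rewrite energy0_small // integral_spectral //; case: sE. Qed.

Lemma pset_varpi_measurable a n : measurable (pset a (varpi ^+ n) : set (borel K)).
Proof. by apply: measurable_pset; exact: varpiX_neq0. Qed.

Lemma modulates_ortho g : sqint mu g -> orthonormal (sqint mu) (inn mu) (modulates g) <->
  (forall k, inn mu (modl (uu k) g) g = (k == 0%N)%:R).
Proof.
move=> sg; have m0 : modulates g 0 = g.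
  by apply/funext => x; rewrite /modulates /modl uu0 oppr0 mul0r chi0 mul1r.
have E j k : uu j = - uu k -> modulates g j = modl (uu k) g.
  by move=> jk; rewrite /modulates jk opprK.
have z j k : uu j = - uu k -> (j == 0%N) = (k == 0%N).
  move=> jk; apply/eqP/eqP => H; apply: uu_inj; first by rewrite uu0 -[uu k]opprK -jk H uu0 oppr0.
  by rewrite jk H uu0 oppr0.
split=> [[_ og] k|og].
  by have [j jk] := uuN k; rewrite -(E _ _ jk) -{2}m0 og (z _ _ jk).
split=> [k|k l]; first exact: sqint_modl.
have [j jk] := uuN k; have [i iE] := uuD j l.
have -> : inn mu (modulates g k) (modulates g l) = inn mu (modl (uu i) g) g.
  rewrite iE jk -(inn_modl2 (uu l)); congr inn; apply/funext => x; rewrite /modulates /modl.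
    rewrite mulrA -chiD; congr (chi _ * _); ring.
  by rewrite mulrA -chiD mulNr subrr chi0 mul1r.
rewrite og; congr ((nat_of_bool _)%:R); apply/eqP/eqP => [H|kl].
  by apply: uu_inj; apply/eqP; rewrite -subr_eq0 -opprB oppr_eq0 addrC -jk -iE H uu0.
by apply: uu_inj; rewrite iE jk kl addrC subrr uu0.
Qed.

(** The translates of [phi] and the wavelets of negative scale span the same space, so
    their energies agree; hence [abs2 g] and [spectral] have the same integral over
    every small set. Orthonormality of the translates says that the periodization of
    [abs2 g] is 1. *)
Lemma MRA_dimension phi : V 0 phi ->
  is_orthonormal_basis mu (V 0) (fun k x => phi (x - uu k)) ->
  {ae mu, forall xi, dimension_function mu varpi uu chi psi xi = 1%E}.
Proof.
move=> /scale_spaceP[sphi _] [tV ot csV].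
have fg := fourierP sphi; have [_ sg] := FT_sqint fg; set g := fourier mu chi phi in fg sg.
pose t k : K -> R[i] := fun x => phi (x - uu k).
have FTt k : FT (t k) (modulates g k) by exact: FT_translate.
have st k : sqint mu (t k) by have [] := FT_sqint (FTt k).
have o_t : orthonormal (sqint mu) (inn mu) t by split.
have o_g : orthonormal (sqint mu) (inn mu) (modulates g) := (FT_orthonormal FTt).1 o_t.
have st' h : range t h -> sqint mu h by move=> [k _ <-].
have et f : sqint mu f -> energy (inn mu) t f = energy (inn mu) neg_wave f.
  move=> sf; apply/eqP; rewrite eq_le; apply/andP; split.
    by apply: (energy_mono HK orthonormal_neg_wave o_t) => // k; apply/parseval_neg_waveP; exact: tV.
  apply: (energy_mono HK o_t orthonormal_neg_wave) => // i.
  split; first exact: (proj1 orthonormal_neg_wave).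
  apply: (cspan_parseval HK o_t); first exact: (proj1 orthonormal_neg_wave).
  apply: (proj2 ((closed_spanP _ st').1 _)); rewrite csV; apply/parseval_neg_waveP.
  by split; [exact: (proj1 orthonormal_neg_wave)|apply: (cspan_parseval HK orthonormal_neg_wave (proj1 orthonormal_neg_wave i)); apply: (cspan_mem HK); [exact: cscale1|exact: (proj1 orthonormal_neg_wave)|exists i]].
have eg f : sqint mu f -> energy (inn mu) (modulates g) f = energy0 f.
  move=> /FT_onto[f' ff']; have [sf' _] := FT_sqint ff'.
  by rewrite (FT_energy FTt ff') (FT_energy FT_neg_wave ff') et.
have mg := emeasurable_abs2 (proj1 sg).
have eqS A : measurable A -> (\int[mu]_(x in A) (abs2 (g x))%:E = \int[mu]_(x in A) spectral x)%E.
  have eqE E : small E -> (\int[mu]_(x in E) (abs2 (g x))%:E = \int[mu]_(x in E) spectral x)%E.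
    move=> sE; have [a Ea] := small_in_disk1 sE; have [mE _] := sE.
    by rewrite -(energy_modulates sg mE Ea) eg ?energy0_spectral //; exact: indic_sqint Ea.
  move=> mA; apply/eqP; rewrite eq_le; apply/andP; split; apply: le_integral_small => //.
  - by move=> x; exact: abs2_EFin_ge0.
  - exact: measurable_spectral.
  - exact: spectral_ge0.
  - by move=> E /eqE ->.
  - exact: measurable_spectral.
  - exact: spectral_ge0.
  - by move=> x; exact: abs2_EFin_ge0.
  - by move=> E /eqE ->.
have ug := ortho_unit_mass sg ((modulates_ortho sg).1 o_g).
have v1 := absv_varpiX_le1.
have fold a n : (\int[mu]_(x in disk a (varpi ^+ n)%R) periodize spectral x = (absv (varpi ^+ n))%:E)%E.
  rewrite -integral_pset ?varpiX_neq0 //; last 2 first.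
  - exact: measurable_spectral.
  - exact: spectral_ge0.
  have mP := pset_varpi_measurable a n.
  by rewrite -eqS // -(sqnorm_restr mP (proj1 sg)) ug.
have : {ae mu, forall x, periodize spectral x = 1%E}.
  apply: ae_eq_disks => //.
  - by apply: measurable_periodize; [exact: measurable_spectral|exact: spectral_ge0].
  - by move=> x; apply: periodize_ge0; exact: spectral_ge0.
  - move=> a n; rewrite fold integral_cst; last by apply: measurable_disk; exact: varpiX_neq0.
    by rewrite mul1e haar_disk // varpiX_neq0.
  - by move=> a; rewrite -[X in disk a X](expr0 varpi) fold ltry.
by apply: filterS => x Hx; rewrite dimension_functionE.
Qed.

(** ** Gluing a function with orthonormal modulates *)

Lemma glue (B : nat -> set (borel K)) (f : nat -> K -> R[i]) :
  (forall n, measurable (B n)) -> trivIset setT B -> (forall n, cmeas (f n : borel K -> _)) ->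
  exists g : K -> R[i], [/\ cmeas (g : borel K -> _), forall n x, B n x -> g x = f n x &
    forall x, ~ (\bigcup_n B n) x -> g x = 0].
Proof.
move=> mB tB mf.
pose g x := if pselect (exists n, B n x) is left H then f (projT1 (cid H)) x else 0.
have gB n x : B n x -> g x = f n x.
  move=> xn; rewrite /g; case: pselect => [H|[]]; last by exists n.
  by case: cid => m /= xm; rewrite (tB m n I I (ex_intro _ x (conj xm xn))).
have g0 x : ~ (\bigcup_n B n) x -> g x = 0.
  by move=> nx; rewrite /g; case: pselect => // -[n xn]; exfalso; apply: nx; exists n.
have mU : measurable (\bigcup_n B n) by exact: bigcup_measurable.
have mg (h : R[i] -> R) : (forall n, measurable_fun [set: borel K] (fun x : borel K => h (f n x))) ->
    measurable_fun [set: borel K] (fun x : borel K => h (g x)).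
  move=> mh; rewrite -(setUv (\bigcup_n B n)); apply/measurable_funU => //; first exact: measurableC.
  split.
    apply/measurable_fun_bigcup => // n.
    apply: (@eq_measurable_fun _ _ _ _ _ (fun x : borel K => h (f n x))).
      by move=> x /set_mem xn; rewrite (gB n).
    exact: measurable_funTS.
  apply: (@eq_measurable_fun _ _ _ _ _ (fun x : borel K => h 0)).
    by move=> x /set_mem xn; rewrite g0.
  exact: measurable_cst.
by exists g; split => //; split; apply: mg => n; case: (mf n).
Qed.

Lemma periodize_per f x k : periodize f (x + uu k) = periodize f x.
Proof.
have /choice[e eE] := uuD k; rewrite /periodize.
rewrite (@reindex_esum _ _ _ [set: nat] [set: nat] e (fun j => f (x + uu j))).
  by apply: eq_esum => j _; rewrite eE addrA.
split => // [i j _ _ ij|j _].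
  by apply: uu_inj; apply: (@addrI _ (uu k)); rewrite -!eE ij.
have [l lE] := uuN k; have [i iE] := uuD l j; exists i => //.
by apply: uu_inj; rewrite eE iE lE addNKr.
Qed.

(** On the piece where [h n] is the first function with a nonzero periodization, divide
    it by the square root of the periodization of its squared modulus. *)
Section Normalize.
Variable h : nat -> K -> R[i].
Hypothesis sh : forall n, sqint mu (h n).

Definition pmass n : borel K -> \bar R := periodize (fun x => (abs2 (h n x))%:E).

Hypothesis good : {ae mu, forall x, (exists n, 0 < pmass n x)%E /\ (forall n, pmass n x < +oo)%E}.

Definition piece n : set (borel K) :=
  [set x | (0 < pmass n x < +oo)%E /\ forall m, (m < n)%N -> pmass m x = 0%E].

Definition pfactor n (x : K) : R := \1_(piece n) x * (fine (pmass n x)) `^ (- 2^-1).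

Lemma measurable_pmass n : measurable_fun [set: borel K] (pmass n).
Proof.
apply: measurable_periodize; first exact: emeasurable_abs2 (proj1 (sh n)).
by move=> x; exact: abs2_EFin_ge0.
Qed.

Lemma pmass_ge0 n x : (0 <= pmass n x)%E.
Proof. by apply: periodize_ge0 => y; exact: abs2_EFin_ge0. Qed.

Lemma measurable_piece n : measurable (piece n).
Proof.
have -> : piece n = (pmass n @^-1` `]0%E, +oo%E[) `&` \bigcap_(m in [set m | (m < n)%N]) (pmass m @^-1` [set 0%E]).
  by apply/seteqP; split => x; rewrite /piece /= in_itv /=.
apply: measurableI.
  rewrite -[X in measurable X]setTI; apply: measurable_pmass => //; exact: emeasurable_itv.
apply: bigcap_measurableType => m _.
rewrite -[X in measurable X]setTI; apply: measurable_pmass => //; exact: emeasurable_set1.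
Qed.

Lemma trivIset_piece : trivIset setT piece.
Proof.
move=> n m _ _ [x [[xn n0] [xm m0]]].
case: (ltngtP n m) => // nm.
  by move: xn; rewrite m0 // ltxx.
by move: xm; rewrite n0 // ltxx.
Qed.

Lemma piece_per n x k : piece n (x + uu k) <-> piece n x.
Proof.
rewrite /piece /= /pmass periodize_per.
by split => -[H H']; split => // m mn; have := H' m mn; rewrite /pmass periodize_per.
Qed.

Lemma pfactor_ge0 n x : 0 <= pfactor n x.
Proof. by rewrite /pfactor mulr_ge0 ?powR_ge0. Qed.

Lemma pfactor_per n x k : pfactor n (x + uu k) = pfactor n x.
Proof.
rewrite /pfactor /pmass periodize_per; congr (_ * _); rewrite !indicE; congr ((nat_of_bool _)%:R).
by apply/idP/idP => /set_mem H; apply: mem_set; [exact: (piece_per n x k).1 H|exact: (piece_per n x k).2 H].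
Qed.

Lemma measurable_pfactor n : measurable_fun [set: borel K] (pfactor n : borel K -> R).
Proof.
apply: measurable_funM; first exact: measurable_indic (measurable_piece n).
apply: (measurableT_comp (measurable_powR _)).
by apply: measurableT_comp; [exact: fine_measurable|exact: measurable_pmass].
Qed.

Lemma pieces_cover : {ae mu, forall x, (\bigcup_n piece n) x}.
Proof.
apply: filterS good => x [ex fin].
have [n n0 nmin] := ex_minnP ex.
exists n => //; split; first by rewrite n0 fin.
move=> m mn; apply/eqP; rewrite eq_le pmass_ge0 andbT leNgt; apply/negP => /nmin.
by rewrite leqNgt mn.
Qed.

(** The periodization of [abs2 g] is 1 by construction. In L2, [g] is the limit of
    finite sums of periodic multiples of the [h n], so [periodic_orth] keeps it
    orthogonal to any vector orthogonal to all their modulates. *)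
Lemma normalized_generator : exists g, [/\ sqint mu g, unit_mass g,
  {ae mu, forall x, periodize (fun x => (abs2 (g x))%:E) x = 1%E} &
  forall w, sqint mu w -> (forall n k, inn mu (modl (uu k) (h n)) w = 0) -> inn mu g w = 0].
Proof.
pose f n x := (pfactor n x)%:C * h n x.
have mf n : cmeas (f n : borel K -> _).
  by apply: cmeasM; [apply: cmeas_real; exact: measurable_pfactor|exact: (proj1 (sh n))].
have [g [mg gB g0]] := glue measurable_piece trivIset_piece mf.
have mga := emeasurable_abs2 mg.
have per1 x : (\bigcup_n piece n) x -> periodize (fun x => (abs2 (g x))%:E) x = 1%E.
  move=> [n _ xn]; have [/andP[n0 nf] _] := xn.
  have E k : (abs2 (g (x + uu k)))%:E = ((pfactor n x ^+ 2)%:E * (abs2 (h n (x + uu k)))%:E)%E.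
    have xk : piece n (x + uu k) by exact/piece_per.
    by rewrite (gB n) // /f abs2M abs2_real pfactor_per EFinM.
  rewrite /periodize; under eq_esum => k _ do rewrite E.
  rewrite esumZl ?sqr_ge0 //; last by move=> k; exact: abs2_EFin_ge0.
  rewrite -[(\esum_(k in _) _)%E]/(pmass n x) -(fineK (x := pmass n x)) ?ge0_fin_numE ?pmass_ge0 //.
  have p0 : 0 < fine (pmass n x) by rewrite fine_gt0 // n0.
  rewrite -EFinM /pfactor indicE mem_set // mul1r -powR_mulrn ?powR_ge0 // -powRrM.
  by rewrite mulNr mulVf // powR_inv1 ?ltW // mulVf // gt_eqF.
have ae1 : {ae mu, forall x, periodize (fun x => (abs2 (g x))%:E) x = 1%E}.
  by apply: filterS pieces_cover => x /per1.
have mper : measurable_fun [set: borel K] (periodize (fun x => (abs2 (g x))%:E)).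
  by apply: measurable_periodize => // x; exact: abs2_EFin_ge0.
have fold a s : s != 0 -> absv s <= 1 ->
    (\int[mu]_(x in pset a s) (abs2 (g x))%:E = (absv s)%:E)%E.
  move=> s0 s1; have mD := measurable_disk a s0.
  rewrite integral_pset //; last by move=> x; exact: abs2_EFin_ge0.
  rewrite -(haar_disk a s0) -[RHS]mul1e -integral_cst //.
  apply: ge0_ae_eq_integral => //.
  - exact: measurable_funTS.
  - by move=> x _; apply: periodize_ge0 => y; exact: abs2_EFin_ge0.
  - by apply: filterS ae1 => x H _.
have v1 := absv_varpiX_le1.
have sg : sqint mu g.
  split => //; have := fold 0 1 (oner_neq0 K); rewrite absv1 psetT /sqnorm => -> //.
  by rewrite ltry.
exists g; split => //.
  move=> n a; rewrite sqnorm_restr ?fold ?varpiX_neq0 //; exact: pset_varpi_measurable.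
move=> w sw hw.
have fE n x : f n x = if x \in piece n then g x else 0.
  case: ifPn => [/set_mem xn|xn]; first by rewrite (gB n).
  by rewrite /f /pfactor indicE (negPf xn) mul0r mul0r.
have sf n : sqint mu (f n).
  split; first exact: mf.
  apply: le_lt_trans (proj2 sg); apply: ge0_le_integral => //.
  - by move=> x _; exact: abs2_EFin_ge0.
  - exact: emeasurable_abs2.
  - by move=> x _; rewrite lee_fin fE; case: ifP => _; rewrite ?abs2_0 ?abs2_ge0.
have f0 n : inn mu (f n) w = 0.
  apply: periodic_orth => //.
  - exact: measurable_pfactor.
  - exact: pfactor_ge0.
  - by move=> x k; exact: pfactor_per.
  - exact: sf.
apply: inn_close0 => // d d0.
pose G N : K -> R[i] := \sum_(n < N) f n.
have sG N : sqint mu (G N) by apply: (ph_sum HK) => n _.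
(* [G N] misses the part of [g] on the pieces of index at least [N]. *)
have tail N : sqnorm mu (g - G N) = (\sum_(N <= n <oo) \int[mu]_(x in piece n) (abs2 (g x))%:E)%E.
  rewrite -nneseries_addn; last by move=> n; apply: integral_ge0 => x _; exact: abs2_EFin_ge0.
  rewrite -ge0_integral_bigcup //.
  - rewrite [RHS]integral_mkcond; apply: eq_integral => x _; rewrite patchE.
    have -> : (g - G N) x = g x - \sum_(n < N) f n x by rewrite /G fct_sumE.
    case: ifPn => [/set_mem[n _ xn]|xN].
      rewrite big1 ?subr0 // => i _; rewrite fE memNset // => xi.
      have E := trivIset_piece I I (ex_intro _ x (conj xi xn)).
      by have := ltn_ord i; rewrite E ltnNge leq_addl.
    have [[n _ xn]|nx] := pselect ((\bigcup_n piece n) x).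
      have nN : (n < N)%N.
        rewrite ltnNge; apply/negP => Nn; move/negP: xN; apply; rewrite inE.
        by exists (n - N)%N => //; rewrite subnK.
      rewrite (bigD1 (Ordinal nN)) //= big1 ?addr0 => [|i /eqP iN].
        by rewrite fE mem_set // subrr abs2_0.
      rewrite fE memNset // => xi; apply: iN; apply/val_inj => /=.
      exact: trivIset_piece I I (ex_intro _ x (conj xi xn)).
    rewrite g0 // big1 ?subrr ?abs2_0 // => i _.
    by rewrite fE memNset // => xi; apply: nx; exists i.
  - by move=> n; exact: measurable_piece.
  - exact: measurable_funTS.
  - by move=> x _; exact: abs2_EFin_ge0.
  - move=> n m _ _ nm; have /addIn := trivIset_piece I I nm; exact.
have fin0 : (\sum_(0 <= n <oo) \int[mu]_(x in piece n) (abs2 (g x))%:E < +oo)%E.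
  rewrite -tail (_ : g - G 0%N = g) ?(proj2 sg) //.
  by apply/funext => x; rewrite /G big_ord0 subr0.
have := nneseries_tail_cvg fin0; move=> /(_ ltac:(by move=> n _; apply: integral_ge0 => x _; exact: abs2_EFin_ge0)).
move=> /fine_cvgP[fN /cvgrPdist_lt /(_ _ d0)[M0 _ HM]]; case: fN => M1 _ HM1.
have HM' := HM (maxn M0 M1) (leq_maxl _ _); have HM1' := HM1 (maxn M0 M1) (leq_maxr _ _).
exists (G (maxn M0 M1)); split => //.
  rewrite (ip_suml HK) // big1 // => n _; exact: f0.
rewrite -lte_fin nsq_fine; last exact: (phB HK).
rewrite tail -(fineK HM1') lte_fin; apply: le_lt_trans HM'.
by rewrite /= sub0r normrN ler_norm.
Qed.

End Normalize.

(** * From the dimension function to a scaling function *)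

(** Up to a scalar, [hatpsi (l, j)] is the transform of the wavelet of scale [- j.+1]
    with translation 0. *)
Lemma hatpsi_ortho i b l (m : nat) k : Lam b -> inn mu (modl b (hatpsi i)) (waveF (l, Posz m, k)) = 0.
Proof.
move=> lb; case: i => l0 j.
have E : exists z, hatpsi (l0, j) = cscale z (neg_waveF (l0, j, 0%N)).
  pose c0 := (q%:R : R) `^ ((Negz j)%:~R / 2) * (absv (varpi ^+ j.+1))^-1.
  have c00 : c0 != 0.
    by rewrite mulf_neq0 // ?invr_eq0 ?gt_eqF ?absv_gt0 ?varpiX_neq0 // powR_gt0 // q_gt0R.
  exists c0^-1%:C; apply/funext => x; rewrite /neg_waveF /waveF /cscale /affF /= uu0 oppr0 mul0r mulr0 chi0 mulr1.
  rewrite !mulrA -!rmorphM /= -mulrA (mulVf c00) mul1r.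
  by [].
have [z ->] := E; rewrite inn_modl.
have [k' ->] := modl_waveF l m k (LamN lb).
rewrite (ph_ipZ HK) ?(proj2 orthonormal_waveF) //; try exact: sqint_waveF.
by case: eqP => [//|_]; rewrite mulr0.
Qed.

Lemma esum_le_eq (f g : nat -> \bar R) k : (forall n, 0 <= f n)%E -> (forall n, f n <= g n)%E ->
  (\esum_(n in [set: nat]) f n = \esum_(n in [set: nat]) g n)%E ->
  (\esum_(n in [set: nat]) f n < +oo)%E -> f k = g k.
Proof.
move=> f0 fg E fin; have g0 n : (0 <= g n)%E by exact: le_trans (fg n).
apply/eqP; rewrite eq_le fg /=.
have sp (h : nat -> \bar R) : (forall n, 0 <= h n)%E ->
    (\esum_(n in [set: nat]) h n = h k + \esum_(n in ~` [set k]) h n)%E.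
  by move=> h0; rewrite (esumID [set k]) // !setTI esum_set1.
have ff : (\esum_(n in ~` [set k]) f n)%E \is a fin_num.
  rewrite ge0_fin_numE; last by apply: esum_ge0.
  by apply: le_lt_trans fin; rewrite (sp f f0) leeDr.
rewrite -(leeD2rE _ _ ff) -(sp f f0) E (sp g g0) leeD2l //.
by apply: le_esum => n _.
Qed.

(** A normalized generator [g] made from the [hatpsi i] has orthonormal modulates in the
    transform of [V_0], whence [abs2 g <= spectral] under integrals. Both have
    periodization 1, so they agree on small sets, and by [parseval_all_eq] the modulates
    span the whole transform of [V_0]. *)
Lemma dimension_MRA : {ae mu, forall xi, dimension_function mu varpi uu chi psi xi = 1%E} ->
  exists2 phi, V 0 phi &
    is_orthonormal_basis mu (V 0) (fun k x => phi (x - uu k)).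
Proof.
move=> D1.
have S1 : {ae mu, forall x, periodize spectral x = 1%E}.
  move: D1; apply: filterS; first exact: (ae_filter_ringOfSetsType mu).
  by move=> x; rewrite dimension_functionE.
pose h n : K -> R[i] := oapp hatpsi (fun=> 0) (pickle_inv n).
have sh n : sqint mu (h n).
  by rewrite /h; case: pickle_inv => [i|] /=; [exact: sqint_hatpsi|exact: sqint0].
have good : {ae mu, forall x, (exists n, 0 < pmass h n x)%E /\ (forall n, pmass h n x < +oo)%E}.
  apply: filterS S1 => x; rewrite /periodize esum_swap; last by move=> *; exact: abs2_EFin_ge0.
  move=> Ex; have pE i : pmass h (pickle i) x = (\esum_(k in [set: nat]) (abs2 (hatpsi i (x + uu k)))%:E)%E.
    by rewrite /pmass /periodize /h pickleK_inv.
  have p0 i : (0 <= \esum_(k in [set: nat]) (abs2 (hatpsi i (x + uu k)))%:E)%E.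
    by apply: esum_ge0 => k _; exact: abs2_EFin_ge0.
  split.
    apply: contrapT => nx; suff : (1 <= 0 :> \bar R)%E by rewrite lee_fin ler10.
    rewrite -Ex esum1 // => i _; apply/eqP; rewrite eq_le p0 andbT leNgt; apply/negP => H.
    by apply: nx; exists (pickle i); rewrite pE.
  move=> n; rewrite /pmass /periodize /h; case: pickle_inv => [i|] /=; last first.
    by rewrite esum1 ?ltry // => k _; rewrite abs2_0.
  apply: (@le_lt_trans _ _ 1%E); last exact: ltry.
  have := @esum_ge_seq _ _ (fun i => \esum_(k in [set: nat]) (abs2 (hatpsi i (x + uu k)))%:E)%E [:: i] isT.
  by rewrite big_seq1 Ex.
have [g [sg ug g1 og]] := normalized_generator sh good.
have gW l (m : nat) k : inn mu g (waveF (l, Posz m, k)) = 0.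
  apply: og; first exact: sqint_waveF.
  move=> n j; rewrite /h; case: pickle_inv => [i|] /=; first by apply: hatpsi_ortho; exists j.
  rewrite (_ : modl _ _ = 0 :> (K -> R[i])); first exact: (ip0l HK (sqint_waveF _)).
  by apply/funext => x; rewrite /modl mulr0.
have o_g : orthonormal (sqint mu) (inn mu) (modulates g).
  by apply/(modulates_ortho sg); exact: unit_mass_ortho.
have p_g k : parseval neg_waveF (modulates g k).
  apply: parseval_neg_waveFP; first exact: (proj1 o_g).
  move=> l m j; rewrite /modulates inn_modl opprK.
  have lk : Lam (uu k) by exists k.
  by have [k' ->] := modl_waveF l m j lk.
have leM f : sqint mu f -> (energy (inn mu) (modulates g) f <= energy0 f)%E.
  by move=> sf; exact: (energy_mono HK orthonormal_neg_waveF o_g).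
have mg := emeasurable_abs2 (proj1 sg).
have leS A : measurable A -> (\int[mu]_(x in A) (abs2 (g x))%:E <= \int[mu]_(x in A) spectral x)%E.
  move=> mA; apply: le_integral_small => //.
  - by move=> x; exact: abs2_EFin_ge0.
  - exact: measurable_spectral.
  - exact: spectral_ge0.
  - move=> E sE; have [a Ea] := small_in_disk1 sE; have [mE _] := sE.
    by rewrite -(energy_modulates sg mE Ea) -energy0_spectral // leM //; exact: indic_sqint Ea.
have eqE E : small E -> energy (inn mu) (modulates g) (cindic E) = energy0 (cindic E).
  move=> sE; have [a Ea] := small_in_disk1 sE; have [mE _] := sE.
  rewrite energy0_spectral // (energy_modulates sg mE Ea).
  have per_mu f : measurable_fun [set: borel K] f -> (forall x, (0 <= f x)%E) ->
      {ae mu, forall x, periodize f x = 1%E} -> (\int[mu]_(x in E) periodize f x = mu E)%E.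
    move=> mf f0 f1; rewrite -[RHS]mul1e -integral_cst //; apply: ge0_ae_eq_integral => //.
    - by apply: measurable_funTS; exact: measurable_periodize.
    - by move=> x _; exact: periodize_ge0.
    - by apply: filterS f1 => x H _.
  have Eg := per_mu _ mg (fun x => abs2_EFin_ge0 (g x)) g1.
  have ES := per_mu _ measurable_spectral spectral_ge0 S1.
  rewrite integral_periodize // in Eg; last by move=> x; exact: abs2_EFin_ge0.
  rewrite integral_periodize // in ES; [|exact: measurable_spectral|exact: spectral_ge0].
  have E0 : [set x | E (x - uu 0)] = E by apply/funext => x; rewrite /= uu0 subr0.
  rewrite -[in LHS]E0 -[in RHS]E0.
  (* The integrals over all the lattice translates of [E] have equal sums, and are compared
     term by term; the term of index 0 is that of [E]. *)
  apply: (@esum_le_eq (fun k => \int[mu]_(x in [set x | E (x - uu k)%R]) (abs2 (g x))%:E)%E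
    (fun k => \int[mu]_(x in [set x | E (x - uu k)%R]) spectral x)%E 0%N).
  - by move=> k; apply: integral_ge0 => x _; exact: abs2_EFin_ge0.
  - by move=> k; apply: leS; exact: measurable_translate.
  - by rewrite Eg ES.
  - by rewrite Eg; exact: mu_sub_disk (oner_neq0 _) mE Ea.
have eqM f : sqint mu f -> energy (inn mu) (modulates g) f = energy0 f.
  move=> sf; apply: (parseval_all_eq HK orthonormal_neg_waveF o_g p_g small_indicators_sqint _ sf (cspan_small sf)).
  by move=> _ [E sE ->]; exact: eqE.
have [phi pg] := FT_onto sg.
pose t k : K -> R[i] := fun x => phi (x - uu k).
have FTt k : FT (t k) (modulates g k) by exact: FT_translate.
have st k : sqint mu (t k) by have [] := FT_sqint (FTt k).
have o_t : orthonormal (sqint mu) (inn mu) t := (FT_orthonormal FTt).2 o_g.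
have st' f : range t f -> sqint mu f by move=> [k _ <-].
have et f : sqint mu f -> energy (inn mu) t f = energy (inn mu) neg_wave f.
  move=> sf; have [f' ff'] := FT_exists sf; have [_ sf'] := FT_sqint ff'.
  by rewrite -(FT_energy FTt ff') eqM // (FT_energy FT_neg_wave ff').
have VP f : V 0 f <-> closed_span mu (range t) f.
  rewrite -parseval_neg_waveP; split.
    move=> [sf pf]; apply/(closed_spanP _ st'); split => //.
    apply: (parseval_cspan HK o_t sf); first by rewrite et.
    by move=> k _; exists k.
  move=> /(closed_spanP _ st')[sf cf]; split => //.
  by rewrite -et //; exact: (cspan_parseval HK o_t).
have tV k : V 0 (t k).
  apply/VP/(closed_spanP _ st'); split => //.
  by apply: (cspan_mem HK) => //; exact: cscale1.
exists phi.
  have := tV 0%N; congr scale_space; apply/funext => x; by rewrite /t uu0 subr0.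
split => //; first exact: (proj2 o_t).
by apply/seteqP; split => f /VP.
Qed.

Lemma MRA_wavelet_dimension : is_MRA_wavelet mu varpi q uu psi <->
  {ae mu, forall xi, dimension_function mu varpi uu chi psi xi = 1%E}.
Proof.
rewrite is_MRA_waveletP; split=> [[phi]|]; first exact: MRA_dimension.
exact: dimension_MRA.
Qed.

End Wavelet.

End Digits.
End LocalField.

Theorem theorem4p1 (R : realType) (K : topologicalFieldType) (p c : nat)
    (mu : {measure set (borel K) -> \bar R}) (absv : K -> R)
    (varpi : K) (eps : 'I_c -> K) (chi : K -> R[i])
    (psi : 'I_(p ^ c).-1 -> K -> R[i])
    (K_local : is_local_field K) (K_char : p \in [pchar K])
    (mu_haar : is_haar mu) (absvP : is_absolute_value mu absv)
    (mu_norm : mu (int_ring absv) = 1%E)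
    (varpiP : is_prime_element absv varpi)
    (c_gt0 : (0 < c)%N) (residueP : residue_field_GF absv (p ^ c))
    (epsP : is_residue_basis absv p eps)
    (chiP : is_basic_character varpi p eps chi)
    (psiP : is_wavelet mu varpi (p ^ c) (trans varpi p eps) psi) :
  is_MRA_wavelet mu varpi (p ^ c) (trans varpi p eps) psi <->
  {ae mu, forall xi, dimension_function mu varpi (trans varpi p eps) chi psi xi
                     = 1%E}.
Proof. by apply: (@MRA_wavelet_dimension R K mu absv). Qed.
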